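(* Assume the setting and Assumptions 1–5 described in the context, and suppose $\theta=r_B$. Then for each $l=0,1,\dots,\hat\tau-1$, as $n\to\infty$, \[ \bar x(n\hat\tau+l)=\frac{(n\hat\tau+l)^{m_B}}{m_B!}\,\frac{1}{\theta^{n\hat\tau+l}}\,\hat c_l+O\big((n\hat\tau+l)^{m_B-1}\theta^{-(n\hat\tau+l)}\big)e^{\rm t}, \] where \[ \hat c_l=\sum_{m=0}^{L-1}\frac{1}{(\hat\omega_m)^l}\,\frac{x(0)\tilde B(\theta\hat\omega_m)\Delta_M(\hat\omega_m)v(\theta)}{(\theta\hat\omega_m-1)\big\{\frac{d}{dy}\delta(A^*(y))|_{y=\theta}-1\big\}}\cdot\mu(\theta)\Delta_M(\hat\omega_m)^{-1}>0 . \]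
   Context: Let $M_0,M$ be positive integers. Consider a discrete-time Markov chain of M/G/1 type with state space $\{(0,j):1\le j\le M_0\}\cup\{(k,j):k\ge1,1\le j\le M\}$ (states with first coordinate $k$ form level $k$), with transition matrix in lexicographic order \[ T=\begin{pmatrix}B(0)&B(1)&B(2)&\cdots\\ C(0)&A(1)&A(2)&\cdots\\ O&A(0)&A(1)&\cdots\\ O&O&A(0)&\cdots\\ \vdots&\vdots&\vdots&\ddots\end{pmatrix}, \] where $A(k)$ ($k\ge0$) are nonnegative $M\times M$, $B(0)$ is $M_0\times M_0$, $B(k)$ ($k\ge1$) are $M_0\times M$, $C(0)$ is $M\times M_0$, all nonnegative; $A=\sum_{k\ge0}A(k)$ is stochastic, $B(0)e+\sum_{k\ge1}B(k)e=e$ ($e$ a column of ones), $\pi A=\pi$, $\pi e=1$. Let $A^*(z)=\sum_{k\ge0}z^kA(k)$, $B^*(z)=\sum_{k\ge1}z^kB(k)$ with convergence radii $r_A,r_B$, and $\Gamma_A^*(z)=z^{-1}A^*(z)$. For a square complex matrix $X$, $\delta(X)$ is a maximum-modulus eigenvalue with nonnegative argument and maximal real part among maximum-modulus eigenvalues. Assumption 1: (a) $T$ irreducible; (b) $A$ irreducible; (c) $\pi\sum_{k\ge1}kA(k)e<1$; (d) $\sum_{k\ge1}kB(k)e$ finite. Assumption 2: $r_A>1$, $r_B>1$. Assumption 3: there is a finite $\theta$ with $1<\theta<r_A$ and $\theta=\delta(A^*(\theta))$. Assumption 4: $B^*(z)$ is meromorphic in an open set containing $\{|z|\le r_B\}$,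 and for some positive integer $m_B$ and finite nonnegative $\tilde B(r_B)\ne O$, $\lim_{z\to r_B}(1-z/r_B)^{m_B}B^*(z)=\tilde B(r_B)$. Assumption 5: there exist exactly $N\ge1$ numbers $\zeta_0,\dots,\zeta_{N-1}$ with $|\zeta_n|=1$, $0=\arg\zeta_0<\cdots<\arg\zeta_{N-1}<2\pi$, such that $\lim_{z\to r_B\zeta_n}(1-z/(r_B\zeta_n))^{m_B}B^*(z)=\tilde B(r_B\zeta_n)$ is finite and nonzero. $x=(x(0),x(1),\dots)$ is the stationary probability vector partitioned by levels, $\bar x(k)=\sum_{l\ge k+1}x(l)$. $\mu(\theta),v(\theta)$ are the Perron–Frobenius left/right eigenvectors of $\Gamma_A^*(\theta)$ with $\mu(\theta)e=1$, $\mu(\theta)v(\theta)=1$. Period $\tau$: in the Markov additive process on $\mathbb Z\times\{1,\dots,M\}$ moving from $(k_0,i)$ to $(k_0+k,j)$ with probability $[\Gamma_A(k)]_{i,j}$, where $\Gamma_A(k)=A(k+1)$ for $k\ge-1$ and $O$ for $k\le-2$, $\tau$ is the common value of $\gcd\{k\ne0:(0,j)\to(k,j)\}$ ($\to$ = reachable with positive probability in $\ge1$ steps). Fix $p:\{1,\dots,M\}\to\{0,\dots,\tau-1\}$ with $[\Gamma_A(k)]_{i,j}>0$ only if $k\equiv p(j)-p(i)\pmod\tau$, and $\Delta_M(z)=\mathrm{diag}(z^{-p(1)},\dots,z^{-p(M)})$; $\omega_x=\exp(2\pi\iota/x)$. Define for $\nu=0,\dots,\tau-1$: $c(\omega_\tau^\nu)=\frac{[x(0)B^*(\theta\omega_\tau^\nu)-x(1)A(0)]\Delta_M(\omega_\tau^\nu)v(\theta)}{(\theta\omega_\tau^\nu-1)\{\frac{d}{dy}\delta(A^*(y))|_{y=\theta}-1\}}$;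 $\mathbb H=\{0\}\cup\{\nu\in\{1,\dots,\tau-1\}:c(\omega_\tau^\nu)\ne0\}$; $\tau'=\tau/\gcd((\{\tau\}\cup\mathbb H)\setminus\{0\})$; $\mathcal P_A=\{\theta\omega_\tau^\nu:\nu\in\mathbb H\}$; $\mathcal P_B=\{\theta\zeta_n:n=0,\dots,N-1\}$; $\mathcal P=\mathcal P_A\cap\mathcal P_B$ with $L$ elements, written $\mathcal P=\{\theta\omega_{\tau'}^{\eta_m}:m=0,\dots,L-1\}$ with integers $0=\eta_0<\eta_1<\cdots<\eta_{L-1}\le\tau'-1$; $\hat\tau=\tau'/\gcd\{\eta_1,\dots,\eta_{L-1},\tau'\}$; $\hat\omega_m=\omega_{\tau'}^{\eta_m}$. $O(g)e^{\rm t}$ denotes a row vector with entries $O(g)$. *)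

(* Defs.v *)
From HB Require Import structures.
From mathcomp Require Import all_boot all_order all_algebra.
From mathcomp Require Import all_classical all_reals all_analysis.
From mathcomp Require Import complex.
Set Implicit Arguments. Unset Strict Implicit. Unset Printing Implicit Defensive.
Import Order.TTheory GRing.Theory Num.Theory.
Import numFieldNormedType.Exports.
Local Open Scope ring_scope.
Local Open Scope classical_set_scope.

(* Complex numbers: R[i] equipped (through the regular alias ^o) with  *)
(* the topology induced by its modulus.                                *)
Definition Cplx (R : realType) := (R[i])^o.

Definition toC {R : realType} (r : R) : Cplx R := Complex r 0.
Definition mxC {R : realType} {m n} (X : 'M[R]_(m, n)) : 'M[Cplx R]_(m, n) :=
  map_mx toC X.

Definition omega {R : realType} (x : nat) : Cplx R :=
  Complex (cos (2 * pi / x%:R)) (sin (2 * pi / x%:R)).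

Definition mxn {R : realType} {m n} (X : 'M[R]_(m, n)) (i j : nat) : R :=
  if insub i is Some i' then (if insub j is Some j' then X i' j' else 0) else 0.

Definition nonneg_mx {R : realType} {m n} (X : 'M[R]_(m, n)) :=
  forall i j, 0 <= X i j.

Definition onesC {R : realType} n : 'cV[R]_n := const_mx 1.

Definition rseries_to {R : realType} (u : nat -> R) (l : R) :=
  (fun N => \sum_(k < N) u k) @ \oo --> l.
Definition mxseries_to {R : realType} {m n} (F : nat -> 'M[R]_(m, n))
  (S : 'M[R]_(m, n)) := forall i j, rseries_to (fun k => F k i j) (S i j).

Definition mxseries {R : realType} {m n} (F : nat -> 'M[R]_(m, n)) : 'M[R]_(m, n) :=
  \matrix_(i, j) lim ((fun N => \sum_(k < N) F k i j) @ \oo).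
Definition cmxseries {R : realType} {m n} (F : nat -> 'M[Cplx R]_(m, n))
  : 'M[Cplx R]_(m, n) :=
  \matrix_(i, j) lim ((fun N => \sum_(k < N) F k i j) @ \oo).

Definition conv_radius {R : realType} {m n} (F : nat -> 'M[R]_(m, n)) : \bar R :=
  ereal_sup [set r%:E | r in
    [set r : R | 0 <= r /\ exists S, mxseries_to (fun k => r ^+ k *: F k) S]].

Definition is_delta {R : realType} {n} (X : 'M[Cplx R]_n) (d : Cplx R) :=
  [/\ eigenvalue X d,
      (forall e, eigenvalue X e -> `|e| <= `|d|),
      (forall e, eigenvalue X e -> `|e| = `|d| -> complex.Re (e : R[i]) <= complex.Re (d : R[i]))
    & 0 <= complex.Im (d : R[i])].
Definition delta {R : realType} {n} (X : 'M[Cplx R]_n) : Cplx R :=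
  xget 0 (is_delta X).

Definition cdifferentiable {R : realType} (f : Cplx R -> Cplx R) (z : Cplx R) :=
  exists l : Cplx R, (fun h => (f (z + h) - f z) / h) @ 0^' --> l.

Definition meromorphic_on {R : realType} (U : set (Cplx R)) (f : Cplx R -> Cplx R) :=
  exists P : set (Cplx R),
  [/\ P `<=` U,
      (forall z, U z -> \forall w \near z^', ~ P w),
      (forall z, U z -> ~ P z -> cdifferentiable f z)
    & (forall q, P q -> exists (m : nat) (K : R),
          \forall w \near q^', `|(w - q) ^+ m * f w| <= toC K)].

Record MG1 (R : realType) := {
  M0 : nat;
  M : nat;
  Ablk : nat -> 'M[R]_M;
  B0 : 'M[R]_M0;
  Bblk : nat -> 'M[R]_(M0, M);      (* B(k), k >= 1 (value at 0 unused) *)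
  C0 : 'M[R]_(M, M0)
}.

Section Chain.
Variable R : realType.
Variable Q : MG1 R.

Local Notation M0 := (M0 Q).
Local Notation M := (M Q).
Local Notation A := (Ablk Q).
Local Notation B0 := (B0 Q).
Local Notation C0 := (C0 Q).

(* B(k) for k >= 1, and 0 for k = 0 (so that B*(z) = sum_{k>=1} z^k B(k)) *)
Definition Bs (k : nat) : 'M[R]_(M0, M) := if k == 0%N then 0 else Bblk Q k.

(* states (k, j): level k, phase j *)
Definition valid_state (s : nat * nat) : bool :=
  if s.1 == 0%N then (s.2 < M0)%N else (s.2 < M)%N.

Definition Tent (s t : nat * nat) : R :=
  let: (k, i) := s in let: (l, j) := t in
  if k == 0%N then (if l == 0%N then mxn B0 i j else mxn (Bs l) i j)
  else if l == 0%N then (if k == 1%N then mxn C0 i j else 0)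
  else if (k <= l.+1)%N then mxn (A (l.+1 - k)) i j else 0.

Definition T_irreducible :=
  forall s t, valid_state s -> valid_state t ->
    exists p : seq (nat * nat),
      [/\ p != [::], path (fun a b => 0 < Tent a b) s p & last s p = t].

Definition mx_irreducible {n} (X : 'M[R]_n) :=
  forall i j : 'I_n, exists p : seq 'I_n,
    [/\ p != [::], path (fun a b => 0 < X a b) i p & last i p = j].

Definition Asum : 'M[R]_M := mxseries A.

Definition is_transition_matrix :=
  [/\ [/\ (forall k, nonneg_mx (A k)), nonneg_mx B0,
          (forall k, nonneg_mx (Bs k)) & nonneg_mx C0],
      (mxseries_to A Asum /\ Asum *m onesC M = onesC M),
      (exists SB, mxseries_to Bs SB /\ B0 *m onesC M0 + SB *m onesC M = onesC M0)
    & C0 *m onesC M0 = A 0%N *m onesC M].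

Definition Assumption1 (pi : 'rV[R]_M) :=
  [/\ T_irreducible,
      mx_irreducible Asum,
      (exists S, mxseries_to (fun k => k%:R *: A k) S /\
                 (pi *m S *m onesC M) 0 0 < 1)
    & exists S, mxseries_to (fun k => k%:R *: Bs k) S].

Definition Assumption2 := (1 < conv_radius A)%E /\ (1 < conv_radius Bs)%E.

Definition AstarR (y : R) : 'M[R]_M := mxseries (fun k => y ^+ k *: A k).
Definition BstarC (z : Cplx R) : 'M[Cplx R]_(M0, M) :=
  cmxseries (fun k => z ^+ k *: mxC (Bs k)).

Definition Assumption3 (theta : R) :=
  [/\ 1 < theta, (theta%:E < conv_radius A)%E
    & toC theta = delta (mxC (AstarR theta)) :> Cplx R].

(* d/dy delta(A*(y)) at y = theta (delta(A*(y)) is real for real y) *)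
Definition ddelta (theta : R) : R :=
  derive1 (fun y : R => complex.Re (delta (mxC (AstarR y)) : R[i])) theta.

Definition Bstar_meromorphic_ext (r : R) (U : set (Cplx R))
  (F : Cplx R -> 'M[Cplx R]_(M0, M)) :=
  [/\ open U, [set z : Cplx R | `|z| <= toC r] `<=` U,
      (forall i j, meromorphic_on U (fun z => F z i j))
    & forall z : Cplx R, `|z| < toC r -> F z = BstarC z].

Definition Btilde (F : Cplx R -> 'M[Cplx R]_(M0, M)) (mB : nat) (w : Cplx R)
  : 'M[Cplx R]_(M0, M) :=
  lim ((fun z => (1 - z / w) ^+ mB *: F z) @ w^').

Definition Assumption4 (r : R) (U : set (Cplx R))
  (F : Cplx R -> 'M[Cplx R]_(M0, M)) (mB : nat) :=
  [/\ Bstar_meromorphic_ext r U F, (0 < mB)%N,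
      (fun z => (1 - z / toC r) ^+ mB *: F z) @ (toC r)^' --> Btilde F mB (toC r),
      (forall i j, 0 <= Btilde F mB (toC r) i j)
    & Btilde F mB (toC r) != 0].

Definition Zset (r : R) (F : Cplx R -> 'M[Cplx R]_(M0, M)) (mB : nat)
  : set (Cplx R) :=
  [set zeta : Cplx R | `|zeta| = 1 /\ exists L : 'M[Cplx R]_(M0, M), L != 0 /\
     (fun z => (1 - z / (toC r * zeta)) ^+ mB *: F z) @ (toC r * zeta)^' --> L].

Definition Assumption5 (r : R) (F : Cplx R -> 'M[Cplx R]_(M0, M)) (mB : nat) :=
  finite_set (Zset r F mB).

(* x(0) = x0, x(k) = xs k for k >= 1 (xs 0 unused) *)
Definition is_stationary (x0 : 'rV[R]_M0) (xs : nat -> 'rV[R]_M) :=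
  [/\ nonneg_mx x0, (forall k, nonneg_mx (xs k)),
      rseries_to (fun k => if k == 0%N then \sum_j x0 0 j else \sum_j xs k 0 j) 1,
      x0 = x0 *m B0 + xs 1%N *m C0
    & forall k, (0 < k)%N ->
        xs k = x0 *m Bs k + \sum_(1 <= l < k.+2) xs l *m A (k.+1 - l)].

Definition xbar (xs : nat -> 'rV[R]_M) (k : nat) : 'rV[R]_M :=
  \row_j lim ((fun N => \sum_(k.+1 <= l < N) xs l 0 j) @ \oo).

(* one step of the Markov additive process: (a,i) -> (b,j) w.p.        *)
(* [Gamma_A(b - a)]_{ij} = [A(b - a + 1)]_{ij} (zero if b - a < -1)    *)
Definition MAP_step (s t : int * 'I_M) : bool :=
  ((s.1 - 1 <= t.1)%R && (0 < A (absz (t.1 - s.1 + 1)) s.2 t.2)).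

Definition MAP_reach (j : 'I_M) (k : int) :=
  exists p : seq (int * 'I_M),
    [/\ p != [::], path MAP_step (0%Z, j) p & last (0%Z, j) p = (k, j)].

Definition is_gcd_of (d : nat) (S : set int) :=
  (forall k, S k -> (d%:Z %| k)%Z) /\
  (forall d' : nat, (forall k, S k -> (d'%:Z %| k)%Z) -> (d' %| d)%N).

Definition is_period (tau : nat) :=
  forall j : 'I_M, is_gcd_of tau [set k | k != 0 /\ MAP_reach j k].

Definition is_phase (tau : nat) (p : 'I_M -> nat) :=
  (forall i, (p i < tau)%N) /\
  (forall (k : nat) (i j : 'I_M), 0 < A k i j ->
     (tau%:Z %| (k%:Z - 1) - ((p j)%:Z - (p i)%:Z))%Z).

Definition DeltaM (p : 'I_M -> nat) (z : Cplx R) : 'M[Cplx R]_M :=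
  diag_mx (\row_i (z ^- p i)).

Section Constants.
Variables (theta : R) (x0 : 'rV[R]_M0) (xs : nat -> 'rV[R]_M)
  (F : Cplx R -> 'M[Cplx R]_(M0, M)) (mB : nat) (tau : nat)
  (p : 'I_M -> nat) (mu : 'rV[R]_M) (v : 'cV[R]_M).

Local Notation thC := (toC theta).

(* B*(w) for |w| = r_B: the value of the meromorphic extension         *)
(* (its limit at w); at a pole it is infinite.                          *)
Definition Bstar_at (w : Cplx R) : 'M[Cplx R]_(M0, M) := lim (F @ w^').
Definition Bstar_finite_at (w : Cplx R) : Prop := cvg (F @ w^').

Definition cval (w : Cplx R) : Cplx R :=
  ((mxC x0 *m Bstar_at (thC * w) - mxC (xs 1%N) *m mxC (A 0%N))
     *m DeltaM p w *m mxC v) 0 0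
  / ((thC * w - 1) * (toC (ddelta theta) - 1)).

(* nu in H  iff  nu = 0 or c(omega_tau^nu) <> 0 (an infinite value,    *)
(* i.e. a pole of B* at theta omega_tau^nu, counts as nonzero)          *)
Definition inH (nu : nat) : bool :=
  (nu == 0%N) ||
  `[< ~ Bstar_finite_at (thC * omega tau ^+ nu) \/ cval (omega tau ^+ nu) != 0 >].

Definition tau' : nat := (tau %/ \big[gcdn/tau]_(nu < tau | inH nu) nu)%N.

Definition PA : set (Cplx R) :=
  [set thC * omega tau ^+ nu | nu in [set nu : nat | (nu < tau)%N /\ inH nu]].
Definition PB : set (Cplx R) := [set thC * zeta | zeta in Zset theta F mB].
Definition Pset : set (Cplx R) := PA `&` PB.

(* P = {theta omega_{tau'}^{eta_m}}: eta ranges over those eta < tau' *)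
Definition inP (eta : nat) : bool := `[< Pset (thC * omega tau' ^+ eta) >].

Definition tauhat : nat :=
  (tau' %/ \big[gcdn/tau']_(eta < tau' | inP eta) eta)%N.

Definition chat (l : nat) : 'rV[Cplx R]_M :=
  \sum_(eta < tau' | inP eta)
    let w := omega tau' ^+ eta in
    ((w ^- l) *
     ((mxC x0 *m Btilde F mB (thC * w) *m DeltaM p w *m mxC v) 0 0
       / ((thC * w - 1) * (toC (ddelta theta) - 1))))
    *: (mxC mu *m invmx (DeltaM p w)).

End Constants.

End Chain.

(* Main.v *)
(** Write X(z) for the generating function of the levels. On |z| < theta it satisfies
    X(z) (z - A*(z)) = z (x(0) B*(z) - x(1) A(0)), and the generating function of the tails is
    (X(z) - X(1)) / (z - 1). The resolvent of A* continues past the circle |z| = theta: a point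
    theta om is singular for it only if om^tau = 1, and there it has a simple pole whose residue
    is the rank-one matrix Delta(om) v mu Delta(om)^-1 divided by 1 - delta'(theta). Hence the
    tail generating function has at most poles of order mB + 1 on the circle, their leading
    coefficients are the summands of [chat], and subtracting principal parts gives the
    coefficients up to one power of k. The limits [chat l] are nonnegative with
    chat (l+1) <= theta chat l, so if one of them vanished all would, contradicting the
    positivity of their sum over a period, which only sees the pole at theta. *)

Require Import Defs.
From HB Require Import structures.
From mathcomp Require Import all_boot all_order all_algebra.
From mathcomp Require Import all_classical all_reals all_analysis.
From mathcomp Require Import complex perm.
From mathcomp Require Import ring lra zify.
Set Implicit Arguments. Unset Strict Implicit. Unset Printing Implicit Defensive.
Import Order.TTheory GRing.Theory Num.Theory.
Import numFieldNormedType.Exports.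
Local Open Scope ring_scope.
Local Open Scope classical_set_scope.

(** * Goursat's lemma and Taylor expansions *)

Section Integral.
Context {R : realType}.
Implicit Types (f g : R -> R) (a b c : R).

(** Three facts carry the argument. The identity for X reaches the circle only if X converges on the
    whole open disc: for each y between 1 and theta a Lyapunov function bounds x(k) by a multiple of
    y^-k. Its test vector h, positive with A*(y) h < y h, comes from the geometric interpolation
    v^s, s = ln y / ln theta, between the eigenvectors e at 1 and v at theta. The number
    delta'(theta) - 1 is positive as a Kullback-Leibler divergence between the walk twisted by theta
    and v and the original one; negative drift at 1 excludes the value 0. The order of the poles of
    B* on the circle is at most mB because its coefficients are nonnegative, so growth along any
    radius is dominated by growth along the radius to theta. The complex analysis rests on means
    over circles. In the coordinate log z an annulus is a rectangle of height 2 pi whose horizontal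
    sides cancel, so Goursat's lemma makes the mean of a holomorphic function independent of the
    radius; Cauchy's formula, Taylor and Laurent series follow. Compactness of the circle leaves
    finitely many principal parts. *)

Definition cont_on f a b := forall x, a <= x <= b -> {for x, continuous f}.
(** For [a > b] the interval is empty and the value is 0, so this integral carries no orientation;
    [Int_cat] therefore asks for ordered endpoints. *)
Definition Int f a b : R := (\int[lebesgue_measure]_(x in `[a, b]) f x)%R.

Lemma cont_on_integrable f a b : cont_on f a b ->
  (@lebesgue_measure R).-integrable `[a, b] (EFin \o f).
Proof.
move=> h; apply: continuous_compact_integrable; first exact: segment_compact.
by apply: continuous_in_subspaceT => x /set_mem /=; rewrite in_itv => /h.
Qed.

Lemma cont_onB f g a b : cont_on f a b -> cont_on g a b ->
  cont_on (fun x => f x - g x) a b.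
Proof. by move=> hf hg x xab; apply: continuousB; [exact: hf|exact: hg]. Qed.

Lemma Int_cat f a b c : a <= c <= b -> cont_on f a b ->
  Int f a b = Int f a c + Int f c b.
Proof.
move=> /andP[ac cb] h; have hi := cont_on_integrable h.
have := @Rintegral_itvB R f (BLeft a) (BRight b) c hi.
rewrite !bnd_simp => /(_ ac cb) e; rewrite /Int.
apply/eqP; rewrite addrC -subr_eq e; apply/eqP; apply: Rintegral_itv_obnd_cbnd.
apply: integrableS hi => //; apply: subset_itvr; by rewrite bnd_simp.
Qed.

Lemma IntD f g a b : cont_on f a b -> cont_on g a b ->
  Int (fun x => f x + g x) a b = Int f a b + Int g a b.
Proof. by move=> hf hg; apply: RintegralD => //; exact: cont_on_integrable. Qed.

Lemma IntB f g a b : cont_on f a b -> cont_on g a b ->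
  Int (fun x => f x - g x) a b = Int f a b - Int g a b.
Proof. by move=> hf hg; apply: RintegralB => //; exact: cont_on_integrable. Qed.

Lemma IntZ f r a b : cont_on f a b -> Int (fun x => r * f x) a b = r * Int f a b.
Proof. by move=> hf; apply: RintegralZl => //; exact: cont_on_integrable. Qed.

Lemma Int_cst r a b : a <= b -> Int (fun=> r) a b = r * (b - a).
Proof.
move=> ab; rewrite /Int Rintegral_cst// /= lebesgue_measure_itv /= lte_fin.
by case: ltgtP ab => [ab|//|->] _ //=; rewrite subrr.
Qed.

Lemma eq_Int f g a b : (forall x, a <= x <= b -> f x = g x) -> Int f a b = Int g a b.
Proof.
move=> h; apply: eq_Rintegral => x /set_mem /=; rewrite in_itv /=; exact: h.
Qed.

Lemma Int_near_cst f a b c (e : R) : a <= b -> cont_on f a b ->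
  (forall x, a <= x <= b -> `|f x - c| <= e) ->
  `|Int f a b - c * (b - a)| <= e * (b - a).
Proof.
move=> ab hf h; rewrite -(Int_cst c ab) -(Int_cst e ab).
have hc r : cont_on (fun=> r) a b by move=> x _; exact: cst_continuous.
rewrite -IntB //.
apply: le_trans.
  apply: le_normr_Rintegral => //; apply: cont_on_integrable; exact: cont_onB.
apply: le_Rintegral => //.
- apply: (@cont_on_integrable (fun t => `|f t - c|)) => x xab.
  apply: continuous_comp; last exact: norm_continuous.
  exact: (cont_onB hf (hc c)) xab.
  exact: cont_on_integrable.
Qed.
End Integral.

(** * Goursat's lemma for closed real one-forms on rectangles *)

Section Goursat.
Context {R : realType}.
Variables (P Q : R -> R -> R).

(** Frechet differentiability at [(a, b)] with partial derivatives [p] and [q]; nothing is asked of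
    the partials at other points. *)
Definition tdiff (F : R -> R -> R) (a b p q : R) := forall e, 0 < e ->
  exists2 d, 0 < d & forall x y, `|x - a| < d -> `|y - b| < d ->
   `|F x y - F a b - p * (x - a) - q * (y - b)| <= e * (`|x - a| + `|y - b|).

Lemma tdiff_cont1 F a b p q : tdiff F a b p q -> {for a, continuous (fun x => F x b)}.
Proof.
move=> h; apply/cvgrPdist_le => /= e e0.
have [d d0 hd] := h _ (@ltr01 R).
have K0 : 0 < 1 + `|p| by rewrite ltr_pwDl.
near=> x.
have xd : `|x - a| < d by rewrite distrC; near: x; exact: cvgr_dist_lt.
have xe : `|x - a| < e / (1 + `|p|).
  by rewrite distrC; near: x; apply: cvgr_dist_lt => //; exact: divr_gt0.
have := hd x b xd; rewrite subrr normr0 => /(_ d0); rewrite mulr0 subr0 addr0 mul1r => H.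
have : `|F x b - F a b| <= `|x - a| * (1 + `|p|).
  have -> : F x b - F a b = (F x b - F a b - p * (x - a)) + p * (x - a) by ring.
  by apply: le_trans (ler_normD _ _) _; rewrite normrM [leRHS]mulrDr mulr1 lerD // mulrC.
rewrite distrC => /le_trans; apply.
by rewrite -ler_pdivlMr // ltW.
Unshelve. all: by end_near. Qed.

Lemma tdiff_swap F a b p q : tdiff F a b p q -> tdiff (fun y x => F x y) b a q p.
Proof.
move=> h e e0; have [d d0 hd] := h e e0; exists d => // x y xb ya.
have := hd y x ya xb; rewrite addrC -addrA [X in _ + X]addrC addrA.
by rewrite [`|x - b| + _]addrC; congr (`| _ | <= _); ring.
Qed.

Lemma tdiff_cont2 F a b p q : tdiff F a b p q -> {for b, continuous (F a)}.
Proof. by move=> /tdiff_swap/tdiff_cont1. Qed.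

(** The one-form [P dx + Q dy] is closed at the point: the shared [p2] is both the y-derivative of
    [P] and the x-derivative of [Q]. *)
Definition closed_at a b := exists p1 p2 q2, tdiff P a b p1 p2 /\ tdiff Q a b p2 q2.

(** Counterclockwise integral of [P dx + Q dy] over the boundary of the rectangle, with opposite
    sides paired. *)
Definition W x1 x2 y1 y2 : R :=
  Int (fun x => P x y1 - P x y2) x1 x2 + Int (fun y => Q x2 y - Q x1 y) y1 y2.

Definition closed_on x1 x2 y1 y2 :=
  forall x y, x1 <= x <= x2 -> y1 <= y <= y2 -> closed_at x y.

Lemma closed_contP x1 x2 y1 y2 y : closed_on x1 x2 y1 y2 -> y1 <= y <= y2 ->
  cont_on (fun x => P x y) x1 x2.
Proof. by move=> h hy x hx; have [p1 [p2 [q2 [/tdiff_cont1 h1 _]]]] := h x y hx hy. Qed.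

Lemma closed_contQ x1 x2 y1 y2 x : closed_on x1 x2 y1 y2 -> x1 <= x <= x2 ->
  cont_on (Q x) y1 y2.
Proof. by move=> h hx y hy; have [p1 [p2 [q2 [_ /tdiff_cont2 h1]]]] := h x y hx hy. Qed.

Lemma closed_sub x1 x2 y1 y2 x1' x2' y1' y2' : closed_on x1 x2 y1 y2 ->
  x1 <= x1' -> x2' <= x2 -> y1 <= y1' -> y2' <= y2 -> closed_on x1' x2' y1' y2'.
Proof. by move=> h *; move=> x y /andP[? ?] /andP[? ?]; apply: h; lra. Qed.

Lemma W_split1 x1 x2 y1 y2 c : x1 <= c <= x2 -> y1 <= y2 -> closed_on x1 x2 y1 y2 ->
  W x1 x2 y1 y2 = W x1 c y1 y2 + W c x2 y1 y2.
Proof.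
move=> hc hy h; have /andP[c1 c2] := hc.
have cP y : y1 <= y <= y2 -> cont_on (fun x => P x y) x1 x2 by exact: closed_contP h.
have cQ x : x1 <= x <= x2 -> cont_on (Q x) y1 y2 by exact: closed_contQ h.
rewrite /W (Int_cat hc); last by apply: cont_onB; apply: cP; lra.
rewrite !(IntB (cQ _ _) (cQ _ _)); [ring|lra..].
Qed.

Lemma W_split2 x1 x2 y1 y2 c : y1 <= c <= y2 -> x1 <= x2 -> closed_on x1 x2 y1 y2 ->
  W x1 x2 y1 y2 = W x1 x2 y1 c + W x1 x2 c y2.
Proof.
move=> hc hx h; have /andP[c1 c2] := hc.
have cP y : y1 <= y <= y2 -> cont_on (fun x => P x y) x1 x2 by exact: closed_contP h.
have cQ x : x1 <= x <= x2 -> cont_on (Q x) y1 y2 by exact: closed_contQ h.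
rewrite /W (Int_cat (f := fun y => _) hc); last by apply: cont_onB; apply: cQ; lra.
rewrite !(IntB (cP _ _) (cP _ _)); [ring|lra..].
Qed.

(** The affine part of the form has zero circulation because both cross coefficients equal [p2];
    only a remainder of order o(s) is integrated over sides of length at most [s]. *)
Lemma W_local a b e : closed_at a b -> 0 < e -> exists2 d, 0 < d &
  forall x1 x2 y1 y2 s, x1 <= a <= x2 -> y1 <= b <= y2 -> closed_on x1 x2 y1 y2 ->
   x2 - x1 <= s -> y2 - y1 <= s -> s < d -> `|W x1 x2 y1 y2| <= e * s ^+ 2.
Proof.
move=> [p1 [p2 [q2 [hP hQ]]]] e0.
(* The remainder is at most e/8 times 2s; each integrand is a difference of two values, hence within
   e s / 2 of a constant, and two pairs of sides of length at most [s] add up to [e * s ^+ 2]. *)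
have e8 : 0 < e / 8 by lra.
have [d1 d10 h1] := hP _ e8; have [d2 d20 h2] := hQ _ e8.
exists (Num.min d1 d2); first by rewrite lt_min d10.
move=> x1 x2 y1 y2 s /andP[ha1 ha2] /andP[hb1 hb2] hc sx sy; rewrite lt_min => /andP[sd1 sd2].
have cP y : y1 <= y <= y2 -> cont_on (fun x => P x y) x1 x2 by exact: closed_contP hc.
have cQ x : x1 <= x <= x2 -> cont_on (Q x) y1 y2 by exact: closed_contQ hc.
have s0 : 0 <= s by lra.
have nx x : x1 <= x <= x2 -> `|x - a| <= s by rewrite ler_norml; lra.
have ny y : y1 <= y <= y2 -> `|y - b| <= s by rewrite ler_norml; lra.
have B1 : forall x y, x1 <= x <= x2 -> y1 <= y <= y2 ->
   `|P x y - P a b - p1 * (x - a) - p2 * (y - b)| <= e / 4 * s.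
  move=> x y hx hy; have := h1 x y (le_lt_trans (nx _ hx) sd1) (le_lt_trans (ny _ hy) sd1).
  move=> /le_trans; apply; have := nx _ hx; have := ny _ hy; nra.
have B2 : forall x y, x1 <= x <= x2 -> y1 <= y <= y2 ->
   `|Q x y - Q a b - p2 * (x - a) - q2 * (y - b)| <= e / 4 * s.
  move=> x y hx hy; have := h2 x y (le_lt_trans (nx _ hx) sd2) (le_lt_trans (ny _ hy) sd2).
  move=> /le_trans; apply; have := nx _ hx; have := ny _ hy; nra.
have ex : x1 <= x2 by lra.
have ey : y1 <= y2 by lra.
have y1in : y1 <= y1 <= y2 by lra.
have y2in : y1 <= y2 <= y2 by lra.
have x1in : x1 <= x1 <= x2 by lra.
have x2in : x1 <= x2 <= x2 by lra.
have I1 : `|Int (fun x => P x y1 - P x y2) x1 x2 - (p2 * (y1 - y2)) * (x2 - x1)| <= e / 2 * s * (x2 - x1).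
  apply: Int_near_cst => //; first by apply: cont_onB; apply: cP.
  move=> x hx; have := B1 x y1 hx y1in; have := B1 x y2 hx y2in.
  rewrite !ler_norml; lra.
have I2 : `|Int (fun y => Q x2 y - Q x1 y) y1 y2 - (p2 * (x2 - x1)) * (y2 - y1)| <= e / 2 * s * (y2 - y1).
  apply: Int_near_cst => //; first by apply: cont_onB; apply: cQ.
  move=> y hy; have := B2 x1 y x1in hy; have := B2 x2 y x2in hy.
  rewrite !ler_norml; lra.
have -> : W x1 x2 y1 y2 =
  (Int (fun x => P x y1 - P x y2) x1 x2 - (p2 * (y1 - y2)) * (x2 - x1)) +
  (Int (fun y => Q x2 y - Q x1 y) y1 y2 - (p2 * (x2 - x1)) * (y2 - y1)).
  by rewrite /W; ring.
apply: le_trans (ler_normD _ _) _; rewrite expr2.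
have : e / 2 * s * (x2 - x1) <= e / 2 * s * s by apply: ler_wpM2l => //; apply: mulr_ge0; lra.
have : e / 2 * s * (y2 - y1) <= e / 2 * s * s by apply: ler_wpM2l => //; apply: mulr_ge0; lra.
lra.
Qed.

Record box := Box { bx1 : R; bx2 : R; by1 : R; by2 : R }.
Definition WB B := W (bx1 B) (bx2 B) (by1 B) (by2 B).
Definition good B := [/\ bx1 B <= bx2 B, by1 B <= by2 B & closed_on (bx1 B) (bx2 B) (by1 B) (by2 B)].
Definition half B B' := [/\ good B', bx1 B <= bx1 B' /\ bx2 B' <= bx2 B, by1 B <= by1 B' /\ by2 B' <= by2 B,
   bx2 B' - bx1 B' = (bx2 B - bx1 B) / 2 /\ by2 B' - by1 B' = (by2 B - by1 B) / 2
  & `|WB B| / 4 <= `|WB B'| ].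

(** Circulation is additive over the four quarters, so one of them carries at least a quarter of its
    modulus. *)
Lemma half_ex B : good B -> exists B', half B B'.
Proof.
case: B => x1 x2 y1 y2 [/= hx hy hc].
pose xm := (x1 + x2) / 2; pose ym := (y1 + y2) / 2.
have xmE : xm = (x1 + x2) / 2 by []. have ymE : ym = (y1 + y2) / 2 by [].
have e : W x1 x2 y1 y2 = W x1 xm y1 ym + W x1 xm ym y2 + W xm x2 y1 ym + W xm x2 ym y2.
  rewrite (@W_split1 _ _ _ _ xm) //; last by lra.
  rewrite (@W_split2 _ xm _ _ ym) //; [|lra|lra|apply: closed_sub hc _ _ _ _; lra].
  rewrite (@W_split2 xm _ _ _ ym) //; [ring|lra|lra|apply: closed_sub hc _ _ _ _; lra].
have [x1m xm2 y1m ym2] : [/\ x1 <= xm, xm <= x2, y1 <= ym & ym <= y2] by split; lra.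
have [dx1 dx2 dy1 dy2] : [/\ xm - x1 = (x2 - x1) / 2, x2 - xm = (x2 - x1) / 2, ym - y1 = (y2 - y1) / 2 & y2 - ym = (y2 - y1) / 2].
  by split; lra.
have [|n1] := leP (`|W x1 x2 y1 y2| / 4) `|W x1 xm y1 ym|.
  exists (Box x1 xm y1 ym); split=> //=; split=> //=; exact: closed_sub hc _ _ _ _.
have [|n2] := leP (`|W x1 x2 y1 y2| / 4) `|W x1 xm ym y2|.
  exists (Box x1 xm ym y2); split=> //=; split=> //=; exact: closed_sub hc _ _ _ _.
have [|n3] := leP (`|W x1 x2 y1 y2| / 4) `|W xm x2 y1 ym|.
  exists (Box xm x2 y1 ym); split=> //=; split=> //=; exact: closed_sub hc _ _ _ _.
have [|n4] := leP (`|W x1 x2 y1 y2| / 4) `|W xm x2 ym y2|.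
  exists (Box xm x2 ym y2); split=> //=; split=> //=; exact: closed_sub hc _ _ _ _.
exfalso; suff : `|W x1 x2 y1 y2| <= `|W x1 xm y1 ym| + `|W x1 xm ym y2| + `|W xm x2 y1 ym| + `|W xm x2 ym y2| by lra.
rewrite {1}e; apply: le_trans (ler_normD _ _) _; rewrite lerD2r.
apply: le_trans (ler_normD _ _) _; rewrite lerD2r; exact: ler_normD.
Qed.

Lemma nested_point (u v : nat -> R) : (forall n, u n <= v n) ->
  (forall n, u n <= u n.+1) -> (forall n, v n.+1 <= v n) ->
  exists a, forall n, u n <= a <= v n.
Proof.
move=> uv uu vv.
have um : {homo u : m n / (m <= n)%N >-> m <= n} by apply: homo_leq => //; exact: le_trans.
have vm n m : (n <= m)%N -> v m <= v n.
  elim: m => [|m IH]; first by rewrite leqn0 => /eqP ->.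
  by rewrite leq_eqVlt => /orP[/eqP-> //|]; rewrite ltnS => /IH; exact: le_trans.
have ub n : ubound (range u) (v n).
  move=> _ [m _ <-]; case: (leqP m n) => [/um h|/ltnW/vm h].
    exact: le_trans h (uv n).
  exact: le_trans (uv m) h.
exists (sup (range u)) => n; apply/andP; split.
  apply: ub_le_sup; [by exists (v 0%N); exact: ub|by exists n].
apply: ge_sup; [by exists (u 0%N); exists 0%N|exact: ub].
Qed.

(** Bisection: the nested quarters keep a circulation of at least [|W| / 4 ^+ n] while their sides
    are at most [s / 2 ^+ n]. At their common point [W_local] bounds the circulation by a small
    multiple of the squared side, a contradiction. *)
Lemma goursat x1 x2 y1 y2 : x1 <= x2 -> y1 <= y2 -> closed_on x1 x2 y1 y2 ->
  W x1 x2 y1 y2 = 0.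
Proof.
move=> hx hy hc; apply/eqP/negPn/negP => W0.
pose B0 := Box x1 x2 y1 y2.
have g0 : good B0 by split.
have /choice [f hf] : forall B, exists B', good B -> half B B'.
  move=> B; have [g|g] := pselect (good B); last by exists B.
  by have [B' h] := half_ex g; exists B'.
pose b n := iter n f B0.
have gb n : good (b n) by elim: n => // n /hf [].
have hb n : half (b n) (b n.+1) by apply: hf; exact: gb.
have [a ha] : exists a, forall n, bx1 (b n) <= a <= bx2 (b n).
  by apply: nested_point => n; [case: (gb n)|case: (hb n) => _ []|case: (hb n) => _ []].
have [c hcc] : exists c, forall n, by1 (b n) <= c <= by2 (b n).
  by apply: nested_point => n; [case: (gb n)|case: (hb n) => _ _ []|case: (hb n) => _ _ []].
pose s := (x2 - x1) + (y2 - y1) + 1.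
have s0 : 0 < s by rewrite /s; lra.
have sz n : bx2 (b n) - bx1 (b n) <= s / 2 ^+ n /\ by2 (b n) - by1 (b n) <= s / 2 ^+ n.
  elim: n => [|n [IH1 IH2]]; first by rewrite expr0 divr1 /s /=; split; lra.
  have [_ _ _ [-> ->] _] := hb n.
  by rewrite exprSr invfM mulrA; split; lra.
have wn n : `|W x1 x2 y1 y2| / 4 ^+ n <= `|WB (b n)|.
  elim: n => [|n IH]; first by rewrite expr0 divr1.
  have [_ _ _ _ h] := hb n.
  rewrite exprSr invfM mulrA; lra.
have w0 : 0 < `|W x1 x2 y1 y2| by rewrite normr_gt0.
(* With this constant the local bound at side [s / 2 ^+ n] is exactly half of the lower bound
   [|W| / 4 ^+ n]. *)
have e0 : 0 < `|W x1 x2 y1 y2| / (2 * s ^+ 2).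
  by rewrite divr_gt0 // mulr_gt0 // exprn_gt0.
have [d d0 hd] := W_local (hc a c (ha 0%N) (hcc 0%N)) e0.
have [n hn] : exists n, s / 2 ^+ n < d.
  have : (fun n => s * (2^-1) ^+ n) @ \oo --> (0 : R).
    have := @cvg_geometric R s 2^-1; rewrite ger0_norm; last by lra.
    by apply; lra.
  move=> /cvgrPdist_lt /(_ d d0) [N _ /(_ N (leqnn N))] /=.
  rewrite sub0r normrN ger0_norm; last by rewrite mulr_ge0 ?exprn_ge0 // ?ltW //; lra.
  by exists N; rewrite -exprVn.
have := hd _ _ _ _ (s / 2 ^+ n) (ha n) (hcc n).
have [_ _ gc] := gb n; have [z1 z2] := sz n.
move=> /(_ gc z1 z2 hn).
rewrite -/(WB (b n)) => h; have := le_trans (wn n) h.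
have -> : `|W x1 x2 y1 y2| / (2 * s ^+ 2) * (s / 2 ^+ n) ^+ 2 = `|W x1 x2 y1 y2| / 4 ^+ n / 2.
  rewrite exprMn exprVn -exprM mulnC exprM (_ : 2 ^+ 2 = 4 :> R); last by ring.
  have s2 : s != 0 by rewrite gt_eqF. 
  have f4 : (4 : R) ^+ n != 0 by rewrite expf_neq0.
  by field; rewrite s2 f4.
have : 0 < `|W x1 x2 y1 y2| / 4 ^+ n by rewrite divr_gt0 // exprn_gt0.
lra.
Qed.

(** The form used when [y] is an angle: the two horizontal sides cancel and only the vertical ones
    remain. *)
Lemma goursat_periodic x1 x2 y1 y2 : x1 <= x2 -> y1 <= y2 -> closed_on x1 x2 y1 y2 ->
  (forall x, P x y1 = P x y2) -> Int (Q x1) y1 y2 = Int (Q x2) y1 y2.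
Proof.
move=> hx hy hc hP; have := goursat hx hy hc; rewrite /W.
have x1in : x1 <= x1 <= x2 by rewrite lexx.
have x2in : x1 <= x2 <= x2 by rewrite lexx andbT.
rewrite (eq_Int (g := fun=> 0)) => [|x _]; last by rewrite hP subrr.
rewrite Int_cst // mul0r add0r (IntB (closed_contQ hc x2in) (closed_contQ hc x1in)).
by move=> /eqP; rewrite subr_eq0 => /eqP.
Qed.
End Goursat.

(** * Modulus, complex derivative and polar form *)

Section ComplexBasics.
Context {R : realType}.
Local Notation C := (Cplx R).
Implicit Types (z w : C) (f g : C -> C).

(** The norm on [Cplx R] takes its values in [Cplx R]; [nc] is the same modulus as a real number. *)
Definition nc z : R := Normc.normc (z : R[i]).
Definition cis (t : R) : C := Complex (cos t) (sin t).

Lemma normCE z : `|z| = toC (nc z). Proof. by []. Qed.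
Lemma ltC_real (a b : R) : (toC a < toC b :> C) = (a < b). Proof. exact: ltcR. Qed.
Lemma leC_real (a b : R) : (toC a <= toC b :> C) = (a <= b). Proof. exact: lecR. Qed.
Lemma gt0C (e : C) : 0 < e -> exists2 r : R, 0 < r & e = toC r.
Proof.
case: e => a b; rewrite ltcE /= => /andP[/eqP-> a0]; by exists a.
Qed.
Lemma ncM z w : nc (z * w) = nc z * nc w. Proof. exact: Normc.normcM. Qed.
Lemma ncV z : nc z^-1 = (nc z)^-1. Proof. exact: Normc.normcV. Qed.
Lemma ncN z : nc (- z) = nc z. Proof. exact: (@normcN R). Qed.
Lemma ncD z w : nc (z + w) <= nc z + nc w. Proof. exact: (@le_normcD R). Qed.
Lemma ncB z w : nc (z - w) <= nc z + nc w. Proof. by rewrite -(ncN w) ncD. Qed.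
Lemma ncC z w : nc (z - w) = nc (w - z). Proof. by rewrite -ncN opprB. Qed.
Lemma nc0 : nc 0 = 0. Proof. exact: Normc.normc0. Qed.
Lemma nc1 : nc 1 = 1. Proof. exact: Normc.normc1. Qed.
Lemma nc_ge0 z : 0 <= nc z. Proof. by case: z => a b; rewrite /nc /= sqrtr_ge0. Qed.
Lemma nc_eq0 z : (nc z == 0) = (z == 0).
Proof. by apply/eqP/eqP => [/Normc.eq0_normc //|->]; exact: nc0. Qed.
Lemma nc_gt0 z : (0 < nc z) = (z != 0).
Proof. by rewrite lt_neqAle nc_ge0 andbT eq_sym nc_eq0. Qed.
Lemma ncX z n : nc (z ^+ n) = nc z ^+ n.
Proof. by elim: n => [|n IH]; rewrite ?expr0 ?nc1 // !exprS ncM IH. Qed.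
Lemma nc_real (a : R) : nc (toC a) = `|a|.
Proof. by rewrite /nc /= expr0n addr0 sqrtr_sqr. Qed.
Lemma ge_nc z w : nc z - nc w <= nc (z - w).
Proof. by rewrite lerBlDr; have := ncD (z - w) w; rewrite subrK. Qed.
Lemma nc_sum (I : Type) (r : seq I) (P : pred I) (F : I -> C) :
  nc (\sum_(i <- r | P i) F i) <= \sum_(i <- r | P i) nc (F i).
Proof.
elim/big_ind2: _ => //; first by rewrite nc0.
by move=> a b c d h1 h2; exact: le_trans (ncD _ _) (lerD h1 h2).
Qed.
Lemma toCD (a b : R) : toC (a + b) = toC a + toC b :> C. Proof. exact: rmorphD (real_complex R) a b. Qed.
Lemma toCM (a b : R) : toC (a * b) = toC a * toC b :> C. Proof. exact: rmorphM (real_complex R) a b. Qed.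
Lemma toCN (a : R) : toC (- a) = - toC a :> C. Proof. exact: rmorphN (real_complex R) a. Qed.
Lemma toCB (a b : R) : toC (a - b) = toC a - toC b :> C. Proof. by rewrite toCD toCN. Qed.
Lemma toCV (a : R) : toC (a^-1) = (toC a)^-1 :> C. Proof. exact: fmorphV (real_complex R) a. Qed.
Lemma toCX (a : R) n : toC (a ^+ n) = toC a ^+ n :> C. Proof. exact: rmorphXn (real_complex R) n a. Qed.
Lemma toC0 : toC 0 = 0 :> C. Proof. by []. Qed.
Lemma toC1 : toC 1 = 1 :> C. Proof. by []. Qed.
Lemma toC_nat n : toC n%:R = n%:R :> C. Proof. exact: rmorph_nat (real_complex R) n. Qed.
Lemma toC_sum (I : Type) (r : seq I) (P : pred I) (F : I -> R) :
  toC (\sum_(i <- r | P i) F i) = \sum_(i <- r | P i) toC (F i).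
Proof. exact: (rmorph_sum (real_complex R)). Qed.
Lemma toC_inj : injective (@toC R). Proof. by move=> a b []. Qed.

Lemma Re_le_nc z : `|complex.Re (z : R[i])| <= nc z.
Proof. by case: z => a b; rewrite /nc /= -sqrtr_sqr ler_wsqrtr // lerDl sqr_ge0. Qed.
Lemma Im_le_nc z : `|complex.Im (z : R[i])| <= nc z.
Proof. by case: z => a b; rewrite /nc /= -sqrtr_sqr ler_wsqrtr // lerDr sqr_ge0. Qed.
Lemma nc_le_ReIm z : nc z <= `|complex.Re (z : R[i])| + `|complex.Im (z : R[i])|.
Proof.
case: z => a b; rewrite /nc /= -[leRHS]ger0_norm ?addr_ge0 // -sqrtr_sqr ler_wsqrtr //.
rewrite -(real_normK (num_real a)) -(real_normK (num_real b)).
by have := normr_ge0 a; have := normr_ge0 b; nra.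
Qed.

Lemma cvgCP (T : Type) (F : set_system T) (FF : Filter F) (u : T -> C) (l : C) :
  u @ F --> l <-> forall e : R, 0 < e -> \forall t \near F, nc (l - u t) < e.
Proof.
split=> [/cvgrPdist_lt h e e0|h].
  have := h (toC e); rewrite ltC_real => /(_ e0).
  by apply: filterS => t; rewrite normCE ltC_real.
apply/cvgrPdist_lt => _ /gt0C [e e0 ->]; have := h e e0.
by apply: filterS => t; rewrite normCE ltC_real.
Qed.

Lemma near_dnbhsC (w : C) (P : C -> Prop) :
  (\forall z \near w^', P z) <-> exists2 d : R, 0 < d & forall z, z != w -> nc (z - w) < d -> P z.
Proof.
split.
  move=> [/= e /gt0C [d d0 ->] h]; exists d => // z zw zd; apply: h => //=.
  by rewrite normCE ltC_real ncC.
move=> [d d0 h]; exists (toC d); first by rewrite /= ltC_real.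
by move=> z /=; rewrite normCE ltC_real ncC => zd zw; apply: h.
Qed.

Lemma near_nbhsC (w : C) (P : C -> Prop) :
  (\forall z \near w, P z) <-> exists2 d : R, 0 < d & forall z, nc (z - w) < d -> P z.
Proof.
split.
  move=> [/= e /gt0C [d d0 ->] h]; exists d => // z zd; apply: h => //=.
  by rewrite normCE ltC_real ncC.
move=> [d d0 h]; exists (toC d); first by rewrite /= ltC_real.
by move=> z /=; rewrite normCE ltC_real ncC => zd; apply: h.
Qed.

Definition has_cderiv f z (l : C) := (fun h => (f (z + h) - f z) / h) @ 0^' --> l.

(** The linear approximation makes sense at [x = z] as well, so derivatives can be composed without
    dividing. *)
Lemma has_cderivP f z l : has_cderiv f z l <->
  forall e : R, 0 < e -> exists2 d : R, 0 < d &
    forall x, nc (x - z) < d -> nc (f x - f z - l * (x - z)) <= e * nc (x - z).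
Proof.
split=> [/cvgCP h e e0|h].
  have /near_dnbhsC [d d0 hd] := h e e0; exists d => // x xd.
  have [->|xz] := eqVneq x z; first by rewrite !subrr mulr0 subr0 nc0 mulr0.
  have xz0 : x - z != 0 by rewrite subr_eq0.
  have := hd (x - z) xz0; rewrite subr0 => /(_ xd); rewrite (_ : z + (x - z) = x); last by ring.
  move=> k; rewrite (_ : f x - f z - l * (x - z) = - (l - (f x - f z) / (x - z)) * (x - z)); last first.
    by field.
  by rewrite ncM ncN ler_wpM2r ?nc_ge0 // ltW.
apply/cvgCP => e e0; have e2 : 0 < e / 2 by rewrite divr_gt0.
have [d d0 hd] := h _ e2; apply/near_dnbhsC; exists d => // x x0; rewrite subr0 => xd.
have := hd (z + x); rewrite addrAC subrr add0r => /(_ xd) k.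
rewrite (_ : l - (f (z + x) - f z) / x = - (f (z + x) - f z - l * x) / x); last by field.
rewrite ncM ncN ncV ltr_pdivrMr ?nc_gt0 //.
by apply: le_lt_trans k _; rewrite ltr_pM2r ?nc_gt0 // ltr_pdivrMr // ltr_pMr // ltrDl.
Qed.

Lemma has_cderiv_derive f z l : has_cderiv f z l <-> is_derive (z : C) (1 : C) (f : C -> C^o) l.
Proof.
have e : (fun h : C => h^-1 *: ((f \o shift z) (h *: (1 : C)) - f z)) = (fun h => (f (z + h) - f z) / h).
  by apply/funext => h /=; rewrite /GRing.scale /= mulr1 mulrC (addrC h).
split=> [h|[h1 h2]].
  split; first by rewrite /derivable e; apply/cvg_ex; exists l.
  by rewrite /derive e; apply: cvg_lim.
by rewrite /has_cderiv -e -h2; exact: h1.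
Qed.

Lemma cdiff_derivable f z : cdifferentiable f z <-> derivable (f : C -> C^o) (z : C) (1 : C).
Proof.
split=> [[l /has_cderiv_derive []] //|h].
by exists ('D_1 (f : C -> C^o) (z : C)); apply/has_cderiv_derive; exact: DeriveDef.
Qed.

Lemma cdiff_cst (a : C) z : cdifferentiable (fun=> a) z.
Proof. by apply/cdiff_derivable; exact: derivable_cst. Qed.
Lemma cdiff_id z : cdifferentiable id z.
Proof. by apply/cdiff_derivable; exact: derivable_id. Qed.
Lemma cdiffD f g z : cdifferentiable f z -> cdifferentiable g z ->
  cdifferentiable (fun x => f x + g x) z.
Proof. by rewrite !cdiff_derivable; exact: derivableD. Qed.
Lemma cdiffM f g z : cdifferentiable f z -> cdifferentiable g z ->
  cdifferentiable (fun x => f x * g x) z.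
Proof. by rewrite !cdiff_derivable; exact: derivableM. Qed.
Lemma cdiffN f z : cdifferentiable f z -> cdifferentiable (fun x => - f x) z.
Proof. by rewrite !cdiff_derivable; exact: derivableN. Qed.
Lemma cdiffB f g z : cdifferentiable f z -> cdifferentiable g z ->
  cdifferentiable (fun x => f x - g x) z.
Proof. by move=> hf hg; apply: cdiffD => //; exact: cdiffN. Qed.
Lemma cdiffV f z : f z != 0 -> cdifferentiable f z -> cdifferentiable (fun x => (f x)^-1) z.
Proof. by move=> fz; rewrite !cdiff_derivable; exact: derivableV. Qed.
Lemma cdiff_sum (I : Type) (r : seq I) (P : pred I) (F : I -> C -> C) z :
  (forall i, P i -> cdifferentiable (F i) z) ->
  cdifferentiable (fun x => \sum_(i <- r | P i) F i x) z.
Proof.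
move=> h; elim: r => [|i r IH].
  by rewrite (_ : (fun _ => _) = fun=> 0); [exact: cdiff_cst|apply/funext => x; rewrite big_nil].
case Pi: (P i).
  rewrite (_ : (fun _ => _) = fun x => F i x + \sum_(i <- r | P i) F i x).
    by apply: cdiffD => //; exact: h.
  by apply/funext => x; rewrite big_cons Pi.
rewrite (_ : (fun _ => _) = fun x => \sum_(i <- r | P i) F i x) //.
by apply/funext => x; rewrite big_cons Pi.
Qed.
Lemma cdiff_prod (I : Type) (r : seq I) (P : pred I) (F : I -> C -> C) z :
  (forall i, P i -> cdifferentiable (F i) z) ->
  cdifferentiable (fun x => \prod_(i <- r | P i) F i x) z.
Proof.
move=> h; elim: r => [|i r IH].
  by rewrite (_ : (fun _ => _) = fun=> 1); [exact: cdiff_cst|apply/funext => x; rewrite big_nil].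
case Pi: (P i).
  rewrite (_ : (fun _ => _) = fun x => F i x * \prod_(i <- r | P i) F i x).
    by apply: cdiffM => //; exact: h.
  by apply/funext => x; rewrite big_cons Pi.
rewrite (_ : (fun _ => _) = fun x => \prod_(i <- r | P i) F i x) //.
by apply/funext => x; rewrite big_cons Pi.
Qed.
Lemma cdiffX f n z : cdifferentiable f z -> cdifferentiable (fun x => f x ^+ n) z.
Proof.
move=> h; rewrite (_ : (fun _ => _) = fun x => \prod_(i < n) f x); first exact: cdiff_prod.
by apply/funext => x; rewrite prodr_const card_ord.
Qed.

Lemma cdiff_near f g z (d : R) : 0 < d -> (forall x, nc (x - z) < d -> f x = g x) ->
  cdifferentiable f z -> cdifferentiable g z.
Proof.
move=> d0 fg [l /has_cderivP h]; exists l; apply/has_cderivP => e e0.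
have [d' d'0 hd] := h e e0; exists (Num.min d d'); first by rewrite lt_min d0.
move=> x; rewrite lt_min => /andP[x1 x2]; rewrite -fg // -fg ?subrr ?nc0 //; exact: hd.
Qed.

Lemma cdiff_continuous f z : cdifferentiable f z -> f x @[x --> z] --> f z.
Proof.
move=> [l /has_cderivP h]; apply/(@cvgCP C (nbhs z) (nbhs_filter z) f (f z)) => e e0; apply/near_nbhsC.
have [d d0 hd] := h _ (@ltr01 R).
have k0 : 0 < 1 + nc l by rewrite ltr_pwDl ?nc_ge0.
exists (Num.min d (e / (1 + nc l))); first by rewrite lt_min d0 divr_gt0.
move=> x; rewrite lt_min => /andP[x1]; rewrite ltr_pdivlMr // => x2.
rewrite ncC; apply: le_lt_trans x2.
have -> : f x - f z = (f x - f z - l * (x - z)) + l * (x - z) by ring.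
apply: le_trans (ncD _ _) _; rewrite ncM [leRHS]mulrDr mulr1 [nc l * _]mulrC lerD2r.
by have := hd x x1; rewrite mul1r.
Qed.

Lemma nc_cis t : nc (cis t) = 1.
Proof. by rewrite /nc /= cos2Dsin2 sqrtr1. Qed.
Lemma cisD s t : cis (s + t) = cis s * cis t.
Proof. by rewrite /cis cosD sinD -[in RHS]/(Complex _ _); congr Complex; rewrite addrC mulrC // (mulrC (sin t)). Qed.
Lemma cis0 : cis 0 = 1. Proof. by rewrite /cis cos0 sin0. Qed.
Lemma cis2pi : cis (2 * pi) = 1.
Proof. by rewrite /cis mulr_natl cos2pi sin2pi. Qed.

Lemma polar z : exists2 t, 0 <= t <= 2 * pi & z = toC (nc z) * cis t.
Proof.
have [->|z0] := eqVneq z 0; first by exists 0; rewrite ?nc0 ?toC0 ?mul0r // lexx /= mulr_ge0 // pi_ge0.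
suff [t ht e] : exists2 t, 0 <= t <= 2 * pi & z / toC (nc z) = cis t.
  exists t => //; rewrite -e mulrC divfK // (_ : 0 = toC 0) // (inj_eq toC_inj) gt_eqF ?nc_gt0 //.
have : nc (z / toC (nc z)) = 1.
  by rewrite ncM ncV nc_real ger0_norm ?nc_ge0 // divff // gt_eqF ?nc_gt0.
move: (_ / _) => [c s]; rewrite /nc /= => /(congr1 (fun x => x ^+ 2)).
rewrite sqr_sqrtr ?addr_ge0 ?sqr_ge0 // expr1n => e.
have cb : -1 <= c <= 1 by have := sqr_ge0 s; nra.
have [/andP[a0 a1]] : 0 <= acos c <= pi /\ cos (acos c) = c.
  by split; [rewrite acos_ge0 // acos_lepi // ?(andP cb)|rewrite acosK // in_itv].
move=> ac; have sa : sin (acos c) ^+ 2 = s ^+ 2.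
  by rewrite sin2cos2 ac; lra.
have := pi_ge0 R => p0.
(* The cosine determines the sine only up to sign; for the negative root the angle is reflected to
   [2 * pi - acos c]. *)
have : (sin (acos c) == s) || (sin (acos c) == - s) by rewrite -eqf_sqr sa.
case/orP => /eqP es.
  by exists (acos c); [lra|rewrite /cis ac es].
exists (2 * pi - acos c); first lra.
rewrite /cis (_ : 2 * pi - acos c = - acos c + pi *+ 2); last by rewrite mulr_natl addrC.
by rewrite cosD2pi sinD2pi cosN sinN ac es opprK.
Qed.
End ComplexBasics.

(** * Circle means of a holomorphic function do not depend on the radius *)

Section CircleMean.
Context {R : realType}.
Local Notation C := (Cplx R).
Implicit Types (K : C -> C) (rho r e x y a b : R).

Lemma real_deriveP (f : R -> R) (x l : R) : is_derive x 1 f l ->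
  forall e, 0 < e -> exists2 d : R, 0 < d & forall y, `|y - x| < d ->
    `|f y - f x - l * (y - x)| <= e * `|y - x|.
Proof.
move=> [h1 h2] e e0; move: h1; rewrite /derivable => /cvg_ex [l' hl']; rewrite /= in hl'.
have ll : l' = l by rewrite -h2 /derive; apply/esym/cvg_lim.
move/cvgrPdist_lt: hl' => /(_ _ e0) [d /= d0 hd]; exists d => // y yd.
have [->|yx] := eqVneq y x; first by rewrite !subrr mulr0 subr0 normr0 mulr0.
have yx0 : y - x != 0 by rewrite subr_eq0.
have yd' : ball_ Num.norm (0 : R) d (y - x) by rewrite /ball_ /= sub0r normrN.
have := hd (y - x) yd' yx0 => /=.
rewrite /GRing.scale /= mulr1 subrK ll => k.
rewrite (_ : f y - f x - l * (y - x) = - (l - (y - x)^-1 * (f y - f x)) * (y - x)); last by field.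
by rewrite normrM normrN ler_wpM2r // ltW.
Qed.

(** Real differentiability whose derivative is multiplication by the complex number [L], that is,
    with the Cauchy-Riemann equations built in. *)
Definition tdiffC (h : R -> R -> C) (x y : R) (L : C) := forall e : R, 0 < e ->
  exists2 d : R, 0 < d & forall x' y', `|x' - x| < d -> `|y' - y| < d ->
   nc (h x' y' - h x y - L * Complex (x' - x) (y' - y)) <= e * (`|x' - x| + `|y' - y|).

(** The exponential of [x + i y]: vertical segments of height [2 * pi] become circles. *)
Definition cexp (x y : R) : C := toC (expR x) * cis y.

Lemma cexpD x y a b : cexp (x + a) (y + b) = cexp x y * cexp a b.
Proof. by rewrite /cexp expRD cisD toCM; ring. Qed.

Lemma cexp_small e : 0 < e -> exists2 d : R, 0 < d & forall a b : R, `|a| < d -> `|b| < d ->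
  nc (cexp a b - 1 - Complex a b) <= e * (`|a| + `|b|).
Proof.
move=> e0; pose e1 := Num.min (e / 8) 1.
have e10 : 0 < e1 by rewrite lt_min; lra.
have e18 : e1 <= e / 8 by rewrite ge_min lexx.
have e11 : e1 <= 1 by rewrite ge_min lexx orbT.
have [d1 d10 h1] := real_deriveP (is_derive_expR (0 : R)) e10.
have [d2 d20 h2] := real_deriveP (is_derive_sin (0 : R)) e10.
have [d3 d30 h3] := real_deriveP (is_derive_cos (0 : R)) e10.
exists (Num.min (Num.min d1 d2) (Num.min d3 (Num.min (e / 8) (1/2)))).
  by rewrite !lt_min d10 d20 d30 /=; lra.
move=> a b; rewrite !lt_min => /andP[/andP[a1 a2] /and3P[a3 a4 a5]] /andP[/andP[b1 b2] /and3P[b3 b4 b5]].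
have := h1 a; have := h2 b; have := h3 b; rewrite !subr0 sin0 cos0 expR0 subr0 mul1r oppr0 mul0r subr0.
move=> /(_ b3) k3 /(_ b2) k2; rewrite mul1r => /(_ a1) k1.
have -> : cexp a b - 1 - Complex a b = Complex (expR a * cos b - 1 - a) (expR a * sin b - b).
  by rewrite /cexp /cis /toC; apply/eqP; rewrite eq_complex /=; apply/andP; split; apply/eqP; ring.
apply: le_trans (nc_le_ReIm _) _ => /=.
have na := normr_ge0 a; have nb := normr_ge0 b.
have a0 := expR_gt0 a.
have ea : expR a <= 2 by move: k1; rewrite ler_norml; have := ler_norm a; nra.
have u1 : `|expR a * cos b - 1 - a| <= e1 * `|a| + 2 * (e1 * `|b|).
  rewrite (_ : _ - a = (expR a - 1 - a) + expR a * (cos b - 1)); last by ring.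
  apply: le_trans (ler_normD _ _) _; rewrite lerD // normrM (ger0_norm (ltW a0)).
  by rewrite ler_pM.
have u2 : `|expR a * sin b - b| <= 2 * (e1 * `|b|) + (2 * `|a|) * `|b|.
  rewrite (_ : _ - b = expR a * (sin b - b) + (expR a - 1) * b); last by ring.
  apply: le_trans (ler_normD _ _) _; rewrite lerD // normrM ?(ger0_norm (ltW a0)) ?ler_pM //.
  rewrite (_ : expR a - 1 = (expR a - 1 - a) + a); last by ring.
  apply: le_trans (ler_normD _ _) _; nra.
nra.
Qed.

Lemma tdiffC_cexp x y : tdiffC cexp x y (cexp x y).
Proof.
move=> e e0.
have k0 : 0 < 1 + nc (cexp x y) by rewrite ltr_pwDl ?nc_ge0.
have [d d0 hd] := cexp_small (divr_gt0 e0 k0); exists d => // x' y' hx hy.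
have -> : cexp x' y' = cexp x y * cexp (x' - x) (y' - y).
  by rewrite -cexpD; congr cexp; ring.
have -> : cexp x y * cexp (x' - x) (y' - y) - cexp x y - cexp x y * Complex (x' - x) (y' - y)
  = cexp x y * (cexp (x' - x) (y' - y) - 1 - Complex (x' - x) (y' - y)) by ring.
rewrite ncM; have := hd _ _ hx hy; set v := nc (_ - _ - _); set s := `|x' - x| + `|y' - y| => h.
have s0 : 0 <= s by rewrite addr_ge0.
have : nc (cexp x y) * v <= (1 + nc (cexp x y)) * (e / (1 + nc (cexp x y)) * s).
  by apply: ler_pM => //; rewrite ?nc_ge0 // lerDr.
by rewrite mulrA [_ * (e / _)]mulrC divfK // gt_eqF.
Qed.

Lemma tdiffC_comp K x y l : has_cderiv K (cexp x y) l ->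
  tdiffC (fun x y => K (cexp x y)) x y (l * cexp x y).
Proof.
move=> /has_cderivP hK e e0.
pose B := 1 + nc (cexp x y); have B0 : 0 < B by rewrite ltr_pwDl ?nc_ge0.
have B1 : 1 <= B by rewrite lerDl nc_ge0.
have l0 : 0 < 2 * (1 + nc l) by rewrite mulr_gt0 // ltr_pwDl ?nc_ge0.
have eB : 0 < e / (4 * B) by rewrite divr_gt0 // mulr_gt0.
have [d1 d10 h1] := hK _ eB.
have [d2 d20 h2] := tdiffC_cexp x y (divr_gt0 e0 l0).
have [d3 d30 h3] := tdiffC_cexp x y (@ltr01 R).
exists (Num.min (Num.min d2 d3) (d1 / (4 * B))).
  by rewrite !lt_min d20 d30 divr_gt0 // mulr_gt0.
move=> x' y'; rewrite !lt_min => /andP[/andP[x2 x3] x4] /andP[/andP[y2 y3] y4].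
set z := cexp x y; set z' := cexp x' y'; set dz := Complex _ _.
have ndz : nc dz <= `|x' - x| + `|y' - y| by exact: nc_le_ReIm.
set s := `|x' - x| + `|y' - y| in ndz *.
have s0 : 0 <= s by rewrite addr_ge0.
have k3 := h3 _ _ x3 y3; rewrite -/z -/z' -/dz -/s mul1r in k3.
have k2 := h2 _ _ x2 y2; rewrite -/z -/z' -/dz -/s in k2.
have zz : nc (z' - z) <= 2 * B * s.
  rewrite (_ : z' - z = (z' - z - z * dz) + z * dz); last by ring.
  apply: le_trans (ncD _ _) _; rewrite ncM.
  have : nc z * nc dz <= B * s by apply: ler_pM; rewrite ?nc_ge0 // lerDr.
  nra.
have zd : nc (z' - z) < d1.
  apply: le_lt_trans zz _; rewrite -mulrA.
  have : s < d1 / (4 * B) + d1 / (4 * B) by rewrite ltrD.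
  rewrite -mulrDl ltr_pdivlMr ?mulr_gt0 //; nra.
rewrite (_ : _ - _ - _ = (K z' - K z - l * (z' - z)) + l * (z' - z - z * dz)); last by ring.
apply: le_trans (ncD _ _) _.
have k1 := h1 _ zd.
have u1 : nc (K z' - K z - l * (z' - z)) <= e / 2 * s.
  apply: le_trans k1 _; apply: le_trans (ler_wpM2l (ltW eB) zz) _.
  rewrite (_ : e / (4 * B) * (2 * B * s) = e / 2 * s) //; field; lra.
have u2 : nc (l * (z' - z - z * dz)) <= e / 2 * s.
  rewrite ncM; apply: le_trans (_ : (1 + nc l) * (e / (2 * (1 + nc l)) * s) <= _).
    by apply: ler_pM; rewrite ?nc_ge0 // lerDr.
  by rewrite (_ : (1 + nc l) * (e / (2 * (1 + nc l)) * s) = e / 2 * s) //; field; lra.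
lra.
Qed.

Local Notation re z := (complex.Re (z : R[i])).
Local Notation im z := (complex.Im (z : R[i])).

Lemma tdiffC_re h x y L : tdiffC h x y L -> tdiff (fun x y => re (h x y)) x y (re L) (- im L).
Proof.
move=> k e e0; have [d d0 hd] := k e e0; exists d => // x' y' hx hy.
apply: le_trans (hd _ _ hx hy); apply: le_trans (Re_le_nc _).
rewrite le_eqVlt; apply/orP; left; apply/eqP; congr `| _ |.
case: (h x' y') => a1 b1; case: (h x y) => a2 b2; case: L {k hd} => a3 b3 /=; ring.
Qed.

Lemma tdiffC_im h x y L : tdiffC h x y L -> tdiff (fun x y => im (h x y)) x y (im L) (re L).
Proof.
move=> k e e0; have [d d0 hd] := k e e0; exists d => // x' y' hx hy.
apply: le_trans (hd _ _ hx hy); apply: le_trans (Im_le_nc _).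
rewrite le_eqVlt; apply/orP; left; apply/eqP; congr `| _ |.
case: (h x' y') => a1 b1; case: (h x y) => a2 b2; case: L {k hd} => a3 b3 /=; ring.
Qed.

Lemma tdiffN F (x y p q : R) : tdiff F x y p q -> tdiff (fun x y => - F x y) x y (- p) (- q).
Proof.
move=> k e e0; have [d d0 hd] := k e e0; exists d => // x' y' hx hy.
apply: le_trans (hd _ _ hx hy); rewrite -normrN.
rewrite le_eqVlt; apply/orP; left; apply/eqP; congr `| _ |; ring.
Qed.

(* 2 pi times the mean of f over the circle of radius rho *)
Definition circ K rho : C :=
  Complex (Int (fun t => re (K (toC rho * cis t))) 0 (2 * pi))
          (Int (fun t => im (K (toC rho * cis t))) 0 (2 * pi)).

(** In logarithmic polar coordinates [K (cexp x y)] is [2 * pi]-periodic in [y] and the form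
    [K (cexp x y) (dx + i dy)] is closed, so [goursat_periodic] equates the integrals over the two
    vertical sides [x = ln r1] and [x = ln r2]. *)
Lemma circ_const K r1 r2 : 0 < r1 -> r1 <= r2 ->
  (forall z, r1 <= nc z <= r2 -> cdifferentiable K z) -> circ K r1 = circ K r2.
Proof.
move=> r10 r12 hK.
pose a := ln r1; pose b := ln r2.
have r20 : 0 < r2 by exact: lt_le_trans r12.
have ab : a <= b by rewrite ler_ln.
have p0 : 0 <= 2 * pi :> R by rewrite mulr_ge0 // pi_ge0.
have ea : expR a = r1 by rewrite lnK.
have eb : expR b = r2 by rewrite lnK.
have hd x y : a <= x <= b -> exists l, has_cderiv K (cexp x y) l.
  move=> /andP[ax xb]; apply: hK; rewrite ncM nc_cis mulr1 nc_real ger0_norm ?expR_ge0 //.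
  by rewrite -ea -eb !ler_expR ax.
have per x : cexp x 0 = cexp x (2 * pi) by rewrite /cexp cis2pi cis0.
(* This pair is minus the real part of the form, and [c2] is its imaginary part; their [dy]
   components are the two integrands of [circ]. *)
have c1 : closed_on (fun x y => - re (K (cexp x y))) (fun x y => im (K (cexp x y))) a b 0 (2 * pi).
  move=> x y hx hy; have [l /tdiffC_comp hl] := hd x y hx; do 3 eexists; split.
    exact: tdiffN (tdiffC_re hl).
  by rewrite opprK; exact: tdiffC_im hl.
have c2 : closed_on (fun x y => im (K (cexp x y))) (fun x y => re (K (cexp x y))) a b 0 (2 * pi).
  move=> x y hx hy; have [l /tdiffC_comp hl] := hd x y hx; do 3 eexists; split.
    exact: tdiffC_im hl.
  exact: tdiffC_re hl.
have p1 x : - re (K (cexp x 0)) = - re (K (cexp x (2 * pi))) by rewrite per.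
have p2 x : im (K (cexp x 0)) = im (K (cexp x (2 * pi))) by rewrite per.
have G1 := goursat_periodic ab p0 c1 p1.
have G2 := goursat_periodic ab p0 c2 p2.
have circE x : circ K (expR x) = Complex (Int (fun y => re (K (cexp x y))) 0 (2 * pi))
   (Int (fun y => im (K (cexp x y))) 0 (2 * pi)) by [].
by rewrite -ea -eb !circE G1 G2.
Qed.
End CircleMean.

(** * Cauchy's formula and Taylor series *)

Section Taylor.
Context {R : realType}.
Local Notation C := (Cplx R).
Implicit Types (f g K : C -> C) (rho r e t : R) (z w : C).
Local Notation re z := (complex.Re (z : R[i])).
Local Notation im z := (complex.Im (z : R[i])).

Definition ccont f rho := forall t, {for (toC rho * cis t : C), continuous f}.

Lemma reD z w : re (z + w) = re z + re w. Proof. by case: z; case: w. Qed.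
Lemma imD z w : im (z + w) = im z + im w. Proof. by case: z; case: w. Qed.
Lemma reB z w : re (z - w) = re z - re w. Proof. by case: z; case: w. Qed.
Lemma imB z w : im (z - w) = im z - im w. Proof. by case: z; case: w. Qed.
Lemma reM z w : re (z * w) = re z * re w - im z * im w. Proof. by case: z; case: w. Qed.
Lemma imM z w : im (z * w) = re z * im w + im z * re w. Proof. by case: z; case: w. Qed.

Lemma cis_near t e : 0 < e -> \forall s \near t, nc (cis s - cis t) < e.
Proof.
move=> e0; have e2 : 0 < e / 2 by rewrite divr_gt0.
have h1 := @continuous_cos R t; have h2 := @continuous_sin R t.
near=> s.
apply: le_lt_trans (nc_le_ReIm _) _; rewrite reB imB /= (splitr e) ltrD //.
  by rewrite distrC; near: s; move/cvgrPdist_lt : h1; exact.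
by rewrite distrC; near: s; move/cvgrPdist_lt : h2; exact.
Unshelve. all: by end_near. Qed.

Lemma cont_circ f rho : ccont f rho ->
  cont_on (fun t => re (f (toC rho * cis t))) 0 (2 * pi) /\
  cont_on (fun t => im (f (toC rho * cis t))) 0 (2 * pi).
Proof.
move=> h; have k t e : 0 < e -> \forall s \near t, nc (f (toC rho * cis s) - f (toC rho * cis t)) < e.
  move=> e0; have /cvgCP/(_ _ e0) /near_nbhsC [d d0 hd] := h t.
  have r0 : 0 < d / (1 + `|rho|) by rewrite divr_gt0 // ltr_pwDl.
  apply: filterS (cis_near t r0) => s; rewrite ltr_pdivlMr ?ltr_pwDl // => hs.
  rewrite ncC; apply: hd; rewrite -mulrBr ncM nc_real.
  apply: le_lt_trans hs; rewrite mulrC ler_wpM2l ?nc_ge0 // lerDr //.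
split=> t _; apply/cvgrPdist_lt => e e0; apply: filterS (k t e e0) => s; rewrite distrC.
  by rewrite -reB; exact: le_lt_trans (Re_le_nc _).
by rewrite -imB; exact: le_lt_trans (Im_le_nc _).
Qed.

Lemma eq_circ f g rho : (forall t, f (toC rho * cis t) = g (toC rho * cis t)) -> circ f rho = circ g rho.
Proof. by move=> h; rewrite /circ; congr Complex; apply: eq_Int => t _; rewrite h. Qed.

Lemma circD f g rho : ccont f rho -> ccont g rho ->
  circ (fun z => f z + g z) rho = circ f rho + circ g rho.
Proof.
move=> /cont_circ [f1 f2] /cont_circ [g1 g2].
rewrite /circ -[RHS]/(Complex _ _) -(IntD f1 g1) -(IntD f2 g2).
by congr Complex; apply: eq_Int => t _; rewrite ?reD ?imD.
Qed.

Lemma circZ a f rho : ccont f rho -> circ (fun z => a * f z) rho = a * circ f rho.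
Proof.
move=> /cont_circ [f1 f2]; case: a => a b.
have ca c (F : R -> R) : cont_on F 0 (2 * pi) -> cont_on (fun t => c * F t) 0 (2 * pi).
  by move=> hF t ht; apply: continuousM; [exact: cst_continuous|exact: hF].
rewrite /circ -[RHS]/(Complex _ _) -(IntZ a f1) -(IntZ b f2) -(IntZ a f2) -(IntZ b f1).
rewrite -(IntB (ca a _ f1) (ca b _ f2)) -(IntD (ca a _ f2) (ca b _ f1)).
by congr Complex; apply: eq_Int => t _; rewrite ?reM ?imM.
Qed.

Lemma ccont_cst a rho : ccont (fun=> a) rho.
Proof. by move=> t; exact: cst_continuous. Qed.
Lemma ccontD f g rho : ccont f rho -> ccont g rho -> ccont (fun z => f z + g z) rho.
Proof. by move=> hf hg t; apply: (@continuousD _ C^o); [exact: hf|exact: hg]. Qed.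
Lemma ccontM f g rho : ccont f rho -> ccont g rho -> ccont (fun z => f z * g z) rho.
Proof. by move=> hf hg t; apply: continuousM; [exact: hf|exact: hg]. Qed.
Lemma ccont_sum n (F : nat -> C -> C) rho : (forall i, ccont (F i) rho) ->
  ccont (fun z => \sum_(i < n) F i z) rho.
Proof.
move=> h; elim: n => [|n IH].
  by rewrite (_ : (fun _ => _) = fun=> 0); [exact: ccont_cst|apply/funext => x; rewrite big_ord0].
rewrite (_ : (fun _ => _) = fun x => \sum_(i < n) F i x + F n x); first exact: (@ccontD (fun x => \sum_(i < n) F i x) (F n) rho IH (h n)).
by apply/funext => x; rewrite big_ord_recr.
Qed.
Lemma ccont_cdiff f rho : (forall z, nc z = `|rho| -> cdifferentiable f z) -> ccont f rho.
Proof. by move=> h t; apply: cdiff_continuous; apply: h; rewrite ncM nc_real nc_cis mulr1. Qed.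

Lemma circ_cst a rho : circ (fun=> a) rho = toC (2 * pi) * a.
Proof.
have p0 : 0 <= 2 * pi :> R by rewrite mulr_ge0 // pi_ge0.
rewrite /circ !Int_cst // subr0; case: a => a b /=; rewrite -[RHS]/(Complex _ _) /=.
by congr Complex; rewrite !(mulrC _ (2 * pi)) mul0r ?subr0 ?addr0.
Qed.

Lemma circ_sum n (F : nat -> C -> C) rho : (forall i, ccont (F i) rho) ->
  circ (fun z => \sum_(i < n) F i z) rho = \sum_(i < n) circ (F i) rho.
Proof.
move=> h; elim: n => [|n IH].
  by rewrite big_ord0 (eq_circ (g := fun=> 0)) ?circ_cst ?mulr0 // => t; rewrite big_ord0.
rewrite big_ord_recr /= -IH -circD //; last exact: ccont_sum.
by apply: eq_circ => t; rewrite big_ord_recr.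
Qed.

Lemma circ_close f r1 r2 e : ccont f r1 -> ccont f r2 ->
  (forall t, 0 <= t <= 2 * pi -> nc (f (toC r1 * cis t) - f (toC r2 * cis t)) <= e) ->
  nc (circ f r1 - circ f r2) <= 4 * pi * e.
Proof.
move=> /cont_circ [f1 f2] /cont_circ [g1 g2] h.
have p0 : 0 <= 2 * pi :> R by rewrite mulr_ge0 // pi_ge0.
rewrite /circ -[X in nc X]/(Complex _ _) -(IntB f1 g1) -(IntB f2 g2).
apply: le_trans (nc_le_ReIm _) _ => /=.
have := Int_near_cst p0 (cont_onB f1 g1) (c := 0) (e := e).
have := Int_near_cst p0 (cont_onB f2 g2) (c := 0) (e := e).
rewrite mul0r !subr0 => H1 H2.
have {}H1 := H1 _; have {}H2 := H2 _.
have -> : 4 * pi * e = e * (2 * pi) + e * (2 * pi) by ring.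
rewrite lerD //; [apply: H2|apply: H1] => t ht; rewrite subr0 -?reB -?imB.
  exact: le_trans (Re_le_nc _) (h t ht).
exact: le_trans (Im_le_nc _) (h t ht).
Qed.

Lemma circ_bound f rho e : ccont f rho ->
  (forall t, 0 <= t <= 2 * pi -> nc (f (toC rho * cis t)) <= e) ->
  nc (circ f rho) <= 4 * pi * e.
Proof.
move=> /cont_circ [f1 f2] h.
have p0 : 0 <= 2 * pi :> R by rewrite mulr_ge0 // pi_ge0.
apply: le_trans (nc_le_ReIm _) _ => /=.
have := Int_near_cst p0 f1 (c := 0) (e := e).
have := Int_near_cst p0 f2 (c := 0) (e := e).
rewrite mul0r !subr0 => H1 H2.
have -> : 4 * pi * e = e * (2 * pi) + e * (2 * pi) by ring.
rewrite lerD //; [apply: H2|apply: H1] => t ht; rewrite subr0.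
  exact: le_trans (Re_le_nc _) (h t ht).
exact: le_trans (Im_le_nc _) (h t ht).
Qed.

Lemma ccont_max f rho : ccont f rho -> exists2 B : R, 0 < B &
  forall t, 0 <= t <= 2 * pi -> nc (f (toC rho * cis t)) <= B.
Proof.
move=> /cont_circ [f1 f2].
have p0 : 0 <= 2 * pi :> R by rewrite mulr_ge0 // pi_ge0.
have ev (F : R -> R) : cont_on F 0 (2 * pi) -> exists2 B : R, 0 <= B & forall t, 0 <= t <= 2 * pi -> `|F t| <= B.
  move=> hF; have hN : {within `[0, 2 * pi]%classic, continuous (fun t => `|F t|)}.
    apply: continuous_in_subspaceT => t /set_mem /=; rewrite in_itv /= => ht.
    by apply: continuous_comp; [exact: hF|exact: norm_continuous].
  have [c hc hm] := EVT_max p0 hN; exists `|F c| => // t ht; apply: hm; by rewrite in_itv.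
have [B1 B10 h1] := ev _ f1; have [B2 B20 h2] := ev _ f2.
exists (B1 + B2 + 1); first by rewrite ltr_wpDl // addr_ge0.
move=> t ht; apply: le_trans (nc_le_ReIm _) _; apply: le_trans (lerD (h1 t ht) (h2 t ht)) _.
by rewrite lerDl.
Qed.

(** Uniform continuity near a compact circle; it lets the mean pass a radius on which
    differentiability is not known. *)
Lemma circ_tube f r0 e : ccont f r0 -> 0 < e -> exists2 d : R, 0 < d & forall r, `|r - r0| < d ->
  forall t, 0 <= t <= 2 * pi -> nc (f (toC r * cis t) - f (toC r0 * cis t)) <= e.
Proof.
move=> h e0; have := @segment_compact R 0 (2 * pi) => /compact_near_coveringP.
move=> /(_ R (nbhs r0) (fun r t => nc (f (toC r * cis t) - f (toC r0 * cis t)) <= e)).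
case.
  move=> t0 _; have e2 : 0 < e / 2 by rewrite divr_gt0.
  have /cvgCP/(_ _ e2) /near_nbhsC [d d0 hd] := h t0.
  pose B := 2 * (1 + `|r0|); have B0 : 0 < B by rewrite mulr_gt0 // ltr_pwDl.
  have r1 : 0 < Num.min 1 (d / B) by rewrite lt_min ltr01 divr_gt0.
  exists ([set s | nc (cis s - cis t0) < d / B], [set r | `|r0 - r| < Num.min 1 (d / 2)]).
    split; first by apply: cis_near; rewrite divr_gt0.
    by exists (Num.min 1 (d / 2)) => //=; rewrite lt_min ltr01 divr_gt0.
  move=> [s r] [hs hr]; have /andP[hr1 hr2] : (`|r0 - r| < 1) && (`|r0 - r| < d / 2) by rewrite -lt_min.
  have {}hs : nc (cis s - cis t0) * B < d by rewrite -ltr_pdivlMr.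
  have key r' : `|r0 - r'| < d / 2 -> nc (toC r' * cis s - toC r0 * cis t0) < d.
    move=> hr'; have -> : toC r' * cis s - toC r0 * cis t0 = (toC r' - toC r0) * cis s + toC r0 * (cis s - cis t0) by ring.
    apply: le_lt_trans (ncD _ _) _; rewrite !ncM -toCB !nc_real nc_cis mulr1 (splitr d) distrC ltrD //.
    move: hs; rewrite /B; have := normr_ge0 r0; have := nc_ge0 (cis s - cis t0); nra.
  have k1 := hd _ (key r hr2).
  have k2 : nc (f (toC r0 * cis t0) - f (toC r0 * cis s)) < e / 2.
    by apply: hd; apply: key; rewrite subrr normr0 divr_gt0.
  have -> : f (toC r * cis s) - f (toC r0 * cis s) = (f (toC r0 * cis t0) - f (toC r0 * cis s)) - (f (toC r0 * cis t0) - f (toC r * cis s)) by ring.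
  apply: le_trans (ncB _ _) _; by rewrite (splitr e) lerD // ltW.
move=> d /= d0 hd; exists d => // r hr t ht; apply: (hd r) => /=; last by rewrite in_itv.
by rewrite distrC.
Qed.

(** The mean is constant in the radius on either side of [nc zeta]. On the inner side it tends to 0
    with the radius because [f 0 = 0], and continuity carries this value across the exceptional
    circle. *)
Lemma circ_exc f zeta r rho : (forall z, nc z < r -> {for z, continuous f}) ->
  (forall z, nc z < r -> z != 0 -> z != zeta -> cdifferentiable f z) ->
  f 0 = 0 -> nc zeta < rho -> rho < r -> circ f rho = 0.
Proof.
move=> fc fd f0 zr rr.
have rho0 : 0 < rho by exact: le_lt_trans (nc_ge0 _) zr.
have cc s : 0 <= s -> s < r -> ccont f s.
  by move=> s0 sr t; apply: fc; rewrite ncM nc_real nc_cis mulr1 ger0_norm.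
have constA s1 s2 : 0 < s1 -> s1 <= s2 -> s2 < r -> (forall s, s1 <= s <= s2 -> s <> nc zeta) ->
   circ f s1 = circ f s2.
  move=> s10 s12 s2r hs; apply: circ_const => // z /andP[z1 z2]; apply: fd.
  - exact: le_lt_trans s2r.
  - by rewrite -nc_gt0; exact: lt_le_trans z1.
  - by apply/eqP => zz; apply: (hs (nc z)); [rewrite z1 z2|rewrite zz].
have p4 : 0 < 4 * pi :> R by rewrite mulr_gt0 // pi_gt0.
have small e : 0 < e -> exists2 d : R, 0 < d & forall s, 0 < s -> s < d -> nc (circ f s) <= e.
  move=> e0; have e4 : 0 < e / (4 * pi) by rewrite divr_gt0.
  have r0 : 0 < r by exact: lt_trans rr.
  have := fc 0; rewrite nc0 => /(_ r0) /cvgCP /(_ _ e4) /near_nbhsC [d d0 hd].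
  exists (Num.min d r); first by rewrite lt_min d0.
  move=> s s0; rewrite lt_min => /andP[sd sr].
  have -> : e = 4 * pi * (e / (4 * pi)) by rewrite mulrC divfK // lt0r_neq0.
  apply: circ_bound; first by apply: cc => //; exact: ltW.
  move=> t _; rewrite -(ncN (f _)) -(add0r (- f _)) -{1}f0 ltW //; apply: hd.
  by rewrite subr0 ncM nc_real nc_cis mulr1 gtr0_norm.
have inner s : 0 < s -> s < nc zeta -> circ f s = 0.
  move=> s0 sz; apply/eqP; rewrite -nc_eq0 eq_le nc_ge0 andbT; apply/ler_addgt0Pr => e e0; rewrite add0r.
  have [d d0 hd] := small e e0.
  have m0 : 0 < Num.min (d / 2) s by rewrite lt_min divr_gt0.
  have md : Num.min (d / 2) s < d by rewrite gt_min ltr_pdivrMr // ltr_pMr // ltrDl ltr01.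
  rewrite -(constA (Num.min (d / 2) s)) ?hd //; first by rewrite ge_min lexx orbT.
    exact: lt_trans (lt_trans zr rr).
  by move=> s' /andP[_ h] ss; move: (le_lt_trans h sz); rewrite ss ltxx.
apply/eqP; rewrite -nc_eq0 eq_le nc_ge0 andbT; apply/ler_addgt0Pr => e e0; rewrite add0r.
have [z0|zn0] := eqVneq zeta 0.
  have [d d0 hd] := small e e0.
  have m0 : 0 < Num.min (d / 2) rho by rewrite lt_min divr_gt0.
  have md : Num.min (d / 2) rho < d by rewrite gt_min ltr_pdivrMr // ltr_pMr // ltrDl ltr01.
  rewrite -(constA (Num.min (d / 2) rho)) ?hd //; first by rewrite ge_min lexx orbT.
  by move=> s' /andP[h _] ss; move: (lt_le_trans m0 h); rewrite ss z0 nc0 ltxx.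
have nz : 0 < nc zeta by rewrite nc_gt0.
have e8 : 0 < e / (8 * pi) by rewrite divr_gt0 // mulr_gt0 // pi_gt0.
have ccz : ccont f (nc zeta) by apply: cc; [exact: ltW|exact: lt_trans zr rr].
have [d d0 hd] := circ_tube ccz e8.
pose s1 := nc zeta - Num.min (d / 2) (nc zeta / 2).
pose s2 := nc zeta + Num.min (d / 2) (rho - nc zeta).
have m1 : 0 < Num.min (d / 2) (nc zeta / 2) by rewrite lt_min !divr_gt0.
have m2 : 0 < Num.min (d / 2) (rho - nc zeta) by rewrite lt_min subr_gt0 zr divr_gt0.
have m1d : Num.min (d / 2) (nc zeta / 2) < d by rewrite gt_min ltr_pdivrMr // ltr_pMr // ltrDl ltr01.
have m2d : Num.min (d / 2) (rho - nc zeta) < d by rewrite gt_min ltr_pdivrMr // ltr_pMr // ltrDl ltr01.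
have m1z : Num.min (d / 2) (nc zeta / 2) <= nc zeta / 2 by rewrite ge_min lexx orbT.
have m2z : Num.min (d / 2) (rho - nc zeta) <= rho - nc zeta by rewrite ge_min lexx orbT.
have s1p : 0 < s1 by rewrite /s1 subr_gt0 (le_lt_trans m1z) // ltr_pdivrMr // ltr_pMr // ltrDl ltr01.
have s1z : s1 < nc zeta by rewrite /s1 ltrBlDr ltrDl.
have zs2 : nc zeta < s2 by rewrite /s2 ltrDl.
have s2r : s2 <= rho by rewrite /s2 -lerBrDl.
have cs1 : ccont f s1 by apply: cc; [exact: ltW|exact: lt_trans s1z (lt_trans zr rr)].
have cs2 : ccont f s2 by apply: cc; [exact: le_trans (ltW nz) (ltW zs2)|exact: le_lt_trans rr].
rewrite -(constA s2) //; last 2 first.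
- exact: lt_trans zs2.
- by move=> s /andP[h _] ss; move: (lt_le_trans zs2 h); rewrite ss ltxx.
rewrite -[circ f s2]subr0 -(inner s1) //.
have pn : (pi : R) != 0 by rewrite lt0r_neq0 ?pi_gt0.
have pn8 : (8 * pi : R) != 0 by rewrite mulf_neq0.
have -> : e = 4 * pi * (2 * (e / (8 * pi))) by rewrite -{1}(divfK pn8 e); ring.
apply: circ_close => // t ht.
have -> : f (toC s2 * cis t) - f (toC s1 * cis t) = (f (toC s2 * cis t) - f (toC (nc zeta) * cis t)) - (f (toC s1 * cis t) - f (toC (nc zeta) * cis t)) by ring.
apply: le_trans (ncB _ _) _; rewrite mulr_natl mulr2n lerD //; apply: hd => //.
  by rewrite /s2 addrAC subrr add0r gtr0_norm.
by rewrite /s1 addrAC subrr add0r normrN gtr0_norm.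
Qed.

Definition psum (h : nat -> C) z n : C := \sum_(k < n) h k * z ^+ k.

(** The mean does not depend on the radius and tends to 0 as the radius grows. *)
Lemma circ_exprN k rho : 0 < rho -> (0 < k)%N -> circ (fun z => z ^- k) rho = 0.
Proof.
move=> rho0 k0; apply/eqP; rewrite -nc_eq0 eq_le nc_ge0 andbT; apply/ler_addgt0Pr => e e0; rewrite add0r.
have cd z : z != 0 -> cdifferentiable (fun z => z ^- k) z.
  move=> z0; apply: (@cdiffV _ (fun z => z ^+ k)); first by rewrite expf_neq0.
  by apply: cdiffX; exact: cdiff_id.
pose s := Num.max rho (Num.max 1 (4 * pi / e)).
have s1 : 1 <= s by rewrite !le_max lexx /= orbT.
have se : 4 * pi / e <= s by rewrite !le_max lexx !orbT.
have s0 : 0 < s by exact: lt_le_trans s1.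
rewrite (circ_const (r2 := s)) //; last 2 first.
- by rewrite le_max lexx.
- by move=> z /andP[z1 _]; apply: cd; rewrite -nc_gt0; exact: lt_le_trans z1.
apply: le_trans (_ : 4 * pi * s^-1 <= e).
  apply: circ_bound.
    by apply: ccont_cdiff => z; rewrite gtr0_norm // => zs; apply: cd; rewrite -nc_gt0 zs.
  move=> t _; rewrite ncV ncX ncM nc_real nc_cis mulr1 gtr0_norm // lef_pV2 ?posrE ?exprn_gt0 //.
  by rewrite -[leLHS]expr1 ler_weXn2l.
by rewrite ler_pdivrMr // [leRHS]mulrC -ler_pdivrMr.
Qed.

(** The coefficients are the circle means of [K z * z ^- k]. The divided difference of [K] at [zeta]
    multiplied by [z] has mean 0; expanding [z / (z - zeta)] as a finite geometric sum turns this
    into Taylor's formula with remainder of order [(nc zeta / rho) ^+ n]. *)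
Lemma taylor K rho r : 0 < rho -> rho < r -> (forall z, nc z < r -> cdifferentiable K z) ->
  exists h : nat -> C, exists2 B : R, 0 < B & (forall k, nc (h k) <= B * rho ^- k) /\
   (forall z, nc z < rho -> psum h z @ \oo --> K z).
Proof.
move=> rho0 rr hK.
have r0 : 0 < r by exact: lt_trans rr.
pose h k := (toC (2 * pi))^-1 * circ (fun z => K z * z ^- k) rho.
have p2 : 0 < 2 * pi :> R by rewrite mulr_gt0 // pi_gt0.
have pC : toC (2 * pi) != 0 :> C by rewrite (_ : 0 = toC 0) // (inj_eq (@toC_inj R)) gt_eqF.
have nrho t : nc (toC rho * cis t) = rho by rewrite ncM nc_real nc_cis mulr1 gtr0_norm.
have zrho t : toC rho * cis t != 0 by rewrite -nc_gt0 nrho.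
have ccK : ccont K rho by apply: ccont_cdiff => z zs; apply: hK; rewrite zs gtr0_norm.
have ccX k : ccont (fun z => z ^- k) rho.
  apply: ccont_cdiff => z; rewrite gtr0_norm // => zs; apply: (@cdiffV _ (fun z => z ^+ k)).
    by rewrite expf_neq0 // -nc_gt0 zs.
  by apply: cdiffX; exact: cdiff_id.
have ccKX k : ccont (fun z => K z * z ^- k) rho.
  exact (ccontM ccK (ccX k)).
have [B B0 hB] := ccont_max ccK.
exists h, (2 * B); first by rewrite mulr_gt0.
split=> [k|zeta zr].
  rewrite ncM ncV nc_real gtr0_norm // mulrC ler_pdivrMr //.
  rewrite (_ : 2 * B * rho ^- k * (2 * pi) = 4 * pi * (B * rho ^- k)); last by ring.
  apply: circ_bound; first exact (ccKX k).
  move=> t ht.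
  rewrite ncM.
  rewrite ncV.
  rewrite ncX.
  rewrite nrho.
  apply: ler_wpM2r; last exact: hB.
  by rewrite invr_ge0 exprn_ge0 // ltW.
have zr' : nc zeta < r by exact: lt_trans rr.
have [l hl] := hK _ zr'.
(* The value [l] makes [phi] continuous at [zeta]; differentiability there is not established, hence
   the exceptional point of [circ_exc]. The factor [z] gives [phi 0 = 0]. *)
pose phi z := (if z == zeta then l else (K z - K zeta) / (z - zeta)) * z.
have phid z : nc z < r -> z != zeta -> cdifferentiable phi z.
  move=> zr1 zz; have d0 : 0 < nc (z - zeta) by rewrite nc_gt0 subr_eq0.
  apply: (@cdiff_near _ (fun z => ((K z - K zeta) / (z - zeta)) * z) phi z _ d0).
    move=> x xd; rewrite /phi ifN //; apply/eqP => xz; move: xd; by rewrite xz ncC ltxx.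
  apply: cdiffM; last exact: cdiff_id.
  apply: cdiffM; first by apply: cdiffB; [exact: hK|exact: cdiff_cst].
  apply: (@cdiffV _ (fun z => z - zeta)); first by rewrite subr_eq0.
  by apply: cdiffB; [exact: cdiff_id|exact: cdiff_cst].
have phic z : nc z < r -> {for z, continuous phi}.
  move=> zr1; have [->|zz] := eqVneq z zeta; last by apply: cdiff_continuous; exact: phid.
  apply: (@continuousM C C (fun z => if z == zeta then l else (K z - K zeta) / (z - zeta)) id); last exact: cvg_id.
  apply/(@cvgCP R C (nbhs zeta) (nbhs_filter zeta)) => e e0; apply/near_nbhsC; rewrite eqxx.
  have e2 : 0 < e / 2 by rewrite divr_gt0.
  have /has_cderivP/(_ _ e2) [d d0 hd] := hl; exists d => // x xd.
  have [xz|xz] := eqVneq x zeta; first by rewrite subrr nc0.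
  rewrite (_ : l - (K x - K zeta) / (x - zeta) = - (K x - K zeta - l * (x - zeta)) / (x - zeta)); last first.
    by field; rewrite subr_eq0.
  rewrite ncM ncN ncV ltr_pdivrMr ?nc_gt0 ?subr_eq0 //.
  apply: le_lt_trans (hd _ xd) _; rewrite ltr_pM2r ?nc_gt0 ?subr_eq0 //.
  by rewrite ltr_pdivrMr // ltr_pMr // ltr1n.
have phi0 : circ phi rho = 0.
  apply: (circ_exc (zeta := zeta) phic _ _ zr rr); last by rewrite /phi mulr0.
  by move=> z zr1 _; exact: phid.
have ccphi : ccont phi rho by move=> t; apply: phic; rewrite nrho.
have [M M0 hM] := ccont_max ccphi.
have zz t : toC rho * cis t - zeta != 0.
  by apply/eqP => /(congr1 (fun x => x + zeta)); rewrite subrK add0r => e; move: zr; rewrite -e nrho ltxx.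
have main n : nc (K zeta - psum h zeta n.+1) <= 2 * M * (nc zeta / rho) ^+ n.+1.
  move: n.+1 (ltn0Sn n) => {}n n0.
  have cc1 k : ccont (fun z => zeta ^+ k * (K z * z ^- k)) rho.
    exact (ccontM (@ccont_cst (zeta ^+ k) rho) (ccKX k)).
  have cc2 k : ccont (fun z => (- K zeta * zeta ^+ k) * z ^- k) rho.
    exact (ccontM (@ccont_cst (- K zeta * zeta ^+ k) rho) (ccX k)).
  have ccs k : ccont (fun z => zeta ^+ k * (K z * z ^- k) + (- K zeta * zeta ^+ k) * z ^- k) rho.
    exact (ccontD (cc1 k) (cc2 k)).
  have ccp : ccont (fun z => phi z * z ^- n) rho by exact (ccontM ccphi (ccX n)).
  have ccl : ccont (fun z => zeta ^+ n * (phi z * z ^- n)) rho.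
    exact (ccontM (@ccont_cst (zeta ^+ n) rho) ccp).
  (* Finite geometric expansion in powers of [zeta / z]; on the circle neither [z] nor [z - zeta]
     vanishes. *)
  have e1 : circ phi rho = circ (fun z => \sum_(k < n) (zeta ^+ k * (K z * z ^- k) + (- K zeta * zeta ^+ k) * z ^- k)
      + zeta ^+ n * (phi z * z ^- n)) rho.
    apply: eq_circ => t; move: (zrho t) (zz t); set z := _ * cis t => z0 zz0.
    elim: n {cc1 cc2 ccs ccp ccl n0} => [|n IH]; first by rewrite big_ord0 add0r !expr0 invr1 mulr1 mul1r.
    rewrite {1}IH big_ord_recr /= -!addrA; congr (_ + _).
    have -> : phi z = (K z - K zeta) / (z - zeta) * z by rewrite /phi ifN // -subr_eq0.
    rewrite !exprS; field; by rewrite z0 zz0 expf_neq0.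
  move: phi0; rewrite e1 (circD (ccont_sum (n := n) ccs) ccl) (circ_sum n ccs).
  have e2 (k : nat) : circ (fun z => zeta ^+ k * (K z * z ^- k) + (- K zeta * zeta ^+ k) * z ^- k) rho =
     toC (2 * pi) * (h k * zeta ^+ k) - toC (2 * pi) * (if k == 0%N then K zeta else 0).
    rewrite (circD (cc1 k) (cc2 k)) (circZ _ (ccKX k)) (circZ _ (ccX k)).
    rewrite /h; case: k => [|k].
      rewrite (eq_circ (f := fun z => z ^- 0) (g := fun=> 1)) ?circ_cst; last by move=> t; rewrite expr0 invr1.
      by rewrite expr0 /=; field.
    by rewrite circ_exprN // !mulr0 subr0 addr0 mulrA mulVKf // mulrC.
  rewrite (eq_bigr (fun k : 'I_n => toC (2 * pi) * (h k * zeta ^+ k) - toC (2 * pi) * (if k == 0%N :> nat then K zeta else 0))); last by move=> k _; exact: e2.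
  rewrite sumrB -!mulr_sumr -/(psum h zeta n).
  have -> : \sum_(k < n) (if k == 0%N :> nat then K zeta else 0) = K zeta.
    by case: n n0 {cc1 cc2 ccs ccp ccl e1} => // n _; rewrite big_ord_recl /= big1 ?addr0.
  rewrite (circZ _ ccp).
  move=> e3; have {e3} : toC (2 * pi) * (K zeta - psum h zeta n) = zeta ^+ n * circ (fun z => phi z * z ^- n) rho.
    by rewrite mulrBr; apply/eqP; rewrite -subr_eq0 -oppr_eq0 -e3; apply/eqP; ring.
  move=> /(congr1 nc); rewrite !ncM ncX nc_real gtr0_norm // => e4.
  rewrite -(ler_pM2l p2) e4 exprMn exprVn.
  rewrite (_ : 2 * pi * (2 * M * (nc zeta ^+ n / rho ^+ n)) = nc zeta ^+ n * (4 * pi * (M * rho ^- n))); last by ring.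
  apply: ler_wpM2l; first by rewrite exprn_ge0 ?nc_ge0.
  apply: circ_bound; first exact ccp.
  move=> t ht; rewrite ncM ncV ncX nrho ler_wpM2r ?invr_ge0 ?exprn_ge0 ?hM //; exact: ltW.
apply/cvgCP => e e0.
have q1 : `|nc zeta / rho| < 1.
  by rewrite ger0_norm ?divr_ge0 ?nc_ge0 ?ltr_pdivrMr ?mul1r // ltW.
have := cvg_geometric (2 * M) q1 => /cvgrPdist_lt /(_ e e0) [N _ hN].
exists N.+1 => // -[//|n] /= hn; apply: le_lt_trans (main n) _.
have := hN n.+1 (ltnW hn); rewrite /= sub0r normrN; apply: le_lt_trans; exact: ler_norm.
Qed.
End Taylor.

(** * Power series, Laurent expansions and coefficient asymptotics *)

Section PowerSeries.
Context {R : realType}.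
Local Notation C := (Cplx R).
Implicit Types (f g K G : C -> C) (rho r e t B : R) (z w : C) (h : nat -> C).
Local Notation re z := (complex.Re (z : R[i])).
Local Notation im z := (complex.Im (z : R[i])).

Lemma re_sum (I : Type) (s : seq I) (P : pred I) (F : I -> C) :
  re (\sum_(i <- s | P i) F i) = \sum_(i <- s | P i) re (F i).
Proof. by elim/big_rec2: _ => // i a b _ <-; rewrite reD. Qed.
Lemma im_sum (I : Type) (s : seq I) (P : pred I) (F : I -> C) :
  im (\sum_(i <- s | P i) F i) = \sum_(i <- s | P i) im (F i).
Proof. by elim/big_rec2: _ => // i a b _ <-; rewrite imD. Qed.

Lemma cvgC_ReIm (u : nat -> C) (a b : R) :
  (fun n => re (u n)) @ \oo --> a -> (fun n => im (u n)) @ \oo --> b -> u @ \oo --> (Complex a b : C).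
Proof.
move=> /cvgrPdist_lt ha /cvgrPdist_lt hb; apply/cvgCP => e e0; have e2 : 0 < e / 2 by rewrite divr_gt0.
near=> n; apply: le_lt_trans (nc_le_ReIm _) _; rewrite reB imB (splitr e) ltrD //=.
  by near: n; exact: ha.
by near: n; exact: hb.
Unshelve. all: by end_near. Qed.

Lemma cvgC_toC (u : nat -> R) (a : R) : u @ \oo --> a -> (fun n => toC (u n) : C) @ \oo --> (toC a : C).
Proof. by move=> h; apply: cvgC_ReIm => //=; exact: cvg_cst. Qed.

Lemma cvg_nc_le (u : nat -> C) (l : C) (c : R) : u @ \oo --> l -> (forall n, nc (u n) <= c) -> nc l <= c.
Proof.
move=> /cvgCP h hc; apply/ler_addgt0Pr => e e0; have [N _ /(_ N (leqnn N)) /= hN] := h e e0.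
rewrite -(subrK (u N) l); apply: le_trans (ncD _ _) _; rewrite addrC lerD //; exact: ltW.
Qed.

Lemma cvgC_unique (u : nat -> C) (l l' : C) : u @ \oo --> l -> u @ \oo --> l' -> l = l'.
Proof.
move=> /cvgCP h /cvgCP h'; apply/eqP; rewrite -subr_eq0 -nc_eq0 eq_le nc_ge0 andbT.
apply/ler_addgt0Pr => e e0; rewrite add0r; have e2 : 0 < e / 2 by rewrite divr_gt0.
have [n [h1 h2]] : exists n, nc (l - u n) < e / 2 /\ nc (l' - u n) < e / 2.
  have [N1 _ H1] := h _ e2; have [N2 _ H2] := h' _ e2; exists (maxn N1 N2).
  by split; [apply: H1; rewrite /= leq_maxl|apply: H2; rewrite /= leq_maxr].
rewrite (_ : l - l' = (l - u n) - (l' - u n)); last by ring.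
by apply: le_trans (ncB _ _) _; rewrite (splitr e) lerD // ltW.
Qed.

Lemma real_geom_cvg (u : nat -> R) B (q : R) : 0 <= q < 1 -> (forall k, `|u k| <= B * q ^+ k) ->
  exists l : R, (fun n => \sum_(k < n) u k) @ \oo --> l.
Proof.
move=> /andP[q0 q1] hu.
have B0 : 0 <= B by have := hu 0%N; rewrite expr0 mulr1; exact: le_trans.
have hq : `|q| < 1 by rewrite ger0_norm.
have cg : cvgn (series (geometric B q)) by apply/cvg_ex; eexists; exact: cvg_geometric_series hq.
have c1 : cvgn [normed series u].
  apply: series_le_cvg cg => n //=; by rewrite ?mulr_ge0 ?exprn_ge0 //; exact: hu.
have /cvg_ex [l hl] := normed_cvg c1; exists l.
rewrite (_ : (fun _ => _) = series u) //.
by apply/funext => n; rewrite /series /= big_mkord.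
Qed.

Lemma geom_sum_le (q : R) n : 0 <= q < 1 -> \sum_(k < n) q ^+ k <= (1 - q)^-1.
Proof.
move=> /andP[q0 q1]; have p : 0 < 1 - q by rewrite subr_gt0.
rewrite -[leRHS]mul1r ler_pdivlMr // mulrC.
have -> : (1 - q) * \sum_(k < n) q ^+ k = 1 - q ^+ n.
  by rewrite -[1 - q ^+ n]opprB subrX1 -mulNr opprB.
by rewrite gerBl exprn_ge0.
Qed.

Lemma cvg_series_C (u : nat -> C) B (q : R) : 0 <= q < 1 -> (forall k, nc (u k) <= B * q ^+ k) ->
  exists2 l : C, (fun n => \sum_(k < n) u k) @ \oo --> l & nc l <= B / (1 - q).
Proof.
move=> hq hu.
have [a ha] : exists l : R, (fun n => \sum_(k < n) re (u k)) @ \oo --> l.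
  by apply: (@real_geom_cvg (fun k => re (u k)) B q hq) => k; exact: le_trans (Re_le_nc _) (hu k).
have [b hb] : exists l : R, (fun n => \sum_(k < n) im (u k)) @ \oo --> l.
  by apply: (@real_geom_cvg (fun k => im (u k)) B q hq) => k; exact: le_trans (Im_le_nc _) (hu k).
have hl : (fun n => \sum_(k < n) u k) @ \oo --> (Complex a b : C).
  apply: cvgC_ReIm.
    by rewrite (_ : (fun _ => _) = (fun n => \sum_(k < n) re (u k))) //; apply/funext => n; exact: re_sum.
  by rewrite (_ : (fun _ => _) = (fun n => \sum_(k < n) im (u k))) //; apply/funext => n; exact: im_sum.
exists (Complex a b : C) => //.
apply: cvg_nc_le hl _ => n; apply: le_trans (nc_sum _ _ _) _.
have B0 : 0 <= B by have := hu 0%N; rewrite expr0 mulr1; exact: le_trans (nc_ge0 _).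
apply: le_trans (_ : \sum_(k < n) B * q ^+ k <= _); first by apply: ler_sum.
by rewrite -mulr_sumr ler_wpM2l // geom_sum_le.
Qed.

(** Cauchy estimates at radius [rho]. The constructor keeps the quantified inequality folded;
    [psboundE] reads it off. *)
Inductive psbound h rho B : Prop := Psbound of (forall k, nc (h k) <= B * rho ^- k).
(* Locked: unification would otherwise try to unfold the limit. *)
Fact psf_key : unit. Proof. exact: tt. Qed.
Definition psf h z : C := locked_with psf_key (lim (psum h z @ \oo)).

Lemma psboundE h rho B k : psbound h rho B -> nc (h k) <= B * rho ^- k.
Proof. by case. Qed.

Lemma psbound_ge0 h rho B : psbound h rho B -> 0 <= B.
Proof. by case=> /(_ 0%N); rewrite expr0 invr1 mulr1; exact: le_trans (nc_ge0 _). Qed.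

Lemma ps_term h rho B z k : 0 < rho -> psbound h rho B -> nc (h k * z ^+ k) <= B * (nc z / rho) ^+ k.
Proof.
move=> r0 hb; rewrite ncM ncX exprMn exprVn [nc z ^+ k * _]mulrC mulrA.
by rewrite ler_wpM2r ?exprn_ge0 ?nc_ge0 // psboundE.
Qed.

Lemma ratio01 rho z : 0 < rho -> nc z < rho -> 0 <= nc z / rho < 1.
Proof. by move=> r0 zr; rewrite divr_ge0 ?nc_ge0 ?(ltW r0) //= ltr_pdivrMr // mul1r. Qed.

Lemma ps_cvg_ex h rho B z : 0 < rho -> psbound h rho B -> nc z < rho ->
  psum h z @ \oo --> psf h z /\ nc (psf h z) <= B / (1 - nc z / rho).
Proof.
move=> r0 hb zr; have [l hl1 hl2] := cvg_series_C (ratio01 r0 zr) (fun k => ps_term z k r0 hb).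
by rewrite /psf unlock (cvg_lim _ hl1).
Qed.

Lemma ps_cvg h rho B z : 0 < rho -> psbound h rho B -> nc z < rho -> psum h z @ \oo --> psf h z.
Proof. by move=> r0 hb zr; case: (ps_cvg_ex r0 hb zr). Qed.

Lemma psf_eq h z l : psum h z @ \oo --> l -> psf h z = l.
Proof. by move=> hl; rewrite /psf unlock; exact: cvg_lim. Qed.

Lemma ps_tail0 h rho B z : 0 < rho -> psbound h rho B -> nc z < rho ->
  (fun n => h n * z ^+ n) @ \oo --> (0 : C).
Proof.
move=> r0 hb zr; apply/cvgCP => e e0; have /andP[q0 q1] := ratio01 r0 zr.
have q1' : `|nc z / rho| < 1 by rewrite ger0_norm.
have := cvg_geometric B q1' => /cvgrPdist_lt /(_ e e0) [N _ hN].
exists N => // n /= hn; rewrite sub0r ncN; apply: le_lt_trans (ps_term z n r0 hb) _.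
by have := hN n hn; rewrite /= sub0r normrN; apply: le_lt_trans; exact: ler_norm.
Qed.

Lemma psum0 h z : psum h z 0 = 0. Proof. by rewrite /psum big_ord0. Qed.
Lemma psumS h z n : psum h z n.+1 = psum h z n + h n * z ^+ n.
Proof. by rewrite /psum big_ord_recr. Qed.
Lemma psumSl h z n : psum h z n.+1 = h 0%N + z * psum (h \o S) z n.
Proof.
rewrite /psum big_ord_recl expr0 mulr1; congr (_ + _); rewrite mulr_sumr.
by apply: eq_bigr => i _; rewrite exprS mulrCA.
Qed.

Lemma psbound_shift h rho B : 0 < rho -> psbound h rho B -> psbound (h \o S) rho (B / rho).
Proof.
move=> r0 hb; constructor => k; apply: le_trans (psboundE k.+1 hb) _.
by rewrite exprS invfM mulrA.
Qed.

Lemma psf_shift h rho B z : 0 < rho -> psbound h rho B -> nc z < rho ->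
  psf h z = h 0%N + z * psf (h \o S) z.
Proof.
move=> r0 hb zr; apply: psf_eq; rewrite -(cvg_shiftS (psum h z)).
rewrite (_ : (fun n => psum h z n.+1) = (fun n => h 0%N + z * psum (h \o S) z n)); last first.
  by apply/funext => n; rewrite psumSl.
apply: cvgD; first exact: cvg_cst.
by apply: cvgM; [exact: cvg_cst|exact: ps_cvg (psbound_shift r0 hb) zr].
Qed.

Lemma psf_at0 h : psf h 0 = h 0%N.
Proof.
apply: psf_eq; rewrite -(cvg_shiftS (psum h 0)) (_ : (fun n => _) = (fun n => h 0%N)); first exact: cvg_cst.
by apply/funext => n; rewrite psumSl mul0r addr0.
Qed.

Lemma psboundD h1 h2 rho B1 B2 : psbound h1 rho B1 -> psbound h2 rho B2 ->
  psbound (fun k => h1 k + h2 k) rho (B1 + B2).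
Proof.
by move=> b1 b2; constructor => k; rewrite mulrDl; apply: le_trans (ncD _ _) _; rewrite lerD // psboundE.
Qed.
Lemma psboundZ a h rho B : psbound h rho B -> psbound (fun k => a * h k) rho (nc a * B).
Proof. by move=> b; constructor => k; rewrite ncM -mulrA ler_wpM2l ?nc_ge0 // psboundE. Qed.
Lemma psfD h1 h2 rho B1 B2 z : 0 < rho -> psbound h1 rho B1 -> psbound h2 rho B2 -> nc z < rho ->
  psf (fun k => h1 k + h2 k) z = psf h1 z + psf h2 z.
Proof.
move=> r0 b1 b2 zr; apply: psf_eq; rewrite (_ : psum _ z = (fun n => psum h1 z n + psum h2 z n)).
  by apply: cvgD; [exact: ps_cvg b1 zr|exact: ps_cvg b2 zr].
by apply/funext => n; rewrite /psum -big_split; apply: eq_bigr => i _; rewrite mulrDl.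
Qed.
Lemma psfZ a h rho B z : 0 < rho -> psbound h rho B -> nc z < rho ->
  psf (fun k => a * h k) z = a * psf h z.
Proof.
move=> r0 b zr; apply: psf_eq; rewrite (_ : psum _ z = (fun n => a * psum h z n)).
  by apply: cvgM; [exact: cvg_cst|exact: ps_cvg b zr].
by apply/funext => n; rewrite /psum mulr_sumr; apply: eq_bigr => i _; rewrite mulrA.
Qed.

Lemma psbound_mono h rho rho' B : 0 < rho' -> rho' <= rho -> psbound h rho B -> psbound h rho' B.
Proof.
move=> r0 rr b; constructor => k; apply: le_trans (psboundE k b) _.
apply: ler_wpM2l; first exact: psbound_ge0 b.
by rewrite lef_pV2 ?posrE ?exprn_gt0 // ?(lt_le_trans r0) // lerXn2r // ?nnegrE ltW // (lt_le_trans r0).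
Qed.

(** Synthetic division by [z - a]: [g j] is the sum over [i] of [h (j.+1 + i) * a ^+ i], and the
    estimate at radius [rho] survives because [nc a < rho]. *)
Lemma ps_factor h rho B a : 0 < rho -> psbound h rho B -> nc a < rho ->
  exists g : nat -> C, exists B' : R, [/\ psbound g rho B', forall j, g j = h j.+1 + a * g j.+1 &
    forall z, nc z < rho -> psf h z - psf h a = (z - a) * psf g z].
Proof.
move=> r0 hb ar; have q01 := ratio01 r0 ar; have /andP[q0 q1] := q01.
have /choice [g hg] : forall j, exists l : C, (fun n => \sum_(i < n) h (j.+1 + i)%N * a ^+ i) @ \oo --> l /\
    nc l <= B / rho * rho ^- j / (1 - nc a / rho).
  move=> j; have [|l l1 l2] := @cvg_series_C (fun i => h (j.+1 + i)%N * a ^+ i) (B / rho * rho ^- j) _ q01; last by exists l.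
  move=> k; rewrite ncM ncX exprMn exprVn.
  have -> : B / rho * rho ^- j * (nc a ^+ k / rho ^+ k) = (B * rho ^- (j.+1 + k)%N) * nc a ^+ k.
    by rewrite exprD exprS !invfM; ring.
  by rewrite ler_wpM2r ?exprn_ge0 ?nc_ge0 // psboundE.
have gb : psbound g rho (B / rho / (1 - nc a / rho)).
  by constructor => k; have [_ /le_trans] := hg k; apply; rewrite mulrAC.
have rec j : g j = h j.+1 + a * g j.+1.
  apply: (cvgC_unique (u := fun n => \sum_(i < n.+1) h (j.+1 + i)%N * a ^+ i)).
    by have [l1 _] := hg j; rewrite (cvg_shiftS (fun n => \sum_(i < n) h (j.+1 + i)%N * a ^+ i)).
  rewrite (_ : (fun n => _) = (fun n => h j.+1 + a * \sum_(i < n) h (j.+2 + i)%N * a ^+ i)); last first.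
    apply/funext => n; rewrite big_ord_recl addn0 expr0 mulr1 mulr_sumr; congr (_ + _).
    by apply: eq_bigr => i _; rewrite exprS mulrCA /= /bump /= add1n addnS addSn.
  apply: cvgD; first exact: cvg_cst.
  by apply: cvgM; [exact: cvg_cst|have [] := hg j.+1].
have rec0 : psf h a = h 0%N + a * g 0%N.
  apply: psf_eq; rewrite -(cvg_shiftS (psum h a)).
  rewrite (_ : (fun n => _) = (fun n => h 0%N + a * \sum_(i < n) h (1 + i)%N * a ^+ i)); last first.
    by apply/funext => n; rewrite psumSl.
  apply: cvgD; first exact: cvg_cst.
  by apply: cvgM; [exact: cvg_cst|have [] := hg 0%N].
exists g, (B / rho / (1 - nc a / rho)); split => // z zr.
have part n : (z - a) * psum g z n.+1 = g n * z ^+ n.+1 + psum h z n.+1 - psf h a.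
  elim: n => [|n IH].
    by rewrite !psumS !psum0 rec0 !expr0 !mulr1 expr1 !add0r; ring.
  rewrite (psumS g) mulrDr IH (psumS h z n.+1) (rec n) !exprS; ring.
apply/esym/(cvgC_unique (u := fun n => (z - a) * psum g z n.+1)).
  apply: cvgM; first exact: cvg_cst.
  by rewrite (cvg_shiftS (psum g z)); exact: ps_cvg gb zr.
rewrite (_ : (fun n => _) = (fun n => z * (g n * z ^+ n) + psum h z n.+1 - psf h a)); last first.
  by apply/funext => n; rewrite part exprS; ring.
rewrite -[X in _ --> X - _]add0r -(mulr0 z); apply: cvgB; last exact: cvg_cst.
apply: cvgD; last by rewrite (cvg_shiftS (psum h z)); exact: ps_cvg hb zr.
by apply: cvgM; [exact: cvg_cst|exact: ps_tail0 gb zr].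
Qed.

(** Dividing twice writes the error of the linear approximation as [(x - a) ^+ 2] times a power
    series bounded near [a]. *)
Lemma ps_deriv_factor h rho B a : 0 < rho -> psbound h rho B -> nc a < rho ->
  exists g : nat -> C, exists B' : R, [/\ psbound g rho B', forall j, g j = h j.+1 + a * g j.+1 &
    has_cderiv (psf h) a (psf g a)].
Proof.
move=> r0 hb ar; have [g [B1 [gb grec hg]]] := ps_factor r0 hb ar.
have [g2 [B2 [gb2 _ hg2]]] := ps_factor r0 gb ar.
exists g, B1; split => //; apply/has_cderivP => e e0.
pose s := (nc a + rho) / 2.
have as_ : nc a < s by rewrite /s ltr_pdivlMr // mulr_natr mulr2n ltrD2l.
have sr : s < rho by rewrite /s ltr_pdivrMr // mulr_natr mulr2n ltrD2r.
have s0 : 0 <= s by rewrite ltW // (le_lt_trans (nc_ge0 a)).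
have B20 := psbound_ge0 gb2.
have p1 : 0 < 1 - s / rho by rewrite subr_gt0 ltr_pdivrMr // mul1r.
pose M := B2 / (1 - s / rho).
have M0 : 0 <= M by rewrite divr_ge0 // ltW.
have M1 : 0 < M + 1 by rewrite ltr_wpDl.
exists (Num.min (s - nc a) (e / (M + 1))); first by rewrite lt_min subr_gt0 as_ divr_gt0.
move=> x; rewrite lt_min => /andP[x1 x2].
have xs : nc x < s.
  rewrite -(subrK a x); apply: le_lt_trans (ncD _ _) _; move: x1; rewrite ltrBrDr //.
have xr : nc x < rho by exact: lt_trans sr.
rewrite (hg x xr) [psf g a * _]mulrC -mulrBr (hg2 x xr) ncM mulrC ler_wpM2r ?nc_ge0 // ncM.
have [_ hb2] := ps_cvg_ex r0 gb2 xr.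
have hM : nc (psf g2 x) <= M.
  apply: le_trans hb2 _; rewrite ler_wpM2l // lef_pV2 ?posrE //; last first.
    by rewrite subr_gt0 ltr_pdivrMr // mul1r.
  by apply: lerB => //; apply: ler_wpM2r; [rewrite invr_ge0 ltW|exact: ltW].
apply: le_trans (_ : e / (M + 1) * (M + 1) <= _); last by rewrite divfK // gt_eqF.
by apply: ler_pM; rewrite ?nc_ge0 ?(ltW x2) // (le_trans hM) // lerDl.
Qed.

Lemma ps_cdiff h rho B a : 0 < rho -> psbound h rho B -> nc a < rho -> cdifferentiable (psf h) a.
Proof. by move=> r0 hb ar; have [g [B1 [_ _ hg]]] := ps_deriv_factor r0 hb ar; exists (psf g a). Qed.

(** Identifies a constant coefficient from nonzero points close to 0, since the function being
    expanded may have an arbitrary value at 0 itself. *)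
Lemma ps_continuous0 h rho B (c : C) : 0 < rho -> psbound h rho B ->
  (forall e, 0 < e -> exists2 d : R, 0 < d & forall s, 0 < s -> s < d -> exists2 z, z != 0 /\ nc z < s & nc (psf h z - c) <= e) ->
  h 0%N = c.
Proof.
move=> r0 hb hc; apply/eqP; rewrite -subr_eq0 -nc_eq0 eq_le nc_ge0 andbT.
apply/ler_addgt0Pr => e e0; rewrite add0r; have e2 : 0 < e / 2 by rewrite divr_gt0.
have c0 : nc (0 : C) < rho by rewrite nc0.
have /cvgCP/(_ _ e2) /near_nbhsC [d d0 hd] := cdiff_continuous (ps_cdiff r0 hb c0).
have [d' d'0 hd'] := hc _ e2.
have m0 : 0 < Num.min d d' / 2 by rewrite divr_gt0 // lt_min d0.
have mm : Num.min d d' / 2 < Num.min d d' by rewrite ltr_pdivrMr // ltr_pMr ?lt_min ?d0 // ltr1n.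
move: mm; rewrite lt_min => /andP[md md'].
have [z [z0 zm] hz] := hd' _ m0 md'.
have := hd z; rewrite subr0 => /(_ (lt_trans zm md)) k; rewrite psf_at0 in k.
rewrite (_ : h 0%N - c = (h 0%N - psf h z) + (psf h z - c)); last by ring.
by apply: le_trans (ncD _ _) _; rewrite (splitr e) lerD // ltW.
Qed.

(** The constant coefficient vanishes by continuity at 0; dividing by [z] gives the shifted series,
    which again vanishes off 0. *)
Lemma ps_zero h rho B (d : R) : 0 < rho -> psbound h rho B -> 0 < d ->
  (forall z, z != 0 -> nc z < d -> psf h z = 0) -> forall k, h k = 0.
Proof.
move=> r0.
have base (g : nat -> C) B' d' : psbound g rho B' -> 0 < d' -> (forall z, z != 0 -> nc z < d' -> psf g z = 0) -> g 0%N = 0.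
  move=> hb d0 hz; apply: (ps_continuous0 r0 hb) => e e0; exists d' => // s s0 sd.
  exists (toC (s / 2)); last first.
    rewrite hz ?subrr ?nc0 ?ltW // -?nc_gt0 nc_real gtr0_norm ?divr_gt0 //.
    by apply: lt_trans sd; rewrite ltr_pdivrMr // ltr_pMr // ltr1n.
  rewrite -nc_gt0 nc_real gtr0_norm ?divr_gt0 //; split => //.
  by rewrite ltr_pdivrMr // ltr_pMr // ltr1n.
move=> hb d0 hz k; elim: k h B hb d d0 hz => [|k IH] h B hb d d0 hz; first exact: base hb d0 hz.
have m0 : 0 < Num.min d rho by rewrite lt_min d0.
apply: (IH (h \o S) _ (psbound_shift r0 hb) _ m0) => z z0; rewrite lt_min => /andP[zd zr].
have := psf_shift r0 hb zr; rewrite hz // (base _ _ _ hb d0 hz) add0r => /esym/eqP.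
by rewrite mulf_eq0 (negbTE z0) => /eqP.
Qed.

Lemma ps_uniq h h' rho rho' B B' (d : R) : 0 < rho -> psbound h rho B -> 0 < rho' -> psbound h' rho' B' ->
  0 < d -> (forall z, z != 0 -> nc z < d -> psf h z = psf h' z) -> forall k, h k = h' k.
Proof.
move=> r0 hb r0' hb' d0 hz k; pose s := Num.min rho rho'.
have s0 : 0 < s by rewrite lt_min r0.
have b1 : psbound h s B by apply: psbound_mono hb; rewrite // ge_min lexx.
have b2 : psbound (fun k => -1 * h' k) s (nc (-1) * B').
  by apply: psboundZ; apply: psbound_mono hb'; rewrite // ge_min lexx orbT.
have b2' : psbound h' s B' by apply: psbound_mono hb'; rewrite // ge_min lexx orbT.
have m0 : 0 < Num.min d s by rewrite lt_min d0.
have := ps_zero s0 (psboundD b1 b2) m0 _ k; rewrite mulN1r => e; apply/eqP; rewrite -subr_eq0.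
apply/eqP/e => z z0; rewrite lt_min => /andP[zd zs].
by rewrite (psfD s0 b1 b2 zs) (psfZ _ s0 b2' zs) hz // mulN1r subrr.
Qed.

Lemma cdiff_shift f (w u : C) : cdifferentiable f (w + u) -> cdifferentiable (fun u => f (w + u)) u.
Proof.
move=> [l /has_cderivP h]; exists l; apply/(has_cderivP (fun u => f (w + u)) u l) => e e0; have [d d0 hd] := h e e0.
exists d => // x xd; rewrite (_ : x - u = (w + x) - (w + u)); last by ring.
apply: hd; rewrite (_ : (w + x) - (w + u) = x - u) //; ring.
Qed.

(** Riemann's removable singularity argument: two spare powers make [u ^+ m.+2 * G (w + u)]
    differentiable at 0 with derivative 0, so its Taylor series has no terms of order 0 and 1 and
    can be shifted twice. *)
Lemma laurent G w m (eps K0 : R) : 0 < eps ->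
  (forall z, z != w -> nc (z - w) < eps -> cdifferentiable G z /\ nc (z - w) ^+ m * nc (G z) <= K0) ->
  exists kap : nat -> C, exists rho, exists B, [/\ 0 < rho, rho <= eps, psbound kap rho B &
    forall z, z != w -> nc (z - w) < rho -> (z - w) ^+ m * G z = psf kap (z - w)].
Proof.
move=> e0 hG.
pose K u := if u == 0 then 0 else u ^+ m.+2 * G (w + u).
have K00 : 0 <= K0.
  have z0 : w + toC (eps / 2) != w.
    by rewrite -subr_eq0 addrAC subrr add0r -nc_gt0 nc_real gtr0_norm divr_gt0.
  have zn : nc (w + toC (eps / 2) - w) < eps.
    by rewrite addrAC subrr add0r nc_real gtr0_norm ?divr_gt0 // ltr_pdivrMr // ltr_pMr // ltr1n.
  by have [_] := hG _ z0 zn; apply: le_trans; rewrite mulr_ge0 ?exprn_ge0 ?nc_ge0.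
have wu u : (w + u == w) = (u == 0) by rewrite -subr_eq0 addrAC subrr add0r.
have hu u : u != 0 -> nc u < eps -> cdifferentiable G (w + u) /\ nc u ^+ m * nc (G (w + u)) <= K0.
  by move=> u0 ue; have := hG (w + u); rewrite wu addrAC subrr add0r; apply.
have Kb u : nc u < eps -> nc (K u) <= K0 * nc u ^+ 2.
  move=> ue; rewrite /K; have [->|u0] := eqVneq u 0; first by rewrite nc0 expr0n mulr0.
  have [_ k] := hu u u0 ue; rewrite ncM ncX -addn2 exprD mulrAC; apply: ler_wpM2r k.
  by rewrite exprn_ge0 ?nc_ge0.
have Kd u : nc u < eps -> cdifferentiable K u.
  move=> ue; have [->|u0] := eqVneq u 0.
    exists 0; apply/has_cderivP => e ee; exists (Num.min eps (e / (K0 + 1))).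
      by rewrite lt_min e0 divr_gt0 // ltr_wpDl.
    move=> x; rewrite subr0 lt_min => /andP[xe]; rewrite ltr_pdivlMr ?ltr_wpDl // => x2.
    rewrite mul0r subr0 {2}/K eqxx subr0; apply: le_trans (Kb x xe) _.
    rewrite expr2 mulrA ler_wpM2r ?nc_ge0 //; apply: le_trans (ltW x2).
    by rewrite mulrC ler_wpM2l ?nc_ge0 // lerDl.
  have d0 : 0 < nc u by rewrite nc_gt0.
  apply: (@cdiff_near _ (fun u => u ^+ m.+2 * G (w + u)) K u (nc u) d0).
    move=> x xu; rewrite /K ifN //; apply/eqP => x0; move: xu; by rewrite x0 sub0r ncN ltxx.
  apply: cdiffM; first by apply: cdiffX; exact: cdiff_id.
  by apply: cdiff_shift; have [] := hu u u0 ue.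
have r0 : 0 < eps / 2 by rewrite divr_gt0.
have re : eps / 2 < eps by rewrite ltr_pdivrMr // ltr_pMr // ltr1n.
have [h [B B0 [hb hs]]] := taylor r0 re Kd.
have {}hb : psbound h (eps / 2) B by constructor.
have {}hs z : nc z < eps / 2 -> psf h z = K z by move=> zr; apply: psf_eq; exact: hs.
have h00 : h 0%N = 0 by rewrite -psf_at0 hs ?nc0 // /K eqxx.
have hb1 := psbound_shift r0 hb; have hb2 := psbound_shift r0 hb1.
have s1 z : z != 0 -> nc z < eps / 2 -> psf (h \o S) z = z ^+ m.+1 * G (w + z).
  move=> z0 zr; apply: (mulfI z0); have := psf_shift r0 hb zr; rewrite h00 add0r hs // => <-.
  by rewrite /K ifN // exprS mulrA.
have h10 : h 1%N = 0.
  apply: (ps_continuous0 (h := h \o S) r0 hb1) => e ee.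
  exists (Num.min (eps / 2) (e / (K0 + 1))); first by rewrite lt_min r0 divr_gt0 // ltr_wpDl.
  move=> s s0; rewrite lt_min => /andP[se1 se2].
  have sh : s / 2 < s by rewrite ltr_pdivrMr // ltr_pMr // ltr1n.
  have sh0 : 0 < s / 2 by rewrite divr_gt0.
  have ns : nc (toC (s / 2)) = s / 2 by rewrite nc_real gtr0_norm.
  have z0 : toC (s / 2) != 0 :> C by rewrite -nc_gt0 ns.
  exists (toC (s / 2)); first by rewrite ns.
  have zr : nc (toC (s / 2)) < eps / 2 by rewrite ns; exact: lt_trans se1.
  rewrite subr0 (s1 _ z0 zr) ncM ncX exprS -mulrA.
  have [_ k] := hu _ z0 (lt_trans zr re).
  apply: le_trans (ler_wpM2l (nc_ge0 _) k) _; rewrite ns.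
  move: se2; rewrite ltr_pdivlMr ?ltr_wpDl // => se2; apply: le_trans (ltW se2).
  by apply: ler_pM; rewrite ?(ltW sh0) ?(ltW sh) // lerDl.
exists (h \o S \o S), (eps / 2); eexists; split; [by []|exact: ltW|exact: hb2|].
move=> z zw zr; have u0 : z - w != 0 by rewrite subr_eq0.
apply: (mulfI u0); have := psf_shift r0 hb1 zr; rewrite /= h10 add0r => <-.
by rewrite s1 // exprS -mulrA (addrC w) subrK.
Qed.

(** The growth bound is needed only at points accumulating at [w]: that already forces the leading
    coefficient to vanish, and the order of the pole drops by one. *)
Lemma laurent_lower f w m kap rho B (K1 : R) : 0 < rho -> psbound kap rho B ->
  (forall z, z != w -> nc (z - w) < rho -> (z - w) ^+ m.+1 * f z = psf kap (z - w)) ->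
  (forall d : R, 0 < d -> exists2 z, z != w /\ nc (z - w) < d & nc (z - w) ^+ m * nc (f z) <= K1) ->
  psbound (kap \o S) rho (B / rho) /\
  forall z, z != w -> nc (z - w) < rho -> (z - w) ^+ m * f z = psf (kap \o S) (z - w).
Proof.
move=> r0 kb hf hr; split; first exact: psbound_shift.
have k0 : kap 0%N = 0.
  apply: (ps_continuous0 r0 kb) => e e0.
  have K10 : 0 <= K1.
    by have [z _] := hr _ r0; apply: le_trans; rewrite mulr_ge0 ?exprn_ge0 ?nc_ge0.
  exists (Num.min rho (e / (K1 + 1))); first by rewrite lt_min r0 divr_gt0 // ltr_wpDl.
  move=> s s0; rewrite lt_min => /andP[sr]; rewrite ltr_pdivlMr ?ltr_wpDl // => se.
  have [z [zw zs] hz] := hr s s0; exists (z - w); first by rewrite subr_eq0.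
  rewrite subr0 -hf //; last exact: lt_trans sr.
  rewrite ncM ncX exprS -mulrA; apply: le_trans (ler_wpM2l (nc_ge0 _) hz) _.
  apply: le_trans (ltW se); apply: ler_pM; rewrite ?nc_ge0 ?(ltW zs) // lerDl //.
move=> z zw zr; have u0 : z - w != 0 by rewrite subr_eq0.
apply: (mulfI u0); have := psf_shift r0 kb zr; rewrite k0 add0r => <-.
by rewrite -hf // exprS mulrA.
Qed.
End PowerSeries.

(** * Coefficient asymptotics from the poles on a circle *)

Section CoefficientAsymptotics.
Context {R : realType}.
Local Notation C := (Cplx R).
Implicit Types (f g K G : C -> C) (rho r e t B theta : R) (z w b : C) (h a : nat -> C).

Lemma psf_mullin a rho B b z : 0 < rho -> psbound a rho B -> nc z < rho ->
  (1 - b * z) * psf a z = psf (fun k => a k - b * (if k is k'.+1 then a k' else 0)) z.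
Proof.
move=> r0 ab zr; apply/esym/psf_eq; rewrite -(cvg_shiftS (psum _ z)).
have -> : (1 - b * z) * psf a z = (1 - b * z) * psf a z + b * z * 0 by rewrite mulr0 addr0.
rewrite (_ : (fun n => _) = (fun n => (1 - b * z) * psum a z n.+1 + b * z * (a n * z ^+ n))); last first.
  apply/funext; elim=> [|n IH].
    by rewrite !psumS !psum0 expr0 !mulr1 mulr0 subr0 !add0r; ring.
  by rewrite psumS IH (psumS a z n.+1) exprS; ring.
apply: cvgD.
  apply: cvgM; first exact: cvg_cst.
  by rewrite (cvg_shiftS (psum a z)); exact: ps_cvg ab zr.
by apply: cvgM; [exact: cvg_cst|exact: ps_tail0 ab zr].
Qed.

(** Taylor coefficients of [(1 - b * z) ^- i.+1]. *)
Definition negbin (i : nat) b (k : nat) : C := 'C(k + i, i)%:R * b ^+ k.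

(** The left side is one term of the binomial expansion of [(q + (1 - q)) ^+ (k + i)]. With [i = 1]
    it bounds [k.+1%:R * q ^+ k] by [(1 - q)^-1]. *)
Lemma bin_geom_le (q : R) k i : 0 <= q <= 1 -> 'C(k + i, i)%:R * q ^+ k * (1 - q) ^+ i <= 1.
Proof.
move=> /andP[q0 q1]; have p0 : 0 <= 1 - q by rewrite subr_ge0.
have := exprDn q (1 - q) (k + i); rewrite (_ : q + (1 - q) = 1); last by ring.
rewrite expr1n => e; rewrite [leRHS]e.
have hi : (i < (k + i).+1)%N by rewrite ltnS leq_addl.
rewrite (bigD1 (Ordinal hi)) //= addnK -mulrA mulr_natl lerDl.
by apply: sumr_ge0 => j _; rewrite mulrn_wge0 // mulr_ge0 // exprn_ge0.
Qed.

Lemma nc_nat n : nc (n%:R : C) = n%:R.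
Proof. by rewrite -toC_nat nc_real ger0_norm. Qed.

Lemma negbin_bound theta rho i b : 0 < rho -> rho < theta -> nc b = theta^-1 ->
  psbound (negbin i b) rho ((1 - rho / theta) ^- i).
Proof.
move=> r0 rt nb; have t0 : 0 < theta by exact: lt_trans rt.
constructor => k; rewrite ncM nc_nat ncX nb.
have p0 : 0 < 1 - rho / theta by rewrite subr_gt0 ltr_pdivrMr // mul1r.
have q01 : 0 <= rho / theta <= 1 by rewrite divr_ge0 ?(ltW r0) ?(ltW t0) //= ler_pdivrMr // mul1r ltW.
have := bin_geom_le k i q01; rewrite -ler_pdivlMr ?exprn_gt0 // mul1r => hk.
rewrite ler_pdivlMr ?exprn_gt0 //; apply: le_trans hk.
by rewrite -mulrA exprMn [rho ^+ k * _]mulrC.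
Qed.

Lemma negbin_psf theta i b z : 0 < theta -> nc b = theta^-1 -> nc z < theta ->
  psf (negbin i b) z * (1 - b * z) ^+ i.+1 = 1.
Proof.
move=> t0 nb zt; pose rho := (nc z + theta) / 2.
have zr : nc z < rho by rewrite /rho ltr_pdivlMr // mulr_natr mulr2n ltrD2l.
have rt : rho < theta by rewrite /rho ltr_pdivrMr // mulr_natr mulr2n ltrD2r.
have r0 : 0 < rho by exact: le_lt_trans (nc_ge0 _) zr.
elim: i => [|i IH].
  rewrite expr1 mulrC (psf_mullin b r0 (negbin_bound 0 r0 rt nb) zr).
  apply: psf_eq; rewrite -(cvg_shiftS (psum _ z)) (_ : (fun n => _) = fun=> (1 : C)); first exact: cvg_cst.
  apply/funext; elim=> [|n IHn]; first by rewrite psumS psum0 /negbin bin0 !expr0; ring.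
  by rewrite psumS IHn /negbin !bin0 exprS; ring.
rewrite exprS mulrA -[RHS]IH; congr (_ * _).
rewrite mulrC (psf_mullin b r0 (negbin_bound i.+1 r0 rt nb) zr); congr (psf _ _).
apply/funext => -[|k]; first by rewrite /negbin !add0n !binn mulr0 subr0.
rewrite /negbin addnS binS natrD !addSnnS exprS; ring.
Qed.

Lemma psf_split h rho B z n : 0 < rho -> psbound h rho B -> nc z < rho ->
  (exists B', psbound (fun k => h (k + n)%N) rho B') /\
  psf h z = \sum_(j < n) h j * z ^+ j + z ^+ n * psf (fun k => h (k + n)%N) z.
Proof.
move=> r0 hb zr; elim: n => [|n [[B' hb'] IH]].
  rewrite big_ord0 add0r expr0 mul1r (_ : (fun k => _) = h); last by apply/funext => k; rewrite addn0.
  by split => //; exists B.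
have e : (fun k => h (k + n.+1)%N) = (fun k => h (k + n)%N) \o S by apply/funext => k; rewrite /= addnS addSn.
split; first by exists (B' / rho); rewrite e; exact: psbound_shift.
by rewrite IH (psf_shift r0 hb' zr) add0n big_ord_recr /= e exprSr; ring.
Qed.

Lemma psf_sum (I : eqType) (s : seq I) (H : I -> nat -> C) (Bs : I -> R) rho z : 0 < rho ->
  (forall i, i \in s -> psbound (H i) rho (Bs i)) -> nc z < rho ->
  psbound (fun k => \sum_(i <- s) H i k) rho (\sum_(i <- s) Bs i) /\
  psf (fun k => \sum_(i <- s) H i k) z = \sum_(i <- s) psf (H i) z.
Proof.
move=> r0; elim: s => [|i s IH] hb zr.
  split; first by constructor => k; rewrite !big_nil nc0 mul0r.
  rewrite big_nil; apply: psf_eq; rewrite (_ : psum _ z = fun=> 0); first exact: cvg_cst.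
  by apply/funext => n; rewrite /psum big1 // => j _; rewrite big_nil mul0r.
have [b1 e1] := IH (fun j hj => hb j (@mem_behead _ (i :: s) j hj)) zr.
have bi := hb i (mem_head i s).
rewrite (_ : (fun k => _) = (fun k => H i k + \sum_(i <- s) H i k)); last by apply/funext => k; rewrite big_cons.
by rewrite !big_cons -e1; split; [exact: psboundD|exact: psfD bi b1 zr].
Qed.

Lemma psbound_mulk h rho rho' B : 0 < rho' -> rho' < rho -> psbound h rho B ->
  exists B', psbound (fun k => k.+1%:R * h k) rho' B'.
Proof.
move=> r0 rr hb; have r1 : 0 < rho by exact: lt_trans rr.
pose q := rho' / rho; have q0 : 0 <= q by rewrite divr_ge0 // ltW.
have q1 : q < 1 by rewrite ltr_pdivrMr // mul1r.
have p0 : 0 < 1 - q by rewrite subr_gt0.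
exists (B / (1 - q)); constructor => k; rewrite ncM nc_nat.
apply: le_trans (ler_wpM2l (ler0n _ _) (psboundE k hb)) _.
have q01 : 0 <= q <= 1 by rewrite q0 ltW.
have := bin_geom_le k 1 q01; rewrite addn1 bin1 expr1 -ler_pdivlMr // mul1r => hk.
have := ler_wpM2l (psbound_ge0 hb) hk; rewrite exprMn exprVn => {}hk.
rewrite ler_pdivlMr ?exprn_gt0 //; apply: le_trans hk.
by rewrite le_eqVlt; apply/orP; left; apply/eqP; ring.
Qed.

(** By the recursion for [g] the partial sums of the differentiated series differ from those of [g]
    by [n%:R * g n * a ^+ n], which tends to 0. *)
Lemma ps_deriv h rho B (a : C) : 0 < rho -> psbound h rho B -> nc a < rho ->
  has_cderiv (psf h) a (psf (fun k => k.+1%:R * h k.+1) a).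
Proof.
move=> r0 hb ar; have [g [B1 [gb grec hg]]] := ps_deriv_factor r0 hb ar.
rewrite (_ : psf (fun k => _) a = psf g a) //; apply: psf_eq.
have e n : psum (fun k => k.+1%:R * h k.+1) a n = psum g a n - (n.+1%:R * g n * a ^+ n - g n * a ^+ n).
  elim: n => [|n IH]; first by rewrite !psum0 !expr0; ring.
  by rewrite !psumS IH (grec n) -!natr1 exprS; ring.
rewrite (_ : psum _ a = (fun n => psum g a n - (n.+1%:R * g n * a ^+ n - g n * a ^+ n))); last by apply/funext.
pose r' := (nc a + rho) / 2.
have ar' : nc a < r' by rewrite /r' ltr_pdivlMr // mulr_natr mulr2n ltrD2l.
have rr : r' < rho by rewrite /r' ltr_pdivrMr // mulr_natr mulr2n ltrD2r.
have r'0 : 0 < r' by exact: le_lt_trans (nc_ge0 _) ar'.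
have [B2 hb2] := psbound_mulk r'0 rr gb.
have -> : psf g a = psf g a - (0 - 0) by rewrite !subr0.
apply: cvgB; first exact: ps_cvg gb ar.
apply: cvgB; [exact: ps_tail0 hb2 ar'|exact: ps_tail0 gb ar].
Qed.

Definition conv (a b : nat -> C) k : C := \sum_(i < k.+1) a i * b (k - i)%N.

(** The coefficients of [a] are peeled off one at a time; after [n] steps there remains [z ^+ n]
    times a convolution with the shifted sequence, which is geometrically small. The smaller radius
    [r'] absorbs the number [k + 1] of terms of a convolution. *)
Lemma psf_conv (a b : nat -> C) rho B1 B2 z : 0 < rho -> psbound a rho B1 -> psbound b rho B2 -> nc z < rho ->
  psf (conv a b) z = psf a z * psf b z.
Proof.
move=> r0 ab bb zr.
pose r' := (nc z + rho) / 2.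
have zr' : nc z < r' by rewrite /r' ltr_pdivlMr // mulr_natr mulr2n ltrD2l.
have rr : r' < rho by rewrite /r' ltr_pdivrMr // mulr_natr mulr2n ltrD2r.
have r'0 : 0 < r' by exact: le_lt_trans (nc_ge0 _) zr'.
have q1 : 0 < 1 - r' / rho by rewrite subr_gt0 ltr_pdivrMr // mul1r.
have B10 := psbound_ge0 ab; have B20 := psbound_ge0 bb.
have cb c B : 0 <= B -> psbound c rho B -> psbound (conv c b) r' (B * B2 / (1 - r' / rho)).
  move=> B0 cb; constructor => k; apply: le_trans (nc_sum _ _ _) _.
  apply: le_trans (_ : \sum_(i < k.+1) B * B2 * rho ^- k <= _).
    apply: ler_sum => i _; rewrite ncM.
    have ik : (i <= k)%N by rewrite -ltnS.
    apply: le_trans (ler_pM (nc_ge0 _) (nc_ge0 _) (psboundE i cb) (psboundE (k - i) bb)) _.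
    by rewrite mulrACA -invfM -exprD subnKC.
  rewrite sumr_const card_ord -mulr_natl.
  have q01 : 0 <= r' / rho <= 1 by rewrite divr_ge0 ?(ltW r0) ?(ltW r'0) //= ler_pdivrMr // mul1r ltW.
  have := bin_geom_le k 1 q01; rewrite addn1 bin1 expr1 -ler_pdivlMr // mul1r => hk.
  have := ler_wpM2l (mulr_ge0 B0 B20) hk; rewrite exprMn exprVn => {}hk.
  rewrite ler_pdivlMr ?exprn_gt0 //; apply: le_trans hk.
  by rewrite le_eqVlt; apply/orP; left; apply/eqP; ring.
have step c B : 0 <= B -> psbound c rho B -> psf (conv c b) z = c 0%N * psf b z + z * psf (conv (c \o S) b) z.
  move=> B0 hc; rewrite (psf_shift r'0 (cb c B B0 hc) zr') {1}/conv big_ord1 subn0.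
  have sb := psbound_shift r0 hc; have sB : 0 <= B / rho by rewrite divr_ge0 // ltW.
  rewrite (_ : conv c b \o S = fun k => c 0%N * b k.+1 + conv (c \o S) b k); last first.
    by apply/funext => k; rewrite /= /conv big_ord_recl subn0; congr (_ + _).
  have b1 := psbound_shift r'0 (psbound_mono r'0 (ltW rr) bb).
  rewrite (psfD r'0 (psboundZ (c 0%N) b1) (cb _ _ sB sb) zr') (psfZ _ r'0 b1 zr').
  by rewrite (psf_shift r0 bb zr) /=; ring.
have rec n : psf (conv a b) z = psum a z n * psf b z + z ^+ n * psf (conv (fun k => a (k + n)%N) b) z /\
    psbound (fun k => a (k + n)%N) rho (B1 / rho ^+ n).
  elim: n => [|n [IH hb]].
    rewrite psum0 mul0r add0r expr0 mul1r invr1 mulr1 (_ : (fun k => _) = a) //.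
    by apply/funext => k; rewrite addn0.
  have e : (fun k => a (k + n.+1)%N) = (fun k => a (k + n)%N) \o S by apply/funext => k; rewrite /= addnS addSn.
  have Bn : 0 <= B1 / rho ^+ n by rewrite divr_ge0 // exprn_ge0 // ltW.
  split; last by rewrite e exprSr invfM mulrA; exact: psbound_shift.
  by rewrite IH (step _ _ Bn hb) psumS e add0n exprSr; ring.
pose K := B1 * B2 / (1 - r' / rho) / (1 - nc z / r').
have q2 : 0 < 1 - nc z / r' by rewrite subr_gt0 ltr_pdivrMr // mul1r.
apply/esym/(cvgC_unique (u := fun n => psum a z n * psf b z)).
  by apply: cvgM; [exact: ps_cvg ab zr|exact: cvg_cst].
apply/cvgCP => e e0; have /andP[z0 z1] := ratio01 r0 zr.
have q1' : `|nc z / rho| < 1 by rewrite ger0_norm.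
have := cvg_geometric K q1' => /cvgrPdist_lt /(_ e e0) [N _ hN]; exists N => // n /= hn.
have [-> hbn] := rec n; rewrite addrAC subrr add0r ncM ncX.
have Bn : 0 <= B1 / rho ^+ n by rewrite divr_ge0 // exprn_ge0 // ltW.
have [_ h] := ps_cvg_ex r'0 (cb _ _ Bn hbn) zr'.
apply: le_lt_trans (ler_wpM2l (exprn_ge0 n (nc_ge0 z)) h) _.
have := hN n hn; rewrite /= sub0r normrN; apply: le_lt_trans; apply: le_trans (ler_norm _).
by rewrite /K exprMn exprVn le_eqVlt; apply/orP; left; apply/eqP; ring.
Qed.

(** Compactness of the interval of angles: finitely many discs of half radius cover the circle, and
    the reserve of the smallest half radius extends the cover to an annulus outside it. *)
Lemma circle_cover theta (rho : C -> R) : 0 < theta -> (forall w, nc w = theta -> 0 < rho w) ->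
  exists D : seq C, exists r : R, [/\ theta < r, forall w, w \in D -> nc w = theta &
    forall z, theta <= nc z -> nc z < r -> exists2 w, w \in D & nc (z - w) < rho w].
Proof.
move=> t0 hr; pose pt t : C := toC theta * cis t.
have npt t : nc (pt t) = theta by rewrite ncM nc_real nc_cis mulr1 gtr0_norm.
have nc_pt s t : nc (pt s - pt t) = theta * nc (cis s - cis t).
  by rewrite -mulrBr ncM nc_real gtr0_norm.
pose f t := ([set s | nc (pt s - pt t) < rho (pt t) / 2])^°.
have fn t : nbhs t (f t).
  apply: nbhs_interior; have e0 : 0 < rho (pt t) / 2 / theta by rewrite !divr_gt0 // hr.
  apply: filterS (cis_near t e0) => s hs; change (nc (pt s - pt t) < rho (pt t) / 2).
  by rewrite nc_pt mulrC -ltr_pdivlMr.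
have := @segment_compact R 0 (2 * pi); rewrite compact_cover => /(_ R setT f).
case.
- by move=> t _; exact: open_interior.
- by move=> t _; exists t => //; exact: nbhs_singleton.
move=> D _ hD.
have [eta eta0 heta] : exists2 eta : R, 0 < eta & forall t, t \in (finmap.enum_fset D) -> eta <= rho (pt t) / 2.
  elim: (finmap.enum_fset D) => [|t s [eta e0 he]]; first by exists 1.
  exists (Num.min eta (rho (pt t) / 2)); first by rewrite lt_min e0 divr_gt0 // hr.
  move=> u; rewrite inE => /orP[/eqP ->|us]; first by rewrite ge_min lexx orbT.
  by rewrite ge_min he.
exists [seq pt t | t <- finmap.enum_fset D], (theta + eta); split.
- by rewrite ltrDl.
- by move=> w /mapP[t _ ->].
move=> z z1 z2; have [t ht zE] := polar z.
have [|u /= uD /interior_subset /= hu] := hD t; first by rewrite /= in_itv.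
exists (pt u); first by apply: map_f.
rewrite (_ : z - pt u = (z - pt t) + (pt t - pt u)); last by ring.
apply: le_lt_trans (ncD _ _) _.
have -> : nc (z - pt t) = nc z - theta.
  by rewrite {1}zE /pt -mulrBl ncM nc_cis mulr1 -toCB nc_real ger0_norm // subr_ge0.
rewrite (splitr (rho (pt u))) ltrD //.
by apply: lt_le_trans (heta u uD); rewrite ltrBlDl.
Qed.

(** Induction on [m] for the rising product [P m k], which dominates [k ^+ m]. Multiplying by [k]
    avoids the exponent [m - 1] when [m = 0]. *)
Lemma pow_near_bin m : exists2 K : R, 0 <= K & forall k, (0 < k)%N ->
  `|'C(k + m, m)%:R - k%:R ^+ m / m`!%:R| * k%:R <= K * k%:R ^+ m.
Proof.
pose P m k : R := \prod_(s < m) (k + s.+1)%:R.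
have PE k : P m k = 'C(k + m, m)%:R * m`!%:R.
  rewrite -natrM bin_ffact ffact_prod /P natr_prod.
  rewrite (reindex_inj rev_ord_inj) /=; apply: eq_bigr => i _; congr _%:R.
  by have := ltn_ord i; lia.
have [K K0 hK] : exists2 K : R, 0 <= K & forall k, (0 < k)%N -> 0 <= P m k - k%:R ^+ m /\ (P m k - k%:R ^+ m) * k%:R <= K * k%:R ^+ m.
  elim: m {PE} => [|m [K K0 IH]]; first by exists 0 => // k _; rewrite /P big_ord0 expr0 subrr !mul0r.
  exists (K * (m.+2)%:R + (m.+1)%:R); first by rewrite addr_ge0 // mulr_ge0.
  move=> k k0; have [h1 h2] := IH k k0.
  have e : P m.+1 k - k%:R ^+ m.+1 = (P m k - k%:R ^+ m) * (k + m.+1)%:R + k%:R ^+ m * m.+1%:R.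
    by rewrite /P big_ord_recr /= natrD exprSr; ring.
  have kk : 0 <= k%:R ^+ m :> R by rewrite exprn_ge0.
  split; first by rewrite e addr_ge0 // mulr_ge0.
  rewrite e exprSr; have h3 : (k + m.+1)%:R <= m.+2%:R * k%:R :> R by rewrite -natrM ler_nat; nia.
  have h4 : K * k%:R ^+ m * (k + m.+1)%:R <= K * k%:R ^+ m * (m.+2%:R * k%:R).
    by apply: ler_wpM2l h3; rewrite mulr_ge0.
  have h5 := ler_wpM2r (ler0n R (k + m.+1)) h2.
  rewrite (_ : (_ + _) * _ = (P m k - k%:R ^+ m) * k%:R * (k + m.+1)%:R + k%:R ^+ m * m.+1%:R * k%:R); last by ring.
  apply: le_trans (lerD (le_trans h5 h4) (lexx _)) _.
  by rewrite le_eqVlt; apply/orP; left; apply/eqP; ring.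
exists (K / m`!%:R); first by rewrite divr_ge0.
move=> k k0; have [h1 h2] := hK k k0.
have f0 : 0 < m`!%:R :> R by rewrite ltr0n fact_gt0.
have -> : 'C(k + m, m)%:R - k%:R ^+ m / m`!%:R = (P m k - k%:R ^+ m) / m`!%:R :> R.
  by rewrite PE mulrBl mulfK // gt_eqF.
rewrite ger0_norm; last by rewrite divr_ge0.
by rewrite mulrAC [leRHS]mulrAC ler_wpM2r // invr_ge0.
Qed.

Lemma bin_le_pow m k : (0 < k)%N -> 'C(k + m, m)%:R <= 2 ^+ m * k%:R ^+ m :> R.
Proof.
move=> k0; rewrite -exprMn; elim: m => [|m IH]; first by rewrite bin0 expr0.
have f0 : 0 < (m.+1)%:R :> R by [].
rewrite -(ler_pM2l f0) -natrM addnS -mul_bin_diag natrM /=.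
have h : (k + m).+1%:R <= m.+1%:R * (2 * k%:R) :> R.
  by rewrite -!natrM ler_nat; nia.
rewrite exprS mulrA; apply: ler_pM => //.
Qed.

(** With [kap] the Taylor coefficients at [w] of [(z - w) ^+ m.+1 * G z], this is the principal part
    of [G]; index [j] belongs to the pole term of order [m + 1 - j]. [ppc] lists the coefficients of
    the same rational function expanded at 0. *)
Definition pp (kap : nat -> C) m w z : C := \sum_(j < m.+1) kap j * (z - w) ^- (m - j).+1.
Definition ppc (kap : nat -> C) m w (k : nat) : C :=
  \sum_(j < m.+1) (kap j * (- w) ^- (m - j).+1) * negbin (m - j) w^-1 k.

Lemma pp_cdiff kap m w z : z != w -> cdifferentiable (pp kap m w) z.
Proof.
move=> zw; apply: (@cdiff_sum _ _ _ _ (fun (j : 'I_m.+1) z => kap j * (z - w) ^- (m - j).+1)) => j _.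
apply: cdiffM; first exact: cdiff_cst.
apply: (@cdiffV _ (fun z => (z - w) ^+ (m - j).+1)); first by rewrite expf_neq0 // subr_eq0.
by apply: cdiffX; apply: cdiffB; [exact: cdiff_id|exact: cdiff_cst].
Qed.

Lemma ppc_psf theta rho kap m w z : 0 < rho -> rho < theta -> nc w = theta -> nc z < rho ->
  (exists B, psbound (ppc kap m w) rho B) /\ psf (ppc kap m w) z = pp kap m w z.
Proof.
move=> r0 rt nw zr; have nb : nc w^-1 = theta^-1 by rewrite ncV nw.
have t0 : 0 < theta by exact: lt_trans rt.
have w0 : w != 0 by rewrite -nc_gt0 nw.
have zw : z - w != 0.
  by rewrite subr_eq0; apply/eqP => e; move: (lt_trans zr rt); rewrite e nw ltxx.
have hb (j : 'I_m.+1) := psboundZ (kap j * (- w) ^- (m - j).+1) (negbin_bound (m - j) r0 rt nb).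
have [b e] := psf_sum r0 (s := index_enum 'I_m.+1) (fun j _ => hb j) zr.
split; first by eexists; exact: b.
rewrite e; apply: eq_bigr => j _; rewrite (psfZ _ r0 (negbin_bound (m - j) r0 rt nb) zr) -mulrA; congr (_ * _).
have h1 := negbin_psf (m - j) t0 nb (lt_trans zr rt).
have e2 : z - w = - w * (1 - w^-1 * z) by field.
have u0 : 1 - w^-1 * z != 0 by apply: contraNneq zw => h; rewrite e2 h mulr0.
rewrite e2 exprMn invfM; congr (_ * _).
apply: (mulIf (expf_neq0 (m - j).+1 u0)); rewrite h1 mulVf // expf_neq0 //.
Qed.

(** The limit bounds [(z - w) ^+ m.+1 * G z] near [w], so [laurent] applies; the power of [- w]
    comes from [z - w = - w * (1 - z / w)]. *)
Lemma regular_part theta G m w (L : C) : 0 < theta -> nc w = theta ->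
  (exists2 eps : R, 0 < eps & forall z, z != w -> nc (z - w) < eps -> cdifferentiable G z) ->
  (fun z => (1 - z / w) ^+ m.+1 * G z) @ w^' --> L ->
  exists kap, exists rho, exists B, [/\ 0 < rho, psbound (fun k => kap (k + m.+1)%N) rho B,
    kap 0%N * (- w) ^- m.+1 = L & forall z, z != w -> nc (z - w) < rho ->
      cdifferentiable G z /\ G z = pp kap m w z + psf (fun k => kap (k + m.+1)%N) (z - w)].
Proof.
move=> t0 nw [eps e0 hG] /cvgCP hL.
have w0 : w != 0 by rewrite -nc_gt0 nw.
have [d d0 hd] : exists2 d : R, 0 < d & forall z, z != w -> nc (z - w) < d -> nc (L - (1 - z / w) ^+ m.+1 * G z) < 1.
  by apply/near_dnbhsC; exact: hL.
have e1 z : (z - w) ^+ m.+1 = (- w) ^+ m.+1 * (1 - z / w) ^+ m.+1 by rewrite -exprMn; congr (_ ^+ _); field.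
have m0 : 0 < Num.min eps d by rewrite lt_min e0.
have [|kap [rho [B [r0 rm kb hk]]]] := @laurent R G w m.+1 (Num.min eps d) (nc ((- w) ^+ m.+1) * (nc L + 1)) m0.
  move=> z zw; rewrite lt_min => /andP[z1 z2]; split; first exact: hG.
  rewrite -ncX -ncM e1 -mulrA ncM ler_wpM2l ?nc_ge0 //.
  rewrite (_ : _ * G z = L - (L - (1 - z / w) ^+ m.+1 * G z)); last by ring.
  by apply: le_trans (ncB _ _) _; rewrite lerD2l ltW // hd.
have c0 : nc (0 : C) < rho by rewrite nc0.
have [[B' kb'] _] := psf_split m.+1 r0 kb c0.
exists kap, rho, B'; split => //.
  have wn0 : (- w) ^+ m.+1 != 0 by rewrite expf_neq0 // oppr_eq0.
  suff -> : kap 0%N = L * (- w) ^+ m.+1 by rewrite mulfK.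
  apply: (ps_continuous0 r0 kb) => e ee.
  have B0 : 0 < nc ((- w) ^+ m.+1) by rewrite nc_gt0.
  have ee' : 0 < e / nc ((- w) ^+ m.+1) by rewrite divr_gt0.
  have [d1 d10 hd1] : exists2 d : R, 0 < d & forall z, z != w -> nc (z - w) < d ->
      nc (L - (1 - z / w) ^+ m.+1 * G z) < e / nc ((- w) ^+ m.+1).
    by apply/near_dnbhsC; exact: hL.
  exists (Num.min rho d1); first by rewrite lt_min r0.
  move=> s s0; rewrite lt_min => /andP[sr sd].
  have ns : nc (toC (s / 2)) = s / 2 by rewrite nc_real gtr0_norm ?divr_gt0.
  have sh : s / 2 < s by rewrite ltr_pdivrMr // ltr_pMr // ltr1n.
  have z0 : toC (s / 2) != 0 :> C by rewrite -nc_gt0 ns divr_gt0.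
  exists (toC (s / 2)); first by rewrite ns.
  pose z := w + toC (s / 2).
  have zw : z - w = toC (s / 2) by rewrite /z addrAC subrr add0r.
  have zneq : z != w by rewrite -subr_eq0 zw.
  rewrite -zw -(hk _ zneq); last by rewrite zw ns (lt_trans sh).
  rewrite e1 (_ : _ - _ = - ((- w) ^+ m.+1 * (L - (1 - z / w) ^+ m.+1 * G z))); last by ring.
  rewrite ncN ncM mulrC -ler_pdivlMr // ltW // hd1 // zw ns; exact: lt_trans sd.
move=> z zw zr; have zr' := lt_le_trans zr rm; move: zr'; rewrite lt_min => /andP[z1 z2].
split; first exact: hG.
have u0 : z - w != 0 by rewrite subr_eq0.
have un0 : (z - w) ^+ m.+1 != 0 by rewrite expf_neq0.
apply: (mulfI un0); rewrite hk // mulrDr; have [_ ->] := psf_split m.+1 r0 kb zr; congr (_ + _).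
rewrite /pp mulr_sumr; apply: eq_bigr => j _; rewrite mulrCA; congr (_ * _).
have jm : (j <= m)%N by rewrite -ltnS.
rewrite (_ : (z - w) ^+ m.+1 = (z - w) ^+ j * (z - w) ^+ (m - j).+1); last by rewrite -exprD addnS subnKC.
by rewrite mulfK // expf_neq0.
Qed.

Lemma ppc_asymp theta kap m w : 0 < theta -> nc w = theta -> (0 < m)%N ->
  exists2 K : R, 0 <= K & forall k, (0 < k)%N ->
    nc (ppc kap m w k - toC (k%:R ^+ m / m`!%:R) * (kap 0%N * (- w) ^- m.+1 * w ^- k)) <= K * k%:R ^+ m.-1 * theta ^- k.
Proof.
move=> t0 nw m0.
have w0 : w != 0 by rewrite -nc_gt0 nw.
have [K1 K10 hK1] := pow_near_bin m.
pose c j := nc (kap j * (- w) ^- (m - j).+1).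
have cn0 j : 0 <= c j by exact: nc_ge0.
exists (c 0%N * K1 + \sum_(j < m) c j.+1 * 2 ^+ (m - j.+1)).
  rewrite addr_ge0 //; first by rewrite mulr_ge0.
  by apply: sumr_ge0 => j _; rewrite mulr_ge0 // exprn_ge0.
move=> k k0; have kp : 0 < k%:R :> R by rewrite ltr0n.
have kp1 : 1 <= k%:R :> R by rewrite ler1n.
have nwk : nc (w^-1 ^+ k) = theta ^- k by rewrite ncX ncV nw exprVn.
have tk : 0 <= theta ^- k by rewrite invr_ge0 exprn_ge0 // ltW.
rewrite /ppc big_ord_recl subn0 /negbin.
have -> : kap 0%N * (- w) ^- m.+1 * ('C(k + m, m)%:R * w^-1 ^+ k) + \sum_(i < m) kap (lift ord0 i) * (- w) ^- (m - lift ord0 i).+1 *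
     ('C(k + (m - lift ord0 i), (m - lift ord0 i))%:R * w^-1 ^+ k) - toC (k%:R ^+ m / m`!%:R) * (kap 0%N * (- w) ^- m.+1 * w ^- k) =
   kap 0%N * (- w) ^- m.+1 * toC ('C(k + m, m)%:R - k%:R ^+ m / m`!%:R) * w^-1 ^+ k + 
    \sum_(i < m) kap (lift ord0 i) * (- w) ^- (m - lift ord0 i).+1 * ('C(k + (m - lift ord0 i), (m - lift ord0 i))%:R * w^-1 ^+ k).
  by rewrite toCB toC_nat -(exprVn w k); ring.
apply: le_trans (ncD _ _) _; rewrite !mulrDl; apply: lerD.
  rewrite ncM nwk ncM nc_real ler_wpM2r // -[X in X * `|_|]/(nc _) -mulrA.
  rewrite -[X in nc (_ * _ ^- X.+1)]subn0 -/(c 0%N) ler_wpM2l //.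
  by have := hK1 k k0; rewrite -ler_pdivlMr // -(prednK m0) /= exprSr mulrA mulfK ?gt_eqF.
apply: le_trans (nc_sum _ _ _) _; rewrite mulr_suml mulr_suml; apply: ler_sum => j _.
rewrite ncM [X in _ * X]ncM nwk nc_nat mulrA ler_wpM2r // -/(c (lift ord0 j)) lift0 -mulrA ler_wpM2l //.
apply: le_trans (bin_le_pow _ k0) _; rewrite ler_wpM2l ?exprn_ge0 //.
by apply: ler_weXn2l => //; have := ltn_ord j; lia.
Qed.

(** Subtracting the principal parts at finitely many points leaves a function differentiable on a
    disc of radius [r > theta], with coefficients O([theta ^- k]). By uniqueness of power series [a]
    is the sum of these and of the coefficients of the principal parts, in which only the poles of
    full order reach [k ^+ m]. *)
Theorem coef_asymp (a : nat -> C) G theta m (L : C -> C) (S : seq C) : 0 < theta -> (0 < m)%N ->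
  (forall rho : R, 0 < rho -> rho < theta -> exists B, psbound a rho B) ->
  (forall z, nc z < theta -> G z = psf a z) ->
  (forall w, nc w = theta -> exists2 eps : R, 0 < eps &
     forall z, z != w -> nc (z - w) < eps -> cdifferentiable G z) ->
  (forall w, nc w = theta -> (fun z => (1 - z / w) ^+ m.+1 * G z) @ w^' --> L w) ->
  uniq S -> (forall w, w \in S -> nc w = theta) ->
  (forall w, nc w = theta -> L w != 0 -> w \in S) ->
  exists K : R, forall k, (0 < k)%N ->
    nc (a k - toC (k%:R ^+ m / m`!%:R) * \sum_(w <- S) L w * w ^- k) <= K * k%:R ^+ m.-1 * theta ^- k.
Proof.
move=> t0 m0 ha hGa hGd hL uS hS hLS.
have /choice [kap] : forall w, exists kap, nc w = theta -> exists rho, exists B, [/\ 0 < rho, psbound (fun k => kap (k + m.+1)%N) rho B,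
    kap 0%N * (- w) ^- m.+1 = L w & forall z, z != w -> nc (z - w) < rho ->
      cdifferentiable G z /\ G z = pp kap m w z + psf (fun k => kap (k + m.+1)%N) (z - w)].
  move=> w; have [nw|nw] := eqVneq (nc w) theta; last by exists (fun=> 0) => e; rewrite e eqxx in nw.
  by have [kap h] := regular_part t0 nw (hGd w nw) (hL w nw); exists kap.
move=> hkap; have /choice [rho hk] : forall w, exists rho : R, nc w = theta -> exists B, [/\ 0 < rho, psbound (fun k => kap w (k + m.+1)%N) rho B,
    kap w 0%N * (- w) ^- m.+1 = L w & forall z, z != w -> nc (z - w) < rho ->
      cdifferentiable G z /\ G z = pp (kap w) m w z + psf (fun k => kap w (k + m.+1)%N) (z - w)].
  move=> w; have [nw|nw] := eqVneq (nc w) theta; last by exists 0 => e; rewrite e eqxx in nw.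
  by have [rho h] := hkap w nw; exists rho.
pose reg w u := psf (fun k => kap w (k + m.+1)%N) u.
have {hk} hk w : nc w = theta -> [/\ 0 < rho w, (forall u, nc u < rho w -> cdifferentiable (reg w) u),
    kap w 0%N * (- w) ^- m.+1 = L w & forall z, z != w -> nc (z - w) < rho w ->
      cdifferentiable G z /\ G z = pp (kap w) m w z + reg w (z - w)].
  move=> /hk [B [h1 h2 h3 h4]]; split => // u ur; exact: ps_cdiff h2 ur.
have [|D0 [r [tr hD0 hcov]]] := circle_cover t0 (rho := rho); first by move=> w /hk [].
(* The centres [D0] of the cover may include regular points and poles of lower order; their
   principal parts are subtracted as well. *)
pose D := undup (S ++ D0).
have uD : uniq D by exact: undup_uniq.
have hD w : w \in D -> nc w = theta.
  by rewrite mem_undup mem_cat => /orP[]; [exact: hS|exact: hD0].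
(* At a point of [D] the value is the one that removes the singularity: the regular part there minus
   the other principal parts. *)
pose K z := if z \in D then reg z 0 - \sum_(w <- D | w != z) pp (kap w) m w z
            else G z - \sum_(w <- D) pp (kap w) m w z.
have sep z : exists2 d : R, 0 < d & forall w, w \in D -> w != z -> d <= nc (w - z).
  elim: D {uD hD K} => [|w s [d d0 hd]]; first by exists 1.
  have [->|wz] := eqVneq w z.
    exists d => // u; rewrite inE => /orP[/eqP ->|]; [by rewrite eqxx|exact: hd].
  exists (Num.min d (nc (w - z))); first by rewrite lt_min d0 nc_gt0 subr_eq0.
  move=> u; rewrite inE => /orP[/eqP -> _|us uz]; first by rewrite ge_min lexx orbT.
  by rewrite ge_min hd.
have Kd z : nc z < r -> cdifferentiable K z.
  move=> zr; have [d d0 hd] := sep z.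
  have nD x : nc (x - z) < d -> x != z -> x \notin D.
    by move=> xd xz; apply/negP => xD; have := hd x xD xz; rewrite leNgt xd.
  have [zD|zD] := boolP (z \in D).
    have [rz hr _ hz] := hk z (hD z zD).
    have m1 : 0 < Num.min d (rho z) by rewrite lt_min d0.
    apply: (@cdiff_near _ (fun x => reg z (x - z) - \sum_(w <- D | w != z) pp (kap w) m w x) K z _ m1).
      move=> x; rewrite lt_min => /andP[x1 x2]; have [->|xz] := eqVneq x z; first by rewrite subrr /K zD.
      rewrite /K ifN ?nD // (hz x xz x2).2 [in RHS](bigD1_seq z) //=; ring.
    apply: cdiffB.
      rewrite (_ : (fun x => _) = (fun u => reg z (- z + u))); last by apply/funext => u; rewrite addrC.
      by apply: cdiff_shift; rewrite addrC subrr; apply: hr; rewrite nc0.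
    apply: (@cdiff_sum _ _ _ _ (fun w x => pp (kap w) m w x)) => w wz; apply: pp_cdiff.
    by rewrite eq_sym.
  apply: (@cdiff_near _ (fun x => G x - \sum_(w <- D) pp (kap w) m w x) K z _ d0).
    move=> x xd; have [->|xz] := eqVneq x z; first by rewrite /K ifN.
    by rewrite /K ifN // nD.
  apply: cdiffB.
    have [zt|zt] := ltP (nc z) theta.
      pose s := (nc z + theta) / 2.
      have zs : nc z < s by rewrite /s ltr_pdivlMr // mulr_natr mulr2n ltrD2l.
      have st : s < theta by rewrite /s ltr_pdivrMr // mulr_natr mulr2n ltrD2r.
      have s0 : 0 < s by exact: le_lt_trans (nc_ge0 _) zs.
      have [B hB] := ha s s0 st.
      have e0 : 0 < theta - nc z by rewrite subr_gt0.
      apply: (@cdiff_near _ (psf a) G z _ e0); last exact: ps_cdiff hB zs.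
      move=> x xz; rewrite hGa // -(subrK z x); apply: le_lt_trans (ncD _ _) _.
      by rewrite -ltrBrDr.
    have [w wD zw] := hcov z zt zr.
    have [_ _ _ hw] := hk w (hD0 w wD).
    have zneq : z != w by apply: contraNneq zD => ->; rewrite mem_undup mem_cat wD orbT.
    by have [] := hw z zneq zw.
  rewrite (_ : (fun x => _) = (fun x => \sum_(w <- D | w \in D) pp (kap w) m w x)); last first.
    by apply/funext => x; rewrite [LHS]big_seq.
  apply: (@cdiff_sum _ _ _ _ (fun w x => pp (kap w) m w x)) => w wD; apply: pp_cdiff.
  by apply: contraNneq zD => ->.
pose s := (theta + r) / 2.
have ts : theta < s by rewrite /s ltr_pdivlMr // mulr_natr mulr2n ltrD2l.
have sr : s < r by rewrite /s ltr_pdivrMr // mulr_natr mulr2n ltrD2r.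
have s0 : 0 < s by exact: lt_trans ts.
have [h [B B0 [hb0 hs0]]] := taylor s0 sr Kd.
have hb : psbound h s B by constructor.
have hs z : nc z < s -> psf h z = K z by move=> zr; apply: psf_eq; exact: hs0.
have aE k : a k = h k + \sum_(w <- D) ppc (kap w) m w k.
  pose q := theta / 2.
  have q0 : 0 < q by rewrite divr_gt0.
  have qt : q < theta by rewrite /q ltr_pdivrMr // ltr_pMr // ltr1n.
  have [Ba hBa] := ha q q0 qt.
  have c0 : nc (0 : C) < q by rewrite nc0.
  have /choice [Bs hBs] : forall w, exists Bw, w \in D -> psbound (ppc (kap w) m w) q Bw.
    move=> w; have [wD|_] := boolP (w \in D); last by exists 0.
    by have [[Bw hw] _] := ppc_psf (kap w) m q0 qt (hD w wD) c0; exists Bw.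
  have hbq : psbound h q B by apply: psbound_mono hb => //; apply: ltW; exact: lt_trans ts.
  have b2 := (psf_sum q0 hBs c0).1.
  apply: (ps_uniq q0 hBa q0 (psboundD hbq b2) q0) => z _ zq.
  have zt := lt_trans zq qt.
  rewrite (psfD q0 hbq b2 zq) (psf_sum q0 hBs zq).2 hs ?(lt_trans zt) // -hGa // /K ifN; last first.
    by apply/negP => /hD e; rewrite e ltxx in zt.
  have -> : \sum_(w <- D) psf (ppc (kap w) m w) z = \sum_(w <- D) pp (kap w) m w z.
    by apply: eq_big_seq => w wD; exact: (ppc_psf (kap w) m q0 qt (hD w wD) zq).2.
  by rewrite subrK.
have /choice [Ks hKs] : forall w, exists K : R, w \in D -> forall k, (0 < k)%N ->
    nc (ppc (kap w) m w k - toC (k%:R ^+ m / m`!%:R) * (L w * w ^- k)) <= K * k%:R ^+ m.-1 * theta ^- k.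
  move=> w; have [wD|_] := boolP (w \in D); last by exists 0.
  have [Kw _ hw] := ppc_asymp (kap w) t0 (hD w wD) m0; exists Kw => _.
  by have [_ _ e _] := hk w (hD w wD); rewrite -e.
(* A point of [D] outside [S] has [L w = 0], so it contributes only to the error term. *)
have sumS k : \sum_(w <- S) L w * w ^- k = \sum_(w <- D) L w * w ^- k.
  rewrite [RHS](bigID [pred w | w \in S]) /= [X in _ + X]big1_seq ?addr0; last first.
    move=> w /andP[wS wD]; have [->|nL] := eqVneq (L w) 0; first by rewrite mul0r.
    by rewrite (hLS w (hD w wD) nL) in wS.
  rewrite -[RHS]big_filter; apply: perm_big; apply: uniq_perm => //; first exact: filter_uniq.
  by move=> w; rewrite mem_filter mem_undup mem_cat /=; case: (w \in S).
exists (B + \sum_(w <- D) Ks w) => k k0.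
rewrite sumS aE -addrA mulr_sumr -sumrB.
apply: le_trans (ncD _ _) _; rewrite !mulrDl; apply: lerD.
  have kp1 : 1 <= k%:R ^+ m.-1 :> R by rewrite exprn_ege1 // ler1n.
  apply: le_trans (hb0 k) _; apply: ler_pM.
  - exact: ltW.
  - by rewrite invr_ge0 exprn_ge0 // ltW.
  - by rewrite ler_peMr // ltW.
  - by rewrite lef_pV2 ?posrE ?exprn_gt0 // lerXn2r ?nnegrE ?ltW.
apply: le_trans (nc_sum _ _ _) _; rewrite mulr_suml mulr_suml big_seq [leRHS]big_seq.
by apply: ler_sum => w wD; exact: hKs.
Qed.
End CoefficientAsymptotics.

(** * Matrices: resolvents and Perron-Frobenius theory *)

Lemma unitmx_ker (F : fieldType) n (X : 'M[F]_n) : (forall u : 'cV_n, X *m u = 0 -> u = 0) -> X \in unitmx.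
Proof.
move=> h; rewrite unitmxE unitfE -det_tr; apply/negP => /det0P [u u0 e].
have : u^T = 0 by apply: h; rewrite -[X]trmxK -trmx_mul e trmx0.
by move=> /(congr1 trmx); rewrite trmxK trmx0 => e2; rewrite e2 eqxx in u0.
Qed.

Lemma nonunit_ker (F : fieldType) n (X : 'M[F]_n) : X \notin unitmx -> exists2 u : 'cV_n, u != 0 & X *m u = 0.
Proof.
rewrite unitmxE unitfE negbK -det_tr => /det0P [u u0 e]; exists u^T.
  by apply: contraNneq u0 => e2; rewrite -[u]trmxK e2 trmx0.
by rewrite -[X]trmxK -trmx_mul e trmx0.
Qed.

Section Deflation.
Variables (K : fieldType) (n : nat) (X Y : 'M[K]_n) (v : 'cV[K]_n) (mu : 'rV[K]_n) (c : K).
Hypothesis muY : mu *m Y = 0.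
Local Notation H := (X + v *m (mu *m (c^-1 *: (X - Y)))).

Lemma deflation_inj (u : 'cV[K]_n) : H \in unitmx -> X *m u = 0 -> u = 0.
Proof.
move=> hH Xu; have h : H *m u = 0.
  rewrite mulmxDl Xu add0r -!mulmxA -scalemxAl mulmxBl Xu sub0r.
  by rewrite -scalemxAr mulmxN mulmxA muY mul0mx oppr0 scaler0 mulmx0.
by have := congr1 (mulmx (invmx H)) h; rewrite mulKmx // mulmx0.
Qed.

(** Multiplying [H] by [c *: invmx X] leaves [c%:M + v *m mu], since the part with [Y] dies under
    [mu]. The right side of the result is thus expressed through [invmx H], which stays finite where
    [X] degenerates. *)
Lemma deflation_invmx : c != 0 -> H \in unitmx -> X \in unitmx ->
  invmx H *m (c%:M + v *m mu) = c *: invmx X.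
Proof.
move=> c0 hH hX; have key : H *m (c *: invmx X) = c%:M + v *m mu.
  rewrite -scalemxAr mulmxDl mulmxV // scalerDr scale_scalar_mx mulr1; congr (_ + _).
  rewrite -!mulmxA -scalemxAl mulmxBl mulmxV // -!scalemxAr scalerA divff // scale1r.
  by rewrite mulmxBr mulmx1 (mulmxA mu) muY mul0mx subr0.
by rewrite -key mulKmx.
Qed.
End Deflation.

Section FunctionMatrices.
Context {R : realType}.
Local Notation C := (Cplx R).
Variable P : (C -> C) -> Prop.
Hypotheses (Pc : forall a, P (fun=> a)) (PD : forall f g, P f -> P g -> P (fun z => f z + g z))
  (PM : forall f g, P f -> P g -> P (fun z => f z * g z)).

(** [P] is instantiated with continuity and with differentiability at a point; determinants,
    adjugates and products stay in such a class because they are polynomial in the entries. *)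
Lemma closed_sum (I : Type) (r : seq I) (Q : pred I) (F : I -> C -> C) :
  (forall i, P (F i)) -> P (fun z => \sum_(i <- r | Q i) F i z).
Proof.
move=> h; elim: r => [|i r IH].
  by rewrite (_ : (fun _ => _) = fun=> 0) //; apply/funext => z; rewrite big_nil.
case Qi: (Q i).
  by rewrite (_ : (fun _ => _) = fun z => F i z + \sum_(i <- r | Q i) F i z); [exact: PD|apply/funext => z; rewrite big_cons Qi].
by rewrite (_ : (fun _ => _) = fun z => \sum_(i <- r | Q i) F i z) //; apply/funext => z; rewrite big_cons Qi.
Qed.

Lemma closed_prod (I : Type) (r : seq I) (Q : pred I) (F : I -> C -> C) :
  (forall i, P (F i)) -> P (fun z => \prod_(i <- r | Q i) F i z).
Proof.
move=> h; elim: r => [|i r IH].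
  by rewrite (_ : (fun _ => _) = fun=> 1) //; apply/funext => z; rewrite big_nil.
case Qi: (Q i).
  by rewrite (_ : (fun _ => _) = fun z => F i z * \prod_(i <- r | Q i) F i z); [exact: PM|apply/funext => z; rewrite big_cons Qi].
by rewrite (_ : (fun _ => _) = fun z => \prod_(i <- r | Q i) F i z) //; apply/funext => z; rewrite big_cons Qi.
Qed.

Lemma closed_det n (A : C -> 'M[C]_n) : (forall i j, P (fun z => A z i j)) -> P (fun z => \det (A z)).
Proof.
move=> h; apply: (@closed_sum _ _ _ (fun (s : 'S_n) z => (-1) ^+ s * \prod_i A z i (s i))) => s.
apply: PM => //; apply: (@closed_prod _ _ _ (fun i z => A z i (s i))) => i; exact: h.
Qed.

Lemma closed_adj n (A : C -> 'M[C]_n) i j : (forall i j, P (fun z => A z i j)) -> P (fun z => (\adj (A z)) i j).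
Proof.
move=> h; rewrite (_ : (fun _ => _) = fun z => (-1) ^+ (j + i) * \det (row' j (col' i (A z)))).
  apply: PM => //; apply: (@closed_det _ (fun z => row' j (col' i (A z)))) => i1 j1.
  by rewrite (_ : (fun _ => _) = fun z => A z (lift j i1) (lift i j1)) //; apply/funext => z; rewrite !mxE.
by apply/funext => z; rewrite mxE.
Qed.

Lemma closed_mulmx m n p (A : C -> 'M[C]_(m, n)) (B : C -> 'M[C]_(n, p)) i j :
  (forall i j, P (fun z => A z i j)) -> (forall i j, P (fun z => B z i j)) -> P (fun z => (A z *m B z) i j).
Proof.
move=> hA hB; rewrite (_ : (fun _ => _) = fun z => \sum_k A z i k * B z k j).
  by apply: (@closed_sum _ _ _ (fun k z => A z i k * B z k j)) => k; exact: PM.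
by apply/funext => z; rewrite mxE.
Qed.
End FunctionMatrices.

Section Resolvent.
Context {R : realType}.
Local Notation C := (Cplx R).
Implicit Types (z w : C).

Definition ccts (w : C) (f : C -> C) := f x @[x --> w] --> f w.
Lemma ccts_cdiff w f : cdifferentiable f w -> ccts w f.
Proof. exact: cdiff_continuous. Qed.
Lemma ccts_cst w a : ccts w (fun=> a). Proof. by apply: ccts_cdiff; exact: cdiff_cst. Qed.
Lemma cctsD w f g : ccts w f -> ccts w g -> ccts w (fun z => f z + g z).
Proof. by move=> hf hg; rewrite /ccts; exact (cvgD hf hg). Qed.
Lemma cctsM w f g : ccts w f -> ccts w g -> ccts w (fun z => f z * g z).
Proof. by move=> hf hg; rewrite /ccts; exact (cvgM hf hg). Qed.
Lemma cctsV w f : f w != 0 -> ccts w f -> ccts w (fun z => (f z)^-1).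
Proof. by move=> f0 hf; apply: (@continuousV _ C f w f0). Qed.
Lemma cctsP w f : ccts w f <-> forall e : R, 0 < e -> exists2 d : R, 0 < d & forall z, nc (z - w) < d -> nc (f w - f z) < e.
Proof.
split=> [h e e0|h]; last first.
  by apply/(@cvgCP R C (nbhs w) (nbhs_filter w) f (f w)) => e e0; apply/near_nbhsC; exact: h.
by apply/near_nbhsC; move/(@cvgCP R C (nbhs w) (nbhs_filter w) f (f w)) : h => /(_ e e0).
Qed.

Lemma ccts_near w f g (d : R) : 0 < d -> (forall z, nc (z - w) < d -> f z = g z) -> ccts w f -> ccts w g.
Proof.
move=> d0 fg /cctsP h; apply/cctsP => e e0; have [d1 d10 h1] := h e e0.
exists (Num.min d d1); first by rewrite lt_min d0.
by move=> z; rewrite lt_min => /andP[z1 z2]; rewrite -!fg ?subrr ?nc0 // h1.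
Qed.

Lemma ccts_neq0 w f : ccts w f -> f w != 0 -> exists2 d : R, 0 < d & forall z, nc (z - w) < d -> f z != 0.
Proof.
move=> /cctsP h f0; have [d d0 hd] := h _ (eq_ind_r (fun b => is_true b) f0 (nc_gt0 (f w))).
exists d => // z zd; apply/eqP => e; have := hd z zd; by rewrite e subr0 ltxx.
Qed.

Lemma ccts_dnbhs w f (l : C) : (fun z => if z == w then l else f z) @ nbhs w --> l <-> f @ w^' --> l.
Proof.
split=> /cvgCP h; apply/cvgCP => e e0.
  apply/near_dnbhsC; have /near_nbhsC [d d0 hd] := h e e0.
  by exists d => // z zw zd; have := hd z zd; rewrite (negbTE zw).
apply/(near_nbhsC w); have /near_dnbhsC [d d0 hd] := h e e0; exists d => // z zd.
by case: eqVneq => [_|zw]; [rewrite subrr nc0|exact: hd].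
Qed.

Lemma unitmx_near n (A : C -> 'M[C]_n) w : (forall i j, ccts w (fun z => A z i j)) -> A w \in unitmx ->
  exists2 d : R, 0 < d & forall z, nc (z - w) < d -> A z \in unitmx.
Proof.
move=> hA; rewrite unitmxE unitfE => u.
have cd := closed_det (@ccts_cst w) (@cctsD w) (@cctsM w) hA.
by have [d d0 hd] := ccts_neq0 cd u; exists d => // z /hd; rewrite unitmxE unitfE.
Qed.

Lemma invmx_cts n (A : C -> 'M[C]_n) w i j : (forall i j, ccts w (fun z => A z i j)) -> A w \in unitmx ->
  ccts w (fun z => (invmx (A z)) i j).
Proof.
move=> hA u; have [d d0 hd] := unitmx_near hA u.
have cd := closed_det (@ccts_cst w) (@cctsD w) (@cctsM w) hA.
have ca := closed_adj (@ccts_cst w) (@cctsD w) (@cctsM w) i j hA.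
apply: (ccts_near (f := fun z => (\det (A z))^-1 * (\adj (A z)) i j) d0).
  by move=> z zd; rewrite /invmx (hd z zd) [RHS]mxE.
by apply: cctsM ca; apply: cctsV cd; rewrite unitmxE unitfE in u.
Qed.

Lemma invmx_cdiff n (A : C -> 'M[C]_n) w i j : (forall i j, cdifferentiable (fun z => A z i j) w) -> A w \in unitmx ->
  cdifferentiable (fun z => (invmx (A z)) i j) w.
Proof.
move=> hA u; have [d d0 hd] := unitmx_near (fun i j => ccts_cdiff (hA i j)) u.
have Pc a : cdifferentiable (fun=> a) w by exact: cdiff_cst.
have PD f g : cdifferentiable f w -> cdifferentiable g w -> cdifferentiable (fun x => f x + g x) w by exact: cdiffD.
have PM f g : cdifferentiable f w -> cdifferentiable g w -> cdifferentiable (fun x => f x * g x) w by exact: cdiffM.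
have cd := closed_det Pc PD PM hA; have ca := closed_adj Pc PD PM i j hA.
apply: (cdiff_near (f := fun z => (\det (A z))^-1 * (\adj (A z)) i j) d0).
  by move=> z zd; rewrite /invmx (hd z zd) [RHS]mxE.
by apply: cdiffM ca; apply: cdiffV cd; rewrite unitmxE unitfE in u.
Qed.

(* With D z = (E z - E w) / (z - w), the matrix H z = E z + v mu D z is invertible at w and
   H z * (z - w) (E z)^-1 = (z - w) + v mu, so (z - w) (E z)^-1 extends continuously to w. *)
Lemma simple_pole n (E : C -> 'M[C]_n) w (E1 : 'M[C]_n) (v : 'cV[C]_n) (mu : 'rV[C]_n) :
  (forall i j, has_cderiv (fun z => E z i j) w (E1 i j)) ->
  E w *m v = 0 -> mu *m E w = 0 -> mu *m v = 1%:M ->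
  (forall u : 'cV_n, E w *m u = 0 -> exists c, u = c *: v) ->
  (mu *m E1 *m v) 0 0 != 0 ->
  (exists2 d : R, 0 < d & forall z, z != w -> nc (z - w) < d -> E z \in unitmx) /\
  forall i j, (fun z => (z - w) * (invmx (E z)) i j) @ w^' --> ((mu *m E1 *m v) 0 0)^-1 * (v i 0 * mu 0 j).
Proof.
move=> hE Ev muE muv ker; set dd := (_ *m v) 0 0 => dd0.
have muEv : mu *m E1 *m v = dd%:M by rewrite [LHS]mx11_scalar.
pose D z := if z == w then E1 else (z - w)^-1 *: (E z - E w).
pose H z := E z + v *m (mu *m D z).
have cE i j : ccts w (fun z => E z i j) by apply: ccts_cdiff; exists (E1 i j); exact: hE.
have cD i j : ccts w (fun z => D z i j).
  have /has_cderivP h := hE i j; apply/cctsP => e e0; have e2 : 0 < e / 2 by rewrite divr_gt0.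
  have [d d0 hd] := h _ e2; exists d => // z zd; rewrite /D eqxx.
  case: eqVneq => [_|zw]; first by rewrite subrr nc0.
  have zw0 : z - w != 0 by rewrite subr_eq0.
  rewrite !mxE (_ : _ - _ = - (E z i j - E w i j - E1 i j * (z - w)) / (z - w)); last by field.
  rewrite ncM ncN ncV ltr_pdivrMr ?nc_gt0 //; apply: le_lt_trans (hd z zd) _.
  by rewrite ltr_pM2r ?nc_gt0 // ltr_pdivrMr // ltr_pMr // ltr1n.
have cH i j : ccts w (fun z => H z i j).
  rewrite (_ : (fun z => _) = fun z => E z i j + (v *m (mu *m D z)) i j); last by apply/funext => z; rewrite mxE.
  apply: cctsD => //.
  apply: (closed_mulmx (@ccts_cst w) (@cctsD w) (@cctsM w) (A := fun=> v) (B := fun z => mu *m D z)) => i1 j1; first exact: ccts_cst.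
  apply: (closed_mulmx (@ccts_cst w) (@cctsD w) (@cctsM w) (A := fun=> mu) (B := D)) => i2 j2; first exact: ccts_cst.
  exact: cD.
have Hw : H w = E w + v *m (mu *m E1) by rewrite /H /D eqxx.
have Hwv : H w *m v = dd *: v by rewrite Hw mulmxDl Ev add0r -mulmxA muEv mul_mx_scalar.
(* For [u] in the kernel of [H w], applying [mu] gives [mu *m E1 *m u = 0], hence [E w *m u = 0] and
   [u] is a multiple of [v]; since [dd] is nonzero the multiple is 0. *)
have uH : H w \in unitmx.
  apply: unitmx_ker => u hu; have mu0 : mu *m E1 *m u = 0.
    move: (congr1 (mulmx mu) hu); rewrite Hw mulmxDl mulmxDr !mulmxA muE mul0mx add0r mulmx0 muv mul1mx; exact.
  move: hu; rewrite Hw mulmxDl -mulmxA mu0 mulmx0 addr0 => /ker [c uc].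
  move: mu0; rewrite uc -scalemxAr muEv => /matrixP/(_ 0 0); rewrite !mxE /= mulr1n => /eqP.
  by rewrite mulf_eq0 (negbTE dd0) orbF => /eqP ->; rewrite scale0r.
have [d d0 hd] := unitmx_near cH uH.
have uE z : z != w -> nc (z - w) < d -> E z \in unitmx.
  move=> zw zd; have hz := hd z zd; rewrite /H /D (negbTE zw) in hz.
  apply: unitmx_ker => u; exact (deflation_inj muE hz).
split; first by exists d.
move=> i j; apply/ccts_dnbhs.
pose T z := invmx (H z) *m ((z - w)%:M + v *m mu).
have Tw : T w i j = dd^-1 * (v i 0 * mu 0 j).
  rewrite /T subrr raddf0 add0r mulmxA.
  have -> : invmx (H w) *m v = dd^-1 *: v.
    by rewrite -[in LHS](scale1r v) -(mulVf dd0) -scalerA -Hwv -scalemxAr mulKmx.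
  by rewrite -scalemxAl mxE mxE big_ord1.
have cT : ccts w (fun z => T z i j).
  apply: (closed_mulmx (@ccts_cst w) (@cctsD w) (@cctsM w) (A := fun z => invmx (H z)) (B := fun z => (z - w)%:M + v *m mu)) => i1 j1.
    exact: invmx_cts.
  rewrite (_ : (fun z => _) = fun z => (z - w) *+ (i1 == j1) + (v *m mu) i1 j1); last by apply/funext => z; rewrite !mxE.
  apply: cctsD; last exact: ccts_cst.
  case: (i1 == j1); last exact: ccts_cst.
  by apply: ccts_cdiff; apply: cdiffB; [exact: cdiff_id|exact: cdiff_cst].
have hT : ccts w (fun z => if z == w then dd^-1 * (v i 0 * mu 0 j) else (z - w) * (invmx (E z)) i j).
  apply: (ccts_near d0 _ cT) => z zd; case: eqVneq => [->|zw]; first exact: Tw.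
  have u0 : z - w != 0 by rewrite subr_eq0.
  have hz := hd z zd; rewrite /T /H /D (negbTE zw) in hz *.
  by rewrite (deflation_invmx muE u0 hz (uE z zw zd)) mxE.
by move: hT; rewrite /ccts eqxx.
Qed.
End Resolvent.

(** * Perron-Frobenius theory for irreducible nonnegative matrices *)

Section PerronFrobenius.
Context {R : realType}.

Lemma fin_pos_lb (I : finType) (f : I -> R) : (forall i, 0 < f i) -> exists2 e, 0 < e & forall i, e <= f i.
Proof.
move=> hf; suff [e e0 he] : exists2 e, 0 < e & forall i, i \in enum I -> e <= f i.
  by exists e => // i; apply: he; rewrite mem_enum.
elim: (enum I) => [|a s [e e0 he]]; first by exists 1.
exists (Num.min e (f a)); first by rewrite lt_min e0 hf.
move=> i; rewrite inE => /orP[/eqP ->|/he h]; first by rewrite ge_min lexx orbT.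
by rewrite ge_min h.
Qed.

Variables (n : nat) (A : 'M[R]_n).
Hypotheses (n0 : (0 < n)%N) (A0 : nonneg_mx A).
Implicit Types (x y u : 'cV[R]_n) (l : R).
Local Notation cge0 x := (forall i, 0 <= x i 0).
Local Notation cgt0 x := (forall i, 0 < x i 0).

Lemma mulmx_ge0 x : cge0 x -> cge0 (A *m x).
Proof. by move=> hx i; rewrite mxE; apply: sumr_ge0 => j _; rewrite mulr_ge0. Qed.

(** Maximum principle: the largest multiple [t *: u] below [x] touches it at some [i0]; if [t < 0],
    the strict inequality for [u] contradicts the one for [x] at [i0]. *)
Lemma touch l u x : cgt0 u -> (forall i, (A *m u) i 0 < l * u i 0) ->
  (forall i, (A *m x) i 0 <= l * x i 0) -> cge0 x.
Proof.
move=> hu hAu hAx i; pose i0 := [arg min_(j < i) (x j 0 / u j 0)]%O.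
have hi0 j : x i0 0 / u i0 0 <= x j 0 / u j 0 by rewrite /i0; case: arg_minP => // k _ h; exact: h.
set t := x i0 0 / u i0 0 in hi0.
have xt j : t * u j 0 <= x j 0 by rewrite -ler_pdivlMr.
have [t0|t0] := leP 0 t; first by apply: le_trans (xt i); rewrite mulr_ge0 // ltW.
have e : x i0 0 = t * u i0 0 by rewrite /t divfK // gt_eqF.
have : t * (A *m u) i0 0 <= (A *m x) i0 0.
  rewrite !mxE mulr_sumr; apply: ler_sum => j _; rewrite mulrCA; exact: ler_wpM2l.
have := hAx i0; have := hAu i0; rewrite e; nra.
Qed.

Hypothesis Airr : mx_irreducible A.

Definition psums L x : 'cV[R]_n := \sum_(k < L) iter k (mulmx A) x.

(** [L] exceeds the length of every chosen path, so for each index some power of [A] in the sum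
    transports a positive entry of [x] to it. *)
Lemma psums_pos : exists L, forall x, cge0 x -> x != 0 -> cgt0 (psums L x).
Proof.
have /choice [p hp] : forall ij : 'I_n * 'I_n, exists p : seq 'I_n, [/\ p != [::], path (fun a b => 0 < A a b) ij.1 p & last ij.1 p = ij.2].
  by case=> i j; exact: Airr.
exists (\sum_ij size (p ij)).+1 => x x0 xn i.
have [j hj] : exists j, 0 < x j 0.
  apply: contrapT => hn; case/eqP: xn; apply/matrixP => k k'; rewrite ord1 mxE.
  apply/eqP; rewrite eq_le x0 andbT leNgt; apply/negP => h; apply: hn; by exists k.
have it0 k : cge0 (iter k (mulmx A) x) by elim: k => //= k IH; exact: mulmx_ge0.
have pos : forall s a, path (fun a b => 0 < A a b) a s -> last a s = j -> 0 < (iter (size s) (mulmx A) x) a 0.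
  elim=> [a _ /= -> //|b s IH a /= /andP[ab pb] lb].
  rewrite mxE (bigD1 b) //=; apply: ltr_wpDr; last by rewrite mulr_gt0 // IH.
  by apply: sumr_ge0 => c _; rewrite mulr_ge0.
have [_ pij lij] := hp (i, j).
have hs : (size (p (i, j)) < (\sum_ij size (p ij)).+1)%N by rewrite ltnS (bigD1 (i, j)) //= leq_addr.
rewrite /psums summxE (bigD1 (Ordinal hs)) //=; apply: ltr_wpDr; last exact: pos.
by apply: sumr_ge0 => k _; exact: it0.
Qed.

Lemma psums_comm L x : A *m psums L x = psums L (A *m x).
Proof. by rewrite /psums mulmx_sumr; apply: eq_bigr => k _; rewrite -iterS iterSr. Qed.

Lemma psumsB L x y : psums L (x - y) = psums L x - psums L y.
Proof.
rewrite /psums -sumrB; apply: eq_bigr => k _; elim: (k : nat) => //= j ->; exact: mulmxBr.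
Qed.

Lemma psumsZ L l x : psums L (l *: x) = l *: psums L x.
Proof.
rewrite /psums scaler_sumr; apply: eq_bigr => k _; elim: (k : nat) => //= j ->; exact/esym/scalemxAr.
Qed.

Lemma psums_eig L l x : A *m x = l *: x -> psums L x = (\sum_(k < L) l ^+ k) *: x.
Proof.
move=> h; rewrite /psums scaler_suml; apply: eq_bigr => k _; elim: (k : nat) => [|j /= ->]; first by rewrite scale1r.
by rewrite -scalemxAr h scalerA exprSr.
Qed.

Lemma eig_pos l x : cge0 x -> x != 0 -> A *m x = l *: x -> cgt0 x.
Proof.
move=> x0 xn h i; have [L hL] := psums_pos; have := hL x x0 xn i.
rewrite (psums_eig L h) mxE => hp; rewrite lt_neqAle x0 andbT; apply/eqP => e.
by rewrite -e mulr0 ltxx in hp.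
Qed.

Lemma subZE (x y : 'cV[R]_n) a i : (x - a *: y) i 0 = x i 0 - a * y i 0.
Proof. by rewrite mxE [X in _ + X]mxE [X in _ - X]mxE. Qed.

Lemma scalar_subE a x i : ((a%:M - A) *m x) i 0 = a * x i 0 - (A *m x) i 0.
Proof. by rewrite mulmxBl mul_scalar_mx mxE [X in X + _]mxE [X in _ + X]mxE. Qed.

(** The eigenvalue is the infimum [ls] of the [l] for which some positive [u] satisfies [A u < l u].
    It is not attained, which forces [ls%:M - A] to be singular. The moduli [y] of a null vector
    satisfy [A y >= ls y], and anything but equality would exclude some [l] above [ls]. *)
Lemma perron_frobenius : exists l, exists2 h : 'cV[R]_n, cgt0 h & A *m h = l *: h.
Proof.
pose S := [set l | exists2 u : 'cV[R]_n, cgt0 u & forall i, (A *m u) i 0 < l * u i 0].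
have i0 : 'I_n by exact: Ordinal n0.
have Slb : lbound S 0.
  move=> l [u u0 hu]; have := hu i0; rewrite leNgt; apply: contraTN => l0; rewrite -leNgt.
  apply: le_trans (mulmx_ge0 (fun i => ltW (u0 i)) i0); rewrite mulr_le0_ge0 // ltW //.
have S0 : S !=set0.
  exists (\sum_i \sum_j A i j + 1), (const_mx 1) => i; first by rewrite mxE.
  rewrite !mxE mulr1; apply: le_lt_trans (_ : \sum_i \sum_j A i j < _); last by rewrite ltrDl.
  rewrite [leRHS](bigD1 i) //= (eq_bigr (A i)) => [|j _]; last by rewrite mxE mulr1.
  by rewrite lerDl; apply: sumr_ge0 => k _; apply: sumr_ge0.
have Si : has_inf S by split => //; exists 0.
pose ls := inf S.
have upS l : ls < l -> exists2 u : 'cV[R]_n, cgt0 u & forall i, (A *m u) i 0 < l * u i 0.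
  move=> h; have e0 : 0 < l - ls by rewrite subr_gt0.
  have [l' [u u0 hu]] := inf_adherent e0 Si; rewrite -/ls addrC subrK => l'l.
  by exists u => // i; apply: lt_trans (hu i) _; rewrite ltr_pM2r.
have nS u : cgt0 u -> (forall i, (A *m u) i 0 < ls * u i 0) -> False.
  move=> u0 hu; have [|e e0 he] := @fin_pos_lb _ (fun i => (ls * u i 0 - (A *m u) i 0) / u i 0 / 2).
    by move=> i; rewrite !divr_gt0 // subr_gt0.
  have : S (ls - e).
    exists u => // i; have := he i; rewrite ler_pdivlMr // ler_pdivlMr // => h.
    have := u0 i; have : 0 < e * u i 0 by rewrite mulr_gt0.
    rewrite mulrBl; nra.
  move=> /(ge_inf (ex_intro _ 0 Slb)); rewrite -/ls; lra.
have sing : (ls%:M - A) \notin unitmx.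
  apply/negP => uN; pose N := invmx (ls%:M - A); pose u := N *m const_mx 1 : 'cV[R]_n.
  have Nu : (ls%:M - A) *m u = const_mx 1 by rewrite mulKVmx.
  pose n1 (x : 'cV[R]_n) := \sum_i `|x i 0|.
  have n10 x : 0 <= n1 x by exact: sumr_ge0.
  have n1i x i : `|x i 0| <= n1 x by rewrite /n1 (bigD1 i) //= lerDl sumr_ge0.
  pose c : R := \sum_i \sum_j `|N i j|.
  have c0 : 0 <= c by apply: sumr_ge0 => i _; exact: sumr_ge0.
  have nN x : n1 (N *m x) <= c * n1 x.
    rewrite /n1 /c mulr_suml; apply: ler_sum => i _; rewrite mxE mulr_suml.
    apply: le_trans (ler_norm_sum _ _ _) _; apply: ler_sum => j _; rewrite normrM.
    by apply: ler_wpM2l => //; exact: n1i.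
  (* The solution [x] of [(ls + e - A) x = 1] is nonnegative by [touch], and [x = u - e N x] keeps
     it within a multiple of [e] of [u]; letting [e] tend to 0 yields [u >= 0]. *)
  have key e : 0 < e -> e * c <= 1 / 2 -> forall i, - (e * c * (2 * n1 u)) <= u i 0.
    move=> e0 ec; have lse : ls < ls + e by rewrite ltrDl.
    have [w w0 hw] := upS _ lse.
    have ue : ((ls + e)%:M - A) \in unitmx.
      apply: unitmx_ker => x hx.
      have hx' : A *m x = (ls + e) *: x.
        by move/eqP: hx; rewrite mulmxBl mul_scalar_mx subr_eq0 => /eqP.
      have p1 : cge0 x by apply: touch w0 hw _ => i; rewrite hx' mxE.
      have p2 : cge0 (- x) by apply: touch w0 hw _ => i; rewrite mulmxN hx' !mxE mulrN.
      apply/matrixP => i j; rewrite ord1 mxE; apply/eqP; rewrite eq_le p1 andbT.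
      by have := p2 i; rewrite mxE oppr_ge0.
    pose x := invmx ((ls + e)%:M - A) *m const_mx 1 : 'cV[R]_n.
    have hx : ((ls + e)%:M - A) *m x = const_mx 1 by rewrite mulKVmx.
    have x0 : cge0 x.
      apply: touch w0 hw _ => i; have := congr1 (fun M : 'cV[R]_n => M i 0) hx.
      by rewrite /= scalar_subE [in RHS]mxE => h; rewrite -subr_ge0 h.
    have xe : x = u - e *: (N *m x).
      have : (ls%:M - A) *m x = const_mx 1 - e *: x.
        by rewrite -hx !mulmxBl !mul_scalar_mx scalerDl [RHS]addrAC addrK.
      move=> /(congr1 (mulmx N)); rewrite mulKmx // => e1.
      by apply: etrans e1 _; rewrite mulmxBr -scalemxAr.
    have nx : n1 x <= 2 * n1 u.
      have : n1 x <= n1 u + e * n1 (N *m x).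
        rewrite {1}/n1 (eq_bigr (fun i => `|u i 0 - e * (N *m x) i 0|)) => [|i _]; last by rewrite {1}xe !mxE.
        rewrite /n1 mulr_sumr -big_split; apply: ler_sum => i _ /=.
        by apply: le_trans (ler_normB _ _) _; rewrite normrM (gtr0_norm e0).
      have := ler_wpM2l (ltW e0) (nN x); have := n10 x; nra.
    move=> i; have xi : x i 0 = u i 0 - e * (N *m x) i 0.
      by rewrite -subZE -xe.
    have h1 := ler_norm ((N *m x) i 0); have h1' := ler_norm (- (N *m x) i 0); rewrite normrN in h1'.
    have h2 := le_trans (n1i (N *m x) i) (le_trans (nN x) (ler_wpM2l c0 nx)).
    have h3 := x0 i; have : e * - (N *m x) i 0 <= e * (c * (2 * n1 u)) by rewrite ler_pM2l //; exact: le_trans h2.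
    lra.
  have u0 : cge0 u.
    move=> i; apply/ler_addgt0Pr => e e0; pose K := c * (2 * n1 u) + 1 + 2 * c.
    have K0 : 0 < K by rewrite /K; have := n10 u; nra.
    pose d := Num.min 1 e / K.
    have d0 : 0 < d by rewrite divr_gt0 // lt_min ltr01.
    have dK : d * K <= 1 /\ d * K <= e by rewrite /d divfK ?gt_eqF // !ge_min lexx; split => //; rewrite lexx orbT.
    have [dK1 dK2] := dK; have nu := n10 u.
    have dc0 : 0 <= d * (c * (2 * n1 u)) by rewrite mulr_ge0 ?(ltW d0) // mulr_ge0 // mulr_ge0.
    have dc1 : 0 <= d * c by rewrite mulr_ge0 // ltW.
    have := key d d0 _ i; rewrite /K !mulrDr mulr1 in dK1 dK2.
    rewrite -(mulrA d c) => h; have {}h := h _; suff : - (d * (c * (2 * n1 u))) <= u i 0 by lra.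
    by apply: h; lra.
  apply: (nS u).
    move=> i; rewrite lt_neqAle u0 andbT; apply/eqP => e.
    have := congr1 (fun M : 'cV[R]_n => M i 0) Nu; rewrite /= scalar_subE -e mulr0 add0r [in RHS]mxE => h.
    by have := mulmx_ge0 u0 i; rewrite -oppr_le0 h ler10.
  move=> i; have := congr1 (fun M : 'cV[R]_n => M i 0) Nu; rewrite /= scalar_subE [in RHS]mxE => h.
  by rewrite -subr_gt0 h.
have [x xn] := nonunit_ker sing; rewrite mulmxBl mul_scalar_mx => /eqP; rewrite subr_eq0 => /eqP /esym Ax.
pose y : 'cV[R]_n := \col_i `|x i 0|.
have y0 : cge0 y by move=> i; rewrite mxE.
have yn : y != 0.
  apply: contraNneq xn => e; apply/eqP/matrixP => i j; rewrite ord1 [RHS]mxE; apply/eqP; rewrite -normr_eq0; apply/eqP.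
  by have := congr1 (fun M : 'cV[R]_n => M i 0) e; rewrite !mxE => ->.
have ls0 : 0 <= ls by apply: lb_le_inf.
have Ay i : ls * y i 0 <= (A *m y) i 0.
  have := congr1 (fun M : 'cV[R]_n => `|M i 0|) Ax; rewrite /= !mxE normrM (ger0_norm ls0) => <-.
  apply: le_trans (ler_norm_sum _ _ _) _; apply: ler_sum => j _; by rewrite normrM mxE (ger0_norm (A0 _ _)).
(* If [A y - ls y] were nonzero, [psums] would make it positive in every entry, leaving room for
   [A z >= (ls + e) z] with [z > 0]; [touch] applied to [- z] excludes this. *)
have eqy : A *m y = ls *: y.
  apply/eqP; rewrite -subr_eq0; apply/negPn/negP => nz.
  have [L hL] := psums_pos.
  have w0 : cge0 (A *m y - ls *: y) by move=> i; rewrite subZE subr_ge0.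
  have z0 := hL y y0 yn; have := hL _ w0 nz; rewrite psumsB psumsZ -psums_comm; set z := psums L y in z0 *.
  move=> hz; have [|e e0 he] := @fin_pos_lb _ (fun i => ((A *m z) i 0 - ls * z i 0) / z i 0).
    by move=> i; rewrite divr_gt0 //; have := hz i; rewrite subZE.
  have lse : ls < ls + e by rewrite ltrDl.
  have [w w1 hw] := upS _ lse.
  have := touch w1 hw (x := - z) _ i0; rewrite mxE => h; have := z0 i0.
  suff : 0 <= - z i0 0 by lra.
  apply: h => i; rewrite mulmxN mxE [X in _ * X]mxE mulrN lerN2; have := he i; rewrite ler_pdivlMr //; lra.
by exists ls, y => //; exact: eig_pos eqy.
Qed.
End PerronFrobenius.

(** * The blocks of the transition matrix *)

Section RealSeries.
Context {R : realType}.
Implicit Types (u v : nat -> R) (l : R).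

Lemma rs_unique u l l' : rseries_to u l -> rseries_to u l' -> l = l'.
Proof. by move=> h h'; rewrite -(cvg_lim (@Rhausdorff R) h) -(cvg_lim (@Rhausdorff R) h'). Qed.

Lemma rs_ext u v l : u =1 v -> rseries_to u l -> rseries_to v l.
Proof. by move=> /funext ->. Qed.

Lemma rsD u v l l' : rseries_to u l -> rseries_to v l' -> rseries_to (fun k => u k + v k) (l + l').
Proof.
move=> h h'; rewrite /rseries_to (_ : (fun _ => _) = (fun n => \sum_(k < n) u k + \sum_(k < n) v k)).
  exact: cvgD.
by apply/funext => n; rewrite big_split.
Qed.

Lemma rsZ u l a : rseries_to u l -> rseries_to (fun k => a * u k) (a * l).
Proof.
move=> h; rewrite /rseries_to (_ : (fun _ => _) = (fun n => a * \sum_(k < n) u k)).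
  by apply: cvgM => //; exact: cvg_cst.
by apply/funext => n; rewrite mulr_sumr.
Qed.

Lemma rs0 : rseries_to (fun=> 0 : R) 0.
Proof.
rewrite /rseries_to (_ : (fun _ => _) = fun=> 0); first exact: cvg_cst.
by apply/funext => n; rewrite big1.
Qed.

Lemma rs_sum (I : Type) (s : seq I) (F : I -> nat -> R) (L : I -> R) :
  (forall i, rseries_to (F i) (L i)) -> rseries_to (fun k => \sum_(i <- s) F i k) (\sum_(i <- s) L i).
Proof.
move=> h; elim: s => [|i s IH].
  by rewrite big_nil; apply: rs_ext rs0 => k; rewrite big_nil.
by rewrite big_cons; apply: rs_ext (rsD (h i) IH) => k; rewrite big_cons.
Qed.

Lemma rs_term u l n : (forall k, 0 <= u k) -> rseries_to u l -> \sum_(k < n) u k <= l.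
Proof.
move=> u0 h; rewrite -(cvg_lim (@Rhausdorff R) h).
apply: (nondecreasing_cvgn_le (u_ := fun n => \sum_(k < n) u k)); last by apply/cvg_ex; exists l.
move=> a b /subnK <-; elim: (b - a)%N => // k IH; rewrite addSn big_ord_recr /=.
by apply: le_trans IH _; rewrite lerDl.
Qed.

Lemma rs_ge0 u l : (forall k, 0 <= u k) -> rseries_to u l -> 0 <= l.
Proof. by move=> u0 h; have := rs_term 0 u0 h; rewrite big_ord0. Qed.

Lemma rs_ge_term u l n : (forall k, 0 <= u k) -> rseries_to u l -> u n <= l.
Proof.
move=> u0 h; apply: le_trans (rs_term n.+1 u0 h); rewrite big_ord_recr /= lerDr.
by apply: sumr_ge0.
Qed.

Lemma rs_le u v l l' : (forall k, u k <= v k) -> rseries_to u l -> rseries_to v l' -> l <= l'.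
Proof.
move=> uv h h'; rewrite -subr_ge0; apply: (@rs_ge0 (fun k => v k + -1 * u k)).
  by move=> k; rewrite mulN1r subr_ge0.
by rewrite (_ : l' - l = l' + -1 * l); [exact (rsD h' (rsZ (a := -1) h))|rewrite mulN1r].
Qed.

Lemma rs_geom u B (q : R) : 0 <= q < 1 -> (forall k, `|u k| <= B * q ^+ k) -> exists l, rseries_to u l.
Proof. by move=> hq hu; have [l hl] := real_geom_cvg hq hu; exists l. Qed.

Lemma rs_lt u v l l' n : (forall k, u k <= v k) -> u n < v n -> rseries_to u l -> rseries_to v l' -> l < l'.
Proof.
move=> uv uvn h h'; rewrite -subr_gt0; apply: lt_le_trans (_ : v n + -1 * u n <= _).
  by rewrite mulN1r subr_gt0.
apply: (@rs_ge_term (fun k => v k + -1 * u k)); first by move=> k; rewrite mulN1r subr_ge0.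
by rewrite (_ : l' - l = l' + -1 * l); [exact (rsD h' (rsZ (a := -1) h))|rewrite mulN1r].
Qed.

Lemma rs_term0 u l : rseries_to u l -> u @ \oo --> (0 : R).
Proof.
move=> h; rewrite (_ : u = fun n => \sum_(k < n.+1) u k - \sum_(k < n) u k); last first.
  by apply/funext => n; rewrite big_ord_recr /= addrAC subrr add0r.
pose f n := \sum_(k < n) u k.
have h1 : f n.+1 @[n --> \oo] --> l by rewrite (cvg_shiftS f).
have h2 := cvgB h1 h; rewrite subrr in h2; exact (h2 _).
Qed.

Lemma rs_bound u l : rseries_to u l -> exists B, forall k, `|u k| <= B.
Proof.
move=> /rs_term0 h; have : cvgn u by apply/cvg_ex; exists 0.
move=> /cvg_seq_bounded [B [_ hB]]; exists (B + 1) => k.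
by apply: (hB (B + 1)) => //; rewrite ltrDl.
Qed.

Lemma psf_real (h : nat -> R) (y l : R) : rseries_to (fun k => y ^+ k * h k) l ->
  psf (fun k => toC (h k)) (toC y) = toC l.
Proof.
move=> /cvgC_toC hl; apply: psf_eq; rewrite (_ : psum _ _ = fun n => toC (\sum_(k < n) y ^+ k * h k)) //.
by apply/funext => n; rewrite toC_sum; apply: eq_bigr => k _; rewrite toCM toCX mulrC.
Qed.

(** Convergence at some [r1] beyond [r] makes the terms bounded at [r1], hence geometrically
    decreasing at [r]. *)
Lemma conv_radius_bound m n (F : nat -> 'M[R]_(m, n)) (r : R) : 0 <= r -> (r%:E < conv_radius F)%E ->
  exists r1, exists B, [/\ r < r1, 0 <= B & forall k i j, `|F k i j| <= B * r1 ^- k].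
Proof.
move=> r0; rewrite /conv_radius => /ereal_sup_gt [_ [r1 [r10 [S hS]] <-]]; rewrite lte_fin => rr1.
have p : 0 < r1 by exact: le_lt_trans rr1.
have /choice [B hB] : forall ij : 'I_m * 'I_n, exists B, forall k, `|r1 ^+ k * F k ij.1 ij.2| <= B.
  move=> [i j]; have [B hB] := rs_bound (hS i j); exists B => k.
  by have := hB k; rewrite mxE.
have B0 ij : 0 <= B ij by exact: le_trans (hB ij 0%N).
exists r1, (\sum_ij B ij); split => // [|k i j]; first by apply: sumr_ge0.
rewrite ler_pdivlMr ?exprn_gt0 //; apply: le_trans (_ : B (i, j) <= _).
  by have := hB (i, j) k; rewrite normrM (ger0_norm (exprn_ge0 k r10)) mulrC.
by rewrite (bigD1 (i, j)) //= lerDl sumr_ge0.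
Qed.

Lemma bound_series m n (F : nat -> 'M[R]_(m, n)) (r1 B y : R) : 0 < r1 ->
  (forall k i j, `|F k i j| <= B * r1 ^- k) -> 0 <= y -> y < r1 ->
  mxseries_to (fun k => y ^+ k *: F k) (mxseries (fun k => y ^+ k *: F k)).
Proof.
move=> r10 hB y0 yr i j; have q01 : 0 <= y / r1 < 1.
  by rewrite divr_ge0 ?(ltW r10) //= ltr_pdivrMr // mul1r.
have [|l hl] := @rs_geom (fun k => (y ^+ k *: F k) i j) B (y / r1) q01.
  move=> k; rewrite mxE normrM (ger0_norm (exprn_ge0 k y0)) exprMn exprVn mulrCA.
  by rewrite ler_wpM2l ?exprn_ge0.
by rewrite mxE (cvg_lim (@Rhausdorff R) hl).
Qed.
End RealSeries.

(** * The kernel twisted by theta and v: its drift, and test vectors below theta *)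

Section Twist.
Context {R : realType}.
Variables (n : nat) (A : nat -> 'M[R]_n) (A1 S At D : 'M[R]_n) (theta : R)
  (pi : 'rV[R]_n) (mu : 'rV[R]_n) (v : 'cV[R]_n).
Hypotheses (A0 : forall k i j, 0 <= A k i j) (t1 : 1 < theta)
  (hA1 : mxseries_to A A1) (hS : mxseries_to (fun k => k%:R *: A k) S)
  (hAt : mxseries_to (fun k => theta ^+ k *: A k) At)
  (hD : mxseries_to (fun k => k%:R *: (theta ^+ k *: A k)) D)
  (A1e : A1 *m onesC n = onesC n) (piA : pi *m A1 = pi) (pie : pi *m onesC n = 1)
  (drift : (pi *m S *m onesC n) 0 0 < 1)
  (muA : mu *m At = theta *: mu) (Av : At *m v = theta *: v) (muv : mu *m v = 1)
  (mu0 : forall j, 0 < mu 0 j) (v0 : forall j, 0 < v j 0).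

Let t0 : 0 < theta. Proof. exact: lt_trans t1. Qed.
Let lt0 : 0 < ln theta. Proof. by rewrite ln_gt0. Qed.

Lemma quad m (x : 'rV[R]_m) (X : 'M[R]_m) (y : 'cV[R]_m) : (x *m X *m y) 0 0 = \sum_i \sum_j x 0 i * X i j * y j 0.
Proof.
rewrite mxE exchange_big /=; apply: eq_bigr => j _; rewrite mxE mulr_suml.
by apply: eq_bigr => i _.
Qed.

(** Otherwise [(k - 1) ln theta + ln v_j - ln v_i] vanishes on the support of the kernel. Averaged
    against [pi], the [ln v] terms cancel by invariance and there remains [pi S e = 1], against the
    drift condition. *)
Lemma twist_nontrivial : exists k i j, 0 < A k i j /\ theta ^+ k * v j 0 != theta * v i 0.
Proof.
apply: contrapT => hn.
have he k i j : A k i j * ((k%:R - 1) * ln theta + (ln (v j 0) - ln (v i 0))) = 0.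
  have [->|nz] := eqVneq (A k i j) 0; first by rewrite mul0r.
  have p : 0 < A k i j by rewrite lt_neqAle eq_sym nz A0.
  have : theta ^+ k * v j 0 = theta * v i 0.
    by apply/eqP; apply: contrapT => /negP h; apply: hn; exists k, i, j.
  move=> /(congr1 (@ln R)); rewrite !lnM ?posrE ?exprn_gt0 // lnXn // => e.
  have -> : (k%:R - 1) * ln theta + (ln (v j 0) - ln (v i 0)) = 0; last by rewrite mulr0.
  by move: e; rewrite -mulr_natl; lra.
have hl i j : (S i j - A1 i j) * ln theta + A1 i j * (ln (v j 0) - ln (v i 0)) = 0.
  have h1 := @hS i j; have h2 := @hA1 i j.
  have := rsD (rsZ (a := ln theta) (rsD h1 (rsZ (a := -1) h2))) (rsZ (a := ln (v j 0) - ln (v i 0)) h2).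
  move=> h3; have := rs_unique (rs_ext _ h3) rs0 => h4.
  have {}h4 := h4 _; rewrite -[RHS]h4; first by ring.
  by move=> k /=; rewrite mxE -[RHS](he k i j); ring.
have sum0 : \sum_i \sum_j pi 0 i * ((S i j - A1 i j) * ln theta + A1 i j * (ln (v j 0) - ln (v i 0))) = 0.
  by rewrite big1 // => i _; rewrite big1 // => j _; rewrite hl mulr0.
have e1 : (pi *m A1 *m onesC n) 0 0 = 1 by rewrite piA pie mxE.
have e2 : \sum_i \sum_j pi 0 i * A1 i j * ln (v j 0) = \sum_j pi 0 j * ln (v j 0).
  rewrite exchange_big /=; apply: eq_bigr => j _; rewrite -mulr_suml; congr (_ * _).
  by rewrite -[in RHS]piA mxE.
have e3 : \sum_i \sum_j pi 0 i * A1 i j * ln (v i 0) = \sum_j pi 0 j * ln (v j 0).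
  apply: eq_bigr => i _; rewrite -mulr_suml -mulr_sumr; congr (_ * _).
  have := congr1 (fun M : 'cV[R]_n => M i 0) A1e; rewrite /= !mxE => e.
  rewrite (_ : \sum_j A1 i j = 1) ?mulr1 // -[RHS]e; apply: eq_bigr => j _; by rewrite mxE mulr1.
have e4 : (pi *m S *m onesC n) 0 0 = 1.
  rewrite quad; move: e1; rewrite quad => e1.
  have sp : (\sum_i \sum_j pi 0 i * S i j * onesC n j 0 - \sum_i \sum_j pi 0 i * A1 i j * onesC n j 0) * ln theta +
     (\sum_i \sum_j pi 0 i * A1 i j * ln (v j 0) - \sum_i \sum_j pi 0 i * A1 i j * ln (v i 0)) = 0.
    rewrite -[RHS]sum0 -!sumrB mulr_suml -big_split; apply: eq_bigr => i _ /=.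
    rewrite -!sumrB mulr_suml -big_split; apply: eq_bigr => j _ /=; rewrite mxE; ring.
  move: sp; rewrite e2 e3 subrr addr0 => /eqP; rewrite mulf_eq0 (gt_eqF lt0) orbF subr_eq0 e1 => /eqP.
  done.
by move: drift; rewrite e4 ltxx.
Qed.

Let lnr_gt (r : R) : 0 < r -> r != 1 -> 1 - r^-1 < ln r.
Proof.
move=> r0 r1; have l0 : - ln r != 0.
  by rewrite oppr_eq0; apply: contraNneq r1 => e; rewrite -(lnK (x := r)) ?posrE // e expR0.
have := expR_gt1Dx l0; rewrite expRN lnK ?posrE //; lra.
Qed.

Let lnr_ge (r : R) : 0 < r -> 1 - r^-1 <= ln r.
Proof.
move=> r0; have [->|r1] := eqVneq r 1; first by rewrite invr1 ln1 subrr.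
exact/ltW/lnr_gt.
Qed.

(* Kullback-Leibler divergence of the theta-twisted kernel from the original one *)
Lemma drift_pos : theta < (mu *m D *m v) 0 0.
Proof.
(* [T] is the twisted mass times [ln r - 1 + 1 / r], nonnegative for every ratio [r > 0]. The terms
   coming from [- 1 + 1 / r] both have total mass [theta] and cancel after summation. *)
pose T k i j := mu 0 i * (theta ^+ k * A k i j) * v j 0 * ((k%:R - 1) * ln theta + (ln (v j 0) - ln (v i 0)))
   - mu 0 i * (theta ^+ k * A k i j) * v j 0 + theta * (mu 0 i * A k i j * v i 0).
pose r k i j := theta ^+ k * v j 0 / (theta * v i 0).
have r0 k i j : 0 < r k i j by rewrite divr_gt0 ?mulr_gt0 ?exprn_gt0.
have lr k i j : ln (r k i j) = (k%:R - 1) * ln theta + (ln (v j 0) - ln (v i 0)).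
  rewrite ln_div ?posrE ?mulr_gt0 ?exprn_gt0 // !lnM ?posrE ?exprn_gt0 // lnXn // -mulr_natl; ring.
have TE k i j : T k i j = mu 0 i * (theta ^+ k * A k i j) * v j 0 * (ln (r k i j) - (1 - (r k i j)^-1)).
  rewrite /T -lr /r invf_div; field.
  by rewrite (gt_eqF (v0 j)) expf_neq0 ?gt_eqF.
have w0 k i j : 0 <= mu 0 i * (theta ^+ k * A k i j) * v j 0.
  rewrite mulr_ge0 ?(ltW (v0 _)) // mulr_ge0 ?(ltW (mu0 _)) // mulr_ge0 ?A0 // exprn_ge0 // ltW //.
have T0 k i j : 0 <= T k i j by rewrite TE mulr_ge0 // subr_ge0 lnr_ge.
pose L i j := mu 0 i * v j 0 * ln theta * (D i j - At i j) + mu 0 i * v j 0 * (ln (v j 0) - ln (v i 0)) * At i j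
  - mu 0 i * v j 0 * At i j + theta * mu 0 i * v i 0 * A1 i j.
have hL i j : rseries_to (fun k => T k i j) (L i j).
  have h1 := @hD i j; have h2 := @hAt i j; have h3 := @hA1 i j.
  have h4 := rsD (rsD (rsZ (a := mu 0 i * v j 0 * ln theta) (rsD h1 (rsZ (a := -1) h2)))
    (rsZ (a := mu 0 i * v j 0 * (ln (v j 0) - ln (v i 0)) - mu 0 i * v j 0) h2)) (rsZ (a := theta * mu 0 i * v i 0) h3).
  rewrite (_ : L i j = mu 0 i * v j 0 * ln theta * (D i j + -1 * At i j) + (mu 0 i * v j 0 * (ln (v j 0) - ln (v i 0)) - mu 0 i * v j 0) * At i j + theta * mu 0 i * v i 0 * A1 i j); last by rewrite /L; ring.
  by apply: rs_ext h4 => k /=; rewrite !mxE /T; ring.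
have L0 i j : 0 <= L i j by exact: rs_ge0 (hL i j).
have [k1 [i1 [j1 [a1 ne1]]]] := twist_nontrivial.
have L1 : 0 < L i1 j1.
  apply: lt_le_trans (rs_ge_term k1 _ (hL i1 j1)) => //.
  rewrite TE mulr_gt0 //; first by rewrite !mulr_gt0 ?exprn_gt0.
  rewrite subr_gt0 lnr_gt //; apply: contraNneq ne1 => e.
  have := congr1 (fun t => t * (theta * v i1 0)) e.
  by rewrite /r divfK ?mul1r; [move=> ->|rewrite gt_eqF // mulr_gt0].
have Ls : 0 < \sum_i \sum_j L i j.
  rewrite (bigD1 i1) //=; apply: ltr_pwDl; last by apply: sumr_ge0 => i _; exact: sumr_ge0.
  by rewrite (bigD1 j1) //=; apply: ltr_pwDl => //; exact: sumr_ge0.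
have e1 : \sum_i \sum_j mu 0 i * At i j * v j 0 = theta.
  by rewrite -quad muA -scalemxAl muv !mxE mulr1.
have e2 : \sum_i \sum_j mu 0 i * At i j * v j 0 * ln (v j 0) = \sum_j theta * mu 0 j * v j 0 * ln (v j 0).
  rewrite exchange_big /=; apply: eq_bigr => j _; rewrite -!mulr_suml; congr (_ * _ * _).
  by have := congr1 (fun M : 'rV[R]_n => M 0 j) muA; rewrite /= !mxE.
have e3 : \sum_i \sum_j mu 0 i * At i j * v j 0 * ln (v i 0) = \sum_j theta * mu 0 j * v j 0 * ln (v j 0).
  apply: eq_bigr => i _; rewrite -mulr_suml; congr (_ * _).
  rewrite (eq_bigr (fun j => mu 0 i * (At i j * v j 0))) => [|j _]; last by rewrite mulrA.
  rewrite -mulr_sumr; have := congr1 (fun M : 'cV[R]_n => M i 0) Av; rewrite /= !mxE => ->; ring.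
have e4 : \sum_i \sum_j theta * (mu 0 i * v i 0 * A1 i j) = theta.
  rewrite (eq_bigr (fun i => theta * (mu 0 i * v i 0))) => [|i _].
    by rewrite -mulr_sumr; have := congr1 (fun M : 'M[R]_1 => M 0 0) muv; rewrite /= !mxE => ->; rewrite mulr1.
  rewrite -mulr_sumr -mulr_sumr; congr (_ * _).
  have := congr1 (fun M : 'cV[R]_n => M i 0) A1e; rewrite /= !mxE => e.
  rewrite (_ : \sum_j A1 i j = 1) ?mulr1 // -[RHS]e; apply: eq_bigr => j _; by rewrite mxE mulr1.
(* The two eigenvector equations cancel the [ln v] terms, so the divergence reduces to [ln theta]
   times the excess of the twisted drift. *)
have eL : \sum_i \sum_j L i j = ln theta * ((mu *m D *m v) 0 0 - theta).
  rewrite quad -[X in _ - X]e1.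
  transitivity (ln theta * (\sum_i \sum_j mu 0 i * D i j * v j 0 - \sum_i \sum_j mu 0 i * At i j * v j 0) +
    (\sum_i \sum_j mu 0 i * At i j * v j 0 * ln (v j 0) - \sum_i \sum_j mu 0 i * At i j * v j 0 * ln (v i 0))
    - (\sum_i \sum_j mu 0 i * At i j * v j 0 - \sum_i \sum_j theta * (mu 0 i * v i 0 * A1 i j))).
    rewrite -!sumrB mulr_sumr -!big_split -sumrB; apply: eq_bigr => i _ /=.
    rewrite -!sumrB mulr_sumr -!big_split -sumrB; apply: eq_bigr => j _ /=; rewrite /L; ring.
  by rewrite e2 e3 e4 e1 !subrr addr0 subr0.
by move: Ls; rewrite eL pmulr_rgt0 // subr_gt0.
Qed.

(* h is built from v^s with s = ln y / ln theta: weak inequality by convexity (Hoelder), made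
   strict by irreducibility. *)
Lemma holder_strict (y : R) (Ay : 'M[R]_n) : 1 < y -> y < theta ->
  mxseries_to (fun k => y ^+ k *: A k) Ay -> nonneg_mx Ay -> mx_irreducible Ay ->
  exists2 h : 'cV[R]_n, (forall i, 0 < h i 0) & forall i, (Ay *m h) i 0 < y * h i 0.
Proof.
move=> y1 yt hAy Ay0 Ayirr.
have y0 : 0 < y by exact: lt_trans y1.
pose s := ln y / ln theta.
have s0 : 0 < s by rewrite divr_gt0 // ln_gt0.
have s1 : s < 1 by rewrite ltr_pdivrMr // mul1r ltr_ln.
have sl : s * ln theta = ln y by rewrite divfK // gt_eqF.
pose u : 'cV[R]_n := \col_i expR (s * ln (v i 0)).
have u0 i : 0 < u i 0 by rewrite mxE expR_gt0.
pose L k i j := (k%:R - 1) * ln theta + (ln (v j 0) - ln (v i 0)).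
(* Strict convexity of [expR] between 0 and [l], from the strict tangent inequality at [s * l] taken
   with weights [1 - s] and [s]. *)
have cvx_lt l : l != 0 -> expR (s * l) < (1 - s) + s * expR l.
  move=> l0; have h1 : 1 + (1 - s) * l < expR ((1 - s) * l) by apply: expR_gt1Dx; rewrite mulf_neq0 // subr_eq0 gt_eqF.
  have h2 : 1 + - (s * l) < expR (- (s * l)) by apply: expR_gt1Dx; rewrite oppr_eq0 mulf_neq0 // gt_eqF.
  have e1 : expR l = expR (s * l) * expR ((1 - s) * l) by rewrite -expRD; congr expR; ring.
  have e2 : 1 = expR (s * l) * expR (- (s * l)) by rewrite -expRD subrr expR0.
  have h3 : (1 - s) * (1 + - (s * l)) < (1 - s) * expR (- (s * l)) by rewrite ltr_pM2l // subr_gt0.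
  have h4 : s * (1 + (1 - s) * l) < s * expR ((1 - s) * l) by rewrite ltr_pM2l.
  have h5 : 0 < (1 - s) * expR (- (s * l)) + s * expR ((1 - s) * l) - 1 by lra.
  have h6 := mulr_gt0 (expR_gt0 (s * l)) h5.
  have -> : 1 - s + s * expR l = expR (s * l) + expR (s * l) * ((1 - s) * expR (- (s * l)) + s * expR ((1 - s) * l) - 1).
    rewrite e1 (_ : expR (s * l) + _ = (1 - s) * (expR (s * l) * expR (- (s * l))) + s * (expR (s * l) * expR ((1 - s) * l))); last by ring.
    by rewrite -e2 mulr1.
  by rewrite ltrDl.
have cvx_le l : expR (s * l) <= (1 - s) + s * expR l.
  by have [->|l0] := eqVneq l 0; [rewrite mulr0 expR0 mulr1 subrK|exact/ltW/cvx_lt].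
have expk (x : R) (k : nat) : 0 < x -> x ^+ k = expR (k%:R * ln x).
  by move=> x0; rewrite expRM_natl lnK.
have rE k i j : theta ^+ k * v j 0 = theta * v i 0 * expR (L k i j).
  have eln (x : R) : 0 < x -> expR (ln x) = x by move=> ?; rewrite lnK.
  rewrite (expk theta) // -{1}(eln (v j 0)) // -{2}(eln theta) // -{1}(eln (v i 0)) // -!expRD; congr expR; rewrite /L; ring.
have uE k i j : y ^+ k * u j 0 = y * u i 0 * expR (s * L k i j).
  have eln (x : R) : 0 < x -> expR (ln x) = x by move=> ?; rewrite lnK.
  rewrite !mxE (expk y) // -{2}(eln y) // -!expRD; congr expR; rewrite /L -sl; ring.
have Tle k i j : y ^+ k * A k i j * u j 0 <= y * u i 0 * ((1 - s) * A k i j + s / (theta * v i 0) * (theta ^+ k * A k i j * v j 0)).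
  have -> : y ^+ k * A k i j * u j 0 = y * u i 0 * A k i j * expR (s * L k i j).
    by rewrite mulrAC (uE k i j); ring.
  have -> : y * u i 0 * ((1 - s) * A k i j + s / (theta * v i 0) * (theta ^+ k * A k i j * v j 0)) =
     y * u i 0 * A k i j * ((1 - s) + s * expR (L k i j)).
    rewrite (_ : theta ^+ k * A k i j * v j 0 = theta * v i 0 * expR (L k i j) * A k i j).
      by field; rewrite !gt_eqF.
    by rewrite -rE; ring.
  by rewrite ler_wpM2l // mulr_ge0 // mulr_ge0 // ltW.
have Tlt k i j : 0 < A k i j -> L k i j != 0 -> y ^+ k * A k i j * u j 0 < y * u i 0 * ((1 - s) * A k i j + s / (theta * v i 0) * (theta ^+ k * A k i j * v j 0)).
  move=> a0 l0.
  have -> : y ^+ k * A k i j * u j 0 = y * u i 0 * A k i j * expR (s * L k i j).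
    by rewrite mulrAC (uE k i j); ring.
  have -> : y * u i 0 * ((1 - s) * A k i j + s / (theta * v i 0) * (theta ^+ k * A k i j * v j 0)) =
     y * u i 0 * A k i j * ((1 - s) + s * expR (L k i j)).
    rewrite (_ : theta ^+ k * A k i j * v j 0 = theta * v i 0 * expR (L k i j) * A k i j).
      by field; rewrite !gt_eqF.
    by rewrite -rE; ring.
  by rewrite ltr_pM2l ?cvx_lt // !mulr_gt0.
have hl i j : rseries_to (fun k => y ^+ k * A k i j * u j 0) (Ay i j * u j 0).
  have h1 := hAy i j; rewrite mulrC; apply: rs_ext (rsZ (a := u j 0) h1) => k /=; rewrite [(y ^+ k *: A k) i j]mxE; ring.
have hr i j : rseries_to (fun k => y * u i 0 * ((1 - s) * A k i j + s / (theta * v i 0) * (theta ^+ k * A k i j * v j 0)))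
   (y * u i 0 * ((1 - s) * A1 i j + s / (theta * v i 0) * (At i j * v j 0))).
  have h1 := @hA1 i j; have h2 := @hAt i j.
  apply: (rsZ (a := y * u i 0)); apply: (rsD (rsZ (a := 1 - s) h1)); apply: (rsZ (a := s / (theta * v i 0))).
  by rewrite mulrC; apply: rs_ext (rsZ (a := v j 0) h2) => k /=; rewrite mxE; ring.
have rowsum i : \sum_j y * u i 0 * ((1 - s) * A1 i j + s / (theta * v i 0) * (At i j * v j 0)) = y * u i 0.
  rewrite -mulr_sumr -[RHS]mulr1; congr (_ * _); rewrite big_split -!mulr_sumr /=.
  have := congr1 (fun M : 'cV[R]_n => M i 0) A1e; rewrite /= !mxE => e.
  rewrite (_ : \sum_j A1 i j = 1); last by rewrite -[RHS]e; apply: eq_bigr => j _; rewrite mxE mulr1.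
  have := congr1 (fun M : 'cV[R]_n => M i 0) Av; rewrite /= !mxE => ->.
  by field; rewrite !gt_eqF.
have Le i j := rs_le (fun k => Tle k i j) (hl i j) (hr i j).
have [k1 [i1 [j1 [a1 ne1]]]] := twist_nontrivial.
have L1 : L k1 i1 j1 != 0 by apply: contraNneq ne1 => e; rewrite (rE k1 i1) e expR0 mulr1.
have Lt := rs_lt (fun k => Tle k i1 j1) (Tlt k1 i1 j1 a1 L1) (hl i1 j1) (hr i1 j1).
(* This defect is only nonnegative and nonzero; summing powers of [Ay] makes it positive everywhere,
   so [psums Ay K u] replaces [u] as the test vector. *)
pose x := y *: u - Ay *m u.
have xE i : x i 0 = y * u i 0 - \sum_j Ay i j * u j 0 by rewrite /x mxE [X in X + _]mxE [X in _ + X]mxE [X in _ - X]mxE.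
have x0 i : 0 <= x i 0.
  by rewrite xE subr_ge0 -{1}(rowsum i); apply: ler_sum => j _; exact: Le.
have xn : x != 0.
  apply: contraTneq (_ : 0 < x i1 0) => [->|]; first by rewrite mxE ltxx.
  rewrite xE subr_gt0 -{1}(rowsum i1) (bigD1 j1) //= [ltRHS](bigD1 j1) //=.
  by apply: ltr_leD => //; apply: ler_sum => j _; exact: Le.
have u0' i : 0 <= u i 0 by exact: ltW.
have un : u != 0 by apply: contraTneq (u0 i1) => ->; rewrite mxE ltxx.
have [K hK] := psums_pos Ay0 Ayirr.
exists (psums Ay K u) => [|i]; first exact: hK.
have := hK x x0 xn i; rewrite /x psumsB psumsZ -psums_comm mxE [X in X + _]mxE [X in _ + X]mxE; lra.
Qed.
End Twist.

(** * Geometric decay of the stationary vector *)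

Section Lyapunov.
Context {R : realType}.

(** Reindexing by [m = k + 1 - l]; for [l] beyond [K + 1] truncated subtraction makes the right side
    an empty sum. *)
Lemma tri_le (g : nat -> R) l K : (forall m, 0 <= g m) ->
  \sum_(1 <= k < K.+1) (if (l < k.+2)%N then g (k.+1 - l)%N else 0) <= \sum_(m < K.+2 - l) g m.
Proof.
move=> g0; elim: K => [|K IH]; first by rewrite big_geq // sumr_ge0.
rewrite big_nat_recr //=; case: ifP => h.
  by rewrite (_ : (K.+3 - l = (K.+2 - l).+1)%N) ?big_ord_recr /= ?lerD2r //; lia.
rewrite addr0; apply: le_trans IH _; rewrite (_ : (K.+2 - l = 0)%N) ?big_ord0 ?sumr_ge0 //; lia.
Qed.

Variables (Q : MG1 R) (x0 : 'rV[R]_(M0 Q)) (xs : nat -> 'rV[R]_(M Q)).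
Local Notation n := (M Q).
Local Notation A := (Ablk Q).
Variables (A1 Ay : 'M[R]_n) (By : 'M[R]_(M0 Q, n)) (y : R) (h : 'cV[R]_n).
Hypotheses (A0 : forall k i j, 0 <= A k i j) (B0 : forall k i j, 0 <= Bs Q k i j)
  (hst : is_stationary x0 xs) (y1 : 1 < y)
  (hA1 : mxseries_to A A1) (A1e : A1 *m onesC n = onesC n)
  (hAy : mxseries_to (fun k => y ^+ k *: A k) Ay)
  (hBy : mxseries_to (fun k => y ^+ k *: Bs Q k) By)
  (h0 : forall i, 0 < h i 0) (Ah : forall i, (Ay *m h) i 0 < y * h i 0).

(* Lyapunov argument with the truncated function min(y^k h, N), so that all sums are finite. *)
Lemma stationary_bound : exists2 C0, 0 <= C0 & forall k j, (0 < k)%N -> xs k 0 j <= C0 * y ^- k.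
Proof.
have [x00 xs0 xsum _ xrec] := hst.
have y0 : 0 < y by exact: lt_trans y1.
have xlim j : (fun k => xs k 0 j) @ \oo --> (0 : R).
  have /rs_term0 /cvgrPdist_lt hx := xsum; apply/cvgrPdist_lt => e e0; have [N _ hN] := hx e e0.
  exists N.+1 => // -[//|k] hk; have := hN k.+1 (ltnW hk); rewrite /= !sub0r !normrN; apply: le_lt_trans.
  rewrite (ger0_norm (xs0 _ _ _)) ger0_norm; last by apply: sumr_ge0 => i _; exact: xs0.
  by rewrite (bigD1 j) //= lerDl sumr_ge0 // => i _; exact: xs0.
have [d d0 hd] := @fin_pos_lb _ _ (fun i => (y * h i 0 - (Ay *m h) i 0) / (y * h i 0)) (fun i => divr_gt0 (eq_ind_r is_true (Ah i) (subr_gt0 _ _)) (mulr_gt0 y0 (h0 i))).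
(* The contraction factor of [Ay] on [h], uniform in the phase; the maximum keeps it nonnegative. *)
pose rho := Num.max 0 (1 - d).
have rho0 : 0 <= rho by rewrite le_max lexx.
have rho1 : rho < 1 by rewrite gt_max ltr01 ltrBlDr ltrDl.
have hrho i : (Ay *m h) i 0 <= rho * (y * h i 0).
  have := hd i; rewrite ler_pdivlMr ?mulr_gt0 // => hh.
  apply: le_trans (_ : (1 - d) * (y * h i 0) <= _); first by lra.
  by rewrite ler_wpM2r ?mulr_ge0 ?(ltW y0) ?(ltW (h0 i)) // /rho le_max lexx orbT.
pose C1 := (x0 *m By *m h) 0 0.
have row1 i : \sum_j A1 i j = 1.
  have := congr1 (fun M : 'cV[R]_n => M i 0) A1e; rewrite /= !mxE => <-.
  by apply: eq_bigr => j _; rewrite mxE mulr1.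
pose V (N : R) k i := Num.min (y ^+ k * h i 0) N.
(* [W] dominates the expectation of [V] after one step by the A-blocks: the untruncated function
   contracts by [rho], and the row sums 1 of [A1] preserve the cap [N]. *)
pose W (N : R) k i := Num.min (rho * (y ^+ k * h i 0)) N.
have yk k i : 0 <= y ^+ k * h i 0 by rewrite mulr_ge0 ?exprn_ge0 // ltW.
have yA m i j : 0 <= y ^+ m * A m i j * h j 0.
  by apply: mulr_ge0 (ltW (h0 j)); apply: mulr_ge0 => //; exact: exprn_ge0 (ltW y0).
have V0 N k i : 0 <= N -> 0 <= V N k i by move=> N0; rewrite le_min yk.
have VW N k i : W N k i <= V N k i.
  by rewrite /W /V le_min !ge_min lexx orbT andbT ler_piMl // ltW.
have inner (N : R) l K i : 0 <= N -> (0 < l)%N ->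
  \sum_(1 <= k < K.+1) (if (l < k.+2)%N then \sum_j A (k.+1 - l)%N i j * V N k j else 0) <= W N l i.
  move=> N0 l0; rewrite le_min; apply/andP; split.
    apply: le_trans (_ : \sum_(1 <= k < K.+1) (if (l < k.+2)%N then y ^+ l.-1 * (\sum_j y ^+ (k.+1 - l) * A (k.+1 - l)%N i j * h j 0) else 0) <= _).
      apply: ler_sum => k _; case: ifP => // hk; rewrite mulr_sumr; apply: ler_sum => j _.
      rewrite [leRHS](_ : _ = A (k.+1 - l)%N i j * (y ^+ k * h j 0)).
        by rewrite ler_wpM2l // ge_min lexx.
      rewrite (_ : y ^+ k = y ^+ l.-1 * y ^+ (k.+1 - l)); first by ring.
      by rewrite -exprD; congr (_ ^+ _); lia.
    apply: le_trans (tri_le (g := fun m => y ^+ l.-1 * (\sum_j y ^+ m * A m i j * h j 0)) l K _) _.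
      by move=> m; rewrite mulr_ge0 ?exprn_ge0 ?(ltW y0) // sumr_ge0.
    rewrite -mulr_sumr; have -> : rho * (y ^+ l * h i 0) = y ^+ l.-1 * (rho * (y * h i 0)).
      by rewrite -{1}(prednK l0) exprSr; ring.
    rewrite ler_wpM2l ?exprn_ge0 ?(ltW y0) //; apply: le_trans (hrho i).
    have hs : rseries_to (fun m => \sum_j y ^+ m * A m i j * h j 0) ((Ay *m h) i 0).
      rewrite mxE; apply: rs_sum => j; have h1 := @hAy i j.
      by rewrite mulrC; apply: rs_ext (rsZ (a := h j 0) h1) => m /=; rewrite mxE mulrC.
    by apply: rs_term hs => m; rewrite sumr_ge0.
  apply: le_trans (_ : \sum_(1 <= k < K.+1) (if (l < k.+2)%N then N * (\sum_j A (k.+1 - l)%N i j) else 0) <= _).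
    apply: ler_sum => k _; case: ifP => // hk; rewrite mulr_sumr; apply: ler_sum => j _.
    by rewrite [leRHS]mulrC ler_wpM2l // ge_min lexx orbT.
  apply: le_trans (tri_le (g := fun m => N * (\sum_j A m i j)) l K _) _.
    by move=> m; rewrite mulr_ge0 ?sumr_ge0.
  rewrite -mulr_sumr ler_piMr // -(row1 i).
  have hs : rseries_to (fun m => \sum_j A m i j) (\sum_j A1 i j) by apply: rs_sum => j; exact: hA1.
  by apply: rs_term hs => m; apply: sumr_ge0.
(* The balance equations summed against [V] up to level [K]. Since level [K + 1] still feeds level
   [K], one boundary term is left; it is at most [N] times the mass of level [K + 1] and vanishes as
   [K] grows. *)
have main (N : R) K : 0 <= N -> \sum_(1 <= k < K.+1) \sum_j xs k 0 j * (V N k j - W N k j) <= C1 + N * \sum_i xs K.+1 0 i.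
  move=> N0.
  have e1 : \sum_(1 <= k < K.+1) \sum_j xs k 0 j * V N k j =
     \sum_(1 <= k < K.+1) \sum_j (x0 *m Bs Q k) 0 j * V N k j +
     \sum_(1 <= l < K.+2) \sum_i xs l 0 i * \sum_(1 <= k < K.+1) (if (l < k.+2)%N then \sum_j A (k.+1 - l)%N i j * V N k j else 0).
    have -> : \sum_(1 <= l < K.+2) \sum_i xs l 0 i * \sum_(1 <= k < K.+1) (if (l < k.+2)%N then \sum_j A (k.+1 - l)%N i j * V N k j else 0)
      = \sum_(1 <= k < K.+1) \sum_(1 <= l < K.+2 | (l < k.+2)%N) \sum_i \sum_j xs l 0 i * A (k.+1 - l)%N i j * V N k j.
      under [RHS]eq_bigr do rewrite big_mkcond.
      rewrite [RHS]exchange_big; apply: eq_bigr => l _ /=.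
      under eq_bigr do rewrite mulr_sumr; rewrite exchange_big; apply: eq_bigr => k _ /=.
      case: ifP => // hk; last by rewrite big1 // => i _; rewrite mulr0.
      by apply: eq_bigr => i _; rewrite mulr_sumr; apply: eq_bigr => j _; rewrite mulrA.
    rewrite -big_split; apply: eq_big_nat => k /andP[k0 kK] /=.
    rewrite -(big_nat_widen 1 k.+2 K.+2 xpredT (fun l => \sum_i \sum_j xs l 0 i * A (k.+1 - l)%N i j * V N k j)) //.
    rewrite {1}(xrec k k0).
    rewrite (eq_bigr (fun j => (x0 *m Bs Q k) 0 j * V N k j + \sum_(1 <= l < k.+2) \sum_i xs l 0 i * A (k.+1 - l)%N i j * V N k j)).
      rewrite big_split /=; congr (_ + _); rewrite exchange_big /=; apply: eq_bigr => l _.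
      by rewrite exchange_big.
    move=> j _; rewrite mxE mulrDl summxE mulr_suml; congr (_ + _); apply: eq_bigr => l _.
    by rewrite mxE mulr_suml.
  have e2 : \sum_(1 <= k < K.+1) \sum_j (x0 *m Bs Q k) 0 j * V N k j <= C1.
    have hs : rseries_to (fun k => \sum_j \sum_i x0 0 i * (y ^+ k * Bs Q k i j) * h j 0) C1.
      rewrite /C1 mxE; apply: rs_sum => j; rewrite mxE mulr_suml; apply: rs_sum => i.
      have h1 := @hBy i j; rewrite (_ : x0 0 i * By i j * h j 0 = x0 0 i * h j 0 * By i j); last by ring.
      by apply: rs_ext (rsZ (a := x0 0 i * h j 0) h1) => k /=; rewrite mxE; ring.
    have s0 k : 0 <= \sum_j \sum_i x0 0 i * (y ^+ k * Bs Q k i j) * h j 0.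
      apply: sumr_ge0 => j _; apply: sumr_ge0 => i _.
      by rewrite mulr_ge0 ?(ltW (h0 j)) // mulr_ge0 ?x00 // mulr_ge0 ?exprn_ge0 // ltW.
    apply: le_trans (rs_term K.+1 s0 hs); rewrite big_ord_recl /= -[leLHS]add0r; apply: lerD; first exact: s0.
    rewrite big_add1 /= big_mkord; apply: ler_sum => k _; apply: ler_sum => j _.
    rewrite mxE mulr_suml; apply: ler_sum => i _; rewrite -!mulrA ler_wpM2l ?x00 //.
    rewrite [leRHS]mulrCA ler_wpM2l // /V ge_min lexx //.
  have e3 : \sum_(1 <= l < K.+2) \sum_i xs l 0 i * (\sum_(1 <= k < K.+1) (if (l < k.+2)%N then \sum_j A (k.+1 - l)%N i j * V N k j else 0))
    <= \sum_(1 <= l < K.+1) \sum_i xs l 0 i * W N l i + N * \sum_i xs K.+1 0 i.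
    rewrite big_nat_recr //=; apply: lerD.
      rewrite big_nat [leRHS]big_nat; apply: ler_sum => l /andP[l0 _]; apply: ler_sum => i _.
      by rewrite ler_wpM2l ?xs0 // inner.
    rewrite mulr_sumr; apply: ler_sum => i _; rewrite [leRHS]mulrC ler_wpM2l ?xs0 //.
    by apply: le_trans (inner N K.+1 K i N0 (ltn0Sn _)) _; rewrite ge_min lexx orbT.
  under eq_bigr do under eq_bigr do rewrite mulrBr.
  under eq_bigr do rewrite sumrB; rewrite sumrB lerBlDr e1.
  apply: le_trans (lerD e2 e3) _; lra.
have [c c0 hc] := fin_pos_lb h0.
have C10 : 0 <= C1.
  rewrite /C1 mxE; apply: sumr_ge0 => j _; rewrite mulr_ge0 ?(ltW (h0 j)) // mxE; apply: sumr_ge0 => i _.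
  rewrite mulr_ge0 ?x00 //; have h1 := @hBy i j; apply: rs_ge0 h1 => k.
  by rewrite mxE mulr_ge0 ?exprn_ge0 // ltW.
have r1 : 0 < 1 - rho by rewrite subr_gt0.
exists (C1 / ((1 - rho) * c)); first by rewrite divr_ge0 // mulr_ge0 // ltW.
(* With this cap [V] and [W] take the values [N] and [rho * N] at [(k, j)], so that single term of
   the sum already isolates [xs k 0 j]. *)
move=> k j k0; pose N := y ^+ k * h j 0.
have N0 : 0 <= N by exact: yk.
have step K : (k <= K)%N -> xs k 0 j * ((1 - rho) * N) <= C1 + N * \sum_i xs K.+1 0 i.
  move=> kK; apply: le_trans (main N K N0).
  have s0 k' i : 0 <= xs k' 0 i * (V N k' i - W N k' i) by rewrite mulr_ge0 ?xs0 // subr_ge0.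
  rewrite (bigD1_seq k) ?iota_uniq //=; last by rewrite mem_index_iota k0 ltnS.
  rewrite -[leLHS]addr0; apply: lerD; last by apply: sumr_ge0 => k' _; exact: sumr_ge0.
  rewrite (bigD1 j) //= -[leLHS]addr0; apply: lerD; last exact: sumr_ge0.
  rewrite ler_wpM2l ?xs0 // /V /W -/N minxx min_l ?mulrBl ?mul1r //.
  by rewrite ler_piMl // ltW.
have lim : xs k 0 j * ((1 - rho) * N) <= C1.
  have hl : (fun K => C1 + N * \sum_i xs K.+1 0 i) @ \oo --> C1.
    rewrite -[X in _ --> X]addr0 -[X in _ --> _ + X](mulr0 N); apply: cvgD; first exact: cvg_cst.
    apply: cvgM; first exact: cvg_cst.
    have /rs_term0 hx := xsum.
    by rewrite -(cvg_shiftS (fun k => if k == 0%N then \sum_j x0 0 j else \sum_j xs k 0 j)) in hx.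
  rewrite -(cvg_lim (@Rhausdorff R) hl); apply: limr_ge; first by apply/cvg_ex; exists C1.
  by exists k => // K /= kK; exact: step.
rewrite mulrAC ler_pdivlMr ?mulr_gt0 // ler_pdivlMr ?exprn_gt0 //; apply: le_trans lim.
rewrite -mulrA ler_wpM2l ?xs0 // mulrAC -mulrA ler_wpM2l ?(ltW r1) //.
by rewrite /N ler_wpM2l ?exprn_ge0 ?(ltW y0).
Qed.
End Lyapunov.

(** * The resolvent of A* on the circle of radius theta *)

Section Phases.
Context {R : realType}.
Local Notation C := (Cplx R).
Local Notation re z := (complex.Re (z : R[i])).
Local Notation im z := (complex.Im (z : R[i])).
Variables (Q : MG1 R) (theta rho B : R) (tau : nat) (p : 'I_(M Q) -> nat)
  (mu : 'rV[R]_(M Q)) (v : 'cV[R]_(M Q)).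
Local Notation n := (M Q).
Local Notation A := (Ablk Q).
Hypotheses (n0 : (0 < n)%N) (A0 : forall k i j, 0 <= A k i j) (t0 : 0 < theta) (tr : theta < rho)
  (hB : forall k i j, `|A k i j| <= B * rho ^- k)
  (hA1 : mxseries_to A (Asum Q)) (irr : mx_irreducible (Asum Q))
  (htau : is_period Q tau) (hp : is_phase tau p)
  (muA : mu *m AstarR Q theta = theta *: mu) (Av : AstarR Q theta *m v = theta *: v)
  (muv : mu *m v = 1) (v0 : forall j, 0 < v j 0).

Definition AstarC (z : C) : 'M[C]_n := \matrix_(i, j) psf (fun k => toC (A k i j)) z.
Definition AstarC' (z : C) : 'M[C]_n := \matrix_(i, j) psf (fun k => toC (k.+1%:R * A k.+1 i j)) z.

Let rho0 : 0 < rho. Proof. exact: lt_trans tr. Qed.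

Lemma Ablk_bound i j : psbound (fun k => toC (A k i j) : C) rho B.
Proof. by split=> k; rewrite nc_real. Qed.

Lemma AstarCE i j : (fun z => AstarC z i j) = psf (fun k => toC (A k i j)).
Proof. by apply: funext => z; rewrite mxE. Qed.

Lemma AstarC_E z i j : AstarC z i j = psf (fun k => toC (A k i j)) z. Proof. exact: mxE. Qed.
Lemma AstarC'_E z i j : AstarC' z i j = psf (fun k => toC (k.+1%:R * A k.+1 i j)) z. Proof. exact: mxE. Qed.

Lemma AstarC_deriv z i j : nc z < rho -> has_cderiv (fun z => AstarC z i j) z (AstarC' z i j).
Proof.
move=> hz; rewrite AstarCE mxE.
have e : (fun k => toC (k.+1%:R * A k.+1 i j) : C) = (fun k => (k.+1%:R : C) * toC (A k.+1 i j)).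
  by apply: funext => k; rewrite toCM toC_nat.
rewrite e; exact (ps_deriv rho0 (Ablk_bound i j) hz).
Qed.

Lemma AstarR_series y : 0 <= y -> y < rho -> mxseries_to (fun k => y ^+ k *: A k) (AstarR Q y).
Proof. exact: bound_series. Qed.

Lemma AstarC_real y : 0 <= y -> y < rho -> AstarC (toC y) = mxC (AstarR Q y).
Proof.
move=> y0 yr; apply/matrixP => i j; rewrite !mxE; apply: psf_real.
have hs := AstarR_series y0 yr; have := @hs i j; rewrite /AstarR mxE; apply: rs_ext => k; by rewrite mxE.
Qed.

Lemma cvg_re (x : nat -> C) (l : C) : x @ \oo --> l -> (fun k => re (x k)) @ \oo --> re l.
Proof.
move=> /cvgCP h; apply/cvgrPdist_lt => e e0; apply: filterS (h e e0) => k.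
by apply: le_lt_trans; rewrite -reB; exact: Re_le_nc.
Qed.

Lemma psf_re (h : nat -> C) r K z (c : C) : 0 < r -> psbound h r K -> nc z < r ->
  rseries_to (fun k => re (h k * z ^+ k * c)) (re (psf h z * c)).
Proof.
move=> r0 hb hz; have h1 : (fun m => psum h z m * c) @ \oo --> psf h z * c.
  by apply: cvgM; [exact: ps_cvg r0 hb hz|exact: cvg_cst].
rewrite /rseries_to; have := cvg_re h1; apply: cvg_trans; apply: near_eq_cvg; near=> m.
by rewrite /psum mulr_suml re_sum.
Unshelve. all: by end_near. Qed.

Lemma re1_eq1 (z : C) : nc z <= 1 -> re z = 1 -> z = 1.
Proof.
case: z => x y; rewrite /nc /= => h e; rewrite e in h *; congr Complex.
have : 1 ^+ 2 + y ^+ 2 <= 1 by rewrite -[leRHS](expr1n _ 2) -[leLHS]sqr_sqrtr ?lerXn2r ?nnegrE ?sqrtr_ge0 ?addr_ge0 ?sqr_ge0.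
by rewrite expr1n gerDl => h2; apply/eqP; rewrite -sqrf_eq0 eq_le h2 sqr_ge0.
Qed.

Lemma Asum_term i j : 0 < Asum Q i j -> exists k, 0 < A k i j.
Proof.
move=> a0; apply: contrapT => h; move: a0; rewrite (_ : Asum Q i j = 0) ?ltxx //.
have h1 := @hA1 i j; apply: rs_unique h1 _; apply: rs_ext rs0 => k; apply/eqP; rewrite eq_sym eq_le A0 andbT leNgt.
by apply/negP => hk; apply: h; exists k.
Qed.

Lemma irr_propagate (P : 'I_n -> Prop) i : P i -> (forall k i j, 0 < A k i j -> P i -> P j) -> forall j, P j.
Proof.
move=> Pi step j; have [s [_ hs <-]] := irr i j.
elim: s i Pi hs {j} => //= x s IH i Pi /andP[hx]; apply: IH.
by have [k hk] := Asum_term hx; exact: step hk Pi.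
Qed.

(** [is_phase] gives [k = 1 + p j - p i] modulo [tau]. This is what makes a rotation of the argument
    of A* a diagonal similarity up to the factor [om]. *)
Lemma phase_exp (om : C) k i j : nc om = 1 -> om ^+ tau = 1 -> 0 < A k i j -> om ^+ k = om * om ^+ p j * om ^- p i.
Proof.
move=> om1 h hk; have om0 : om != 0 by rewrite -nc_eq0 om1 oner_eq0.
have := hp.2 k i j hk; case/dvdzP => q e.
have e2 : om ^ (k%:Z) = om ^ (q * tau%:Z + 1 + (p j)%:Z - (p i)%:Z) by congr (_ ^ _); lia.
move: e2; rewrite -exprnP => ->; rewrite !expfzDr // (mulrC q) -exprz_exp -exprnP h exp1rz mul1r expr1z.
by rewrite -exprnN -exprnP.
Qed.

Section Kernel.
Variables (om : C) (u : 'cV[C]_n).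
Local Notation w := (toC theta * om).
Hypotheses (om1 : nc om = 1) (hu : AstarC w *m u = w *: u) (u0 : u != 0).
Let phi i : C := u i 0 / toC (v i 0).

Let v0C i : (toC (v i 0) : C) != 0. Proof. by rewrite -nc_eq0 nc_real normr_eq0 gt_eqF. Qed.
Let om0 : om != 0. Proof. by rewrite -nc_eq0 om1 oner_eq0. Qed.
Let hw : nc w = theta. Proof. by rewrite ncM nc_real om1 mulr1 ger0_norm ?ltW. Qed.

(* A weighted mean of points of the unit disc equals 1 only if all of them are 1. *)
Lemma kernel_max i k j : (forall l, nc (phi l) <= nc (phi i)) -> phi i != 0 -> 0 < A k i j ->
  om ^+ k * phi j = om * phi i.
Proof.
move=> hmax pi0 hk.
pose c : C := (om * phi i)^-1.
pose psi k j : C := om ^+ k * phi j * c.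
have psi1 k' l : nc (psi k' l) <= 1.
  rewrite /psi /c ncM ncM ncX om1 expr1n mul1r ncV ncM om1 mul1r ler_pdivrMr ?mul1r ?hmax //.
  by rewrite nc_gt0.
have re1 k' l : re (psi k' l) <= 1 by apply: le_trans (ler_norm _) (le_trans (Re_le_nc _) (psi1 _ _)).
have tl : theta < rho by [].
have hr (l : 'I_n) : rseries_to (fun k => theta ^+ k * A k i l * v l 0) (AstarR Q theta i l * v l 0).
  have hs := AstarR_series (ltW t0) tl; have h1 := @hs i l; rewrite mulrC.
  by apply: rs_ext (rsZ (a := v l 0) h1) => k' /=; rewrite mxE mulrC.
have hl l : rseries_to (fun k => theta ^+ k * A k i l * v l 0 * re (psi k l)) (re (AstarC w i l * (u l 0 * c))).
  have hwr : nc w < rho by rewrite hw.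
  rewrite mxE; have := psf_re (c := u l 0 * c) rho0 (Ablk_bound i l) hwr; apply: rs_ext => k'.
  have -> : toC (A k' i l) * w ^+ k' * (u l 0 * c) = toC (theta ^+ k' * A k' i l * v l 0) * psi k' l :> C.
    rewrite !toCM toCX /psi /phi exprMn; field.
    exact: v0C.
  by rewrite reM /= mul0r subr0.
have e1 : \sum_l AstarR Q theta i l * v l 0 = theta * v i 0.
  by have := congr1 (fun M : 'cV[R]_n => M i 0) Av; rewrite /= !mxE.
have e2 : \sum_l re (AstarC w i l * (u l 0 * c)) = theta * v i 0.
  rewrite -re_sum.
  have -> : \sum_l AstarC w i l * (u l 0 * c) = toC (theta * v i 0) :> C; last by [].
  under eq_bigr do rewrite mulrA; rewrite -mulr_suml.
  have := congr1 (fun M : 'cV[C]_n => M i 0) hu; rewrite /= [LHS]mxE [RHS]mxE => ->.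
  have -> : u i 0 = toC (v i 0) * phi i by rewrite /phi mulrC divfK.
  by rewrite /c toCM; field; rewrite om0 pi0.
have le' l k' : theta ^+ k' * A k' i l * v l 0 * re (psi k' l) <= theta ^+ k' * A k' i l * v l 0.
  by rewrite ler_piMr // mulr_ge0 ?(ltW (v0 l)) // mulr_ge0 // exprn_ge0 // ltW.
have lL l := rs_le (le' l) (hl l) (hr l).
suff re1' : re (psi k j) = 1.
  have := re1_eq1 (psi1 k j) re1'; rewrite /psi /c => e.
  have ne : om * phi i != 0 by rewrite mulf_neq0.
  by rewrite -[LHS](divfK ne) e mul1r.
apply/eqP; rewrite eq_le re1 /= leNgt; apply/negP => lt1.
have lt' : theta ^+ k * A k i j * v j 0 * re (psi k j) < theta ^+ k * A k i j * v j 0.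
  by rewrite gtr_pMr // !mulr_gt0 // exprn_gt0.
have lt2 := rs_lt (le' j) lt' (hl j) (hr j).
have : \sum_l re (AstarC w i l * (u l 0 * c)) < \sum_l AstarR Q theta i l * v l 0.
  by rewrite (bigD1 j) //= [ltRHS](bigD1 j) //=; apply: ltr_leD => //; apply: ler_sum.
by rewrite e1 e2 ltxx.
Qed.

(** Maximality of [nc (phi l)] propagates along the support of [A], so by irreducibility every index
    is maximal and [kernel_max] applies everywhere. *)
Lemma kernel_phase k i j : 0 < A k i j -> om ^+ k * phi j = om * phi i.
Proof.
have [i0 hi0] : exists i0, forall l, nc (phi l) <= nc (phi i0).
  have i1 : 'I_n by exact: Ordinal n0.
  have := @arg_maxP _ _ _ i1 xpredT (fun l => nc (phi l)) isT; case=> i' _ h.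
  by exists i' => l; exact: h.
have p0 : phi i0 != 0.
  have [l hl] : exists l, u l 0 != 0.
    apply: contrapT => h; move/negP: u0; apply; apply/eqP/matrixP => l m; rewrite ord1 mxE.
    by apply/eqP; apply: contrapT => /negP h2; apply: h; exists l.
  rewrite -nc_gt0; apply: lt_le_trans (hi0 l); rewrite nc_gt0 mulf_neq0 //.
  by rewrite invr_eq0.
have all_eq : forall l, nc (phi l) = nc (phi i0).
  apply: (irr_propagate (P := fun l => nc (phi l) = nc (phi i0)) (i := i0)) => [//|k' a b hab ha].
  have h1 : forall l, nc (phi l) <= nc (phi a) by move=> l; rewrite ha.
  have h2 : phi a != 0 by rewrite -nc_gt0 ha nc_gt0.
  have := congr1 nc (kernel_max h1 h2 hab); rewrite ncM ncX om1 expr1n mul1r ncM om1 mul1r => ->; exact ha.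
move=> hk; apply: kernel_max hk => [l|]; first by rewrite !all_eq.
by rewrite -nc_gt0 all_eq nc_gt0.
Qed.

Lemma kernel_nonzero i : phi i != 0.
Proof.
have ex : exists l, phi l != 0.
  apply: contrapT => h; move/negP: u0; apply; apply/eqP/matrixP => l m; rewrite ord1 mxE.
  apply/eqP; apply: contrapT => /negP h2; apply: h; exists l; rewrite mulf_neq0 // invr_eq0 //.
have [l hl] := ex; apply: (irr_propagate (P := fun l => phi l != 0) hl) => k a b hab ha.
by apply: contraNneq (mulf_neq0 om0 ha) => e; rewrite -(kernel_phase hab) e mulr0.
Qed.

(** Along a path of the additive process the relation of [kernel_phase] telescopes, so a return to
    the same phase with displacement [k] forces [om ^ k = 1]. The order of [om] divides all such
    [k], hence their gcd [tau]. *)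
Lemma kernel_root : om ^+ tau = 1.
Proof.
have hS j k : MAP_reach (Q := Q) j k -> om ^ k = 1.
  move=> [s [_ hs hl]].
  have gen : forall s a (i : 'I_n), path (@MAP_step _ Q) (a, i) s ->
     om ^ (last (a, i) s).1 * phi (last (a, i) s).2 = om ^ a * phi i.
    elim=> //= -[b l] s' IH a i /andP[/andP[/= ab hA] /IH ->].
    have e : b = (a - 1 + (absz (b - a + 1))%:Z)%R by lia.
    rewrite {1}e expfzDr // -mulrA -exprnP (kernel_phase hA) mulrA; congr (_ * _).
    by rewrite -{2}(expr1z om) -expfzDr // subrK.
  have := gen s 0%Z j hs; rewrite hl /= expr0z mul1r => e.
  by apply: (mulIf (kernel_nonzero j)); rewrite e mul1r.
have ha (k : int) : om ^ k = 1 -> om ^+ `|k|%N = 1.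
  by case: k => m //= /(congr1 GRing.inv); rewrite /exprz invrK invr1.
pose j0 : 'I_n := Ordinal n0; have [d1 d2] := htau j0.
have tau0 : (0 < tau)%N by exact: leq_ltn_trans (hp.1 j0).
(* Some nonzero displacement is reachable, for otherwise the gcd property would let 0 divide the
   positive [tau]; hence [om] has finite order. *)
have [k0 [k00 k0r]] : exists k, k != 0 /\ MAP_reach j0 k.
  apply: contrapT => h; have := d2 0%N; rewrite dvd0n (gtn_eqF tau0) => h2.
  by have // : false by apply: h2 => k hk; case: h; exists k.
have k0p : (0 < `|k0|)%N by rewrite absz_gt0.
have [m mp _] := prim_order_exists k0p (ha _ (hS _ _ k0r)).
apply/eqP; rewrite -(prim_order_dvd mp); apply: d2 => k [_ kr].
by rewrite dvdzE /= (prim_order_dvd mp) ha // (hS _ _ kr).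
Qed.

(** [om ^+ p j * phi j] is constant along the support of [A], hence constant, which leaves one
    degree of freedom. *)
Lemma kernel_vec : exists c, u = c *: (DeltaM p om *m mxC v).
Proof.
pose i0 : 'I_n := Ordinal n0; exists (om ^+ p i0 * phi i0).
have h : forall j, om ^+ p j * phi j = om ^+ p i0 * phi i0.
  apply: (irr_propagate (P := fun j => om ^+ p j * phi j = om ^+ p i0 * phi i0) (i := i0)) => // k i j hk <-.
  have := kernel_phase hk; rewrite (phase_exp om1 kernel_root hk) => e.
  have e2 : om * (om ^+ p j * phi j) = om * (om ^+ p i * phi i).
    have pn : om ^+ p i != 0 by rewrite expf_neq0.
    transitivity (om ^+ p i * (om * om ^+ p j * om ^- p i * phi j)); last by rewrite e mulrCA.
    by rewrite -!mulrA; do 2 (rewrite [RHS]mulrCA; congr (_ * _)); rewrite mulrA divff ?mul1r.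
  exact: (mulfI om0 e2).
apply/matrixP => j l; rewrite ord1 mxE /DeltaM mul_diag_mx !mxE -(h j) /phi.
have pn : om ^+ p j != 0 by rewrite expf_neq0.
by field; rewrite v0C pn.
Qed.
End Kernel.

Lemma psf_scale (h : nat -> C) z a : psf h (z * a) = psf (fun k => h k * a ^+ k) z.
Proof.
rewrite /psf (_ : psum h (z * a) = psum (fun k => h k * a ^+ k) z) //; apply: funext => m.
by apply: eq_bigr => k _; rewrite exprMn mulrA mulrAC.
Qed.

Lemma dAblk_bound i j r : 0 < r -> r < rho ->
  exists K, psbound (fun k => toC (k.+1%:R * A k.+1 i j) : C) r K.
Proof.
move=> r0 rr; have [K hK] := psbound_mulk r0 rr (psbound_shift rho0 (Ablk_bound i j)).
exists K; split=> k; rewrite (toCM k.+1%:R (A k.+1 i j)) toC_nat; exact: (psboundE k hK).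
Qed.

Lemma rs_shift (f : nat -> R) l : f 0%N = 0 -> rseries_to (f \o S) l -> rseries_to f l.
Proof.
move=> f0 h; rewrite /rseries_to -(cvg_shiftS (fun m => \sum_(k < m) f k)).
by move: h; rewrite /rseries_to; under [in X in _ -> X]eq_fun do rewrite big_ord_recl f0 add0r.
Qed.

Definition AstarR' : 'M[R]_n := mxseries (fun k => theta ^+ k *: (k.+1%:R *: A k.+1)).

Lemma AstarR'_series : mxseries_to (fun k => theta ^+ k *: (k.+1%:R *: A k.+1)) AstarR'.
Proof.
move=> i j; have r0 : 0 < (theta + rho) / 2 by rewrite divr_gt0 ?addr_gt0.
have rr : (theta + rho) / 2 < rho by rewrite midf_lt.
have rt : theta < (theta + rho) / 2 by rewrite midf_lt.
have [K hK] := dAblk_bound i j r0 rr.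
have q01 : 0 <= theta / ((theta + rho) / 2) < 1 by rewrite divr_ge0 ?(ltW r0) ?ltW //= ltr_pdivrMr // mul1r.
have [|l hl] := @rs_geom _ (fun k => (theta ^+ k *: (k.+1%:R *: A k.+1)) i j) K _ q01.
  move=> k; have := psboundE k hK; rewrite nc_real => h.
  rewrite mxE [X in _ * X]mxE normrM (ger0_norm (exprn_ge0 _ (ltW t0))).
  by rewrite expr_div_n mulrCA -exprVn ler_wpM2l ?exprn_ge0 ?(ltW t0) // exprVn.
by rewrite /AstarR' mxE (cvg_lim (@Rhausdorff R) hl).
Qed.

Lemma AstarR'_drift : mxseries_to (fun k => k%:R *: (theta ^+ k *: A k)) (theta *: AstarR').
Proof.
move=> i j; apply: rs_shift; first by rewrite !mxE mul0r.
have h := @AstarR'_series i j; rewrite mxE; apply: rs_ext (rsZ (a := theta) h) => k /=.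
by rewrite !mxE exprS; ring.
Qed.

Lemma AstarC'_real : AstarC' (toC theta) = mxC AstarR'.
Proof.
apply/matrixP => i j; rewrite mxE [RHS]mxE; apply: psf_real.
by have h := @AstarR'_series i j; apply: rs_ext h => k; rewrite !mxE.
Qed.

Lemma scalar_mx_subE (F : nzRingType) m (a : F) (X : 'M[F]_m) i j : (a%:M - X) i j = a *+ (i == j) - X i j.
Proof. by rewrite !mxE. Qed.

Lemma scalar_mx_sub_deriv m (X : C -> 'M[C]_m) w (X1 : 'M[C]_m) i j : has_cderiv (fun z => X z i j) w (X1 i j) ->
  has_cderiv (fun z => (z%:M - X z) i j) w ((1%:M - X1) i j).
Proof.
move=> /has_cderivP hd; apply/has_cderivP => x x0; have [d d0 h] := hd x x0; exists d => // z hz.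
have gen (b : bool) (a1 a2 a3 x1 x2 : C) :
  - (a1 - a2 - a3 * (x1 - x2)) = (x1 *+ b - a1) - (x2 *+ b - a2) - (1 *+ b - a3) * (x1 - x2).
  by case: b; rewrite ?mulr1n ?mulr0n; ring.
by rewrite !scalar_mx_subE -gen ncN; exact (h z hz).
Qed.

Section Rotation.
Variable om : C.
Hypotheses (om1 : nc om = 1) (omt : om ^+ tau = 1).
Let om0 : om != 0. Proof. by rewrite -nc_eq0 om1 oner_eq0. Qed.
Let pn i : om ^+ p i != 0. Proof. exact: expf_neq0. Qed.

(** Entrywise form of A*(z om) = om Delta(om) A*(z) Delta(om)^-1; each coefficient in the support is
    rotated by [phase_exp]. *)
Lemma AstarC_rot z i j : nc z < rho -> AstarC (z * om) i j = om * om ^+ p j * om ^- p i * AstarC z i j.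
Proof.
move=> hz; refine (etrans (etrans (AstarC_E (z * om) i j) (psf_scale _ z om)) _).
refine (etrans _ (congr1 (fun t => _ * t) (esym (AstarC_E z i j)))).
rewrite (_ : (fun k => _) = (fun k => (om * om ^+ p j * om ^- p i) * toC (A k i j))).
  exact: (psfZ _ rho0 (Ablk_bound i j) hz).
apply: funext => k; have [->|nz] := eqVneq (A k i j) 0; first by rewrite toC0 mul0r mulr0.
have hk : 0 < A k i j by rewrite lt_neqAle eq_sym nz A0.
by rewrite (phase_exp om1 omt hk) mulrC.
Qed.

Lemma AstarC'_rot i j : AstarC' (toC theta * om) i j = om ^+ p j * om ^- p i * AstarC' (toC theta) i j.
Proof.
have r0 : 0 < (theta + rho) / 2 by rewrite divr_gt0 ?addr_gt0.
have rr : (theta + rho) / 2 < rho by rewrite midf_lt.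
have rt : nc (toC theta) < (theta + rho) / 2 by rewrite nc_real gtr0_norm // midf_lt.
have [K hK] := dAblk_bound i j r0 rr.
refine (etrans (etrans (AstarC'_E (toC theta * om) i j) (psf_scale _ (toC theta) om)) _).
refine (etrans _ (congr1 (fun t => _ * t) (esym (AstarC'_E (toC theta) i j)))).
rewrite (_ : (fun k => _) = (fun k => (om ^+ p j * om ^- p i) * toC (k.+1%:R * A k.+1 i j))).
  exact: (psfZ _ r0 hK rt).
apply: funext => k; have [->|nz] := eqVneq (A k.+1 i j) 0; first by rewrite mulr0 toC0 mul0r mulr0.
have hk : 0 < A k.+1 i j by rewrite lt_neqAle eq_sym nz A0.
rewrite mulrC; congr (_ * _); apply: (mulfI om0); rewrite -exprS (phase_exp om1 omt hk); ring.
Qed.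

Lemma DeltaM_inv : invmx (DeltaM p om) = diag_mx (\row_i om ^+ p i).
Proof.
have e : DeltaM p om *m diag_mx (\row_i om ^+ p i) = 1%:M.
  apply/matrixP => i j; rewrite /DeltaM mul_diag_mx !mxE; case: eqP => [->|_]; last by rewrite mulr0.
  by rewrite mulr1n mulVf.
have [u1 _] := mulmx1_unit e.
by rewrite -[LHS]mulmx1 -e mulmxA mulVmx // mul1mx.
Qed.

Let vw := DeltaM p om *m mxC v.
Let muw := mxC mu *m invmx (DeltaM p om).

Lemma vwE i : vw i 0 = om ^- p i * toC (v i 0).
Proof. by rewrite /vw /DeltaM mul_diag_mx !mxE. Qed.

Lemma muwE j : muw 0 j = toC (mu 0 j) * om ^+ p j.
Proof. by rewrite /muw DeltaM_inv mul_mx_diag !mxE. Qed.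

Let t0r : nc (toC theta) < rho. Proof. by rewrite nc_real gtr0_norm. Qed.

Lemma AstarC_vw : AstarC (toC theta * om) *m vw = (toC theta * om) *: vw.
Proof.
apply/matrixP => i j; rewrite ord1 mxE [RHS]mxE vwE.
transitivity (om * om ^- p i * toC (\sum_j AstarR Q theta i j * v j 0)).
  rewrite toC_sum mulr_sumr; apply: eq_bigr => k _.
  rewrite (AstarC_rot i k t0r) vwE (AstarC_real (ltW t0) tr) [mxC _ i k]mxE toCM.
  by field; rewrite !pn.
have := congr1 (fun M : 'cV[R]_n => M i 0) Av; rewrite /= mxE [RHS]mxE => ->.
by rewrite toCM; ring.
Qed.

Lemma AstarC_muw : muw *m AstarC (toC theta * om) = (toC theta * om) *: muw.
Proof.
apply/matrixP => i j; rewrite ord1 mxE [RHS]mxE muwE.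
transitivity (om * om ^+ p j * toC (\sum_i mu 0 i * AstarR Q theta i j)).
  rewrite toC_sum mulr_sumr; apply: eq_bigr => k _.
  rewrite (AstarC_rot k j t0r) muwE (AstarC_real (ltW t0) tr) [mxC _ k j]mxE toCM.
  by field; rewrite !pn.
have := congr1 (fun M : 'rV[R]_n => M 0 j) muA; rewrite /= mxE [RHS]mxE => ->.
by rewrite toCM; ring.
Qed.

Lemma muw_vw : muw *m vw = 1%:M.
Proof.
apply/matrixP => i j; rewrite !ord1 mxE [RHS]mxE eqxx.
transitivity (toC (\sum_i mu 0 i * v i 0) : C).
  rewrite toC_sum; apply: eq_bigr => k _; rewrite muwE vwE toCM; by field.
by have := congr1 (fun M : 'M[R]_1 => M 0 0) muv; rewrite /= !mxE => ->.
Qed.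

Lemma muw_AstarC'_vw : (muw *m AstarC' (toC theta * om) *m vw) 0 0 = toC ((mu *m AstarR' *m v) 0 0).
Proof.
rewrite mxE [in RHS]mxE toC_sum; apply: eq_bigr => j _ /=.
rewrite mxE [in RHS]mxE !mulr_suml toC_sum; apply: eq_bigr => i _.
rewrite muwE vwE AstarC'_rot AstarC'_real [mxC _ i j]mxE !toCM; field.
by rewrite !pn.
Qed.

(** [simple_pole] with the rotated eigenvectors: one-dimensionality of the kernel is [kernel_vec],
    and the derivative paired with them is 1 minus the twisted drift at [theta], the same number for
    every [om]. *)
Lemma resolvent_pole : 1 < (mu *m AstarR' *m v) 0 0 ->
  (exists2 d : R, 0 < d & forall z, z != toC theta * om -> nc (z - toC theta * om) < d -> z%:M - AstarC z \in unitmx) /\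
  forall i j, (fun z => (z - toC theta * om) * (invmx (z%:M - AstarC z)) i j) @ (toC theta * om)^' -->
    (1 - toC ((mu *m AstarR' *m v) 0 0))^-1 * (vw i 0 * muw 0 j).
Proof.
move=> d1; set w := toC theta * om.
have hw : nc w = theta by rewrite /w ncM nc_real om1 mulr1 gtr0_norm.
have e : (muw *m (1%:M - AstarC' w) *m vw) 0 0 = 1 - toC ((mu *m AstarR' *m v) 0 0).
  by rewrite mulmxBr mulmx1 mulmxBl mxE [X in X + _](_ : _ = 1) ?[X in _ + X]mxE ?muw_AstarC'_vw // muw_vw mxE.
rewrite -e; apply: simple_pole.
- move=> i j; have hr : nc w < rho by rewrite hw.
  exact (scalar_mx_sub_deriv (@AstarC_deriv w i j hr)).
- by rewrite mulmxBl mul_scalar_mx AstarC_vw subrr.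
- by rewrite mulmxBr mul_mx_scalar AstarC_muw subrr.
- exact: muw_vw.
- move=> u hu; have [->|u0] := eqVneq u 0; first by exists 0; rewrite scale0r.
  apply: (kernel_vec om1 _ u0); apply/eqP; rewrite eq_sym -subr_eq0.
  by rewrite mulmxBl mul_scalar_mx in hu; rewrite hu.
- rewrite e subr_eq0 -toC1; apply/eqP => /toC_inj e2; by rewrite -e2 ltxx in d1.
Qed.
End Rotation.

Lemma resolvent_regular om : nc om = 1 -> om ^+ tau != 1 ->
  (toC theta * om)%:M - AstarC (toC theta * om) \in unitmx.
Proof.
move=> om1 omt; apply: unitmx_ker => u hu; have [//|u0] := eqVneq u 0.
have hk : AstarC (toC theta * om) *m u = (toC theta * om) *: u.
  by apply/eqP; rewrite eq_sym -subr_eq0; rewrite mulmxBl mul_scalar_mx in hu; rewrite hu.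
by move/eqP: omt => []; exact: kernel_root om1 hk u0.
Qed.
End Phases.

(** [eigenvalue] speaks of row vectors, while the Perron vectors at hand are columns. *)
Lemma eigenvalue_col (F : fieldType) n (X : 'M[F]_n) a :
  eigenvalue X a <-> exists2 u : 'cV_n, u != 0 & X *m u = a *: u.
Proof.
have sub (Y : 'M[F]_n) (y : 'cV_n) : ((Y - a%:M) *m y == 0) = (Y *m y == a *: y).
  by rewrite mulmxBl mul_scalar_mx subr_eq0.
split=> [/eigenvalueP[x hx x0]|[u u0 hu]].
  have ns : X - a%:M \notin unitmx.
    apply: contraNN x0 => hun; have h : x *m (X - a%:M) = 0 by rewrite mulmxBr mul_mx_scalar hx subrr.
    by rewrite -[x]mulmx1 -(mulmxV hun) mulmxA h mul0mx.
  have [u u0 hu] := nonunit_ker ns; exists u => //.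
  by apply/eqP; rewrite -sub hu.
have ns : (X - a%:M)^T \notin unitmx.
  rewrite unitmx_tr; apply: contraNN u0 => hun; have /eqP h : (X - a%:M) *m u == 0 by rewrite sub hu.
  by rewrite -[u]mul1mx -(mulVmx hun) -mulmxA h mulmx0.
have [x x0 hx] := nonunit_ker ns; apply/eigenvalueP; exists x^T.
  apply/eqP; rewrite -subr_eq0 -mul_mx_scalar -mulmxBr -[X in _ *m X]trmxK -trmx_mul hx trmx0 //.
by apply: contraNneq x0 => e; rewrite -[x]trmxK e trmx0.
Qed.

(** * For a nonnegative matrix with a positive eigenvector, delta is its eigenvalue *)

Section PerronDelta.
Context {R : realType}.
Local Notation C := (Cplx R).
Variables (n : nat) (X : 'M[R]_n) (l : R) (h : 'cV[R]_n).
Hypotheses (n0 : (0 < n)%N) (X0 : nonneg_mx X) (h0 : forall i, 0 < h i 0) (Xh : X *m h = l *: h).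

Lemma mxC_mul m k q (P : 'M[R]_(m, k)) (S : 'M[R]_(k, q)) : mxC (P *m S) = mxC P *m mxC S.
Proof. by apply/matrixP => i j; rewrite !mxE toC_sum; apply: eq_bigr => r _; rewrite !mxE toCM. Qed.

Let l0 : 0 <= l.
Proof.
pose i : 'I_n := Ordinal n0.
have := congr1 (fun M : 'cV[R]_n => M i 0) Xh; rewrite /= [RHS]mxE => e.
rewrite -(pmulr_lge0 l (h0 i)) -e mxE; apply: sumr_ge0 => j _; exact: mulr_ge0 (X0 _ _) (ltW (h0 j)).
Qed.

(** An eigenvector is compared with the positive one at an index where the ratio of moduli is
    largest. *)
Lemma spectral_radius_le (e : C) : eigenvalue (mxC X) e -> nc e <= l.
Proof.
move=> /eigenvalue_col[u u0 hu].
have [i hi] : exists i, forall j, nc (u j 0) / h j 0 <= nc (u i 0) / h i 0.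
  have := @arg_maxP _ _ _ (Ordinal n0) xpredT (fun j => nc (u j 0) / h j 0) isT; case=> i _ H.
  by exists i => j; exact: H.
set t := nc (u i 0) / h i 0 in hi.
have le_t j : nc (u j 0) <= t * h j 0 by rewrite -ler_pdivrMr ?hi.
have t0 : 0 < t.
  rewrite lt_neqAle eq_sym divr_ge0 ?nc_ge0 ?ltW // andbT; apply: contraNneq u0 => e0.
  apply/eqP/matrixP => j k; rewrite ord1 mxE; apply/eqP; rewrite -nc_eq0 eq_le nc_ge0 andbT.
  by have := le_t j; rewrite e0 mul0r.
have ui : nc (u i 0) = t * h i 0 by rewrite /t divfK // gt_eqF.
have := congr1 (fun M : 'cV[C]_n => M i 0) hu; rewrite /= [RHS]mxE => e1.
have : nc e * nc (u i 0) <= l * (t * h i 0).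
  rewrite -ncM -e1 mxE; apply: le_trans (nc_sum _ _ _) _.
  apply: le_trans (_ : \sum_j X i j * (t * h j 0) <= _).
    by apply: ler_sum => j _; rewrite ncM mxE nc_real ger0_norm // ler_wpM2l.
  have := congr1 (fun M : 'cV[R]_n => M i 0) Xh; rewrite /= mxE [RHS]mxE => e2.
  rewrite (eq_bigr (fun j => t * (X i j * h j 0))) => [|j _]; last by rewrite mulrCA.
  by rewrite -mulr_sumr e2 mulrCA.
by rewrite ui ler_pM2r // mulr_gt0.
Qed.

(** [delta] chooses some number satisfying [is_delta], so uniqueness has to be shown: maximal
    modulus gives [nc d = l], comparison with the eigenvalue [l] gives real part [l], and both
    together leave no imaginary part. *)
Lemma delta_perron : delta (mxC X) = toC l.
Proof.
have eig : eigenvalue (mxC X) (toC l).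
  apply/eigenvalue_col; exists (mxC h).
    apply: contraTneq (h0 (Ordinal n0)) => e; have := congr1 (fun M : 'cV[C]_n => M (Ordinal n0) 0) e.
    by rewrite /= !mxE => /toC_inj ->; rewrite ltxx.
  by rewrite -mxC_mul Xh; apply/matrixP => i j; rewrite !mxE toCM.
have hl : is_delta (mxC X) (toC l).
  split=> // e he; have h1 := spectral_radius_le he.
    by rewrite !normCE leC_real nc_real ger0_norm.
  by move=> _; apply: le_trans (ler_norm _) (le_trans (Re_le_nc _) h1).
have := @xgetPex _ 0 (is_delta (mxC X)) (ex_intro _ _ hl); rewrite -/(delta (mxC X)).
move: (delta (mxC X)) => d [d1 d2 d3 d4].
have e1 : nc d = l.
  apply: le_anti; rewrite spectral_radius_le //=.
  by have := d2 _ eig; rewrite !normCE leC_real nc_real ger0_norm.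
have e2 : complex.Re (d : R[i]) = l.
  apply: le_anti; apply/andP; split; first by rewrite -e1; apply: le_trans (ler_norm _) (Re_le_nc _).
  apply: (d3 _ eig); rewrite !normCE e1 nc_real ger0_norm //.
case: d e1 e2 {d1 d2 d3 d4} => x y; rewrite /nc /= => e1 e2; rewrite e2 in e1 *; congr Complex.
have : l ^+ 2 + y ^+ 2 = l ^+ 2 by rewrite -{2}e1 sqr_sqrtr // addr_ge0 ?sqr_ge0.
by rewrite -[RHS]addr0 => /addrI /eqP; rewrite sqrf_eq0 => /eqP.
Qed.
End PerronDelta.

(** * The derivative of delta(A*(y)) at theta *)

Section DeltaDerivative.
Context {R : realType}.
Local Notation C := (Cplx R).
Variables (Q : MG1 R) (theta rho B : R) (tau : nat) (p : 'I_(M Q) -> nat)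
  (mu : 'rV[R]_(M Q)) (v : 'cV[R]_(M Q)).
Local Notation n := (M Q).
Local Notation A := (Ablk Q).
Hypotheses (n0 : (0 < n)%N) (A0 : forall k i j, 0 <= A k i j) (t0 : 0 < theta) (tr : theta < rho)
  (hB : forall k i j, `|A k i j| <= B * rho ^- k)
  (hA1 : mxseries_to A (Asum Q)) (irr : mx_irreducible (Asum Q))
  (htau : is_period Q tau) (hp : is_phase tau p)
  (muA : mu *m AstarR Q theta = theta *: mu) (Av : AstarR Q theta *m v = theta *: v)
  (muv : mu *m v = 1) (mu0 : forall j, 0 < mu 0 j) (v0 : forall j, 0 < v j 0).

Let hser := AstarR_series t0 tr hB.

Lemma AstarR_irr y : 0 < y -> y < rho -> nonneg_mx (AstarR Q y) /\ mx_irreducible (AstarR Q y).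
Proof.
move=> y0 yr; have hs := hser (ltW y0) yr.
have pos k i j : 0 <= (y ^+ k *: A k) i j by rewrite mxE mulr_ge0 // exprn_ge0 // ltW.
split=> [i j|i j]; first by have h := @hs i j; apply: rs_ge0 h => k; exact: pos.
have [s [s0 sp sl]] := irr i j; exists s; split=> //; apply: sub_path sp => a b hab.
have [k hk] := Asum_term A0 hA1 hab; have h := @hs a b.
apply: lt_le_trans (rs_ge_term k (fun k => pos k a b) h); by rewrite mxE mulr_gt0 // exprn_gt0.
Qed.

Let f (y : R) : R := complex.Re (delta (mxC (AstarR Q y)) : R[i]).

(** The normalisation against [mu] gives [mu *m (h - v) = 0], which is what lets [deflated_unit]
    control [h - v]. *)
Lemma delta_eig y : 0 < y -> y < rho -> exists h : 'cV[R]_n,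
  [/\ forall i, 0 < h i 0, AstarR Q y *m h = f y *: h & \sum_i mu 0 i * h i 0 = 1].
Proof.
move=> y0 yr; have [nn ir] := AstarR_irr y0 yr.
have [l [h h0 hl]] := perron_frobenius n0 nn ir.
have fy : f y = l by rewrite /f (delta_perron n0 nn h0 hl).
have s0 : 0 < \sum_i mu 0 i * h i 0.
  rewrite (bigD1 (Ordinal n0)) //= ltr_pwDl ?mulr_gt0 // sumr_ge0 // => i _.
  by rewrite mulr_ge0 // ltW.
exists ((\sum_i mu 0 i * h i 0)^-1 *: h); split.
- by move=> i; rewrite mxE mulr_gt0 // invr_gt0.
- by rewrite -scalemxAr hl fy !scalerA mulrC.
- rewrite (eq_bigr (fun i => (\sum_i mu 0 i * h i 0)^-1 * (mu 0 i * h i 0))) => [|i _].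
    by rewrite -mulr_sumr mulVf // gt_eqF.
  by rewrite mxE mulrCA.
Qed.

Lemma delta_theta : f theta = theta.
Proof.
have [nn ir] := AstarR_irr t0 tr.
by rewrite /f (delta_perron n0 nn v0 Av).
Qed.

(** Applying [mu] to a null vector [u] gives [mu *m u = 0], so [u] lies in the eigenspace of
    [theta]; by [kernel_vec] at [om = 1] it is a multiple of [v], and [mu *m v = 1] makes it 0. *)
Lemma deflated_unit : theta%:M - AstarR Q theta + v *m mu \in unitmx.
Proof.
apply: unitmx_ker => u hu; have [//|u0] := eqVneq u 0.
have mul : mu *m (theta%:M - AstarR Q theta) = 0 by rewrite mulmxBr mul_mx_scalar muA subrr.
have mu_u : mu *m u = 0.
  have := congr1 (mulmx mu) hu; rewrite mulmx0 mulmxA mulmxDr mul add0r !mulmxA muv.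
  by rewrite -[1 *m mu]/(1%:M *m mu) mul1mx.
have hk : AstarR Q theta *m u = theta *: u.
  move: hu; rewrite mulmxDl -mulmxA mu_u mulmx0 addr0 mulmxBl mul_scalar_mx => /eqP.
  by rewrite subr_eq0 => /eqP.
have hC : AstarC Q (toC theta * 1) *m mxC u = (toC theta * 1) *: mxC u.
  rewrite mulr1 (AstarC_real t0 tr hB (ltW t0) tr) -mxC_mul hk.
  by apply/matrixP => i j; rewrite !mxE toCM.
have uC : mxC u != 0.
  apply: contraNneq u0 => e; apply/eqP/matrixP => i j; have := congr1 (fun M : 'cV[C]_n => M i j) e.
  by rewrite /= !mxE => /toC_inj.
have [c hc] := kernel_vec n0 A0 t0 tr hB hA1 irr htau hp Av v0 (nc1 : nc (1 : C) = 1) hC uC.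
have d1 : DeltaM p (1 : C) = 1%:M.
  by apply/matrixP => i j; rewrite /DeltaM !mxE expr1n invr1.
have := congr1 (mulmx (mxC mu)) hc; rewrite d1 mul1mx -scalemxAr -!mxC_mul mu_u muv => /matrixP/(_ 0 0).
rewrite !mxE /= mulr1 => c0; move/negP: uC => []; by rewrite hc -c0 toC0 scale0r.
Qed.

Let S (y : R) : R := \sum_i \sum_j `|AstarR Q y i j - AstarR Q theta i j|.
Let Rr (y : R) : R := \sum_i \sum_j `|AstarR Q y i j - AstarR Q theta i j - AstarR' Q theta i j * (y - theta)|.

(** First-order perturbation with explicit constants: [f y - theta] equals
    [mu (A*(y) - A*(theta)) h], and the deflated inverse bounds [h - v] by a multiple of [S y], so
    [h] may be replaced by [v]. *)
Lemma delta_bound : exists2 K, 0 <= K & forall y, 0 < y -> y < rho ->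
  `|f y - theta - (mu *m AstarR' Q theta *m v) 0 0 * (y - theta)| <= K * Rr y + K * S y * `|y - theta|.
Proof.
have [c c0 hc] := fin_pos_lb mu0.
pose m := \sum_i mu 0 i.
have mi i : mu 0 i <= m by rewrite /m (bigD1 i) //= lerDl sumr_ge0 // => k _; exact: ltW.
have m0 : 0 <= m by rewrite sumr_ge0 // => k _; exact: ltW.
pose G := invmx (theta%:M - AstarR Q theta + v *m mu).
pose g := \sum_i \sum_j `|G i j|.
have g0 : 0 <= g by rewrite sumr_ge0 // => i _; rewrite sumr_ge0.
pose d := \sum_i \sum_j `|AstarR' Q theta i j|.
have d0 : 0 <= d by rewrite sumr_ge0 // => i _; rewrite sumr_ge0.
pose Kh := g * ((m / c + 1) / c).
have Kh0 : 0 <= Kh by rewrite !mulr_ge0 ?invr_ge0 ?addr_ge0 ?divr_ge0 ?(ltW c0).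
have term_le (X : 'M[R]_n) i j : `|X i j| <= \sum_i \sum_j `|X i j|.
  rewrite (bigD1 i) //= (bigD1 j) //= -addrA lerDl addr_ge0 ?sumr_ge0 // => k _; exact: sumr_ge0.
exists (m / c + m * d * Kh); first exact (addr_ge0 (divr_ge0 m0 (ltW c0)) (mulr_ge0 (mulr_ge0 m0 d0) Kh0)).
move=> y y0 yr; have [h [h0 hl hm]] := delta_eig y0 yr.
have S0 : 0 <= S y by rewrite sumr_ge0 // => i _; rewrite sumr_ge0.
have R0 : 0 <= Rr y by rewrite sumr_ge0 // => i _; rewrite sumr_ge0.
have hle i : `|h i 0| <= c^-1.
  rewrite gtr0_norm // -[leRHS]mul1r ler_pdivlMr // mulrC -hm (bigD1 i) //=.
  apply: le_trans (_ : mu 0 i * h i 0 <= _); first by rewrite ler_pM2r.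
  by rewrite lerDl sumr_ge0 // => k _; rewrite mulr_ge0 // ltW.
pose e i j := AstarR Q y i j - AstarR Q theta i j.
have hS (w : 'I_n -> R) : (forall i, 0 <= w i <= m) -> `|\sum_i w i * \sum_j e i j * h j 0| <= m * (S y / c).
  move=> hw; apply: le_trans (ler_norm_sum _ _ _) _; rewrite mulrA mulr_sumr mulr_suml; apply: ler_sum => i _.
  have /andP[w0 wm] := hw i; rewrite normrM (ger0_norm w0) -mulrA.
  apply: ler_pM => //; apply: le_trans (ler_norm_sum _ _ _) _; rewrite mulr_suml; apply: ler_sum => j _.
  by rewrite normrM ler_wpM2l.
have muA' j : \sum_i mu 0 i * AstarR Q theta i j = theta * mu 0 j.
  by have := congr1 (fun M : 'rV[R]_n => M 0 j) muA; rewrite /= mxE [RHS]mxE.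
have hl' i : \sum_j AstarR Q y i j * h j 0 = f y * h i 0.
  by have := congr1 (fun M : 'cV[R]_n => M i 0) hl; rewrite /= mxE [RHS]mxE.
have fE : f y - theta = \sum_i mu 0 i * \sum_j e i j * h j 0.
  transitivity (\sum_i mu 0 i * (f y * h i 0) - \sum_j theta * mu 0 j * h j 0).
    rewrite [X in _ = X - _](eq_bigr (fun i => f y * (mu 0 i * h i 0))) => [|i _]; last by rewrite mulrCA.
    rewrite [X in _ = _ - X](eq_bigr (fun i => theta * (mu 0 i * h i 0))) => [|i _]; last by rewrite mulrA.
    by rewrite -!mulr_sumr hm !mulr1.
  rewrite [X in _ - X = _](eq_bigr (fun j => \sum_i mu 0 i * (AstarR Q theta i j * h j 0))) => [|j _].
    rewrite exchange_big -sumrB; apply: eq_bigr => i _ /=; rewrite -hl' -mulr_sumr -mulrBr -sumrB.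
    by congr (_ * _); apply: eq_bigr => j _; rewrite /e mulrBl.
  by rewrite -muA' mulr_suml; apply: eq_bigr => i _; rewrite mulrA.
have fle : `|f y - theta| <= m * (S y / c).
  by rewrite fE; apply: hS => i; rewrite mi ltW.
have hv i : `|h i 0 - v i 0| <= Kh * S y.
  (* Since [mu] kills [h - v], the deflated matrix acts on it like [theta%:M - AstarR Q theta], and
     the eigenvalue equations give the right side. *)
  have hG : h - v = G *m ((theta - f y) *: h + (AstarR Q y - AstarR Q theta) *m h).
    have Gu : G *m (theta%:M - AstarR Q theta + v *m mu) = 1%:M by rewrite /G mulVmx // deflated_unit.
    rewrite -[LHS]mul1mx -Gu -mulmxA; congr (G *m _).
    have muh : mu *m h = 1%:M by apply/matrixP => a b; rewrite !ord1 mxE [RHS]mxE eqxx.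
    have muv' : mu *m v = 1%:M by rewrite muv.
    rewrite mulmxDl !mulmxBr !mulmxBl !mul_scalar_mx Av subrr subr0.
    by rewrite -!mulmxA muh muv' !mulmx1 subrr addr0 hl scalerBl addrA subrK.
  have -> : h i 0 - v i 0 = (h - v) i 0 by rewrite mxE [X in _ = _ + X]mxE.
  rewrite hG mxE; apply: le_trans (ler_norm_sum _ _ _) _.
  have c1 : 0 <= (m / c + 1) / c * S y.
    by rewrite mulr_ge0 // mulr_ge0 ?invr_ge0 ?(ltW c0) // addr_ge0 // divr_ge0 // ltW.
  apply: le_trans (_ : \sum_j `|G i j| * ((m / c + 1) / c * S y) <= _); last first.
    rewrite -mulr_suml -[leRHS]mulrA ler_wpM2r // /g [leRHS](bigD1 i) //= lerDl sumr_ge0 // => k _.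
    by rewrite sumr_ge0.
  apply: ler_sum => j _; rewrite normrM ler_wpM2l //.
  rewrite mxE [X in X + _]mxE [X in _ + X]mxE.
  apply: le_trans (ler_normD _ _) _.
  have -> : (m / c + 1) / c * S y = m * (S y / c) * c^-1 + S y / c by field; rewrite gt_eqF.
  apply: lerD.
    by rewrite normrM; apply: ler_pM => //; rewrite distrC.
  apply: le_trans (ler_norm_sum _ _ _) _; apply: le_trans (_ : \sum_k `|e j k| / c <= _).
    apply: ler_sum => k _; rewrite normrM.
    have -> : (AstarR Q y - AstarR Q theta) j k = e j k by rewrite mxE [X in _ + X]mxE.
    by rewrite ler_wpM2l.
  rewrite -mulr_suml ler_wpM2r ?invr_ge0 ?(ltW c0) // /S [leRHS](bigD1 j) //= lerDl sumr_ge0 // => k _.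
  by rewrite sumr_ge0.
pose r i j := e i j - AstarR' Q theta i j * (y - theta).
have -> : f y - theta - (mu *m AstarR' Q theta *m v) 0 0 * (y - theta) =
   (\sum_i mu 0 i * \sum_j r i j * h j 0) + (y - theta) * (\sum_i mu 0 i * \sum_j AstarR' Q theta i j * (h j 0 - v j 0)).
  rewrite fE quad mulr_suml mulr_sumr -big_split -sumrB; apply: eq_bigr => i _ /=.
  rewrite mulr_suml !mulr_sumr -big_split -sumrB; apply: eq_bigr => j _ /=; rewrite /r; ring.
apply: le_trans (ler_normD _ _) _; rewrite [leRHS](_ : _ = m / c * Rr y + `|y - theta| * (m * d * (Kh * S y)) +
   (m * d * Kh * Rr y + m / c * S y * `|y - theta|)); last by ring.
rewrite -[leLHS]addr0; apply: lerD; last first.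
  have mc : 0 <= m / c by rewrite divr_ge0 // ltW.
  exact (addr_ge0 (mulr_ge0 (mulr_ge0 (mulr_ge0 m0 d0) Kh0) R0) (mulr_ge0 (mulr_ge0 mc S0) (normr_ge0 _))).
apply: lerD.
  apply: le_trans (ler_norm_sum _ _ _) _; rewrite mulr_sumr; apply: ler_sum => i _.
  rewrite normrM (ger0_norm (ltW (mu0 i))) -mulrA; apply: ler_pM => //; first exact: ltW.
  apply: le_trans (ler_norm_sum _ _ _) _; rewrite mulr_sumr; apply: ler_sum => j _.
  by rewrite normrM mulrC ler_wpM2r.
rewrite normrM ler_wpM2l //.
apply: le_trans (ler_norm_sum _ _ _) _.
apply: le_trans (_ : \sum_i m * ((\sum_j `|AstarR' Q theta i j|) * (Kh * S y)) <= _); last first.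
  by rewrite -mulr_sumr -mulr_suml mulrA.
apply: ler_sum => i _.
rewrite normrM (ger0_norm (ltW (mu0 i))); apply: ler_pM => //; first exact: ltW.
apply: le_trans (ler_norm_sum _ _ _) _; rewrite [leRHS]mulr_suml; apply: ler_sum => j _.
by rewrite normrM ler_wpM2l.
Qed.

Lemma AstarR_deriv i j e : 0 < e -> exists2 d : R, 0 < d & forall y, `|y - theta| < d -> 0 < y -> y < rho ->
  `|AstarR Q y i j - AstarR Q theta i j - AstarR' Q theta i j * (y - theta)| <= e * `|y - theta|.
Proof.
move=> e0; have hr : nc (toC theta) < rho by rewrite nc_real gtr0_norm.
have /has_cderivP h := @AstarC_deriv _ _ _ _ _ t0 tr hB (toC theta) i j hr.
have [d d0 hd] := h _ e0; exists d => // y hy y0 yr.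
have := hd (toC y); rewrite -toCB nc_real => /(_ hy).
rewrite (AstarC_real t0 tr hB (ltW y0) yr) (AstarC_real t0 tr hB (ltW t0) tr) (AstarC'_real t0 tr hB).
by rewrite [mxC (AstarR Q y) i j]mxE [mxC (AstarR Q theta) i j]mxE [mxC _ i j]mxE -toCB -toCM -toCB nc_real.
Qed.

Lemma ddelta_formula : ddelta Q theta = (mu *m AstarR' Q theta *m v) 0 0.
Proof.
have [K K0 hK] := delta_bound.
set d1 := (mu *m _ *m v) 0 0 in hK *.
pose dd := \sum_i \sum_j `|AstarR' Q theta i j|.
have dd0 : 0 <= dd by rewrite sumr_ge0 // => i _; rewrite sumr_ge0.
have SR y : S y <= Rr y + dd * `|y - theta|.
  rewrite /S /Rr /dd mulr_suml -big_split; apply: ler_sum => i _ /=.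
  rewrite mulr_suml -big_split; apply: ler_sum => j _ /=.
  by rewrite -normrM; apply: le_trans (ler_normD _ _); rewrite subrK.
rewrite /ddelta /derive1; apply: cvg_lim => //; apply/cvgrPdist_le => e0 e00.
(* [delta_bound] will give [K e (1 + e + dd)] times the increment, at most [K e (2 + dd)] because
   [e <= 1]; the constant [N] below spreads [e] over the entries of the matrix. *)
pose e := Num.min 1 (e0 / (K * (2 + dd) + 1)).
have D0 : 0 < K * (2 + dd) + 1 by rewrite ltr_wpDl // mulr_ge0 // addr_ge0.
have e1 : e <= 1 by rewrite ge_min lexx.
have eD : e * (K * (2 + dd)) <= e0.
  apply: le_trans (_ : e0 / (K * (2 + dd) + 1) * (K * (2 + dd)) <= _).
    by rewrite ler_wpM2r ?ge_min ?lexx ?orbT // mulr_ge0 // addr_ge0.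
  by rewrite mulrAC ler_pdivrMr // ler_pM2l // lerDl.
have e_gt0 : 0 < e by rewrite lt_min ltr01 divr_gt0.
pose N : R := (n%:R + 1) ^+ 2.
have nn : 0 <= (n%:R : R) by rewrite ler0n.
have N0 : 0 < N by rewrite exprn_gt0 // ltr_wpDl.
have hall : \forall h \near (0 : R)^', forall i j : 'I_n, `|h| < e -> 0 < h + theta -> h + theta < rho ->
   `|AstarR Q (h + theta) i j - AstarR Q theta i j - AstarR' Q theta i j * h| <= (e / N) * `|h|.
  apply: filter_forall => i; apply: filter_forall => j.
  have [d d0 hd] := AstarR_deriv i j (divr_gt0 e_gt0 N0).
  near=> h => _ y0 yr; have := hd (h + theta); rewrite addrK; apply=> //.
  by near: h; exact: dnbhs0_lt.
near=> h.
have hn0 : h != 0 by near: h; exact: nbhs_dnbhs_neq.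
have he : `|h| < e by near: h; exact: dnbhs0_lt.
have ht : `|h| < theta by near: h; exact: dnbhs0_lt.
have hr : `|h| < rho - theta by near: h; apply: dnbhs0_lt; rewrite subr_gt0.
have y0 : 0 < h + theta by move: ht; rewrite ltr_norml => /andP[]; lra.
have yr : h + theta < rho by move: hr; rewrite ltr_norml => /andP[]; lra.
have hh i j : `|AstarR Q (h + theta) i j - AstarR Q theta i j - AstarR' Q theta i j * h| <= (e / N) * `|h|.
  move: i j he y0 yr; near: h; exact: hall.
have Rle : Rr (h + theta) <= e * `|h|.
  apply: le_trans (_ : \sum_(i < n) \sum_(j < n) (e / N) * `|h| <= _).
    by apply: ler_sum => i _; apply: ler_sum => j _; rewrite addrK.
  have cst (c : R) : \sum_(i < n) \sum_(j < n) c = c * n%:R * n%:R.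
    by rewrite !sumr_const !card_ord -(mulr_natr (c *+ n)) -(mulr_natr c).
  rewrite cst [leLHS](_ : _ = e * `|h| * (n%:R ^+ 2 / N)); last by ring.
  rewrite ler_piMr ?mulr_ge0 ?(ltW e_gt0) // ler_pdivrMr // mul1r /N lerXn2r ?nnegrE ?addr_ge0 // lerDl //.
have := hK _ y0 yr; rewrite addrK => hk.
rewrite -(ler_pM2r (_ : 0 < `|h|)) ?normr_gt0 // -normrM mulrBl distrC.
rewrite [h^-1 *: _ * h](_ : _ = f (h + theta) - f theta); last by rewrite /GRing.scale /= mulrC mulrA divff // mul1r.
rewrite delta_theta; apply: le_trans hk _.
have S1 := SR (h + theta); rewrite addrK in S1.
have h0 : 0 <= `|h| by [].
apply: le_trans (_ : K * (e * `|h|) + K * (e * `|h| + dd * `|h|) * e <= _).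
  apply: lerD; first by rewrite ler_wpM2l.
  apply: ler_pM => //; first by rewrite mulr_ge0 // sumr_ge0 // => i _; rewrite sumr_ge0.
    by rewrite ler_wpM2l //; apply: le_trans S1 _; rewrite lerD2r.
  exact: ltW.
apply: le_trans (_ : e * (K * (2 + dd)) * `|h| <= _); last by rewrite ler_wpM2r.
have hh2 : 0 <= K * e * `|h| by rewrite !mulr_ge0 // ltW.
have := ler_wpM2l hh2 e1; nra.
Unshelve. all: by end_near. Qed.
End DeltaDerivative.

(** * Roots of unity *)

Section RootsOfUnity.
Context {R : realType}.
Local Notation C := (Cplx R).

Lemma omegaX n k : (omega n : C) ^+ k = cis (k%:R * (2 * pi / n%:R)).
Proof.
elim: k => [|k IH]; first by rewrite mul0r cis0.
rewrite exprSr IH -[omega n]/(cis (2 * pi / n%:R)) -cisD; congr cis.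
by move: (2 * pi / n%:R) => x; rewrite -[k.+1%:R]natr1 mulrDl mul1r.
Qed.

Lemma nc_omega n : nc (omega n : C) = 1. Proof. exact: nc_cis. Qed.

(** If the order [m] were below [n], then with [y = m pi / n] in (0, pi) the cosine of 2y would be
    1, against [sin y > 0]. *)
Lemma omega_prim n : (0 < n)%N -> n.-primitive_root (omega n : C).
Proof.
move=> n0; have nR : (0 : R) < n%:R by rewrite ltr0n.
have h1 : (omega n : C) ^+ n = 1 by rewrite omegaX mulrC divfK ?cis2pi // gt_eqF.
have [m mp md] := prim_order_exists n0 h1.
have m0 := prim_order_gt0 mp.
have [e|ne] := eqVneq m n; first by rewrite -e in mp *.
have mn : (m < n)%N by rewrite ltn_neqAle ne dvdn_leq.
have := prim_expr_order mp; rewrite omegaX => /(congr1 (fun z : C => complex.Re (z : R[i]))) /=.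
pose y : R := m%:R / n%:R * pi.
have -> : m%:R * (2 * pi / n%:R) = y + y by rewrite /y; field; rewrite gt_eqF.
have y0 : 0 < y by rewrite !mulr_gt0 ?invr_gt0 ?ltr0n // pi_gt0.
have y1 : y < pi by rewrite /y gtr_pMl ?pi_gt0 // ltr_pdivrMr // mul1r ltr_nat.
have s0 : 0 < sin y by apply: sin_gt0_pi; rewrite y0.
rewrite cosD -!expr2 => e; have := cos2Dsin2 y; have := mulr_gt0 s0 s0; rewrite -!expr2 in e *; lra.
Qed.

Lemma omega_div n d : (0 < n)%N -> (d %| n)%N -> (omega (n %/ d) : C) = omega n ^+ d.
Proof.
move=> n0 /dvdnP[q e]; rewrite omegaX e; have d0 : (0 < d)%N by move: n0; rewrite e muln_gt0 => /andP[].
have q0 : (0 < q)%N by move: n0; rewrite e muln_gt0 => /andP[].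
rewrite mulnK // -[omega q]/(cis (2 * pi / q%:R)); congr cis; rewrite natrM; field.
by rewrite !pnatr_eq0 -!lt0n q0 d0.
Qed.

Lemma sum_prim_root n (z : C) eta : n.-primitive_root z -> (eta < n)%N ->
  \sum_(l < n) (z ^+ eta) ^- l = if eta == 0%N then n%:R else 0.
Proof.
move=> zp en; case: eqP => [->|/eqP e0].
  by rewrite (eq_bigr (fun=> 1)) ?sumr_const ?card_ord // => l _; rewrite expr1n invr1.
have n0 := prim_order_gt0 zp.
pose q := (z ^+ eta)^-1.
have q1 : q != 1.
  rewrite invr_eq1 -(prim_order_dvd zp); apply/negP => /dvdn_leq h.
  by have := h _; rewrite lt0n e0 leqNgt en => /(_ isT).
rewrite (eq_bigr (fun l : 'I_n => q ^+ l)) => [|l _]; last by rewrite /q exprVn.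
have h := subrX1 q n; have qn : q ^+ n = 1 by rewrite /q exprVn -exprM mulnC exprM (prim_expr_order zp) expr1n invr1.
by move: h; rewrite qn subrr => /esym/eqP; rewrite mulf_eq0 subr_eq0 (negPf q1) => /eqP.
Qed.
End RootsOfUnity.

(** * Positivity of the periodic limits of a decreasing sequence *)

Section PeriodicLimit.
Context {R : realType}.
Local Notation C := (Cplx R).
Local Notation re z := (complex.Re (z : R[i])).
Local Notation im z := (complex.Im (z : R[i])).

Lemma small_ge0 (x K : R) : (forall n : nat, exists2 k : nat, (n < k)%N & x <= K / k%:R) -> x <= 0.
Proof.
move=> h; apply/ler_addgt0Pr => e e0; rewrite add0r.
have [k hk hx] := h (Num.truncn (K / e)); apply: le_trans hx _.
have kR : (0 : R) < k%:R by rewrite ltr0n (leq_ltn_trans _ hk).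
rewrite ler_pdivrMr // mulrC -ler_pdivrMr //.
by apply: le_trans (ltW (truncnS_gt _)) _; rewrite ler_nat.
Qed.

(* c (l+1) <= theta * c l, so a zero of c would propagate around the period. *)
Lemma periodic_limit_pos (a : nat -> R) (c : nat -> C) (theta K s : R) m T : 0 < theta -> (0 < T)%N ->
  (forall k, 0 <= a k) -> (forall k, a k.+1 <= a k) -> (forall k, c (k + T)%N = c k) ->
  (forall k, (0 < k)%N -> nc (toC (a k * theta ^+ k * m`!%:R / k%:R ^+ m) - c k) <= K / k%:R) ->
  \sum_(l < T) c l = toC s -> 0 < s -> forall l, exists2 r : R, 0 < r & c l = toC r.
Proof.
move=> t0 T0 a0 amon per hc hs s0.
have perM n l : c (n * T + l)%N = c l.
  by elim: n => [//|n IH]; rewrite mulSn -addnA addnC per.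
pose b k := a k * theta ^+ k * m`!%:R / k%:R ^+ m.
have b0 k : 0 <= b k by rewrite /b !mulr_ge0 ?invr_ge0 ?exprn_ge0 ?(ltW t0).
(* Every [l] has arbitrarily large representatives modulo [T], so error bounds of order [1 / k]
   become exact statements about [c l]. *)
have big l n : exists2 k, (n < k)%N & c k = c l /\ c k.+1 = c l.+1.
  exists (n.+1 * T + l)%N; last by rewrite -addnS !perM.
  by rewrite (leq_trans (_ : n < n.+1 * T)%N) ?leq_addr // leq_pmulr.
have hre k : (0 < k)%N -> `|b k - re (c k)| <= K / k%:R.
  by move=> k0; apply: le_trans (hc k k0); rewrite -[b k]/(re (toC (b k))) -reB; exact: Re_le_nc.
have im0 l : im (c l) = 0.
  apply/eqP; rewrite -normr_le0; apply: (small_ge0 (K := K)) => n; have [k hk [e _]] := big l n; exists k => //.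
  apply: le_trans (hc k _); last exact: leq_ltn_trans hk.
  by rewrite -e -normrN -[- im (c k)]add0r -[0 in X in `|X|]/(im (toC (b k))) -imB; exact: Im_le_nc.
have re0 l : 0 <= re (c l).
  rewrite -oppr_le0; apply: (small_ge0 (K := K)) => n; have [k hk [e _]] := big l n; exists k => //.
  have k0 : (0 < k)%N by exact: leq_ltn_trans hk.
  apply: le_trans (hre k k0); rewrite -e; apply: le_trans (ler_norm _); have := b0 k; lra.
(* This is monotonicity of [a] multiplied by [theta ^+ k.+1]; replacing [k] by [k + 1] in the
   denominator [k ^+ m] only helps. *)
have remon l : re (c l.+1) <= theta * re (c l).
  rewrite -subr_le0; apply: (small_ge0 (K := (theta + 1) * K)) => n; have [k hk [e e1]] := big l n; exists k => //.
  have k0 : (0 < k)%N by exact: leq_ltn_trans hk.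
  have kR : (0 : R) < k%:R by rewrite ltr0n.
  have h1 := hre k k0; have h2 := hre k.+1 isT; rewrite e in h1; rewrite e1 in h2.
  have K0 : 0 <= K by have := le_trans (normr_ge0 _) h1; rewrite pmulr_lge0 // invr_gt0.
  have h3 : K / k.+1%:R <= K / k%:R by rewrite ler_wpM2l // lef_pV2 ?posrE ?ltr0n // ler_nat.
  have h4 : b k.+1 <= theta * b k.
    rewrite /b exprS.
    have -> : theta * (a k * theta ^+ k * m`!%:R / k%:R ^+ m) = a k * (theta * theta ^+ k) * m`!%:R / k%:R ^+ m by ring.
    apply: ler_pM; rewrite ?invr_ge0 ?exprn_ge0 //.
    - by rewrite !mulr_ge0 ?exprn_ge0 // ltW.
    - by rewrite !ler_wpM2r // mulr_ge0 ?exprn_ge0 // ltW.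
    - by rewrite lef_pV2 ?posrE ?exprn_gt0 ?ltr0n // lerXn2r ?nnegrE // ler_nat.
  move: h1 h2; rewrite !ler_norml => /andP[_ h1] /andP[h2 _].
  have h5 : theta * (b k - re (c l)) <= theta * (K / k%:R) by rewrite ler_wpM2l // ltW.
  rewrite (_ : (theta + 1) * K / k%:R = theta * (K / k%:R) + K / k%:R); last by rewrite -mulrA mulrDl mul1r.
  move: h2 h3 h4 h5; rewrite mulrBr; move: (re (c l.+1)) (theta * re (c l)) (theta * b k) (b k.+1) (K / k.+1%:R) (theta * (K / k%:R)) (K / k%:R) => x1 x2 x3 x4 x5 x6 x7; lra.
move=> l; exists (re (c l)); last by have := im0 l; case: (c l) => x y /= ->.
rewrite lt_neqAle re0 andbT eq_sym; apply/eqP => z0.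
have zall n : re (c (l + n)%N) = 0.
  elim: n => [|n IH]; first by rewrite addn0.
  by apply/eqP; rewrite eq_le re0 andbT addnS; apply: le_trans (remon _) _; rewrite IH mulr0.
have zz j : re (c j) = 0.
  rewrite -(perM l j) -[(l * T + j)%N](subnKC (m := l)) ?zall //.
  by apply: leq_trans (leq_addr _ _); rewrite leq_pmulr.
have := congr1 (fun z : C => re z) hs; rewrite re_sum big1 //= => e; by rewrite -e ltxx in s0.
Qed.
End PeriodicLimit.

(** * Limits of matrix-valued functions *)

Section MatrixLimits.
Context {R : realType}.
Local Notation C := (Cplx R).

Lemma mx_cvgP (T : topologicalType) (X : Type) (G : set_system X) (FF : Filter G) m n (f : X -> 'M[T]_(m, n)) (L : 'M[T]_(m, n)) :
  f @ G --> L <-> forall i j, (fun x => f x i j) @ G --> L i j.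
Proof.
split=> h.
  move=> i j; have hc : (fun N : 'M[T]_(m, n) => N i j) @ nbhs L --> L i j.
    move=> A hA; exists (fun i' j' => [set x | i' = i -> j' = j -> A x]) => [i' j'|N /= hN]; last exact: hN.
    apply: filterS (_ : nbhs (L i' j') (fun x => i' = i -> j' = j -> A x)) => //.
    have [e1|ne1] := eqVneq i' i; last by apply: nearW => x e; rewrite e eqxx in ne1.
    have [e2|ne2] := eqVneq j' j; last by apply: nearW => x _ e; rewrite e eqxx in ne2.
    by apply: filterS (_ : nbhs (L i' j') A) => //; rewrite e1 e2.
  exact: cvg_comp h hc.
move=> A [P hP hA]; rewrite /nbhs /= /fmap /=.
have h2 : \forall x \near G, forall i j, P i j (f x i j).
  by apply: filter_forall => i; apply: filter_forall => j; exact: h (hP i j).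
by apply: filterS h2 => x hx; apply: hA.
Qed.

Lemma dnbhs_unique (f : C -> C) (w : C) (a b : C) : f @ w^' --> a -> f @ w^' --> b -> a = b.
Proof. by move=> h1 h2; apply: (cvg_unique _ h1 h2); exact: norm_hausdorff. Qed.

Lemma mx_lim m n (f : C -> 'M[C]_(m, n)) (w : C) (L : 'M[C]_(m, n)) : f @ w^' --> L -> lim (f @ w^') = L.
Proof.
move=> h; have h2 : f @ w^' --> lim (f @ w^') by apply: cvgP h.
have /mx_cvgP h1 := h; have /mx_cvgP h3 := h2.
by apply/matrixP => i j; apply: dnbhs_unique (h3 i j) (h1 i j).
Qed.
Lemma one_sub_div_exp_cvg0 (w : C) k : w != 0 -> (0 < k)%N -> (fun z : C => (1 - z / w) ^+ k) @ w^' --> (0 : C).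
Proof.
move=> w0 k0; apply/cvgCP => e e0; apply/near_dnbhsC; have nw : 0 < nc w by rewrite nc_gt0.
exists (nc w * Num.min 1 e); first by rewrite mulr_gt0 // lt_min ltr01.
move=> z _ hz; rewrite sub0r ncN ncX.
have y0 := nc_ge0 (1 - z / w).
have : nc (1 - z / w) < Num.min 1 e.
  have -> : 1 - z / w = (w - z) * w^-1 by field.
  by rewrite ncM ncV ncC ltr_pdivrMr // mulrC.
rewrite lt_min => /andP[y1 ye]; apply: le_lt_trans ye.
by rewrite -(prednK k0) exprS ler_piMr // exprn_ile1 // ltW.
Qed.

Lemma one_sub_div_cvg0 (w : C) : w != 0 -> (fun z : C => 1 - z / w) @ w^' --> (0 : C).
Proof.
move=> w0; have e : (fun z : C => 1 - z / w) = (fun z => (1 - z / w) ^+ 1) by apply: funext => z; rewrite expr1.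
by rewrite e; exact: one_sub_div_exp_cvg0.
Qed.
End MatrixLimits.

(** * Poles of B* on its circle of convergence *)

Section BoundaryPoles.
Context {R : realType}.
Local Notation C := (Cplx R).
Variables (Q : MG1 R) (theta : R) (U : set C) (F : C -> 'M[C]_(M0 Q, M Q)) (mB : nat).
Hypotheses (t0 : 0 < theta) (B0 : forall k i j, 0 <= Bs Q k i j)
  (rB : conv_radius (Bs Q) = theta%:E) (H4 : Assumption4 theta U F mB).

Lemma Bs_bound r : 0 < r -> r < theta -> exists2 K, 0 <= K & forall i j, psbound (fun k => toC (Bs Q k i j) : C) r K.
Proof.
move=> r0 rt; have := @conv_radius_bound _ _ _ (Bs Q) r (ltW r0); rewrite rB lte_fin => /(_ rt) [r1 [K [rr1 K0 hK]]].
exists K => // i j; apply: (@psbound_mono _ _ r1) => //; first exact: ltW.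
by split=> k; rewrite nc_real.
Qed.

Lemma Bs_mid (z : C) : nc z < theta -> exists r K, [/\ 0 < r, r < theta, nc z < r, 0 <= K & forall i j, psbound (fun k => toC (Bs Q k i j) : C) r K].
Proof.
move=> hz; have r0 : 0 < (nc z + theta) / 2 by rewrite divr_gt0 // ltr_wpDl // nc_ge0.
have rt : (nc z + theta) / 2 < theta by rewrite midf_lt.
by have [K K0 hK] := Bs_bound r0 rt; exists ((nc z + theta) / 2), K; split=> //; rewrite midf_lt.
Qed.

Lemma F_psf z i j : nc z < theta -> F z i j = psf (fun k => toC (Bs Q k i j)) z.
Proof.
move=> hz; have [[_ _ _ hF] _ _ _ _] := H4; rewrite hF ?normCE ?ltC_real // /BstarC /cmxseries mxE.
have [r [K [r0 rt zr _ hb]]] := Bs_mid hz.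
apply/esym; apply: psf_eq; have h := ps_cvg r0 (hb i j) zr.
have e : psum (fun k => toC (Bs Q k i j)) z = (fun N => \sum_(k < N) (z ^+ k *: mxC (Bs Q k)) i j).
  by apply: funext => N; apply: eq_bigr => k _; rewrite !mxE mulrC.
by rewrite -e; apply/cvg_ex; exists (psf (fun k => toC (Bs Q k i j)) z).
Qed.

Let tC0 : (toC theta : C) != 0. Proof. by rewrite -nc_eq0 nc_real normr_eq0 gt_eqF. Qed.

(** The coefficients are nonnegative, so each partial sum at [z] is dominated by the one at the real
    point of the same modulus. *)
Lemma F_le_radial (z : C) (y : R) i j : nc z = y -> y < theta -> nc (F z i j) <= nc (F (toC y) i j).
Proof.
move=> zy yt; have y0 : 0 <= y by rewrite -zy nc_ge0.
have hz : nc z < theta by rewrite zy.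
have hy : nc (toC y) < theta by rewrite nc_real ger0_norm.
have [r [K [r0 rt zr _ hb]]] := Bs_mid hz; have [r' [K' [r0' rt' zr' _ hb']]] := Bs_mid hy.
rewrite (F_psf i j hz) (F_psf i j hy).
apply: cvg_nc_le (ps_cvg r0 (hb i j) zr) _ => N.
have q01 := ratio01 r0' zr'; rewrite nc_real ger0_norm // in q01.
have [|l hl'] := @rs_geom _ (fun k => y ^+ k * Bs Q k i j) K' _ q01.
  move=> k; have := psboundE k (hb' i j); rewrite nc_real => h.
  by rewrite normrM (ger0_norm (exprn_ge0 _ y0)) expr_div_n mulrCA -exprVn ler_wpM2l ?exprn_ge0 // exprVn.
rewrite (psf_real hl') nc_real; apply: le_trans (ler_norm _).
apply: le_trans (rs_term N _ hl') => [|k]; last by rewrite mulr_ge0 ?exprn_ge0.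
apply: le_trans (nc_sum _ _ _) _; apply: ler_sum => k _.
by rewrite ncM nc_real ger0_norm // ncX zy mulrC.
Qed.

Lemma F_radial i j (d : R) : 0 < d -> exists2 K1, 0 <= K1 & exists2 d' : R, 0 < d' & d' <= d /\
  forall (w : C) s, nc w = theta -> 0 < s -> s < d' -> let z := toC (1 - s) * w in
   nc (z - w) = s * theta /\ nc (z - w) ^+ mB * nc (F z i j) <= K1.
Proof.
move=> d0; have [_ _ hl _ _] := H4; have /mx_cvgP/(_ i j)/cvgCP/(_ 1 ltr01) := hl.
move=> /near_dnbhsC[e e0 he].
set T := Btilde F mB (toC theta) i j in he.
exists (theta ^+ mB * (nc T + 1)).
  by rewrite mulr_ge0 ?exprn_ge0 ?(ltW t0) // addr_ge0 ?nc_ge0.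
exists (Num.min d (Num.min 1 (e / theta))); first by rewrite !lt_min d0 ltr01 divr_gt0.
split; first by rewrite ge_min lexx.
move=> w s hw s0; rewrite !lt_min => /and3P[_ s1 se] /=.
have ez : toC (1 - s) * w - w = - (toC s * w) by rewrite toCB toC1; ring.
have n1 : nc (toC (1 - s) * w - w) = s * theta by rewrite ez ncN ncM nc_real hw gtr0_norm.
split=> //; rewrite n1.
have s1' : 0 < 1 - s by rewrite subr_gt0.
have st : (1 - s) * theta < theta by rewrite gtr_pMl // gtrBl.
have le1 : nc (F (toC (1 - s) * w) i j) <= nc (F (toC ((1 - s) * theta)) i j).
  by apply: F_le_radial st; rewrite ncM nc_real hw gtr0_norm.
have := he (toC ((1 - s) * theta)).
have e1 : toC ((1 - s) * theta) - toC theta = - toC (s * theta) :> C by rewrite -toCB -toCN; congr toC; ring.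
rewrite e1 ncN nc_real gtr0_norm ?mulr_gt0 // -ltr_pdivlMr // => /(_ _ se) h.
have {}h := h _; have {h} : nc (T - (1 - toC ((1 - s) * theta) / toC theta) ^+ mB * F (toC ((1 - s) * theta)) i j) < 1.
  have := h _; rewrite mxE; apply; apply/eqP => /toC_inj h2.
  by rewrite h2 ltxx in st.
have -> : 1 - toC ((1 - s) * theta) / toC theta = toC s :> C by rewrite toCM toCB toC1; field.
move=> h; have h3 : nc (toC s ^+ mB * F (toC ((1 - s) * theta)) i j) <= nc T + 1.
  have := ge_nc (toC s ^+ mB * F (toC ((1 - s) * theta)) i j) T; rewrite ncC => h4.
  lra.
rewrite ncM ncX nc_real gtr0_norm // in h3.
rewrite exprMn mulrAC mulrC; apply: ler_wpM2l; first by rewrite exprn_ge0 // ltW.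
by apply: le_trans h3; rewrite ler_wpM2l ?exprn_ge0 ?(ltW s0).
Qed.

(** Meromorphy only gives some order [m], which may exceed [mB]; [F_laurent] lowers it. *)
Lemma F_regular (w : C) i j : nc w = theta -> exists m, exists K, exists2 e : R, 0 < e & 
  forall z, z != w -> nc (z - w) < e -> cdifferentiable (fun z => F z i j) z /\ nc (z - w) ^+ m * nc (F z i j) <= K.
Proof.
move=> hw; have [[oU sU mero _] _ _ _ _] := H4.
have Uw : U w by apply: sU; rewrite /= normCE leC_real hw.
have [P [PU iso diff polb]] := mero i j.
have [d1 d10 hd1] : exists2 d : R, 0 < d & forall z, nc (z - w) < d -> U z.
  by apply/near_nbhsC; apply: open_nbhs_nbhs; split.
have /near_dnbhsC[d2 d20 hd2] := iso w Uw.
have dif z : z != w -> nc (z - w) < d1 -> nc (z - w) < d2 -> cdifferentiable (fun z => F z i j) z.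
  by move=> zw h1 h2; apply: diff; [exact: hd1|exact: hd2].
have [Pw|nPw] := pselect (P w).
  have [m [K /near_dnbhsC[d3 d30 hd3]]] := polb w Pw.
  exists m, K, (Num.min d1 (Num.min d2 d3)); first by rewrite !lt_min d10 d20.
  move=> z zw; rewrite !lt_min => /and3P[h1 h2 h3]; split; first exact: dif.
  by have := hd3 z zw h3; rewrite normCE leC_real ncM ncX.
have hc := cdiff_continuous (diff w Uw nPw); have /cvgCP/(_ 1 ltr01)/near_nbhsC[d3 d30 hd3] := hc.
exists 0%N, (nc (F w i j) + 1), (Num.min d1 (Num.min d2 d3)); first by rewrite !lt_min d10 d20.
move=> z zw; rewrite !lt_min => /and3P[h1 h2 h3]; split; first exact: dif.
rewrite expr0 mul1r; have := hd3 z h3; have := ge_nc (F z i j) (F w i j); rewrite ncC; lra.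
Qed.

(* Coefficients of B* being nonnegative, |F| on the ray to w is at most F on the ray to theta;
   this bounds the order of the pole at w by mB. *)
Lemma F_laurent (w : C) i j : nc w = theta -> exists kap, exists rho, exists K, [/\ 0 < rho, psbound kap rho K &
  forall z, z != w -> nc (z - w) < rho -> cdifferentiable (fun z => F z i j) z /\ (z - w) ^+ mB * F z i j = psf kap (z - w)].
Proof.
move=> hw; have [m [K [e e0 he]]] := F_regular i j hw.
have [kap [rho [K' [rho0 re hb hk]]]] : exists kap : nat -> C, exists rho, exists B, [/\ 0 < rho, rho <= e, psbound kap rho B &
    forall z, z != w -> nc (z - w) < rho -> (z - w) ^+ (m + mB) * F z i j = psf kap (z - w)].
  apply: (laurent (K0 := e ^+ mB * K) e0) => z zw hz; have [h1 h2] := he z zw hz; split=> //.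
  rewrite addnC exprD -mulrA; apply: ler_pM => //; rewrite ?exprn_ge0 ?mulr_ge0 ?nc_ge0 ?exprn_ge0 ?nc_ge0 //.
  by rewrite lerXn2r ?nnegrE ?nc_ge0 ?(ltW e0) ?(ltW hz).
have {}he z : z != w -> nc (z - w) < rho -> cdifferentiable (fun z => F z i j) z.
  by move=> zw hz; apply: (he z zw _).1; exact: lt_le_trans re.
clear e0 re K.
suff [kap2 [K2 [hb2 hk2]]] : exists kap2, exists K2, psbound kap2 rho K2 /\
    forall z, z != w -> nc (z - w) < rho -> (z - w) ^+ mB * F z i j = psf kap2 (z - w).
  by exists kap2, rho, K2; split=> // z zw hz; split; [exact: he|exact: hk2].
(* Each step removes one order in excess of [mB]; [low] supplies points on the radius to [w] where
   the smaller growth holds. *)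
elim: m kap K' hb hk => [|m IH] kap K' hb hk; first by exists kap, K'.
have w0 : w != 0 by rewrite -nc_gt0 hw.
have [K1 K10 [d' d'0 [_ hd']]] := F_radial i j ltr01.
have low (d : R) : 0 < d -> exists2 z, z != w /\ nc (z - w) < d & nc (z - w) ^+ (m + mB) * nc (F z i j) <= theta ^+ m * K1.
  move=> d0; pose s := Num.min (Num.min (d' / 2) (2^-1)) (d / (2 * theta)).
  have s0 : 0 < s by rewrite !lt_min !divr_gt0 ?mulr_gt0 ?invr_gt0 ?ltr0n.
  have sd' : s < d' by apply: le_lt_trans (_ : d' / 2 < d'); [rewrite /s !ge_min lexx|lra].
  have s1 : s <= 1 by apply: le_trans (_ : 2^-1 <= 1); [rewrite /s !ge_min lexx !orbT|lra].
  have sd : s * theta < d.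
    apply: le_lt_trans (_ : d / (2 * theta) * theta < _); first by rewrite ler_wpM2r ?(ltW t0) // /s ge_min lexx orbT.
    by rewrite invfM mulrA divfK ?gt_eqF // ltr_pdivrMr // ltr_pMr // ltr1n.
  have [h1 h2] := hd' w s hw s0 sd'; exists (toC (1 - s) * w).
    by split; rewrite ?h1 // -subr_eq0 -nc_gt0 h1 mulr_gt0.
  rewrite exprD -mulrA; apply: ler_pM => //; rewrite ?exprn_ge0 ?mulr_ge0 ?exprn_ge0 ?nc_ge0 //.
  by rewrite h1 lerXn2r ?nnegrE ?mulr_ge0 ?(ltW s0) ?(ltW t0) // ler_piMl // ltW.
have [hb2 hk2] := laurent_lower rho0 hb hk low.
exact: IH hb2 hk2.
Qed.

(** [Btilde] is a [lim], informative only once convergence is known. The Laurent expansion provides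
    it at every point of the circle, with limit 0 where the pole has lower order. *)
Lemma Btilde_cvg (w : C) : nc w = theta -> (fun z => (1 - z / w) ^+ mB *: F z) @ w^' --> Btilde F mB w.
Proof.
move=> hw; suff [L hL] : exists L : 'M[C]_(M0 Q, M Q), (fun z => (1 - z / w) ^+ mB *: F z) @ w^' --> L.
  by rewrite /Btilde (mx_lim hL).
have /choice[L hL] : forall ij : 'I_(M0 Q) * 'I_(M Q), exists l : C, (fun z => (1 - z / w) ^+ mB * F z ij.1 ij.2) @ w^' --> l.
  move=> [i j] /=; have [kap [rho [K [rho0 hb hk]]]] := F_laurent i j hw.
  exists ((- w^-1) ^+ mB * kap 0%N).
  have w0 : w != 0 by rewrite -nc_gt0 hw.
  have c0 : ccts 0 (psf kap) by apply: ccts_cdiff; apply: (ps_cdiff rho0 hb); rewrite nc0.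
  have n0 : 0 < nc (- w^-1) ^+ mB by rewrite exprn_gt0 // nc_gt0 oppr_eq0 invr_eq0.
  apply/cvgCP => e e0; apply/near_dnbhsC.
  have /cctsP/(_ _ (divr_gt0 e0 n0)) [d d0 hd] := c0.
  exists (Num.min d rho); first by rewrite lt_min d0.
  move=> z zw; rewrite lt_min => /andP[h1 h2]; have [_ hkz] := hk z zw h2.
  have -> : (1 - z / w) ^+ mB * F z i j = (- w^-1) ^+ mB * ((z - w) ^+ mB * F z i j).
    by rewrite mulrA -exprMn; congr (_ ^+ _ * _); field.
  rewrite hkz -mulrBr ncM ncX mulrC -ltr_pdivlMr //.
  have := hd (z - w); rewrite subr0 psf_at0 => h; exact (h h1).
exists (\matrix_(i, j) L (i, j)); apply/mx_cvgP => i j; rewrite mxE.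
have := hL (i, j) => /=; rewrite (_ : (fun z => (1 - z / w) ^+ mB * F z i j) = (fun z => ((1 - z / w) ^+ mB *: F z) i j)) //.
by apply: funext => z; rewrite mxE.
Qed.

(** A finite limit of [F] would tend to 0 after multiplication by [(1 - z / w) ^+ mB], as [mB] is
    positive. *)
Lemma F_not_cvg (w : C) : nc w = theta -> Btilde F mB w != 0 -> ~ cvg (F @ w^').
Proof.
move=> hw nz hF; move/negP: nz; apply; apply/eqP/matrixP => i j; rewrite [RHS]mxE.
have [_ mB0 _ _ _] := H4; have w0 : w != 0 by rewrite -nc_gt0 hw.
have hL : F @ w^' --> lim (F @ w^') by exact: hF.
have /mx_cvgP/(_ i j) h1 := Btilde_cvg hw; have /mx_cvgP/(_ i j) h2 := hL.
apply: dnbhs_unique h1 _.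
have h3 := one_sub_div_exp_cvg0 w0 mB0.
have e : (fun z => ((1 - z / w) ^+ mB *: F z) i j) = (fun z => (1 - z / w) ^+ mB * F z i j).
  by apply: funext => z; rewrite mxE.
rewrite e -[0](mul0r (lim (F @ w^') i j)); exact: cvgM h3 h2.
Qed.
End BoundaryPoles.

(** * Generating functions of the levels and of the tails *)

Section GeneratingFunction.
Context {R : realType}.
Local Notation C := (Cplx R).
Local Notation re z := (complex.Re (z : R[i])).

Lemma psbound_conv (a b : nat -> C) rho rho' B1 B2 : 0 < rho' -> rho' < rho -> psbound a rho B1 -> psbound b rho B2 ->
  exists K, psbound (conv a b) rho' K.
Proof.
move=> r0 rr ha hb; have rho0 : 0 < rho by exact: lt_trans rr.
have B10 := psbound_ge0 ha; have B20 := psbound_ge0 hb.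
have hg : psbound (fun k => toC (B1 * B2 * rho ^- k) : C) rho (B1 * B2).
  by split=> k; rewrite nc_real ger0_norm // !mulr_ge0 // invr_ge0 exprn_ge0 // ltW.
have [K hK] := psbound_mulk r0 rr hg; exists K; split=> k; apply: le_trans (psboundE k hK).
rewrite ncM nc_nat nc_real ger0_norm; last by rewrite !mulr_ge0 // invr_ge0 exprn_ge0 // ltW.
apply: le_trans (nc_sum _ _ _) _; apply: le_trans (_ : \sum_(i < k.+1) B1 * B2 * rho ^- k <= _).
  apply: ler_sum => i _; have ik : (i <= k)%N by rewrite -ltnS.
  rewrite ncM; apply: le_trans (ler_pM (nc_ge0 _) (nc_ge0 _) (psboundE i ha) (psboundE (k - i)%N hb)) _.
  by rewrite mulrACA -invfM -exprD subnKC.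
by rewrite sumr_const card_ord -[leLHS]mulr_natl.
Qed.

Lemma psbound_unshift (u : nat -> C) r K : 0 < r -> psbound u r K ->
  psbound (fun k => if k is k'.+1 then u k' else 0) r (r * K).
Proof.
move=> r0 hu; have K0 := psbound_ge0 hu; split=> -[|k].
  by rewrite nc0 !mulr_ge0 ?invr_ge0 ?exprn_ge0 // ltW.
apply: le_trans (psboundE k hu) _; rewrite exprS invfM; move: (r ^- k) => q.
by rewrite (_ : r * K * (r^-1 * q) = K * q) //; field; rewrite gt_eqF.
Qed.

Definition unit_seq (c : C) k : C := if k == 0%N then c else 0.

Lemma unit_seq_bound c r : 0 < r -> psbound (unit_seq c) r (nc c).
Proof.
move=> r0; split=> k; rewrite /unit_seq; case: eqP => [->|_]; first by rewrite expr0 invr1 mulr1.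
by rewrite nc0 mulr_ge0 ?nc_ge0 // invr_ge0 exprn_ge0 // ltW.
Qed.

Lemma unit_seq_psf c z : psf (unit_seq c) z = c.
Proof.
apply: psf_eq; rewrite -(cvg_shiftS (psum (unit_seq c) z)).
rewrite (_ : (fun k => psum (unit_seq c) z k.+1) = (fun=> c)); first exact: cvg_cst.
apply: funext => k; rewrite psumSl /psum big1 ?mulr0 ?addr0 // => i _.
by rewrite /unit_seq /= mul0r.
Qed.

Variables (Q : MG1 R) (x0 : 'rV[R]_(M0 Q)) (xs : nat -> 'rV[R]_(M Q)).
Local Notation n := (M Q).
Local Notation A := (Ablk Q).
Hypothesis hst : is_stationary x0 xs.

(** Level 0 has its own dimension and [xs 0] is unconstrained, so the sequence is set to 0 there and
    the series starts at level 1. *)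
Definition xpos k : 'rV[R]_n := if k == 0%N then 0 else xs k.

Lemma xpos_ge0 k j : 0 <= xpos k 0 j.
Proof. by rewrite /xpos; case: eqP => _; rewrite ?mxE //; case: hst => _ h _ _ _; exact: h. Qed.

Section Tail.
Variables (rho K : R) (j : 'I_n).
Hypotheses (r1 : 1 < rho) (hK : psbound (fun k => toC (xpos k 0 j) : C) rho K).

(** Synthetic division at [a = 1]: the quotient coefficients of [ps_factor] are the tail sums, which
    also shows that the limits defining [xbar] exist. *)
Lemma xbar_gen : exists K', [/\ psbound (fun k => toC (xbar xs k 0 j) : C) rho K',
  forall k, xbar xs k 0 j = xs k.+1 0 j + xbar xs k.+1 0 j, forall k, 0 <= xbar xs k 0 j &
  forall z, nc z < rho -> psf (fun k => toC (xpos k 0 j)) z - psf (fun k => toC (xpos k 0 j)) 1 =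
     (z - 1) * psf (fun k => toC (xbar xs k 0 j)) z].
Proof.
have r0 : 0 < rho by exact: lt_trans r1.
have n1 : nc (1 : C) < rho by rewrite nc1.
have [g [K' [hg rec hz]]] := ps_factor r0 hK n1.
have rec' k : g k = toC (xs k.+1 0 j) + g k.+1 by rewrite rec mul1r.
have part k m : g k = toC (\sum_(k.+1 <= l < k.+1 + m) xs l 0 j) + g (k + m)%N.
  elim: m => [|m IH]; first by rewrite !addn0 big_geq // toC0 add0r.
  by rewrite !addnS big_nat_recr ?leq_addr //= toCD -addrA -addSn -rec' -IH.
have g0 : g @ \oo --> (0 : C).
  have := ps_tail0 r0 hg n1; rewrite (_ : (fun k => g k * 1 ^+ k) = g) //.
  by apply: funext => k; rewrite expr1n mulr1.
have cvgp k : (fun N => toC (\sum_(k.+1 <= l < N) xs l 0 j) : C) @ \oo --> g k.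
  have h : (fun N => g k - g N.-1) @ \oo --> g k - 0.
    apply: cvgB; first exact: cvg_cst.
    by rewrite -(cvg_shiftS (fun N => g N.-1)).
  rewrite subr0 in h; move: h; apply: cvg_trans; apply: near_eq_cvg; near=> N.
  have kN : (k.+1 <= N)%N by near: N; exists k.+1.
  rewrite (part k (N - k.+1)%N) subnKC //.
  by rewrite (_ : (k + (N - k.+1))%N = N.-1) ?addrK //; lia.
have gE k : g k = toC (xbar xs k 0 j).
  have h1 := cvg_re (cvgp k); have h2 := cvgC_toC h1.
  have e : g k = toC (re (g k)) by apply: cvgC_unique (cvgp k) h2.
  by rewrite e /xbar mxE; congr toC; apply/esym; apply: (cvg_lim (@Rhausdorff R)).
have gf : g = (fun k => toC (xbar xs k 0 j)) by apply: funext.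
rewrite gf in hg hz rec'.
have xs0 : forall k, nonneg_mx (xs k) by have [] := hst.
exists K'; split=> // k; first by have := rec' k; rewrite -toCD => /toC_inj.
have hk : (fun N => \sum_(k.+1 <= l < N) xs l 0 j) @ \oo --> re (g k) by exact: cvg_re (cvgp k).
rewrite /xbar mxE; apply: limr_ge; first by apply/cvg_ex; exists (re (g k)).
by apply: nearW => N; apply: sumr_ge0 => l _; exact: xs0.
Unshelve. all: by end_near. Qed.
End Tail.

(** The balance equations of the positive levels, multiplied by [z ^+ k.+1] and summed; the sum over
    [l] is a Cauchy product. Bounds at the smaller radius [r] justify each rearrangement. *)
Lemma X_identity (rho B KX KB : R) (z : C) j : 0 < rho -> nc z < rho ->
  (forall i j, psbound (fun k => toC (A k i j) : C) rho B) ->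
  (forall i, psbound (fun k => toC (xpos k 0 i) : C) rho KX) ->
  (forall i j, psbound (fun k => toC (Bs Q k i j) : C) rho KB) ->
  \sum_i psf (fun k => toC (xpos k 0 i)) z * (z%:M - AstarC Q z) i j =
  z * (\sum_i toC (x0 0 i) * psf (fun k => toC (Bs Q k i j)) z - toC ((xs 1%N *m A 0%N) 0 j)).
Proof.
move=> r0 zr hA hX hB; have [_ _ _ _ xrec] := hst.
pose r := (nc z + rho) / 2.
have rp : 0 < r by rewrite divr_gt0 // ltr_wpDl // nc_ge0.
have rr : r < rho by rewrite midf_lt.
have zr' : nc z < r by rewrite midf_lt.
pose cv i := conv (fun k => toC (xpos k 0 i)) (fun k => toC (A k i j)).
have /choice[Kc hKc] : forall i, exists K, psbound (cv i) r K.
  by move=> i; exact: psbound_conv rp rr (hX i) (hA i j).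
have [hb1 e1] := @psf_sum _ _ (index_enum _) cv Kc r z rp (fun i _ => hKc i) zr'.
have hB' i : psbound (fun k => toC (x0 0 i) * toC (Bs Q k i j) : C) r (nc (toC (x0 0 i)) * KB).
  exact: psbound_mono (ltW rr) (psboundZ _ (hB i j)).
have [hb2 e2] := @psf_sum _ _ (index_enum _) (fun i k => toC (x0 0 i) * toC (Bs Q k i j) : C) _ r z rp (fun i _ => hB' i) zr'.
pose s k : C := if k is k'.+1 then toC (xpos k' 0 j) else 0.
pose t k : C := if k is k'.+1 then \sum_i toC (x0 0 i) * toC (Bs Q k' i j) else 0.
pose c0 := - toC ((xs 1%N *m A 0%N) 0 j) : C.
(* [dl] removes the term [xs 1 *m A 0] at exponent 1 of the convolution: it is a passage from level
   1 down to level 0, absent from the equations of the positive levels. *)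
pose dl k : C := if k is k'.+1 then unit_seq c0 k' else 0.
have seq k : s k = t k + (\sum_i cv i k + dl k).
  case: k => [|k] /=.
    rewrite big1 ?addr0 ?add0r // => i _; by rewrite /cv /conv big_ord1 /xpos /= mxE toC0 mul0r.
  have ecv : \sum_i cv i k.+1 = toC (\sum_i \sum_(1 <= l < k.+2) xs l 0 i * A (k.+1 - l)%N i j).
    rewrite toC_sum; apply: eq_bigr => i _; rewrite /cv /conv big_ord_recl /= /xpos /= [X in toC X * _]mxE toC0 mul0r add0r.
    rewrite big_add1 big_mkord toC_sum; apply: eq_bigr => l _; by rewrite toCM.
  rewrite ecv.
  case: k {ecv} => [|k].
    rewrite /dl /unit_seq /c0 /= /xpos /= mxE toC0 big1 ?add0r; last by move=> i _; rewrite /Bs /= mxE toC0 mulr0.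
    rewrite mxE -toCN -toCD; apply/esym; rewrite -[RHS]toC0; congr toC.
    by rewrite -sumrB big1 // => i _; rewrite big_nat1 subnn subrr.
  rewrite /dl /unit_seq /= addr0 /xpos /= {1}(xrec k.+1) // mxE toCD; congr (_ + _).
    by rewrite mxE toC_sum; apply: eq_bigr => i _; rewrite toCM.
  rewrite summxE exchange_big; congr toC; apply: eq_bigr => l _ /=.
  by rewrite mxE.
have hs := psbound_unshift rp (psbound_mono rp (ltW rr) (hX j)).
have ht := psbound_unshift rp hb2.
have hd1 := psbound_unshift rp (unit_seq_bound c0 rp).
have hd2 : psf dl z = c0 * z.
  by rewrite (psf_shift rp hd1 zr') add0r (_ : dl \o S = unit_seq c0) // unit_seq_psf mulrC.
have es : psf s z = z * psf (fun k => toC (xpos k 0 j)) z.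
  by rewrite (psf_shift rp hs zr') add0r.
have et : psf t z = z * \sum_i toC (x0 0 i) * psf (fun k => toC (Bs Q k i j)) z.
  rewrite (psf_shift rp ht zr') add0r; congr (_ * _).
  rewrite (_ : t \o S = (fun k => \sum_i toC (x0 0 i) * toC (Bs Q k i j))) // e2.
  by apply: eq_bigr => i _; rewrite (psfZ _ r0 (hB i j) zr).
have e3 : psf s z = psf t z + (psf (fun k => \sum_i cv i k) z + psf dl z).
  rewrite -(psfD rp hb1 hd1 zr') -(psfD rp ht (psboundD hb1 hd1) zr'); congr (psf _ z).
  by apply: funext => k; rewrite seq.
rewrite es et e1 hd2 /c0 in e3.
have e4 : \sum_i psf (cv i) z = \sum_i psf (fun k => toC (xpos k 0 i)) z * AstarC Q z i j.
  by apply: eq_bigr => i _; rewrite AstarC_E; exact: psf_conv r0 (hX i) (hA i j) zr.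
have e5 : \sum_i psf (fun k => toC (xpos k 0 i)) z * (z%:M - AstarC Q z) i j =
   z * psf (fun k => toC (xpos k 0 j)) z - \sum_i psf (cv i) z.
  rewrite e4 (eq_bigr (fun i => psf (fun k => toC (xpos k 0 i)) z * (z *+ (i == j)) - psf (fun k => toC (xpos k 0 i)) z * AstarC Q z i j)).
    rewrite sumrB (bigD1 j) //= eqxx mulr1n mulrC big1 ?addr0 // => i /negPf ij.
    by rewrite ij mulr0n mulr0.
  by move=> i _; rewrite scalar_mx_subE mulrBr.
rewrite e5 e3; ring.
Qed.
End GeneratingFunction.

Section PuncturedLimits.
Context {R : realType}.
Local Notation C := (Cplx R).
Implicit Types (f g : C -> C) (w a b : C).

Lemma dcvg_cst w a : (fun=> a) @ w^' --> a. Proof. exact: cvg_cst. Qed.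
Lemma dcvgM f g w a b : f @ w^' --> a -> g @ w^' --> b -> (fun z => f z * g z) @ w^' --> a * b.
Proof. by move=> hf hg; exact (cvgM hf hg). Qed.
Lemma dcvgD f g w a b : f @ w^' --> a -> g @ w^' --> b -> (fun z => f z + g z) @ w^' --> a + b.
Proof. by move=> hf hg; exact (cvgD hf hg). Qed.
Lemma dcvgB f g w a b : f @ w^' --> a -> g @ w^' --> b -> (fun z => f z - g z) @ w^' --> a - b.
Proof. by move=> hf hg; exact (cvgB hf hg). Qed.
Lemma dcvg_sum (I : Type) (s : seq I) (f : I -> C -> C) (l : I -> C) w :
  (forall i, f i @ w^' --> l i) -> (fun z => \sum_(i <- s) f i z) @ w^' --> \sum_(i <- s) l i.
Proof.
move=> h; elim: s => [|i s IH].
  have e : (fun z => \sum_(i <- [::]) f i z) = (fun=> 0) by apply: funext => z; rewrite big_nil.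
  by rewrite big_nil e; exact: dcvg_cst.
have e : (fun z => \sum_(k <- i :: s) f k z) = (fun z => f i z + \sum_(k <- s) f k z).
  by apply: funext => z; rewrite big_cons.
by rewrite big_cons e; exact (dcvgD (h i) IH).
Qed.
Lemma dcvg_ccts f w : ccts w f -> f @ w^' --> f w.
Proof. by move=> h; apply: cvg_trans h; exact: cvg_app (@nbhs_dnbhs _ w). Qed.
End PuncturedLimits.

(** * The continued generating function of the tails *)

Section Quotient.
Context {R : realType}.
Local Notation C := (Cplx R).
Variables (m n mB : nat) (F : C -> 'M[C]_(m, n)) (E : C -> 'M[C]_n) (x : 'rV[C]_m) (c : 'rV[C]_n) (X1 : C).
Hypothesis mB0 : (0 < mB)%N.

(** The identity solved for the level generating function and inserted in (X(z) - X(1)) / (z - 1);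
    [c] will be [xs 1 *m A 0] and [E z] will be [z%:M - AstarC z]. *)
Definition quotient_fn j z : C := (z * ((x *m F z - c) *m invmx (E z)) 0 j - X1) / (z - 1).

Lemma quotient_cdiff j z : (forall i j, cdifferentiable (fun z => F z i j) z) ->
  (forall i j, cdifferentiable (fun z => E z i j) z) -> E z \in unitmx -> z != 1 ->
  cdifferentiable (quotient_fn j) z.
Proof.
move=> hF hE un z1; apply: cdiffM; last first.
  apply: cdiffV; first by rewrite subr_eq0.
  by apply: cdiffB; [exact: cdiff_id|exact: cdiff_cst].
apply: cdiffB; last exact: cdiff_cst.
apply: cdiffM; first exact: cdiff_id.
have e : (fun z => ((x *m F z - c) *m invmx (E z)) 0 j) =
  (fun z => \sum_i (\sum_k x 0 k * F z k i - c 0 i) * invmx (E z) i j).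
  apply: funext => y; rewrite mxE; apply: eq_bigr => i _; congr (_ * _).
  by rewrite mxE [X in _ + X]mxE; congr (_ - _); rewrite mxE.
rewrite e; apply: cdiff_sum => i _; apply: cdiffM; last exact: invmx_cdiff.
apply: cdiffB; last exact: cdiff_cst.
by apply: cdiff_sum => k _; apply: cdiffM; [exact: cdiff_cst|exact: hF].
Qed.

(** Of the [mB + 1] factors, [mB] are absorbed by [F] and one by the inverse; the terms with [c] and
    [X1] keep a surplus power of [1 - z / w] and vanish. *)
Lemma quotient_lim j (w : C) (B : 'M[C]_(m, n)) (I : 'M[C]_n) : w != 0 -> w != 1 ->
  (forall i j, (fun z => (1 - z / w) ^+ mB * F z i j) @ w^' --> B i j) ->
  (forall i, (fun z => (1 - z / w) * invmx (E z) i j) @ w^' --> I i j) ->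
  (fun z => (1 - z / w) ^+ mB.+1 * quotient_fn j z) @ w^' --> w * (\sum_i (\sum_k x 0 k * B k i) * I i j) / (w - 1).
Proof.
move=> w0 w1 hB hI.
have hp k (k0 : (0 < k)%N) := one_sub_div_exp_cvg0 w0 k0.
have hid : (fun z : C => z) @ w^' --> w by exact: (@nbhs_dnbhs _ w).
have hden : (fun z : C => (z - 1)^-1) @ w^' --> (w - 1)^-1.
  apply: (dcvg_ccts (f := fun z => (z - 1)^-1)); apply: ccts_cdiff; apply: cdiffV; first by rewrite subr_eq0.
  by apply: cdiffB; [exact: cdiff_id|exact: cdiff_cst].
have hrow i : (fun z => \sum_k x 0 k * ((1 - z / w) ^+ mB * F z k i) - (1 - z / w) ^+ mB * c 0 i) @ w^' --> \sum_k x 0 k * B k i - 0 * c 0 i.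
  apply: dcvgB; last by apply: dcvgM; [exact: hp|exact: dcvg_cst].
  by apply: dcvg_sum => k; apply: dcvgM; [exact: dcvg_cst|exact: hB].
have hN : (fun z => z * (\sum_i (\sum_k x 0 k * ((1 - z / w) ^+ mB * F z k i) - (1 - z / w) ^+ mB * c 0 i) * ((1 - z / w) * invmx (E z) i j)) - (1 - z / w) ^+ mB.+1 * X1) @ w^' -->
   w * (\sum_i (\sum_k x 0 k * B k i - 0 * c 0 i) * I i j) - 0 * X1.
  apply: dcvgB; last by apply: dcvgM; [exact: hp|exact: dcvg_cst].
  by apply: dcvgM hid _; apply: dcvg_sum => i; apply: dcvgM; [exact: hrow|exact: hI].
have hQ := dcvgM hN hden.
have e1 : w * (\sum_i (\sum_k x 0 k * B k i - 0 * c 0 i) * I i j) - 0 * X1 = w * (\sum_i (\sum_k x 0 k * B k i) * I i j).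
  by rewrite mul0r subr0; congr (_ * _); apply: eq_bigr => i _; rewrite mul0r subr0.
rewrite e1 in hQ.
have e2 : (fun z => (1 - z / w) ^+ mB.+1 * quotient_fn j z) =
  (fun z => (z * (\sum_i (\sum_k x 0 k * ((1 - z / w) ^+ mB * F z k i) - (1 - z / w) ^+ mB * c 0 i) * ((1 - z / w) * invmx (E z) i j)) - (1 - z / w) ^+ mB.+1 * X1) * (z - 1)^-1).
  apply: funext => z; rewrite /quotient_fn mulrA; congr (_ * _); rewrite mulrBr mulrCA; congr (_ * _ - _).
  rewrite mxE mulr_sumr; apply: eq_bigr => i _.
  have -> : (x *m F z - c) 0 i = \sum_k x 0 k * F z k i - c 0 i by rewrite mxE [X in _ + X]mxE; congr (_ - _); rewrite mxE.
  rewrite exprS.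
  rewrite (_ : \sum_k x 0 k * ((1 - z / w) ^+ mB * F z k i) = (1 - z / w) ^+ mB * \sum_k x 0 k * F z k i).
    move: ((1 - z / w) ^+ mB) (1 - z / w) (\sum_k _) (c 0 i) (invmx _ _ _) => a1 a2 a3 a4 a5; ring.
  by rewrite mulr_sumr; apply: eq_bigr => k _; rewrite mulrCA.
by rewrite e2.
Qed.

Lemma quotient_eq j z (X X1v : 'rV[C]_n) (b : C) : X1v 0 j = X1 -> E z \in unitmx -> z != 1 ->
  X *m E z = z *: (x *m F z - c) -> X 0 j - X1 = (z - 1) * b -> b = quotient_fn j z.
Proof.
move=> hX1 un z1 hX hb.
have e : X = z *: ((x *m F z - c) *m invmx (E z)) by rewrite -[X]mulmx1 -(mulmxV un) mulmxA hX scalemxAl.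
have z10 : z - 1 != 0 by rewrite subr_eq0.
have e2 : X 0 j = z * ((x *m F z - c) *m invmx (E z)) 0 j by rewrite {1}e mxE.
by rewrite /quotient_fn -e2 hb mulrC mulKf.
Qed.
End Quotient.

(** * The tail generating function near the circle of radius theta *)

Section BoundaryAnalysis.
Context {R : realType}.
Local Notation C := (Cplx R).
Variables (Q : MG1 R) (x0 : 'rV[R]_(M0 Q)) (xs : nat -> 'rV[R]_(M Q)) (theta rho B : R)
  (U : set C) (F : C -> 'M[C]_(M0 Q, M Q)) (mB tau : nat) (p : 'I_(M Q) -> nat)
  (mu : 'rV[R]_(M Q)) (v : 'cV[R]_(M Q)).
Local Notation n := (M Q).
Local Notation A := (Ablk Q).
Hypotheses (n0 : (0 < n)%N) (A0 : forall k i j, 0 <= A k i j) (B0 : forall k i j, 0 <= Bs Q k i j)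
  (t1 : 1 < theta) (tr : theta < rho)
  (hB : forall k i j, `|A k i j| <= B * rho ^- k)
  (hA1 : mxseries_to A (Asum Q)) (irr : mx_irreducible (Asum Q))
  (htau : is_period Q tau) (hp : is_phase tau p)
  (muA : mu *m AstarR Q theta = theta *: mu) (Av : AstarR Q theta *m v = theta *: v)
  (muv : mu *m v = 1) (mu0 : forall j, 0 < mu 0 j) (v0 : forall j, 0 < v j 0)
  (d1 : 1 < (mu *m AstarR' Q theta *m v) 0 0)
  (rB : conv_radius (Bs Q) = theta%:E) (H4 : Assumption4 theta U F mB)
  (hst : is_stationary x0 xs)
  (hX : forall r, 0 < r -> r < theta -> exists K, forall j, psbound (fun k => toC (xpos xs k 0 j) : C) r K).

Let t0 : 0 < theta. Proof. exact: lt_trans t1. Qed.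
Let rho0 : 0 < rho. Proof. exact: lt_trans tr. Qed.
Let tC0 : (toC theta : C) != 0. Proof. by rewrite -nc_eq0 nc_real normr_eq0 gt_eqF. Qed.
Let D : C := toC ((mu *m AstarR' Q theta *m v) 0 0).
Let E (z : C) : 'M[C]_n := z%:M - AstarC Q z.

(** The limit of [(1 - z / w) *: invmx (E z)] rather than of [(z - w) *: invmx (E z)], hence the
    factor [- w^-1]; it is 0 where the resolvent is regular. *)
Definition residue (w : C) : 'M[C]_n :=
  let om := w / toC theta in
  if om ^+ tau == 1 then
    \matrix_(i, j) (- w^-1 * ((1 - D)^-1 * ((DeltaM p om *m mxC v) i 0 * (mxC mu *m invmx (DeltaM p om)) 0 j)))
  else 0.

Lemma E_cdiff z i j : nc z < rho -> cdifferentiable (fun z => E z i j) z.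
Proof.
move=> hz; have h := @AstarC_deriv _ _ _ _ _ t0 tr hB z i j hz.
by exists ((1%:M - AstarC' Q z) i j); exact (scalar_mx_sub_deriv h).
Qed.

Lemma resolvent_residue (w : C) : nc w = theta ->
  (exists2 d : R, 0 < d & forall z, z != w -> nc (z - w) < d -> E z \in unitmx) /\
  forall i j, (fun z => (1 - z / w) * invmx (E z) i j) @ w^' --> residue w i j.
Proof.
move=> hw; set om := w / toC theta.
have ew : toC theta * om = w by rewrite /om mulrC divfK.
have om1 : nc om = 1 by rewrite /om ncM ncV nc_real hw gtr0_norm // divff // gt_eqF.
have w0 : w != 0 by rewrite -nc_gt0 hw.
rewrite /residue -/om; case: ifP => [/eqP omt|/negbT omt].
  have [h1 h2] := resolvent_pole n0 A0 t0 tr hB hA1 irr htau hp muA Av muv v0 om1 omt d1.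
  rewrite ew in h1 h2; split; first exact: h1.
  move=> i j; rewrite mxE; have h3 := dcvgM (@dcvg_cst R w (- w^-1)) (h2 i j).
  have e : (fun z => (1 - z / w) * invmx (E z) i j) = (fun z => - w^-1 * ((z - w) * (invmx (E z)) i j)).
    by apply: funext => z; rewrite mulrA; congr (_ * _); field.
  by rewrite e; exact h3.
have un := resolvent_regular n0 A0 t0 tr hB hA1 irr htau hp Av v0 om1 omt; rewrite ew in un.
have hr : nc w < rho by rewrite hw.
have hc i j : ccts w (fun z => E z i j) by apply: ccts_cdiff; exact: E_cdiff.
have [d d0 hd] := @unitmx_near R n E w hc un.
split; first (exists d; [exact d0|move=> z _; exact (hd z)]).
move=> i j; rewrite mxE -(mul0r (invmx (E w) i j)).
have h1 := one_sub_div_cvg0 w0.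
have h2 := @invmx_cts R n E w i j hc un.
exact (dcvgM h1 (dcvg_ccts h2)).
Qed.

Let c1 : 'rV[C]_n := mxC (xs 1%N *m A 0%N).
Let X1 j : C := psf (fun k => toC (xpos xs k 0 j)) 1.
Let qf j := quotient_fn F E (mxC x0) c1 (X1 j) j.

(** Inside the disc the power series is kept, because the quotient formula may fail at 1 and where
    [E z] is singular; [xbar_quotient] shows that the two agree elsewhere in the disc. *)
Definition xbar_ext j (z : C) : C := if nc z < theta then psf (fun k => toC (xbar xs k 0 j)) z else qf j z.

Definition boundary_coef j (w : C) : C :=
  w * (\sum_i (\sum_k mxC x0 0 k * Btilde F mB w k i) * residue w i j) / (w - 1).

Lemma xbar_bound r j : 0 < r -> r < theta -> exists K, psbound (fun k => toC (xbar xs k 0 j) : C) r K.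
Proof.
move=> r0 rt; pose y := Num.max r ((1 + theta) / 2).
have y1 : 1 < y by rewrite lt_max midf_lt ?orbT.
have yt : y < theta by rewrite gt_max rt midf_lt.
have [K hK] := hX (lt_trans ltr01 y1) yt; have [K' [hK' _ _ _]] := xbar_gen hst y1 (hK j).
by exists K'; apply: psbound_mono hK' => //; rewrite le_max lexx.
Qed.

Lemma xbar_step k j : xbar xs k 0 j = xs k.+1 0 j + xbar xs k.+1 0 j.
Proof.
have y1 : 1 < (1 + theta) / 2 by rewrite midf_lt.
have yt : (1 + theta) / 2 < theta by rewrite midf_lt.
have [K hK] := hX (lt_trans ltr01 y1) yt; by have [K' [_ h _ _]] := xbar_gen hst y1 (hK j).
Qed.

Lemma xbar_ge0 k j : 0 <= xbar xs k 0 j.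
Proof.
have y1 : 1 < (1 + theta) / 2 by rewrite midf_lt.
have yt : (1 + theta) / 2 < theta by rewrite midf_lt.
have [K hK] := hX (lt_trans ltr01 y1) yt; by have [K' [_ _ h _]] := xbar_gen hst y1 (hK j).
Qed.

Lemma xbar_quotient j z : nc z < theta -> z != 1 -> E z \in unitmx ->
  psf (fun k => toC (xbar xs k 0 j)) z = qf j z.
Proof.
move=> zt z1 un; pose y := (Num.max (nc z) 1 + theta) / 2.
have mt : Num.max (nc z) 1 < theta by rewrite gt_max zt t1.
have y1 : 1 < y by apply: le_lt_trans (_ : Num.max (nc z) 1 < y); [rewrite le_max lexx orbT|rewrite midf_lt].
have zy : nc z < y by apply: le_lt_trans (_ : Num.max (nc z) 1 < y); [rewrite le_max lexx|rewrite midf_lt].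
have yt : y < theta by rewrite midf_lt.
have y0 : 0 < y by exact: lt_trans y1.
have [K hK] := hX y0 yt; have [K' [_ _ _ hz]] := xbar_gen hst y1 (hK j).
have [KB _ hKB] := Bs_bound rB y0 yt.
have hKA i k : psbound (fun m => toC (A m i k) : C) y B.
  exact: psbound_mono y0 (ltW (lt_trans yt tr)) (Ablk_bound hB i k).
pose X : 'rV[C]_n := \row_i psf (fun k => toC (xpos xs k 0 i)) z.
pose X1v : 'rV[C]_n := \row_i X1 i.
apply: (@quotient_eq _ _ _ F E (mxC x0) c1 (X1 j) j z X X1v) => //; first by rewrite mxE.
  apply/matrixP => a k; rewrite ord1 mxE [RHS]mxE.
  have -> : (mxC x0 *m F z - c1) 0 k = \sum_i toC (x0 0 i) * psf (fun k' => toC (Bs Q k' i k)) z - toC ((xs 1%N *m A 0%N) 0 k).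
    rewrite mxE [X in _ + X]mxE [X in _ - X]mxE; congr (_ - _); rewrite mxE; apply: eq_bigr => i _.
    by rewrite mxE (F_psf t0 rB H4 i k zt).
  rewrite -(X_identity hst k y0 zy hKA hK hKB); apply: eq_bigr => i _.
  by rewrite mxE.
by rewrite mxE; exact (hz z zy).
Qed.

(** In a punctured disc around [w] the function coincides with the quotient on both sides of the
    circle, so differentiability and the limit are inherited from it. *)
Lemma xbar_ext_boundary j (w : C) : nc w = theta ->
  (exists2 e : R, 0 < e & forall z, z != w -> nc (z - w) < e -> cdifferentiable (xbar_ext j) z) /\
  (fun z => (1 - z / w) ^+ mB.+1 * xbar_ext j z) @ w^' --> boundary_coef j w.
Proof.
move=> hw; have [[d d0 hd] hI] := resolvent_residue hw.
have [_ mB0 _ _ _] := H4.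
have w0 : w != 0 by rewrite -nc_gt0 hw.
have w1 : w != 1 by apply: contraTneq t1 => e; rewrite -hw e nc1 ltxx.
have [eF eF0 heF] : exists2 e : R, 0 < e & forall z, z != w -> nc (z - w) < e -> forall i k, cdifferentiable (fun z => F z i k) z.
  have /choice[e he] : forall ik : 'I_(M0 Q) * 'I_n, exists e : R, 0 < e /\ forall z, z != w -> nc (z - w) < e -> cdifferentiable (fun z => F z ik.1 ik.2) z.
    move=> [i k]; have [kap [r [K [r0 _ h]]]] := F_laurent t0 B0 rB H4 i k hw.
    by exists r; split=> // z zw hz; have [] := h z zw hz.
  have [e1 e10 hle] := fin_pos_lb (fun ik => (he ik).1).
  exists e1 => // z zw hz i k; apply: ((he (i, k)).2 z zw); exact: lt_le_trans (hle (i, k)).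
(* The gaps [theta - 1] and [rho - theta] keep the disc away from the zero of [z - 1] and within the
   domain of A*. *)
pose e := Num.min (Num.min d eF) (Num.min (theta - 1) (rho - theta)).
have e0 : 0 < e by rewrite !lt_min d0 eF0 !subr_gt0 t1 tr.
have near_eq z : z != w -> nc (z - w) < e ->
   [/\ E z \in unitmx, forall i k, cdifferentiable (fun z => F z i k) z, z != 1, nc z < rho & xbar_ext j z = qf j z].
  move=> zw; rewrite !lt_min => /andP[/andP[h1 h2] /andP[h3 h4]].
  have z1 : z != 1.
    apply: contraTneq h3 => ->; rewrite -leNgt; have := ge_nc w 1; rewrite nc1 hw ncC; lra.
  have un := hd z zw h1; split=> //; first exact: heF.
    have := ge_nc z w; rewrite hw; lra.
  by rewrite /xbar_ext; case: ifP => // zt; exact: xbar_quotient.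
split.
  exists e => // z zw hz; have [un hF z1 zr _] := near_eq z zw hz.
  have hq : cdifferentiable (qf j) z.
    by apply: quotient_cdiff => // a b; exact: E_cdiff.
  have r0 : 0 < Num.min (nc (z - w)) (e - nc (z - w)) by rewrite lt_min nc_gt0 subr_eq0 zw subr_gt0.
  apply: cdiff_near r0 _ hq => y; rewrite lt_min => /andP[h1 h2]; apply/esym.
  have yw : y != w by apply: contraTneq h1 => ->; rewrite ncC ltxx.
  have hy : nc (y - w) < e.
    have -> : y - w = (y - z) + (z - w) by ring.
    apply: le_lt_trans (ncD _ _) _; lra.
  by have [] := near_eq y yw hy.
have hBt i k : (fun z => (1 - z / w) ^+ mB * F z i k) @ w^' --> Btilde F mB w i k.
  have /mx_cvgP/(_ i k) h := Btilde_cvg t0 B0 rB H4 hw.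
  have e1 : (fun z => (1 - z / w) ^+ mB * F z i k) = (fun z => ((1 - z / w) ^+ mB *: F z) i k).
    by apply: funext => z; rewrite mxE.
  by rewrite e1.
have hl := @quotient_lim R _ _ mB F E (mxC x0) c1 (X1 j) mB0 j w (Btilde F mB w) (residue w) w0 w1 hBt (fun i => hI i j).
move/cvgCP: hl => hl; apply/cvgCP => x x00; have /near_dnbhsC[d' d'0 h'] := hl x x00.
apply/near_dnbhsC; exists (Num.min d' e); first by rewrite lt_min d'0.
move=> z zw; rewrite lt_min => /andP[h1 h2]; have [_ _ _ _ ->] := near_eq z zw h2.
exact (h' z zw h1).
Qed.
End BoundaryAnalysis.

(** * Positivity of the stationary probabilities of level 0 *)

Section StationaryPositivity.
Context {R : realType}.
Variables (Q : MG1 R) (x0 : 'rV[R]_(M0 Q)) (xs : nat -> 'rV[R]_(M Q)).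
Hypotheses (A0 : forall k i j, 0 <= Ablk Q k i j) (B00 : nonneg_mx (B0 Q)) (Bs0 : forall k i j, 0 <= Bs Q k i j)
  (C00 : nonneg_mx (C0 Q)) (hst : is_stationary x0 xs) (Tirr : T_irreducible Q).

Lemma mxn_gt0 m k (X : 'M[R]_(m, k)) i j : 0 < mxn X i j -> exists (i' : 'I_m) (j' : 'I_k), [/\ i = i' :> nat, j = j' :> nat & 0 < X i' j'].
Proof.
rewrite /mxn; case: insubP => [i' _ <-|_]; last by rewrite ltxx.
by case: insubP => [j' _ <-|_]; [exists i', j'|rewrite ltxx].
Qed.

Lemma mxnE m k (X : 'M[R]_(m, k)) (i : 'I_m) (j : 'I_k) : mxn X i j = X i j.
Proof. by rewrite /mxn !valK. Qed.

Let weight (s : nat * nat) : R := if s.1 == 0%N then mxn x0 0 s.2 else mxn (xs s.1) 0 s.2.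

Let mulmx_gt0 m k (x : 'rV[R]_m) (X : 'M[R]_(m, k)) i j : (forall i, 0 <= x 0 i) -> (forall i j, 0 <= X i j) ->
  0 < x 0 i -> 0 < X i j -> 0 < (x *m X) 0 j.
Proof.
move=> x_ge0 X_ge0 xi Xij; rewrite mxE (bigD1 i) //= ltr_pwDl ?mulr_gt0 // sumr_ge0 // => l _.
exact: mulr_ge0.
Qed.

Let mulmx_ge0' m k (x : 'rV[R]_m) (X : 'M[R]_(m, k)) j : (forall i, 0 <= x 0 i) -> (forall i j, 0 <= X i j) ->
  0 <= (x *m X) 0 j.
Proof. by move=> x_ge0 X_ge0; rewrite mxE sumr_ge0 // => l _; exact: mulr_ge0. Qed.

(** The balance equation for [t] is a sum of nonnegative terms, one of which is the weight of [s]
    times the transition entry; the cases follow the block structure. *)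
Lemma weight_step s t : 0 < weight s -> 0 < Tent Q s t -> 0 < weight t.
Proof.
have [x00 xs0 _ e0 ek] := hst.
have x00' i : 0 <= x0 0 i by exact: x00.
have xs0' k i : 0 <= xs k 0 i by exact: xs0.
have B00' i j : 0 <= B0 Q i j by exact: B00.
have C00' i j : 0 <= C0 Q i j by exact: C00.
case: s => k i; case: t => l j; rewrite /weight /Tent /=.
have [k0|k0] := eqVneq k 0%N; have [l0|l0] := eqVneq l 0%N.
- move=> /mxn_gt0[z [i' [z0 ei xi]]] /mxn_gt0[i2 [j' [ei2 ej Bij]]].
  have ei' : i' = i2 by apply: val_inj; rewrite /= -ei.
  rewrite ej -[0%N]/(val (0 : 'I_1)) mxnE {1}e0 mxE ltr_pwDl //.
    by apply: (mulmx_gt0 (i := i')) => //; [move: xi; rewrite (ord1 z)|rewrite ei'].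
  by apply: mulmx_ge0'.
- move=> /mxn_gt0[z [i' [z0 ei xi]]] /mxn_gt0[i2 [j' [ei2 ej Bij]]].
  have ei' : i' = i2 by apply: val_inj; rewrite /= -ei.
  rewrite ej -[0%N]/(val (0 : 'I_1)) mxnE (ek l) ?lt0n // mxE ltr_pwDl //.
    by apply: (mulmx_gt0 (i := i')) => //; [move: xi; rewrite (ord1 z)|rewrite ei'].
  by rewrite summxE sumr_ge0 // => q _; exact: mulmx_ge0'.
- case: eqP => [->|]; last by rewrite ltxx.
  move=> /mxn_gt0[z [i' [z0 ei xi]]] /mxn_gt0[i2 [j' [ei2 ej Bij]]].
  have ei' : i' = i2 by apply: val_inj; rewrite /= -ei.
  rewrite ej -[0%N]/(val (0 : 'I_1)) mxnE {1}e0 mxE ltr_wpDl //.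
    by apply: mulmx_ge0'.
  by apply: (mulmx_gt0 (i := i')) => //; [move: xi; rewrite (ord1 z)|rewrite ei'].
- case: ifP => [kl|]; last by rewrite ltxx.
  move=> /mxn_gt0[z [i' [z0 ei xi]]] /mxn_gt0[i2 [j' [ei2 ej Bij]]].
  have ei' : i' = i2 by apply: val_inj; rewrite /= -ei.
  rewrite ej -[0%N]/(val (0 : 'I_1)) mxnE (ek l) ?lt0n // mxE ltr_wpDl //.
    by apply: mulmx_ge0'.
  rewrite summxE (bigD1_seq k) ?iota_uniq //=; last by rewrite mem_index_iota lt0n k0 ltnS.
  rewrite ltr_pwDl //; last by rewrite sumr_ge0 // => q _; exact: mulmx_ge0'.
  by apply: (mulmx_gt0 (i := i')) => //; [move: xi; rewrite (ord1 z)|rewrite ei'].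
Qed.

(** Some state has positive weight because the total mass is 1, and positivity travels along a path
    of positive transitions to [(0, i)]. *)
Lemma x0_gt0 i : 0 < x0 0 i.
Proof.
have [x00 xs0 hsum _ _] := hst.
have [s vs ws] : exists2 s, valid_state Q s & 0 < weight s.
  apply: contrapT => hn.
  have z0 (j : 'I_(M0 Q)) : x0 0 j = 0.
    apply/eqP; rewrite eq_le x00 andbT leNgt; apply/negP => h; apply: hn; exists (0%N, val j).
      by rewrite /valid_state /=.
    by rewrite /weight /= -[0%N]/(val (0 : 'I_1)) mxnE.
  have zk k (j : 'I_(M Q)) : (0 < k)%N -> xs k 0 j = 0.
    move=> k0; apply/eqP; rewrite eq_le xs0 andbT leNgt; apply/negP => h; apply: hn; exists (k, val j).
      by rewrite /valid_state /= (gtn_eqF k0).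
    by rewrite /weight /= (gtn_eqF k0) -[0%N]/(val (0 : 'I_1)) mxnE.
  have H k : (if k == 0%N then \sum_j x0 0 j else \sum_j xs k 0 j) = 0.
    by case: k => [|k] /=; rewrite big1 // => j _; rewrite ?z0 ?zk.
  by have /eqP := rs_unique (rs_ext H hsum) rs0; rewrite oner_eq0.
have vt : valid_state Q (0%N, val i) by rewrite /valid_state /=.
have [q [_ hp hl]] := Tirr vs vt.
have : 0 < weight (last s q).
  elim: q s ws hp {vs hl} => //= t q IH s ws /andP[hst' hq]; apply: IH hq; exact: weight_step ws hst'.
by rewrite hl /weight /= -[0%N]/(val (0 : 'I_1)) mxnE.
Qed.
End StationaryPositivity.

Lemma big_gcdn_dvd (I : eqType) (s : seq I) (P : pred I) (f : I -> nat) N :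
  (\big[gcdn/N]_(i <- s | P i) f i %| N)%N /\
  forall i, i \in s -> P i -> (\big[gcdn/N]_(i <- s | P i) f i %| f i)%N.
Proof.
elim: s => [|i s [IH1 IH2]]; first by rewrite big_nil.
rewrite big_cons; case: ifP => Pi; split.
- exact: dvdn_trans (dvdn_gcdr _ _) IH1.
- move=> j; rewrite inE => /orP[/eqP -> _|js Pj]; first exact: dvdn_gcdl.
  exact: dvdn_trans (dvdn_gcdr _ _) (IH2 j js Pj).
- exact: IH1.
- by move=> j; rewrite inE => /orP[/eqP -> |js Pj]; [rewrite Pi|exact: IH2].
Qed.

Lemma geom_orthogonality (R : realType) m (z : Cplx R) (P : pred nat) (T : nat -> Cplx R) :
  m.-primitive_root z -> P 0%N ->
  \sum_(e < m | P e) \sum_(l < m) (z ^+ e) ^- l * T e = m%:R * T 0%N.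
Proof.
move=> zp P0; have m0 := prim_order_gt0 zp.
rewrite (eq_bigr (fun e : 'I_m => (if val e == 0%N then m%:R else 0) * T e)) => [|e _]; last first.
  by rewrite -mulr_suml (sum_prim_root zp (ltn_ord e)).
rewrite (bigD1 (Ordinal m0)) //= big1 ?addr0 // => e /andP[_ ne].
by rewrite ifN ?mul0r //; apply: contraNneq ne => e0; apply/eqP/val_inj.
Qed.

(** * The dominant poles, the constants chat and the expansion of the tails *)

Section FinalAssembly.
Context {R : realType}.
Local Notation C := (Cplx R).
Variables (Q : MG1 R) (x0 : 'rV[R]_(M0 Q)) (xs : nat -> 'rV[R]_(M Q)) (theta rho B : R)
  (U : set C) (F : C -> 'M[C]_(M0 Q, M Q)) (mB tau : nat) (p : 'I_(M Q) -> nat)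
  (mu : 'rV[R]_(M Q)) (v : 'cV[R]_(M Q)).
Local Notation n := (M Q).
Local Notation A := (Ablk Q).
Hypotheses (n0 : (0 < n)%N) (A0 : forall k i j, 0 <= A k i j) (B0 : forall k i j, 0 <= Bs Q k i j)
  (t1 : 1 < theta) (tr : theta < rho)
  (hB : forall k i j, `|A k i j| <= B * rho ^- k)
  (hA1 : mxseries_to A (Asum Q)) (irr : mx_irreducible (Asum Q))
  (htau : is_period Q tau) (hp : is_phase tau p)
  (muA : mu *m AstarR Q theta = theta *: mu) (Av : AstarR Q theta *m v = theta *: v)
  (muv : mu *m v = 1) (mu0 : forall j, 0 < mu 0 j) (v0 : forall j, 0 < v j 0)
  (hD : ddelta Q theta = (mu *m AstarR' Q theta *m v) 0 0)
  (d1 : 1 < (mu *m AstarR' Q theta *m v) 0 0)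
  (rB : conv_radius (Bs Q) = theta%:E) (H4 : Assumption4 theta U F mB)
  (hst : is_stationary x0 xs) (x0p : forall i, 0 < x0 0 i)
  (hX : forall r, 0 < r -> r < theta -> exists K, forall j, psbound (fun k => toC (xpos xs k 0 j) : C) r K).

Let t0 : 0 < theta. Proof. exact: lt_trans t1. Qed.
Let tC0 : (toC theta : C) != 0. Proof. by rewrite -nc_eq0 nc_real normr_eq0 gt_eqF. Qed.
Let tau0 : (0 < tau)%N. Proof. exact: leq_ltn_trans (hp.1 (Ordinal n0)). Qed.
Local Notation tau1 := (tau' theta x0 xs F tau p v).
Local Notation inP' := (inP theta x0 xs F mB tau p v).
Local Notation inH' := (inH theta x0 xs F tau p v).
Local Notation tauh := (tauhat theta x0 xs F mB tau p v).
Local Notation chat' := (chat theta x0 xs F mB tau p mu v).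
Local Notation bcoef := (boundary_coef x0 theta F mB tau p mu v).
Let d := \big[gcdn/tau]_(nu < tau | inH' nu) nu.

Let dtau : (d %| tau)%N.
Proof. by have [] := big_gcdn_dvd (index_enum 'I_tau) (fun nu => inH' nu) (fun nu => val nu) tau. Qed.
Let d0 : (0 < d)%N. Proof. exact: dvdn_gt0 dtau. Qed.
Let ddvd (nu : 'I_tau) : inH' nu -> (d %| nu)%N.
Proof.
have [_ h] := big_gcdn_dvd (index_enum 'I_tau) (fun nu => inH' nu) (fun nu => val nu) tau.
by apply: h; rewrite mem_index_enum.
Qed.
Let tau1E : tau1 = (tau %/ d)%N. Proof. by []. Qed.
Let tau10 : (0 < tau1)%N. Proof. by rewrite tau1E divn_gt0 // dvdn_leq. Qed.
Let om1E : (omega tau1 : C) = omega tau ^+ d. Proof. by rewrite tau1E omega_div. Qed.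
Let om1P : tau1.-primitive_root (omega tau1 : C). Proof. exact: omega_prim. Qed.
Let omnc k : nc ((omega tau1 : C) ^+ k) = 1. Proof. by rewrite ncX nc_omega expr1n. Qed.
Let omtau k : ((omega tau1 : C) ^+ k) ^+ tau = 1.
Proof.
have e : (omega tau1 : C) ^+ tau = 1.
  by rewrite om1E -exprM mulnC exprM (prim_expr_order (omega_prim tau0)) expr1n.
by rewrite -exprM mulnC exprM e expr1n.
Qed.
Let omt1 k : ((omega tau1 : C) ^+ k) ^+ tau1 = 1.
Proof. by rewrite -exprM mulnC exprM (prim_expr_order om1P) expr1n. Qed.

Lemma Zset_Btilde (om : C) : nc om = 1 -> Btilde F mB (toC theta * om) != 0 -> Zset theta F mB om.
Proof.
move=> h1 h2; split; first by rewrite normCE h1.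
exists (Btilde F mB (toC theta * om)); split=> //; apply: (Btilde_cvg t0 B0 rB H4).
by rewrite ncM nc_real h1 mulr1 gtr0_norm.
Qed.

(** A nonzero leading coefficient makes [F] diverge, which puts the exponent [nu] of [om] in [inH];
    then the gcd [d] divides [nu] and [om] is a power of [omega tau1]. *)
Lemma inP_Btilde (om : C) : nc om = 1 -> om ^+ tau = 1 -> Btilde F mB (toC theta * om) != 0 ->
  exists2 eta : 'I_tau1, inP' eta & om = omega tau1 ^+ eta.
Proof.
move=> h1 omt h2; have [nu e] := prim_rootP (omega_prim tau0) omt.
have hH : inH' nu.
  rewrite /inH; apply/orP; right; apply/asboolP; left; rewrite /Bstar_finite_at -e.
  by apply: (F_not_cvg t0 B0 rB H4) => //; rewrite ncM nc_real h1 mulr1 gtr0_norm.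
have dn := ddvd hH.
have et : (nu %/ d < tau1)%N by rewrite tau1E ltn_divRL // divnK.
have e2 : om = omega tau1 ^+ (nu %/ d)%N by rewrite om1E -exprM mulnC divnK.
exists (Ordinal et) => //=; rewrite /inP; apply/asboolP; rewrite -e2; split.
  by exists (val nu); [split; [exact: ltn_ord|exact: hH]|rewrite e].
by exists om => //; exact: Zset_Btilde.
Qed.

Let S : seq C := [seq toC theta * omega tau1 ^+ (val eta) | eta : 'I_tau1 <- enum 'I_tau1 & inP' eta].

Let D : C := toC ((mu *m AstarR' Q theta *m v) 0 0).
Let D1 : D != 1. Proof. by rewrite -toC1; apply/eqP => /toC_inj e; have := d1; rewrite e ltxx. Qed.
Let q (om : C) : C := (mxC x0 *m Btilde F mB (toC theta * om) *m DeltaM p om *m mxC v) 0 0 / ((toC theta * om - 1) * (D - 1)).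

(** The rank-one residue factors the double sum; the factor [w] cancels against [- w^-1], whose sign
    turns [1 - D] into [D - 1]. *)
Lemma bcoefE j (om : C) : nc om = 1 -> om ^+ tau = 1 ->
  bcoef j (toC theta * om) = q om * (mxC mu *m invmx (DeltaM p om)) 0 j.
Proof.
move=> h1 h2; set w := toC theta * om.
have hw : nc w = theta by rewrite ncM nc_real h1 mulr1 gtr0_norm.
have w0 : w != 0 by rewrite -nc_gt0 hw.
have w1 : w - 1 != 0 by rewrite subr_eq0; apply: contraTneq t1 => e; rewrite -hw e nc1 ltxx.
have ew : w / toC theta = om by rewrite /w mulrC mulKf.
rewrite /boundary_coef /residue ew h2 eqxx /q.
set m := (mxC mu *m _) 0 j; set r := fun i => \sum_k mxC x0 0 k * Btilde F mB w k i.
have -> : (mxC x0 *m Btilde F mB w *m DeltaM p om *m mxC v) 0 0 = \sum_i r i * (DeltaM p om *m mxC v) i 0.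
  by rewrite -mulmxA mxE; apply: eq_bigr => i _; rewrite mxE.
have -> : \sum_i r i * (\matrix_(i, j) (- w^-1 * ((1 - D)^-1 * ((DeltaM p om *m mxC v) i 0 * (mxC mu *m invmx (DeltaM p om)) 0 j)))) i j
   = (\sum_i r i * (DeltaM p om *m mxC v) i 0) * (- w^-1 * ((1 - D)^-1 * m)).
  rewrite mulr_suml; apply: eq_bigr => i _; rewrite mxE -/m.
  by move: (_ *m _) (r i) (1 - D)^-1 => X r' D'; ring.
move: (\sum_i _) => s; have D2 : 1 - D != 0 by rewrite subr_eq0 eq_sym.
have D3 : D - 1 != 0 by rewrite subr_eq0.
rewrite -/w; move: w0 w1 D2 D3; move: (w) (D) m => w' D' m' w0 w1 D2 D3; field.
by rewrite D3 D2 w1 w0.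
Qed.

Lemma chatE k j : chat' k 0 j = \sum_(eta < tau1 | inP' eta)
  (omega tau1 ^+ eta) ^- k * (q (omega tau1 ^+ eta) * (mxC mu *m invmx (DeltaM p (omega tau1 ^+ eta))) 0 j).
Proof.
rewrite /chat summxE; apply: eq_bigr => eta _; by rewrite mxE /q /D -hD !mulrA.
Qed.

Lemma chat_sum k j : \sum_(w <- S) bcoef j w * w ^- k = toC (theta ^- k) * chat' k 0 j.
Proof.
rewrite chatE big_map big_filter big_enum_cond /= mulr_sumr; apply: eq_bigr => eta _.
rewrite bcoefE //; move: (q _ * _) => s; rewrite exprMn invfM toCV toCX.
by rewrite mulrC -mulrA.
Qed.

(** [coef_asymp] in each column. A nonzero coefficient needs both a pole of the resolvent and a
    nonzero [Btilde], so by [inP_Btilde] the list [S] contains every point that contributes. *)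
Lemma xbar_asymptotics : exists K : R, forall k j, (0 < k)%N ->
  nc (toC (xbar xs k 0 j) - toC (k%:R ^+ mB / mB`!%:R * theta ^- k) * chat' k 0 j) <= K * k%:R ^+ mB.-1 * theta ^- k.
Proof.
have [_ mB0 _ _ _] := H4.
have /choice[K hK] : forall j, exists K : R, forall k, (0 < k)%N ->
   nc (toC (xbar xs k 0 j) - toC (k%:R ^+ mB / mB`!%:R) * \sum_(w <- S) bcoef j w * w ^- k) <= K * k%:R ^+ mB.-1 * theta ^- k.
  move=> j.
  have hb r : 0 < r -> r < theta -> exists K, psbound (fun k => toC (xbar xs k 0 j) : C) r K.
    move=> r0 rt; exact (xbar_bound t1 hst hX j r0 rt).
  have hbd w := xbar_ext_boundary n0 A0 B0 t1 tr hB hA1 irr htau hp muA Av muv v0 d1 rB H4 hst hX j (w := w).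
  apply: (@coef_asymp R _ (xbar_ext x0 xs theta F j) theta mB (bcoef j) S t0 mB0).
  - exact: hb.
  - by move=> z hz; rewrite /xbar_ext hz.
  - by move=> w hw; have [] := hbd w hw.
  - by move=> w hw; have [] := hbd w hw.
  - rewrite map_inj_in_uniq => [|a b _ _ /(mulfI tC0) /eqP].
      by apply: filter_uniq; exact: enum_uniq.
    by rewrite (eq_prim_root_expr om1P) (modn_small (ltn_ord a)) (modn_small (ltn_ord b)) => /eqP /val_inj.
  - by move=> w /mapP[eta _ ->]; rewrite ncM nc_real omnc mulr1 gtr0_norm.
  move=> w hw nz; pose om := w / toC theta.
  have ew : w = toC theta * om by rewrite /om mulrC divfK.
  have om1 : nc om = 1 by rewrite /om ncM ncV nc_real hw gtr0_norm // divff // gt_eqF.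
  have omt : om ^+ tau = 1.
    apply/eqP; apply: contraNT nz => /negPf omt; rewrite /boundary_coef /residue -/om omt big1 ?mulr0 ?mul0r // => i _.
    by rewrite [X in _ * X]mxE mulr0.
  have Bt : Btilde F mB (toC theta * om) != 0.
    apply: contraNneq nz => Bt; rewrite ew bcoefE // /q Bt mulmx0 !mul0mx mxE !mul0r.
    by [].
  have [eta he e] := inP_Btilde om1 omt Bt.
  by rewrite ew e; apply/mapP; exists eta => //; rewrite mem_filter he mem_enum.
exists (\sum_j `|K j|) => k j k0; apply: le_trans (_ : K j * k%:R ^+ mB.-1 * theta ^- k <= _).
  have := hK j k k0; rewrite chat_sum mulrA -toCM; exact.
rewrite -!mulrA ler_wpM2r ?mulr_ge0 ?invr_ge0 ?exprn_ge0 ?(ltW t0) //.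
apply: le_trans (ler_norm _) _; rewrite (bigD1 j) //= lerDl; exact: sumr_ge0.
Qed.

(** For each admissible [eta] the product of [eta] and [tauhat] is a multiple of [tau1], so every
    frequency in the sum has period [tauhat]. *)
Lemma chat_tauhat k l j : chat' (k * tauh + l)%N 0 j = chat' l 0 j.
Proof.
rewrite !chatE; apply: eq_bigr => eta he; congr (_^-1 * _).
have [h1 h2] := big_gcdn_dvd (index_enum 'I_tau1) (fun nu => inP' nu) (fun nu => val nu) tau1.
have {}h2 := h2 eta (mem_index_enum _) he.
rewrite exprD mulnC exprM.
have -> : (omega tau1 ^+ eta) ^+ tauh = 1 :> C; last by rewrite expr1n mul1r.
apply/eqP; rewrite -exprM -(prim_order_dvd om1P) /tauhat -/tau1.
by rewrite muln_divA // mulnC -muln_divA // dvdn_mulr.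
Qed.

Lemma inP0 : inP' 0%N.
Proof.
have [_ _ _ _ h] := H4.
rewrite /inP; apply/asboolP; rewrite expr0; split.
  by exists 0%N; [split=> //; rewrite /inH eqxx|rewrite expr0].
exists 1 => //; apply: Zset_Btilde; first exact: nc1.
by rewrite mulr1.
Qed.

(** At [om = 1] the numerator is a sum of nonnegative terms with a positive one, from a positive
    entry of [Btilde] at [theta]; the denominator is positive because [theta] and the twisted drift
    both exceed 1. *)
Lemma q1_pos : exists2 s : R, 0 < s & q 1 = toC s.
Proof.
have [_ _ _ Bt0 Btn] := H4.
pose b i k := complex.Re (Btilde F mB (toC theta) i k : R[i]).
have bE i k : Btilde F mB (toC theta) i k = toC (b i k).
  have := Bt0 i k; rewrite /b; case: (Btilde _ _ _ i k) => x y; rewrite lecE /= => /andP[/eqP -> _]; by [].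
have b0 i k : 0 <= b i k by have := Bt0 i k; rewrite bE -toC0 leC_real.
have [i1 [k1 bp]] : exists i k, 0 < b i k.
  apply: contrapT => hn; move/negP: Btn; apply; apply/eqP/matrixP => i k; rewrite [RHS]mxE bE -toC0; congr toC.
  apply/eqP; rewrite eq_le b0 andbT leNgt; apply/negP => h; apply: hn; by exists i, k.
pose s := \sum_k (\sum_i x0 0 i * b i k) * v k 0.
have s0 : 0 < s.
  have xb i k : 0 <= x0 0 i * b i k by rewrite mulr_ge0 // ltW.
  rewrite /s (bigD1 k1) //= ltr_pwDl //.
    rewrite mulr_gt0 // (bigD1 i1) //= ltr_pwDl ?mulr_gt0 // sumr_ge0 //.
  by rewrite sumr_ge0 // => k _; rewrite mulr_ge0 ?(ltW (v0 k)) // sumr_ge0.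
exists (s / ((theta - 1) * ((mu *m AstarR' Q theta *m v) 0 0 - 1))).
  by rewrite divr_gt0 // mulr_gt0 // subr_gt0.
rewrite /q toCM toCV toCM !toCB toC1 mulr1; congr (_ / _).
have dl : DeltaM p (1 : C) = 1%:M by apply/matrixP => i j; rewrite /DeltaM !mxE expr1n invr1.
rewrite dl mulmx1 mxE /s toC_sum; apply: eq_bigr => k _; rewrite mxE toCM toC_sum [mxC v k 0]mxE; congr (_ * _).
by apply: eq_bigr => i _; rewrite bE toCM [mxC x0 0 i]mxE.
Qed.

(** [periodic_limit_pos] is used with period [tau1]: orthogonality of the frequencies leaves only
    [eta = 0] in the sum over a period, which equals [tau1 * s * mu j] with [s] from [q1_pos]. *)
Lemma chat_pos l j : 0 < chat' l 0 j.
Proof.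
have [K hK] := xbar_asymptotics; have [_ mB0 _ _ _] := H4.
have [_ xs0 _ _ _] := hst.
have [s s0 qs] := q1_pos.
have [r r0 ->] : exists2 r : R, 0 < r & chat' l 0 j = toC r; last by rewrite -toC0 ltC_real.
apply: (@periodic_limit_pos R (fun k => xbar xs k 0 j) (fun k => chat' k 0 j) theta (K * mB`!%:R) (tau1%:R * s * mu 0 j) mB tau1) => //.
- by move=> k; exact: (xbar_ge0 t1 hst hX k j).
- by move=> k; rewrite (xbar_step t1 hst hX k j) lerDr; exact: xs0.
- move=> k; rewrite !chatE; apply: eq_bigr => eta _; congr (_^-1 * _).
  by rewrite exprD omt1 mulr1.
- move=> k k0; have kR : (0 : R) < k%:R by rewrite ltr0n.
  have f0 : (0 : R) < mB`!%:R by rewrite ltr0n fact_gt0.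
  have tk : 0 < theta ^+ k by rewrite exprn_gt0.
  have km : 0 < (k%:R : R) ^+ mB by rewrite exprn_gt0.
  (* Multiplying by [c] normalises the factor of [chat] to 1 and turns the error into
     [K * mB! / k]. *)
  pose c : R := theta ^+ k * mB`!%:R / k%:R ^+ mB.
  have c0 : 0 < c by rewrite !mulr_gt0 ?invr_gt0.
  have e : toC (xbar xs k 0 j * theta ^+ k * mB`!%:R / k%:R ^+ mB) - chat' k 0 j =
     toC c * (toC (xbar xs k 0 j) - toC (k%:R ^+ mB / mB`!%:R * theta ^- k) * chat' k 0 j).
    rewrite mulrBr mulrA -!toCM; congr (toC _ - _); first by rewrite /c; ring.
    rewrite (_ : c * _ = 1) ?toC1 ?mul1r // /c; field.
    by rewrite !gt_eqF.
  rewrite e ncM nc_real gtr0_norm //.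
  apply: le_trans (ler_wpM2l (ltW c0) (hK k j k0)) _.
  rewrite le_eqVlt; apply/orP; left; apply/eqP; have e2 : (k%:R : R) ^+ mB = k%:R * k%:R ^+ mB.-1 by rewrite -exprS prednK.
  rewrite /c e2; field.
  by rewrite !gt_eqF // exprn_gt0.
- pose T e : C := q (omega tau1 ^+ e) * (mxC mu *m invmx (DeltaM p (omega tau1 ^+ e))) 0 j.
  transitivity (\sum_(l < tau1) \sum_(eta < tau1 | inP' eta) (omega tau1 ^+ eta) ^- l * T eta).
    by apply: eq_bigr => k _; exact: chatE.
  rewrite exchange_big /= (geom_orthogonality (P := inP') T om1P inP0).
  rewrite /T expr0 qs (muwE _ _ nc1) expr1n mulr1 !toCM toC_nat; exact: mulrA.
by rewrite !mulr_gt0 // ltr0n.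
Qed.
End FinalAssembly.

Unset Implicit Arguments.

Theorem theorem3p4 (R : realType) (Q : MG1 R)
  (pi : 'rV[R]_(M Q)) (x0 : 'rV[R]_(M0 Q)) (xs : nat -> 'rV[R]_(M Q))
  (theta : R) (U : set (Cplx R)) (F : Cplx R -> 'M[Cplx R]_(M0 Q, M Q))
  (mB : nat) (tau : nat) (p : 'I_(M Q) -> nat)
  (mu : 'rV[R]_(M Q)) (v : 'cV[R]_(M Q)) :
  (0 < M0 Q)%N -> (0 < M Q)%N ->
  is_transition_matrix Q ->
  pi *m Asum Q = pi -> pi *m onesC (M Q) = 1 ->
  Assumption1 pi -> Assumption2 Q -> Assumption3 Q theta ->
  Assumption4 theta U F mB -> Assumption5 theta F mB ->
  (* theta = r_B *)
  conv_radius (Bs Q) = theta%:E ->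
  is_stationary x0 xs ->
  is_period Q tau -> is_phase tau p ->
  (* Perron-Frobenius left/right eigenvectors of Gamma_A^*(theta) *)
  mu *m (theta^-1 *: AstarR Q theta) = mu ->
  (theta^-1 *: AstarR Q theta) *m v = v ->
  (forall j, 0 < mu 0 j) -> (forall j, 0 < v j 0) ->
  mu *m onesC (M Q) = 1 -> mu *m v = 1 ->
  forall l : nat, (l < tauhat theta x0 xs F mB tau p v)%N ->
    (forall j, 0 < chat theta x0 xs F mB tau p mu v l 0 j) /\
    exists (K : R) (N0 : nat), forall n : nat, (N0 <= n)%N ->
      forall j : 'I_(M Q),
        let k := (n * tauhat theta x0 xs F mB tau p v + l)%N in
        `| mxC (xbar xs k) 0 j
           - toC ((k%:R) ^+ mB / (mB`!)%:R * theta ^- k)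
             * chat theta x0 xs F mB tau p mu v l 0 j |
        <= toC (K * (k%:R) ^+ mB.-1 * theta ^- k).

Proof.
move=> m0 n0 [[A0 B00 Bs0 C00] [hA1 A1e] _ _] piA pie [Tirr irr [S [hS drift]] _] _ [t1 tA _] H4 _ rB hst
  htau hp muG Gv mu0 v0 mu1 muv.
have A0' k i j : 0 <= Ablk Q k i j by exact: A0.
have Bs0' k i j : 0 <= Bs Q k i j by exact: Bs0.
have t0 : 0 < theta by exact: lt_trans t1.
have tn0 : theta != 0 by rewrite gt_eqF.
have [rho [B [tr _ hB]]] := conv_radius_bound (ltW t0) tA.
have muA : mu *m AstarR Q theta = theta *: mu.
  by rewrite -[in RHS]muG -scalemxAr scalerA divff // scale1r.
have Av : AstarR Q theta *m v = theta *: v.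
  by rewrite -[in RHS]Gv -scalemxAl scalerA divff // scale1r.
have hAt := AstarR_series t0 tr hB (ltW t0) tr.
(* [drift_pos] concerns the sum weighted by [k], which is [theta] times the derivative of A*;
   dividing by [theta] gives the bound 1. *)
have d1 : 1 < (mu *m AstarR' Q theta *m v) 0 0.
  have := drift_pos A0' t1 hA1 hS hAt (AstarR'_drift t0 tr hB) A1e piA pie drift muA Av muv mu0 v0.
  by rewrite -scalemxAr -scalemxAl mxE -[X in X < _]mulr1 ltr_pM2l.
have hD := ddelta_formula n0 A0' t0 tr hB hA1 irr htau hp muA Av muv mu0 v0.
have hX r : 0 < r -> r < theta -> exists K, forall j, psbound (fun k => toC (xpos xs k 0 j) : Cplx R) r K.
  (* [y] is above 1 for the Lyapunov argument, above [r] for the bound at radius [r], and below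
     [theta] for the test vector to exist. *)
  move=> r0 rt; pose y := (Num.max r 1 + theta) / 2.
  have mt : Num.max r 1 < theta by rewrite gt_max rt t1.
  have yt : y < theta by rewrite midf_lt.
  have my : Num.max r 1 < y by rewrite midf_lt.
  have y1 : 1 < y by apply: le_lt_trans my; rewrite le_max lexx orbT.
  have ry : r < y by apply: le_lt_trans my; rewrite le_max lexx.
  have y0 : 0 < y by exact: lt_trans y1.
  have hAy := AstarR_series t0 tr hB (ltW y0) (lt_trans yt tr).
  have [nn ir] := AstarR_irr A0' t0 tr hB hA1 irr y0 (lt_trans yt tr).
  have [h h0 hh] := holder_strict A0' t1 hA1 hS hAt A1e piA pie drift Av v0 y1 yt hAy nn ir.
  have [r1 [KB [yr1 _ hKB]]] : exists r1, exists KB, [/\ y < r1, 0 <= KB & forall k i j, `|Bs Q k i j| <= KB * r1 ^- k].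
    by apply: conv_radius_bound (ltW y0) _; rewrite rB lte_fin.
  have hBy := bound_series (lt_trans y0 yr1) hKB (ltW y0) yr1.
  have [K K0 hK] := stationary_bound A0' Bs0' hst y1 hA1 A1e hAy hBy h0 hh.
  exists K => j; apply: (psbound_mono r0 (ltW ry)); split=> k.
  rewrite nc_real ger0_norm; last exact: (xpos_ge0 hst).
  rewrite /xpos; case: eqP => [_|/eqP k0]; first by rewrite mxE mulr_ge0 ?invr_ge0 ?exprn_ge0 // ltW.
  by apply: hK; rewrite lt0n.
have x0p i := x0_gt0 A0' B00 Bs0' C00 hst Tirr i.
move=> l hl; split.
  by move=> j; exact: (chat_pos n0 A0' Bs0' t1 tr hB hA1 irr htau hp muA Av muv mu0 v0 hD d1 rB H4 hst x0p hX).
have [K hK] := xbar_asymptotics n0 A0' Bs0' t1 tr hB hA1 irr htau hp muA Av muv v0 hD d1 rB H4 hst hX.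
(* The estimate of [xbar_asymptotics] starts at [k = 1]; this holds for [n >= 1] since [hl] makes
   [tauhat] positive. *)
exists K; exists 1%N; move=> n n1 j; cbv zeta; set k := (n * _ + l)%N; have k0 : (0 < k)%N.
  by rewrite /k addn_gt0 muln_gt0 n1 (leq_ltn_trans _ hl).
have := hK k j k0; rewrite normCE leC_real [mxC _ 0 j]mxE {2}/k (chat_tauhat x0 xs F mB n0 hp hD).
exact.
Qed.
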